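(* Let $s\in(\frac12,1)$. Then there exists a function $Q_s\in L_s(\mathbb{R})$, unique up to the transformations $Q_s(x)\mapsto Q_s(\mu(x+y))+2s\log\mu$ with $y\in\mathbb{R}$, $\mu>0$, such that every solution $u\in L_s(\mathbb{R})$ of $$(-\Delta)^s u = e^u \ \text{ in } \mathbb{R} \quad\text{with}\quad \int_{\mathbb{R}} e^u\,dx < +\infty$$ is of the form $$u(x) = Q_s(\mu(x+y)) + 2s\log\mu$$ for some $y\in\mathbb{R}$ and $\mu>0$.
   Context: For $s\in(0,1)$ and $\varphi\in C_c^\infty(\mathbb{R})$, $(-\Delta)^s\varphi(x) = C_s\,\mathrm{PV}\int_{\mathbb{R}}\frac{\varphi(x)-\varphi(y)}{|x-y|^{1+2s}}\,dy$ with $C_s = \frac{4^s}{\sqrt{\pi}}\frac{\Gamma(\frac12+s)}{|\Gamma(-s)|}$. The space $L_s(\mathbb{R})$ consists of all real-valued $u\in L^1_{\mathrm{loc}}(\mathbb{R})$ with $\int_{\mathbb{R}}\frac{|u(x)|}{1+|x|^{1+2s}}\,dx<+\infty$. A function $u\in L_s(\mathbb{R})$ with $e^u\in L^1_{\mathrm{loc}}(\mathbb{R})$ is a solution of $(-\Delta)^s u = e^u$ if $\int_{\mathbb{R}} u\,(-\Delta)^s\varphi\,dx = \int_{\mathbb{R}} e^u\varphi\,dx$ for all $\varphi\in C_c^\infty(\mathbb{R})$. For $y\in\mathbb{R}$ and $\mu>0$, the map $u(x)\mapsto u(\mu(x+y))+2s\log\mu$ sends solutions of the problem $(-\Delta)^s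 u = e^u$ in $\mathbb{R}$ with $\int_{\mathbb{R}} e^u\,dx<+\infty$ to solutions of the same problem. *)

(* Defs.v *)
From HB Require Import structures.
From mathcomp Require Import all_boot all_order all_algebra.
From mathcomp Require Import all_classical all_reals all_analysis.

Set Implicit Arguments.
Unset Strict Implicit.
Unset Printing Implicit Defensive.

Import Order.TTheory GRing.Theory Num.Theory.
Import numFieldNormedType.Exports.

Local Open Scope classical_set_scope.
Local Open Scope ring_scope.

Definition euler_integral (R : realType) (z : R) : R :=
  \int[lebesgue_measure]_(t in `]0%R, +oo[) (t `^ (z - 1) * expR (- t)).

(* Euler's integral, continued to the negative non-integers by the functional
   equation Gamma(z) = Gamma(z + n) / (z (z + 1) ... (z + n - 1)), where n is
   least such that 0 <= z + n.  The values at 0, -1, -2, ... carry no meaning. *)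
Definition Gamma (R : realType) (z : R) : R :=
  let n := if 0 <= z then 0%N else `|Num.floor z|%N in
  euler_integral (z + n%:R) / \prod_(i < n) (z + i%:R).

Definition fraclap_cst (R : realType) (s : R) : R :=
  4 `^ s / Num.sqrt pi * (Gamma (2^-1 + s) / `|Gamma (- s)|).

Definition smooth (R : realType) (phi : R -> R) : Prop :=
  forall (n : nat) (x : R), derivable (derive1n n phi) x 1.

Definition test_function (R : realType) (phi : R -> R) : Prop :=
  smooth phi /\ compact (closure [set x | phi x != 0]).

(* lim is total; the principal value exists when phi is a test function and
   0 < s < 1. *)
Definition fraclap (R : realType) (s : R) (phi : R -> R) (x : R) : R :=
  fraclap_cst s *
  lim ((\int[lebesgue_measure]_(y in [set y | (eps < `|x - y|)%R])
          ((phi x - phi y) / `|x - y| `^ (1 + 2 * s))) @[eps --> 0^'+]).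

Definition Ls_space (R : realType) (s : R) (u : R -> R) : Prop :=
  locally_integrable setT u /\
  (\int[lebesgue_measure]_x (`|u x| / (1 + `|x| `^ (1 + 2 * s)))%:E < +oo)%E.

Definition liouville_solution (R : realType) (s : R) (u : R -> R) : Prop :=
  [/\ Ls_space s u,
      locally_integrable setT (expR \o u) &
      forall phi : R -> R, test_function phi ->
        (\int[lebesgue_measure]_x (u x * fraclap s phi x)%:E =
         \int[lebesgue_measure]_x (expR (u x) * phi x)%:E)%E].

Definition finite_mass (R : realType) (u : R -> R) : Prop :=
  (\int[lebesgue_measure]_x (expR (u x))%:E < +oo)%E.

Definition rescale (R : realType) (s mu y : R) (Q : R -> R) : R -> R :=
  fun x => Q (mu * (x + y)) + 2 * s * ln mu.

(* Elements of Ls_space are functions up to null sets, so equality is taken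
   almost everywhere. *)
Definition rescaling_of (R : realType) (s : R) (u Q : R -> R) : Prop :=
  exists y mu : R,
    0 < mu /\ {ae (@lebesgue_measure R), forall x, u x = rescale s mu y Q x}.

(* Uniqueness of such a Q fails when there is no solution, as every element of
   Ls_space then qualifies; uniqueness up to rescaling thus entails that a
   solution exists and, by invariance of the problem, that Q is one. *)
Definition represents_solutions (R : realType) (s : R) (Q : R -> R) : Prop :=
  Ls_space s Q /\
  forall u : R -> R, liouville_solution s u -> finite_mass u ->
    rescaling_of s u Q.

(* Main.v *)
(* Put al = 2 s - 1 and f = e^u. As |x|^al is a fundamental solution up to a
   constant, testing the equation against compactly supported truncations of
   |.|^al * eta'' shows that it amounts to log f = a - c |.|^al * f; finite mass
   excludes a linear term. Integrating f' over ]p, +oo[ turns this into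
   f(p) = c al int_{y < p < z} (z - y)^(al - 1) f(y) f(z) dy dz.
   Fix a reference density g with the decay of a solution, and let X be the
   increasing map transporting (a multiple of) g to f. In terms of w = X' the
   equation becomes, up to a scalar, a fixed-point equation for an operator that
   is monotone and homogeneous of degree 1 - al < 1. Monotone iteration between
   two constants yields a fixed point, and comparison of ratios shows that it is
   unique among functions bounded above and away from 0. Two-sided bounds on f
   and on the double integral show that each solution yields such a w. What w
   leaves free is X(0), a translation, and the scalar, a dilation. *)
From HB Require Import structures.
Require Import Defs.
From mathcomp Require Import all_boot all_order all_algebra.
From mathcomp Require Import all_classical all_reals all_analysis.
From mathcomp Require Import measurable_realfun.
From mathcomp Require Import ring lra.
Import Order.TTheory GRing.Theory Num.Theory.
Import numFieldNormedType.Exports.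
Set Implicit Arguments.
Unset Strict Implicit.
Unset Printing Implicit Defensive.
Local Open Scope classical_set_scope.
Local Open Scope ring_scope.

(** * Integration on the real line *)

(** Passing to f' replaces |.|^al by the odd kernel sgn(t) |t|^(al - 1); same-side interactions
    cancel, and what is left is a positive quadratic expression with a decreasing kernel. In the
    coordinate of the reference density the product f(X x) X'(x) is prescribed, so the unknown
    enters the kernel only through the gaps X(b) - X(a), and enlarging X' lowers the energy. Hence w
    -> g / energy preserves order and contracts logarithms of ratios by the factor 1 - al; al > 0 is
    the condition s > 1/2. The obstacle is that these ratios must be bounded at the start. The
    energy at p is comparable to (1 + |p|)^(al - 1) times the smaller of the masses on the two sides
    of p, for solutions and for g alike, and g is chosen to equal al times this expression.
    Transport matches the masses up to a factor, so only the weights at x and X(x) remain to be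
    compared, and the logarithms of the masses do that. Neither f nor X is assumed differentiable:
    derivatives are replaced by integrated identities and quadratic bounds on increments. *)

Definition ind {R : realType} (b : bool) : R := b%:R.

Section real_integral.
Context {R : realType}.
Implicit Types f g h : R -> R.
Local Notation mu := (@lebesgue_measure R).

Definition integ f : R := \int[mu]_x f x.
Definition itg f : Prop := mu.-integrable setT (EFin \o f).

Lemma ae_imp (P Q : R -> Prop) : (forall x, P x -> Q x) ->
  {ae mu, forall x, P x} -> {ae mu, forall x, Q x}.
Proof.
by move=> PQ [N [mN N0 PN]]; exists N; split => // x nQ; apply: PN => /PQ.
Qed.

Lemma itg_meas f : itg f -> measurable_fun setT f.
Proof. by move=> /measurable_int /measurable_EFinP. Qed.

Lemma eq_integ f g : f =1 g -> integ f = integ g.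
Proof. by move=> /funext ->. Qed.

Lemma eq_itg f g : f =1 g -> itg f -> itg g.
Proof. by move=> /funext ->. Qed.

Lemma itgD f g : itg f -> itg g -> itg (fun x => f x + g x).
Proof. by move=> If Ig; have := integrableD measurableT If Ig. Qed.

Lemma itgZ c f : itg f -> itg (fun x => c * f x).
Proof. by move=> If; have := integrableZl measurableT c If. Qed.

Lemma itgN f : itg f -> itg (fun x => - f x).
Proof. by move=> /(itgZ (-1)); apply: eq_itg => x; rewrite mulN1r. Qed.

Lemma itgB f g : itg f -> itg g -> itg (fun x => f x - g x).
Proof. by move=> If Ig; apply: itgD => //; exact: itgN. Qed.

Lemma itg0 : itg (fun=> 0).
Proof. exact: integrable0. Qed.

Lemma itg_norm f : itg f -> itg (fun x => `|f x|).
Proof. exact: integrable_norm. Qed.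

Lemma itg_le f g : measurable_fun setT f -> (forall x, `|f x| <= g x) ->
  itg g -> itg f.
Proof.
move=> mf fg; apply: le_integrable => //; first exact/measurable_EFinP.
by move=> x _ /=; rewrite lee_fin (le_trans (fg x))// ler_norm.
Qed.

Lemma integD f g : itg f -> itg g ->
  integ (fun x => f x + g x) = integ f + integ g.
Proof. exact: RintegralD. Qed.

Lemma integZ c f : itg f -> integ (fun x => c * f x) = c * integ f.
Proof. by move=> If; exact: RintegralZl. Qed.

Lemma integN f : itg f -> integ (fun x => - f x) = - integ f.
Proof.
by move=> If; rewrite -mulN1r -integZ//; apply: eq_integ => x; rewrite mulN1r.
Qed.

Lemma integB f g : itg f -> itg g ->
  integ (fun x => f x - g x) = integ f - integ g.
Proof. exact: RintegralB. Qed.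

Lemma integ0 : integ (fun=> 0) = 0.
Proof. by rewrite /integ /Rintegral integral0. Qed.

Lemma integ_ge0 f : (forall x, 0 <= f x) -> 0 <= integ f.
Proof. by move=> f0; apply: Rintegral_ge0. Qed.

Lemma le_integ f g : itg f -> itg g -> (forall x, f x <= g x) ->
  integ f <= integ g.
Proof. by move=> If Ig fg; apply: le_Rintegral. Qed.

Lemma norm_integ_le f g : measurable_fun setT f -> (forall x, `|f x| <= g x) ->
  itg g -> `|integ f| <= integ g.
Proof.
move=> mf fg Ig; have If : itg f by exact: itg_le Ig.
apply: (@le_trans _ _ (integ (fun x => `|f x|))); first exact: le_normr_Rintegral.
by apply: le_integ => //; exact: itg_norm.
Qed.

Lemma EFin_integ f : itg f -> (\int[mu]_x (f x)%:E = (integ f)%:E)%E.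
Proof. by move=> If; rewrite /integ /Rintegral fineK//; exact: integrable_fin_num. Qed.

Lemma itg_ge0P f : measurable_fun setT f -> (forall x, 0 <= f x) ->
  itg f <-> (\int[mu]_x (f x)%:E < +oo)%E.
Proof.
move=> mf f0; rewrite /itg; split => [/integrableP[_]|fi]; last apply/integrableP; last split.
- by under eq_integral do rewrite /= ger0_norm//.
- exact/measurable_EFinP.
- by under eq_integral do rewrite /= ger0_norm//.
Qed.

Lemma ae_eq_integ f g : measurable_fun setT f -> measurable_fun setT g ->
  {ae mu, forall x, f x = g x} -> integ f = integ g.
Proof.
move=> mf mg fg; rewrite /integ /Rintegral; congr fine.
apply: ae_eq_integral => //; [exact/measurable_EFinP|exact/measurable_EFinP|].
by apply: ae_imp fg => x /= -> _.
Qed.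

Lemma ae_itg f g : measurable_fun setT g -> {ae mu, forall x, f x = g x} ->
  itg f -> itg g.
Proof.
move=> mg fg /integrableP[mf If]; apply/integrableP; split; first exact/measurable_EFinP.
rewrite -(_ : (\int[mu]_x `|(f x)%:E| = \int[mu]_x `|(g x)%:E|)%E)//.
apply: ae_eq_integral => //.
- exact: (measurableT_comp (@abse_measurable R setT)).
- by apply: measurableT_comp => //; exact/measurable_EFinP.
- by apply: ae_imp fg => x /= -> _.
Qed.

Lemma integ_eq0 f : itg f -> (forall x, 0 <= f x) -> integ f = 0 ->
  {ae mu, forall x, f x = 0}.
Proof.
move=> If f0 I0.
have mf := itg_meas If.
have : (\int[mu]_x `|(f x)%:E| = 0)%E.
  by under eq_integral do rewrite /= ger0_norm//; rewrite EFin_integ// I0.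
move/(ae_eq_integral_abs mu measurableT (proj2 (measurable_EFinP _ _) mf)).
by apply: filterS => x /(_ Logic.I) [].
Qed.

Lemma dct (f_ : nat -> R -> R) f g :
  (forall n, measurable_fun setT (f_ n)) -> measurable_fun setT f ->
  (forall x, f_ n x @[n --> \oo] --> f x) ->
  (forall n x, `|f_ n x| <= g x) -> itg g ->
  itg f /\ integ (f_ n) @[n --> \oo] --> integ f.
Proof.
move=> mf_ mf cf fg Ig.
have [|||||] := @dominated_convergence _ _ _ mu setT measurableT
  (fun n => EFin \o f_ n) (EFin \o f) (EFin \o g).
- by move=> n; apply/measurable_EFinP; exact: mf_.
- exact/measurable_EFinP.
- by apply/aeW => x _; apply/cvg_EFin; [exact: nearW|exact: cf].
- exact: Ig.
- by apply/aeW => x n _ /=; rewrite lee_fin.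
move=> If _ H; split => //.
have H2 : (integ (f_ n))%:E @[n --> \oo] --> (integ f)%:E.
  rewrite -EFin_integ//; apply: cvg_trans H; apply: near_eq_cvg; apply: nearW => n.
  by rewrite -EFin_integ//; apply: itg_le Ig.
by move/fine_cvgP : H2 => [].
Qed.

(** The integral is by definition the difference of those of the positive and negative parts, and
    Tonelli makes each of these measurable, whether or not the sections are integrable. *)
Lemma measurable_param d (T : measurableType d) (f : T * R -> R) :
  measurable_fun setT f -> measurable_fun setT (fun x => integ (fun y => f (x, y))).
Proof.
move=> mf; rewrite /integ /Rintegral.
apply: (measurableT_comp (@fine_measurable R setT measurableT)).
rewrite (_ : (fun x => _) = (fun x => (\int[mu]_y (EFin \o f)^\+ (x, y)) -
    (\int[mu]_y (EFin \o f)^\- (x, y)))%E); last first.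
  by apply/funext => x; rewrite [LHS]integralE; congr (_ - _)%E;
    apply: eq_integral => y _; rewrite ?funeposE ?funenegE.
apply: emeasurable_funB.
- have mp := measurable_funepos ((measurable_EFinP _ _).2 mf).
  by apply: (@measurable_fun_fubini_tonelli_F _ _ _ _ R mu _ mp) => x; rewrite funepos_ge0.
- have mn := measurable_funeneg ((measurable_EFinP _ _).2 mf).
  by apply: (@measurable_fun_fubini_tonelli_F _ _ _ _ R mu _ mn) => x; rewrite funeneg_ge0.
Qed.

Lemma measurable_pair1 d (T : measurableType d) (f : T * R -> R) x :
  measurable_fun setT f -> measurable_fun setT (fun y => f (x, y)).
Proof. by move=> mf; exact: (measurableT_comp mf (pair1_measurable x)). Qed.

Lemma measurable_swap (f : R * R -> R) :
  measurable_fun setT f -> measurable_fun setT (fun p => f (p.2, p.1)).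
Proof.
move=> mf; apply: (measurableT_comp mf).
by apply/measurable_fun_pairP; split; [exact: measurable_snd|exact: measurable_fst].
Qed.

(** The two variables play different roles: in the applications every x-section is integrable with
    an explicit majorant, while the y-sections are integrable only almost everywhere. *)
Lemma fubini (f : R * R -> R) g :
  measurable_fun setT f ->
  (forall x, itg (fun y => f (x, y))) ->
  (forall x, integ (fun y => `|f (x, y)|) <= g x) -> itg g ->
  [/\ integ (fun x => integ (fun y => f (x, y))) =
      integ (fun y => integ (fun x => f (x, y))),
      itg (fun x => integ (fun y => f (x, y))),
      itg (fun y => integ (fun x => f (x, y))) &
      {ae mu, forall y, itg (fun x => f (x, y))}].
Proof.
move=> mf If fg Ig.
have mEf := (measurable_EFinP _ _).2 mf.
have Ipf : (mu \x mu)%E.-integrable setT (EFin \o f).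
  refine (proj2 (@integrable12ltyP _ _ _ _ _ mu mu (EFin \o f) mEf) _).
  apply: (@le_lt_trans _ _ (\int[mu]_x (g x)%:E)%E); last first.
    by rewrite EFin_integ// ltry.
  apply: ge0_le_integral => //.
  - by move=> x _; apply: integral_ge0.
  - have mabs := measurableT_comp (@abse_measurable R setT) mEf.
    by apply: (@measurable_fun_fubini_tonelli_F _ _ _ _ R mu _ mabs) => ?; exact: abse_ge0.
  - by apply/measurable_EFinP; exact: itg_meas.
  - move=> x _ /=.
    by rewrite (EFin_integ (itg_norm (If x))) lee_fin.
have /= E := Fubini Ipf.
have IF : itg (fun x => integ (fun y => f (x, y))).
  have := integrable_fubini_F Ipf; apply: eq_integrable => // x _ /=.
  by rewrite /fubini_F /= EFin_integ.
have aeG : {ae mu, forall y, itg (fun x => f (x, y))}.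
  by have := ae_integrable2 Ipf.
have mG : measurable_fun setT (fun y => integ (fun x => f (x, y))).
  by apply: (@measurable_param _ R (fun p => f (p.2, p.1))); exact: measurable_swap.
have mEs := measurable_swap mf; move/measurable_EFinP in mEs.
have Ips : (mu \x mu)%E.-integrable setT (EFin \o (fun p : R * R => f (p.2, p.1))).
  refine (proj2 (@integrable12ltyP _ _ _ _ _ mu mu _ mEs) _).
  exact: (proj1 (@integrable21ltyP _ _ _ _ _ mu mu _ mEf) Ipf).
have IGe := integrable_fubini_F Ips.
have mGe := measurable_int _ IGe.
(* Where a y-section is not integrable [integ] takes a default value, so the extended and the real
   inner integrals agree only almost everywhere. *)
have aeq : {ae mu, forall y,
   fubini_F mu (EFin \o (fun p : R * R => f (p.2, p.1))) y = (integ (fun x => f (x, y)))%:E}.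
  by apply: ae_imp aeG => y Iy; rewrite /fubini_F /= EFin_integ.
have IG : itg (fun y => integ (fun x => f (x, y))).
  move/integrableP : IGe => [_ IGe]; apply/integrableP; split.
    exact/measurable_EFinP.
  rewrite -(_ : (\int[mu]_y `|fubini_F mu (EFin \o (fun p : R * R => f (p.2, p.1))) y| =
    \int[mu]_x `|(EFin \o (fun y => integ (fun x => f (x, y)))) x|)%E)//.
  apply: ae_eq_integral => //.
  - exact: measurableT_comp.
  - by apply: measurableT_comp => //; exact/measurable_EFinP.
  - by apply: ae_imp aeq => y /= ->.
split; [|exact: IF|exact: IG|exact: aeG].
apply: EFin_inj; rewrite -(EFin_integ IF) -(EFin_integ IG).
under eq_integral do rewrite -(EFin_integ (If _)).
rewrite E; apply: ae_eq_integral => //.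
- exact/measurable_EFinP.
- by apply: ae_imp aeq => y /= <-.
Qed.

Lemma ind_ge0 b : 0 <= ind b :> R. Proof. exact: ler0n. Qed.

Lemma ind_le1 b : ind b <= 1 :> R. Proof. by rewrite /ind lern1 leq_b1. Qed.

Lemma measurable_ind d (T : measurableType d) (b : T -> bool) :
  measurable_fun setT b -> measurable_fun setT (fun x => ind (b x) : R).
Proof.
move=> mb; rewrite (_ : (fun x => _) = \1_(b @^-1` [set true]) :> (T -> R)); last first.
  apply/funext => x; rewrite indicE; congr (_ %:R).
  have [bx|bx] := boolP (b x); first by rewrite mem_set.
  by rewrite memNset//=; exact/negP.
apply: measurable_indic; rewrite -[_ @^-1` _]setTI; exact: mb.
Qed.

End real_integral.

(** * Measures with a density and changes of variables *)

Section density_measure.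
Context {R : realType} (p : R -> R).
Hypotheses (p0 : forall x, 0 <= p x) (mp : measurable_fun setT p).
Local Notation mu := (@lebesgue_measure R).

(** The two proofs are arguments of the term so that the measure structure declared below can be
    inferred from it. *)
Definition density (_ : forall x, 0 <= p x) (_ : measurable_fun setT p)
  (A : set (measurableTypeR R)) : \bar R := (\int[mu]_(x in A) (p x)%:E)%E.

Let density0 : density p0 mp set0 = 0%E.
Proof. by rewrite /density integral_set0. Qed.

Let density_ge0 A : (0 <= density p0 mp A)%E.
Proof. by apply: integral_ge0 => x _; rewrite lee_fin. Qed.

Let density_sigma_additive : semi_sigma_additive (density p0 mp).
Proof.
move=> /= F mF tF mUF; rewrite /density; apply: cvg_toP.
  apply: ereal_nondecreasing_is_cvgn => m n mn.
  apply: lee_sum_nneg_natr => // k _ _; apply: integral_ge0 => /= x Fkx.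
  by rewrite lee_fin.
rewrite ge0_integral_bigcup//=.
- by apply/measurable_funTS/measurable_EFinP.
- by move=> x _; rewrite lee_fin.
Qed.

HB.instance Definition _ := isMeasure.Build _ _ _
  (density p0 mp) density0 density_ge0 density_sigma_additive.

End density_measure.

Section change_of_variables.
Context {R : realType}.
Implicit Types f g h p q : R -> R.
Local Notation mu := (@lebesgue_measure R).

(* Layer-cake: int h dnu is the integral over t > 0 of nu {h > t}, so two
   densities with the same values on intervals integrate every h alike. *)
Lemma change_of_variables (X : R -> R) p q :
  measurable_fun setT X ->
  (forall x, 0 <= p x) -> measurable_fun setT p ->
  (forall x, 0 <= q x) -> measurable_fun setT q ->
  (forall c d, c < d ->
    (\int[mu]_(x in X @^-1` `]c, d]) (p x)%:E = \int[mu]_(x in `]c, d]) (q x)%:E)%E) ->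
  (forall c d, (\int[mu]_(x in `]c, d]) (q x)%:E < +oo)%E) ->
  forall h, measurable_fun setT h -> (forall x, 0 <= h x) ->
  (\int[mu]_x (h (X x) * p x)%:E = \int[mu]_x (h x * q x)%:E)%E.
Proof.
move=> mX p0 mp q0 mq pq qfin.
pose T : measurableTypeR R -> measurableTypeR R := X.
have mT : measurable_fun setT T by exact: mX.
(* Half-open intervals are stable under intersection and exhaust the line by sets of finite mass, so
   agreement on them extends to all measurable sets. *)
have E A : measurable A -> pushforward (density p0 mp) T A = density q0 mq A.
  apply: (@measure_unique _ R (measurableTypeR R) (@ocitv R)
     (fun n => `](- n%:R), n%:R]%classic)) => //.
  - by move=> B C; exact: ocitvI.
  - by move=> i; exact: is_ocitv.
  - exact: bigcup_itvT.
  - move=> _ [[c d]] _ <- /=; rewrite /pushforward /density/=.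
    have [cd|dc] := ltP c d; first exact: pq.
    by rewrite set_itv_ge ?bnd_simp -?leNgt// preimage_set0 !integral_set0.
  - move=> k /=; rewrite /pushforward /density/=.
    have [->|k0] := eqVneq k 0%N.
      by rewrite oppr0 set_itvxx preimage_set0 integral_set0.
    by rewrite pq ?gtrN ?ltr0n ?lt0n.
move=> h mh h0.
pose L (r : R -> R) (Y : R -> R) (z : R * R) : R :=
  ind ((0 <= z.2) && (z.2 < h (Y z.1))) * r z.1.
have layer (r Y : R -> R) : (forall x, 0 <= r x) -> measurable_fun setT r ->
    measurable_fun setT Y ->
    (\int[mu]_x (h (Y x) * r x)%:E = \int[mu]_t \int[mu]_x (L r Y (x, t))%:E)%E.
  move=> r0 mr mY.
  have mL : measurable_fun setT (fun z => (L r Y z)%:E).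
    apply/measurable_EFinP; apply: measurable_funM; last exact: (measurableT_comp mr).
    apply: measurable_ind; apply: measurable_and.
      by apply: measurable_fun_ler.
    apply: measurable_fun_ltr => //.
    by apply: (measurableT_comp mh); apply: (measurableT_comp mY).
  rewrite -(@fubini_tonelli _ _ _ _ R mu mu _ mL); last first.
    by move=> z; rewrite lee_fin mulr_ge0.
  apply: eq_integral => x _; rewrite /L /=.
  transitivity (\int[mu]_y ((r x)%:E * (\1_(`[0%R, h (Y x)[) y)%:E))%E.
    rewrite ge0_integralZl//.
    - rewrite integral_indic//= setIT lebesgue_measure_itv/= lte_fin.
      case: ltP => hx; first by rewrite ?oppr0 ?oppe0 ?addr0 ?adde0 -EFinM mulrC.
      by rewrite mule0 (@le_anti _ _ (h (Y x)) 0) ?mul0r// hx h0.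
    - by apply/measurable_EFinP; exact: measurable_indic.
    - by rewrite lee_fin.
  apply: eq_integral => y _; rewrite -EFinM indicE mulrC.
  congr (_ * _)%:E; congr (_ %:R).
  have [yh|yh] := boolP ((0 <= y) && (y < h (Y x))); first by rewrite mem_set//= in_itv.
  by rewrite memNset//= in_itv/=; exact/negP.
rewrite (layer p X)// (layer q id)//; apply: eq_integral => t _.
have sl (r Y : R -> R) : (forall x, 0 <= r x) -> measurable_fun setT r ->
    measurable_fun setT Y ->
    (\int[mu]_x (L r Y (x, t))%:E =
     \int[mu]_(x in Y @^-1` [set y | (0 <= t)%R /\ (t < h y)%R]) (r x)%:E)%E.
  move=> r0 mr mY; rewrite [RHS]integral_mkcond; apply: eq_integral => x _.
  rewrite /L /patch /=.
  have [/andP th|th] := boolP ((0 <= t) && (t < h (Y x))).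
    by rewrite mem_set//= mul1r.
  by rewrite memNset ?mul0r//= => /andP; exact/negP.
rewrite (sl p X)// (sl q id)//.
have mA : measurable ([set y | (0 <= t)%R /\ (t < h y)%R] : set (measurableTypeR R)).
  have := @measurable_and _ _ setT (fun y : R => 0 <= t) (fun y : R => t < h y).
  move=> /(_ (measurable_cst _) (measurable_fun_ltr (measurable_cst _) mh)).
  move=> /(_ measurableT [set true] Logic.I); rewrite setTI.
  by congr measurable; apply/seteqP; split => y /= /andP.
exact: E _ mA.
Qed.

End change_of_variables.

Section affine.
Context {R : realType}.
Implicit Types f g h : R -> R.
Local Notation mu := (@lebesgue_measure R).

Lemma ge0_integral_affine k a f : k != 0 -> measurable_fun setT f -> (forall x, 0 <= f x) ->
  (\int[mu]_x (f (k * x + a) * `|k|)%:E = \int[mu]_x (f x)%:E)%E.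
Proof.
move=> k0 mf f0.
have k0' : 0 < `|k| by rewrite normr_gt0.
under [RHS]eq_integral do rewrite -[f _]mulr1.
rewrite -(@change_of_variables R (fun x => k * x + a) (fun=> `|k|) (fun=> 1))//.
- by apply: measurable_funD => //; apply: measurable_funM.
- move=> c d cd.
  (* A negative k reverses the interval, so the closed end changes sides. *)
  have set_img : (fun x => k * x + a) @^-1` `]c, d] =
     [set` if 0 < k then `]((c - a) / k), ((d - a) / k)] else `[((d - a) / k), ((c - a) / k)[].
    apply/seteqP; split => x; case: ltP => k00 /=; rewrite !in_itv/= -?lerBrDr -?ltrBlDr.
    - by rewrite ltr_pdivrMr// ler_pdivlMr// mulrC.
    - have kn : k < 0 by rewrite lt_neqAle k0.
      by rewrite ler_ndivrMr// ltr_ndivlMr// mulrC andbC.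
    - by rewrite ltr_pdivrMr// ler_pdivlMr// mulrC.
    - have kn : k < 0 by rewrite lt_neqAle k0.
      by rewrite ler_ndivrMr// ltr_ndivlMr// mulrC andbC.
  rewrite set_img !integral_cst//= !lebesgue_measure_itv /=.
  rewrite lte_fin cd mul1e.
  case: (ltP 0 k) => kk /=; rewrite lte_fin.
    rewrite ltr_pM2r ?invr_gt0// ltrD2r cd -!EFinB -EFinM gtr0_norm//.
    congr EFin; field; exact: k0.
  have kn : k < 0 by rewrite lt_neqAle k0.
  rewrite ltr_nM2r ?invr_lt0// ltrD2r cd -!EFinB -EFinM ltr0_norm//.
  congr EFin; field; exact: k0.
- move=> c d; rewrite integral_cst//= mul1e lebesgue_measure_itv/=.
  by case: ifP => _; rewrite ?ltry// -EFinB ltry.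
Qed.

Lemma itg_affine k a f : k != 0 -> itg f -> itg (fun x => f (k * x + a)).
Proof.
move=> k0 If; have mf := itg_meas If.
have mfa : measurable_fun setT (fun x => f (k * x + a)).
  apply: (measurableT_comp mf).
  by apply: measurable_funD => //; apply: measurable_funM.
have mnf : measurable_fun setT (fun x => `|f x|) by exact: (measurableT_comp (@normr_measurable R setT)).
suff H : itg (fun x => `|f (k * x + a)| * `|k|).
  apply: (@itg_le _ _ (fun x => `|k|^-1 * (`|f (k * x + a)| * `|k|))) => //.
    by move=> x; rewrite mulrCA mulVf ?mulr1// normr_eq0.
  exact: itgZ.
have fn0 x : 0 <= `|f x| by [].
apply/itg_ge0P.
- apply: measurable_funM => //.
  exact: (measurableT_comp (@normr_measurable R setT) mfa).
- by move=> x; rewrite mulr_ge0.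
- rewrite (@ge0_integral_affine k a (fun x => `|f x|))//.
  by rewrite (EFin_integ (itg_norm If)) ltry.
Qed.

Lemma integ_affine k a f : k != 0 -> itg f ->
  integ (fun x => f (k * x + a)) = `|k|^-1 * integ f.
Proof.
move=> k0 If; have mf := itg_meas If.
have k0' : `|k| != 0 by rewrite normr_eq0.
have mnf : measurable_fun setT (fun x => `|f x|) by exact: (measurableT_comp (@normr_measurable R setT)).
have pos g : itg g -> (forall x, 0 <= g x) -> integ (fun x => g (k * x + a)) = `|k|^-1 * integ g.
  move=> Ig g0.
  have := @ge0_integral_affine k a g k0 (itg_meas Ig) g0.
  rewrite (EFin_integ Ig) EFin_integ; last first.
    by apply: eq_itg (itgZ `|k| (itg_affine a k0 Ig)) => x; rewrite mulrC.
  move=> [<-]; rewrite -integZ; last first.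
    by apply: eq_itg (itgZ `|k| (itg_affine a k0 Ig)) => x; rewrite mulrC.
  by apply: eq_integ => x; rewrite mulrCA mulVf// mulr1.
have In := itg_norm If.
(* A difference of two nonnegative integrable functions, to each of which the formula for densities
   applies. *)
have E1 : integ (fun x => f (k * x + a)) = integ (fun x => (`|f (k * x + a)| + f (k * x + a)) - `|f (k * x + a)|).
  by apply: eq_integ => x; rewrite addrAC subrr add0r.
rewrite E1 (@integB _ (fun x => `|f (k * x + a)| + f (k * x + a)) (fun x => `|f (k * x + a)|)).
- rewrite (pos (fun x => `|f x| + f x)) ?(pos (fun x => `|f x|))//.
  + by rewrite integD// mulrDr addrAC subrr add0r.
  + exact: itgD.
  + by move=> x; rewrite addrC -lerBlDr sub0r lerNl ler_normr lexx orbT.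
- by apply: (itg_affine a k0 (f := fun x => `|f x| + f x)); exact: itgD.
- exact: (itg_affine a k0 In).
Qed.

Lemma integ_shift a f : itg f -> integ (fun x => f (x + a)) = integ f.
Proof.
move=> If; have := @integ_affine 1 a f (oner_neq0 _) If.
by rewrite normr1 invr1 mul1r => <-; apply: eq_integ => x; rewrite mul1r.
Qed.

Lemma itg_shift a f : itg f -> itg (fun x => f (x + a)).
Proof.
move=> If; have := @itg_affine 1 a f (oner_neq0 _) If.
by apply: eq_itg => x; rewrite mul1r.
Qed.

Lemma integ_refl a f : itg f -> integ (fun x => f (a - x)) = integ f.
Proof.
have n1 : -1 != 0 :> R by rewrite oppr_eq0 oner_neq0.
move=> If; have := @integ_affine (-1) a f n1 If.
by rewrite normrN1 invr1 mul1r => <-; apply: eq_integ => x; rewrite mulN1r addrC.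
Qed.

Lemma itg_refl a f : itg f -> itg (fun x => f (a - x)).
Proof.
have n1 : -1 != 0 :> R by rewrite oppr_eq0 oner_neq0.
move=> If; have := @itg_affine (-1) a f n1 If.
by apply: eq_itg => x; rewrite mulN1r addrC.
Qed.

End affine.

Section calculus.
Context {R : realType}.
Implicit Types f g h F : R -> R.
Local Notation mu := (@lebesgue_measure R).

Lemma continuous_measurable f : continuous f -> measurable_fun setT f.
Proof. exact: continuous_measurable_fun. Qed.

Lemma ind_restrict (D : set R) (b : R -> bool) f : (forall x, D x <-> b x) ->
  (fun x => ind (b x) * f x) = f \_ D.
Proof.
move=> Db; apply/funext => x; rewrite patchE.
have [bx|bx] := boolP (b x); first by rewrite /ind mul1r mem_set//; exact/Db.
by rewrite /ind mul0r memNset// => /Db; exact/negP.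
Qed.

Lemma itg_ind (D : set R) (b : R -> bool) f : measurable D -> (forall x, D x <-> b x) ->
  itg (fun x => ind (b x) * f x) <-> mu.-integrable D (EFin \o f).
Proof.
move=> mD Db; rewrite /itg (ind_restrict _ Db) -restrict_EFin; split.
  exact: (proj2 (@integrable_mkcond _ (measurableTypeR R) R mu D (EFin \o f) mD)).
exact: (proj1 (@integrable_mkcond _ (measurableTypeR R) R mu D (EFin \o f) mD)).
Qed.

Lemma integ_ind (D : set R) (b : R -> bool) f : (forall x, D x <-> b x) ->
  integ (fun x => ind (b x) * f x) = \int[mu]_(x in D) f x.
Proof. by move=> Db; rewrite /integ (ind_restrict _ Db) [RHS]Rintegral_mkcond. Qed.

Lemma itg_ind_cont f a b : continuous f -> itg (fun x => ind (a <= x <= b) * f x).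
Proof.
move=> cf; have mab : measurable (`[a, b] : set R) by exact: measurable_itv.
have Db (x : R) : `[a, b]%classic x <-> a <= x <= b by rewrite /= in_itv.
apply/(itg_ind f mab Db); apply: continuous_compact_integrable.
  exact: segment_compact.
exact: continuous_subspaceT.
Qed.

Lemma ftc F f a b : a <= b -> (forall x, is_derive x (1:R) F (f x)) -> continuous f ->
  integ (fun x => ind (a <= x <= b) * f x) = F b - F a.
Proof.
rewrite le_eqVlt => /predU1P[<- dF cf|ab dF cf].
  have Db (x : R) : `[a, a]%classic x <-> a <= x <= a by rewrite /= in_itv.
  by rewrite subrr (integ_ind f Db) set_itv1 Rintegral_set1.
have Db (x : R) : `[a, b]%classic x <-> a <= x <= b by rewrite /= in_itv.
rewrite (integ_ind f Db).
have cF : continuous F.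
  move=> x; apply: differentiable_continuous; apply/derivable1_diffP.
  exact: (@ex_derive _ _ _ _ _ _ _ (dF x)).
rewrite /Rintegral (continuous_FTC2 ab _ (F := F))//.
- exact: continuous_subspaceT.
- split; [by move=> x _; exact: (@ex_derive _ _ _ _ _ _ _ (dF x))| |].
  + exact/cvg_at_right_filter/cF.
  + exact/cvg_at_left_filter/cF.
- by move=> x _; rewrite derive1E; exact: (@derive_val _ _ _ _ _ _ _ (dF x)).
Qed.

Lemma cont_bounded f a b : continuous f ->
  exists2 M, 0 <= M & forall x, a <= x <= b -> `|f x| <= M.
Proof.
move=> cf.
have [ab|ab] := leP a b; last first.
  by exists 0 => // x /andP[ax xb]; have := lt_le_trans ab (le_trans ax xb); rewrite ltxx.
have cn : {within `[a, b], continuous (fun x => `|f x|)}.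
  apply: continuous_subspaceT => x.
  by apply: (@continuous_comp _ _ _ f); [exact: cf|exact: norm_continuous].
have [c _ cM] := EVT_max ab cn.
by exists `|f c| => // x xab; apply: cM; rewrite in_itv.
Qed.

Lemma integ_lim_sym f : itg f ->
  integ (fun x => ind (- n%:R <= x <= n%:R) * f x) @[n --> \oo] --> integ f.
Proof.
move=> If; have mf := itg_meas If.
have mf_ n : measurable_fun setT (fun x : R => ind (- n%:R <= x <= n%:R) * f x).
  apply: measurable_funM => //; apply: measurable_ind.
  by apply: measurable_and; apply: measurable_fun_ler.
have cf (x : R) : ind (- n%:R <= x <= n%:R) * f x @[n --> \oo] --> f x.
  apply: cvg_near_cst; near=> n.
  have xn : `|x| <= n%:R by near: n; exact: nbhs_infty_ger.
  by rewrite -ler_norml xn /ind mul1r.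
have fg n (x : R) : `|ind (- n%:R <= x <= n%:R) * f x| <= `|f x|.
  by rewrite normrM ler_piMl// ger0_norm ?ind_le1 ?ind_ge0.
by have [_] := dct mf_ mf cf fg (itg_norm If).
Unshelve. all: by end_near. Qed.

End calculus.

Lemma measurable_normr_comp {R : realType} d (T : measurableType d) (f : T -> R) :
  measurable_fun setT f -> measurable_fun setT (fun x => `|f x|).
Proof. exact: (measurableT_comp (@normr_measurable R setT)). Qed.

Lemma measurable_powR_comp {R : realType} d (T : measurableType d) (f : T -> R) (b : R) :
  measurable_fun setT f -> measurable_fun setT (fun x => f x `^ b).
Proof. exact: (measurableT_comp (@measurable_powR R b)). Qed.

Lemma measurable_inv_comp {R : realType} d (T : measurableType d) (f : T -> R) :
  measurable_fun setT f -> (forall x, 0 <= f x) -> measurable_fun setT (fun x => (f x)^-1).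
Proof.
move=> mf f0; rewrite (_ : (fun x => _) = (fun x => f x `^ (-1))).
  exact: measurable_powR_comp.
by apply/funext => x; rewrite powR_inv1.
Qed.

Ltac mfun := repeat first
  [ assumption | exact: measurable_cst | exact: measurable_id
  | exact: measurable_fst | exact: measurable_snd
  | match goal with H : measurable_fun setT ?g |- measurable_fun setT ?f =>
      match f with fun x => g _ => apply: (measurableT_comp H) end end
  | apply: measurable_funM | apply: measurable_funB | apply: measurable_funD
  | apply: measurableT_comp (@oppr_measurable _ _) _
  | apply: measurable_ind | apply: measurable_and | apply: measurable_fun_ler
  | apply: measurable_fun_ltr | apply: measurable_normr_comp
  | apply: measurable_powR_comp ].

(** * Integrals of powers and decay weights *)

Section powers.
Context {R : realType}.
Implicit Types f g h F : R -> R.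
Local Notation mu := (@lebesgue_measure R).

(** Fatou: improper integrals become integrable as soon as their truncations have bounded
    integrals. *)
Lemma itg_fatou (f_ : nat -> R -> R) f B :
  (forall n, itg (f_ n)) -> (forall n x, 0 <= f_ n x) -> measurable_fun setT f ->
  (forall x, f_ n x @[n --> \oo] --> f x) ->
  (forall n, integ (f_ n) <= B) -> itg f /\ integ f <= B.
Proof.
move=> If_ f_0 mf cf fB.
have f0 x : 0 <= f x.
  rewrite -(cvg_lim _ (cf x))//; apply: limr_ge; first by apply/cvg_ex; exists (f x).
  by apply: nearW => n.
have H : (\int[mu]_x (f x)%:E <= B%:E)%E.
  rewrite (_ : (\int[mu]_x (f x)%:E = \int[mu]_x limn_einf (fun n => (f_ n x)%:E))%E); last first.
    apply: eq_integral => x _.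
    have c : (f_ n x)%:E @[n --> \oo] --> (f x)%:E by apply/cvg_EFin; [exact: nearW|exact: cf].
    by rewrite (cvg_limn_einf_sup c).
  apply: (le_trans (fatou _ _ _ _)) => //.
  - by move=> n; apply/measurable_EFinP; exact: itg_meas.
  - by move=> n x _; rewrite lee_fin.
  - rewrite (_ : (fun n => _) = (fun n => (integ (f_ n))%:E)); last first.
      by apply/funext => n; rewrite EFin_integ.
    rewrite limn_einf_lim; apply: lime_le; first exact: is_cvg_einfs.
    apply: nearW => n; apply: (@le_trans _ _ (integ (f_ n))%:E); last by rewrite lee_fin.
    by apply: ereal_inf_lbound; exists n => //=.
have If : itg f by apply/itg_ge0P => //; apply: le_lt_trans H _; exact: ltry.
by split => //; rewrite -lee_fin -EFin_integ.
Qed.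

Lemma ftc_in F f a b : a <= b ->
  (forall x : R, a < x < b -> is_derive x (1:R) F (f x)) ->
  {within `[a, b], continuous f} -> {within `[a, b], continuous F} ->
  itg (fun x => ind (a <= x <= b) * f x) /\
  integ (fun x => ind (a <= x <= b) * f x) = F b - F a.
Proof.
move=> ab dF cf cF.
have Db (x : R) : `[a, b]%classic x <-> a <= x <= b by rewrite /= in_itv.
have mab : measurable (`[a, b] : set R) by exact: measurable_itv.
split.
  apply/(itg_ind f mab Db); apply: continuous_compact_integrable => //.
  exact: segment_compact.
move: ab; rewrite (integ_ind f Db) le_eqVlt => /predU1P[<-|ab].
  by rewrite subrr set_itv1 Rintegral_set1.
rewrite /Rintegral (continuous_FTC2 ab cf (F := F))//.
- have /(continuous_within_itvP _ ab)[_ ca cb] := cF.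
  split => // x; rewrite in_itv/= => /dF dFx.
  exact: (@ex_derive _ _ _ _ _ _ _ dFx).
- move=> x; rewrite in_itv/= => /dF dFx.
  by rewrite derive1E; exact: (@derive_val _ _ _ _ _ _ _ dFx).
Qed.

Lemma is_derive_cont F x (d : R) : is_derive x (1:R) F d -> {for x, continuous F}.
Proof.
move=> dF; apply: differentiable_continuous; apply/derivable1_diffP.
exact: (@ex_derive _ _ _ _ _ _ _ dF).
Qed.

Lemma powR_continuous (b x : R) : 0 < x -> {for x, continuous (fun y => y `^ b)}.
Proof. by move=> x0; apply: is_derive_cont (is_derive1_powR b x0). Qed.

Lemma within_cont (D : set R) f : (forall x, D x -> {for x, continuous f}) ->
  {within D, continuous f}.
Proof. by move=> cf; apply: continuous_in_subspaceT => x /set_mem /cf. Qed.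

Lemma is_derive_powRdiv (b x : R) : 0 < x -> 1 - b != 0 ->
  is_derive x (1:R) (fun y => y `^ (1 - b) / (1 - b)) (x `^ (- b)).
Proof.
move=> x0 b1.
have H := is_derive1_powR (1 - b) x0.
rewrite (_ : (fun y => _) = (1 - b)^-1 *: (fun y : R => y `^ (1 - b))); last first.
  by apply/funext => y; rewrite /= mulrC.
apply: is_derive_eq.
by rewrite /GRing.scale/= mulrA mulVf// mul1r addrAC subrr add0r.
Qed.

Lemma ftc_powR (b p q : R) : 0 < p -> p <= q -> 1 - b != 0 ->
  itg (fun x => ind (p <= x <= q) * x `^ (- b)) /\
  integ (fun x => ind (p <= x <= q) * x `^ (- b)) = (q `^ (1 - b) - p `^ (1 - b)) / (1 - b).
Proof.
move=> p0 pq b1; rewrite mulrBl.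
apply: (@ftc_in (fun y => y `^ (1 - b) / (1 - b)) (fun y => y `^ (- b))) => //.
- move=> x /andP[px _]; apply: is_derive_powRdiv => //; exact: lt_trans px.
- apply: within_cont => x; rewrite /= in_itv/= => /andP[px _].
  by apply: powR_continuous; exact: lt_le_trans px.
- apply: within_cont => x; rewrite /= in_itv/= => /andP[px _].
  by apply: is_derive_cont (is_derive_powRdiv _ b1); exact: lt_le_trans px.
Qed.

Lemma cvg_harmonic_powR (b : R) : 0 < b -> (n.+1%:R^-1 : R) `^ b @[n --> \oo] --> (0 : R).
Proof.
move=> b0; have := @powR_cvg0 R b b0.
move=> /cvg_at_rightP /(_ (fun n => n.+1%:R^-1)); apply; split => //.
exact: cvg_harmonic.
Qed.

Lemma itg_powR0 (b r : R) : 0 < b < 1 -> 0 <= r ->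
  itg (fun x => ind (0 <= x <= r) * x `^ (- b)) /\
  integ (fun x => ind (0 <= x <= r) * x `^ (- b)) = r `^ (1 - b) / (1 - b).
Proof.
move=> /andP[b0 b1] r0.
have b10 : 0 < 1 - b by rewrite subr_gt0.
have b10' : 1 - b != 0 by rewrite gt_eqF.
pose f_ (n : nat) (x : R) : R := ind (n.+1%:R^-1 <= x <= r) * x `^ (- b).
have E n : itg (f_ n) /\ (n.+1%:R^-1 <= r ->
     integ (f_ n) = (r `^ (1 - b) - (n.+1%:R^-1 `^ (1 - b))) / (1 - b)).
  have [nr|nr] := leP (n.+1%:R^-1) r.
    by have [I1 I2] := @ftc_powR b n.+1%:R^-1 r (ltac:(by rewrite invr_gt0)) nr b10'.
  split => //; apply: eq_itg (@itg0 R) => x; rewrite /f_.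
  case: leP => //= nx; last by rewrite mul0r.
  by rewrite leNgt (lt_le_trans nr nx)/= mul0r.
have f_0 n x : 0 <= f_ n x by rewrite mulr_ge0 ?ind_ge0 ?powR_ge0.
pose f := fun x : R => ind (0 <= x <= r) * x `^ (- b).
have mf : measurable_fun setT f by rewrite /f; mfun.
have cf x : f_ n x @[n --> \oo] --> f x.
  rewrite /f_ /f; have [x0|x0|x0] := ltgtP x 0.
  - apply: cvg_near_cst; apply: nearW => n.
    by rewrite [_ <= x]leNgt (lt_trans x0) ?invr_gt0//= mul0r.
  - apply: cvg_near_cst; near=> n; congr (ind (_ && _) * _).
    near: n.
    have [N NP] := ltr_add_invr x0; exists N => // n /= Nn.
    move: NP; rewrite add0r => NP; apply: le_trans (ltW NP).
    by rewrite lef_pV2 ?posrE// ler_nat.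
  (* A negative power of 0 is 0 by convention, so the singular point contributes nothing. *)
  - rewrite x0 powR0 ?oppr_eq0 ?gt_eqF// mulr0.
    by apply: cvg_near_cst; apply: nearW => n; rewrite mulr0.
have fle n x : f_ n x <= f x.
  rewrite /f_ /f ler_wpM2r ?powR_ge0// /ind ler_nat.
  case: (_ <= r); rewrite ?andbF// !andbT.
  by case: (leP (n.+1%:R^-1) x) => //= nx; rewrite (le_trans _ nx)// ltW// invr_gt0.
have [If _] : itg f /\ integ f <= r `^ (1 - b) / (1 - b).
  apply: (itg_fatou (f_ := f_)) => //; first by move=> n; exact: (E n).1.
  move=> n; have [nr|nr] := leP (n.+1%:R^-1) r.
    rewrite ((E n).2 nr) ler_wpM2r ?invr_ge0 ?(ltW b10)//.
    by rewrite gerBl powR_ge0.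
  rewrite (_ : integ (f_ n) = 0) ?divr_ge0 ?powR_ge0 ?(ltW b10)//.
  rewrite -(integ0 (R := R)); apply: eq_integ => x; rewrite /f_.
  case: leP => //= nx; last by rewrite mul0r.
  by rewrite leNgt (lt_le_trans nr nx)/= mul0r.
split => //.
move: r0; rewrite le_eqVlt => /predU1P[<-|r0].
  rewrite powR0// mul0r.
  rewrite -[RHS](integ0 (R := R)); apply: eq_integ => x.
  rewrite -eq_le; case: eqP => [<-|]; rewrite ?/ind ?mul0r//.
  by rewrite powR0 ?mulr0// oppr_eq0 gt_eqF.
have mf_ n := itg_meas (E n).1.
have fn n x : `|f_ n x| <= f x by rewrite ger0_norm.
have [_ H] := dct mf_ mf cf fn If.
have H2 : integ (f_ n) @[n --> \oo] --> (r `^ (1 - b) - 0) / (1 - b).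
  apply: (@cvg_trans _ ((r `^ (1 - b) - (n.+1%:R^-1 `^ (1 - b))) / (1 - b) @[n --> \oo])).
    apply: near_eq_cvg; near=> n; rewrite (E n).2//.
    near: n; have [N NP] := ltr_add_invr r0; exists N => // n /= Nn.
    move: NP; rewrite add0r => NP; apply: le_trans (ltW NP).
    by rewrite lef_pV2 ?posrE// ler_nat.
  apply: cvgMl; apply: cvgB; first exact: cvg_cst.
  exact: cvg_harmonic_powR.
rewrite subr0 in H2.
by rewrite -(cvg_lim _ H)// -(cvg_lim _ H2).
Unshelve. all: by end_near. Qed.

Lemma itg_powRy (b r : R) : 1 < b -> 0 < r ->
  itg (fun x => ind (r <= x) * x `^ (- b)) /\
  integ (fun x => ind (r <= x) * x `^ (- b)) <= r `^ (1 - b) / (b - 1).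
Proof.
move=> b1 r0.
have b10 : 0 < b - 1 by rewrite subr_gt0.
have b10' : 1 - b != 0 by rewrite lt_eqF// subr_lt0.
apply: (itg_fatou (f_ := fun n x => ind (r <= x <= r + n%:R) * x `^ (- b))).
- by move=> n; have [] := @ftc_powR b r (r + n%:R) r0 (ltac:(by rewrite lerDl)) b10'.
- by move=> n x; rewrite mulr_ge0 ?ind_ge0 ?powR_ge0.
- by mfun.
- move=> x; apply: cvg_near_cst; near=> n; congr (ind _ * _).
  rewrite (_ : x <= _) ?andbT//; apply: (@le_trans _ _ n%:R).
    by near: n; exact: nbhs_infty_ger.
  by rewrite lerDr ltW.
- move=> n; have [_ ->] := @ftc_powR b r (r + n%:R) r0 (ltac:(by rewrite lerDl)) b10'.
  rewrite -[1 - b]opprB invrN mulrN -mulNr ler_wpM2r ?invr_ge0 ?(ltW b10)//.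
  by rewrite !opprB gerBl powR_ge0.
Unshelve. all: by end_near. Qed.

Lemma itg_even (f : R -> R) : itg f -> itg (fun x => f x + f (- x)).
Proof.
move=> If; apply: itgD => //.
by apply: eq_itg (itg_refl 0 If) => x; rewrite sub0r.
Qed.

Lemma integ_even (f : R -> R) : itg f -> integ (fun x => f x + f (- x)) = 2 * integ f.
Proof.
move=> If; have If' : itg (fun x => f (- x)).
  by apply: eq_itg (itg_refl 0 If) => x; rewrite sub0r.
rewrite integD// mulr_natl mulr2n; congr (_ + _).
by rewrite -[RHS](integ_refl 0)//; apply: eq_integ => x; rewrite sub0r.
Qed.

Lemma itg_pow0 (b r : R) : 0 < b < 1 -> 0 <= r ->
  itg (fun x => ind (`|x| <= r) * `|x| `^ (- b)) /\
  integ (fun x => ind (`|x| <= r) * `|x| `^ (- b)) = 2 * (r `^ (1 - b) / (1 - b)).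
Proof.
move=> b01 r0; have [I1 <-] := itg_powR0 b01 r0.
(* The half-lines overlap at 0 only, where the power is 0 by convention. *)
have E (x : R) : ind (0 <= x <= r) * x `^ (- b) + ind (0 <= - x <= r) * (- x) `^ (- b)
   = ind (`|x| <= r) * `|x| `^ (- b).
  have bn : - b != 0 by rewrite oppr_eq0 gt_eqF//; case/andP: b01.
  have [x0|x0|->] := ltgtP x 0.
  - by rewrite /= /ind mul0r add0r oppr_ge0 (ltW x0) ltr0_norm.
  - by rewrite /= oppr_ge0 [x <= 0]leNgt x0/= /ind mul0r addr0 gtr0_norm.
  - by rewrite oppr0 normr0 powR0// !mulr0 addr0.
by rewrite -(integ_even I1); split; [apply: eq_itg (itg_even I1)|apply: eq_integ] => x; rewrite E.
Qed.

Lemma itg_powy (b r : R) : 1 < b -> 0 < r ->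
  itg (fun x => ind (r <= `|x|) * `|x| `^ (- b)) /\
  integ (fun x => ind (r <= `|x|) * `|x| `^ (- b)) <= 2 * (r `^ (1 - b) / (b - 1)).
Proof.
move=> b1 r0; have [I1 I2] := itg_powRy b1 r0.
have E (x : R) : ind (r <= x) * x `^ (- b) + ind (r <= - x) * (- x) `^ (- b)
   = ind (r <= `|x|) * `|x| `^ (- b).
  have bn : - b != 0 by rewrite oppr_eq0 gt_eqF// (lt_trans _ b1).
  have [x0|x0|->] := ltgtP x 0.
  - by rewrite [r <= x]leNgt (lt_trans x0 r0)/= mul0r add0r ltr0_norm.
  - rewrite [r <= - x]leNgt (lt_trans _ r0) ?oppr_lt0//= mul0r addr0 gtr0_norm//.
  - by rewrite oppr0 normr0 powR0// !mulr0 addr0.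
split; first by apply: eq_itg (itg_even I1) => x; rewrite E.
rewrite (_ : integ _ = integ (fun x : R => ind (r <= x) * x `^ (- b) + ind (r <= - x) * (- x) `^ (- b))).
  by rewrite (integ_even I1) ler_wpM2l.
by apply: eq_integ => x; rewrite E.
Qed.

Lemma itg_ind_bdd (c : R) r : 0 <= r -> itg (fun x => ind (`|x| <= r) * c).
Proof.
move=> r0; have := @itg_ind_cont R (fun=> c) (- r) r (ltac:(by move=> x; exact: cst_continuous)).
by apply: eq_itg => x; rewrite ler_norml.
Qed.

(** The base satisfies 1 + |x + y| <= (1 + |x|) (1 + |y|), which is what the convolution estimates
    rest on. *)
Definition wt (q : R) (x : R) : R := (1 + `|x|) `^ (- q).

Lemma wt_gt0 q x : 0 < wt q x.
Proof. by rewrite powR_gt0// ltr_pwDl. Qed.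

Lemma wt_meas q : measurable_fun setT (wt q).
Proof. by rewrite /wt; mfun. Qed.

Lemma powR_le_neg (a b q : R) : 0 <= q -> 0 < a -> a <= b -> b `^ (- q) <= a `^ (- q).
Proof.
move=> q0 a0 ab; rewrite !powRN lef_pV2 ?posrE ?powR_gt0//; last exact: lt_le_trans ab.
by rewrite ge0_ler_powR// ?nnegrE ?ltW// (lt_le_trans a0).
Qed.

Lemma itg_wt q : 1 < q -> itg (wt q).
Proof.
move=> q1; have q0 : 0 <= q by rewrite ltW// (lt_trans _ q1).
have := itgD (itg_ind_bdd 1 (@ler01 R)) (itg_powy q1 (@ltr01 R)).1.
apply: itg_le; first exact: wt_meas.
move=> x; rewrite gtr0_norm ?wt_gt0//.
have [x1|x1] := leP `|x| 1.
  rewrite /ind !mul1r; apply: (@le_trans _ _ (1 `^ (- q))).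
    by apply: powR_le_neg => //; rewrite lerDl.
  by rewrite powR1 lerDl mulr_ge0 ?ind_ge0 ?powR_ge0.
rewrite (ltW x1) /ind mul0r mul1r add0r.
by apply: powR_le_neg; rewrite // ?(lt_trans _ x1)// lerDr.
Qed.

End powers.

(** * Decay of integrals of second differences *)

Section second_difference.
Context {R : realType}.
Implicit Types (f : R -> R) (al B d x t : R).

Definition sd f x t : R := f (x + t) + f (x - t) - 2 * f x.

Lemma sdN f x t : sd f x (- t) = sd f x t.
Proof. by rewrite /sd opprK [f (x - t) + _]addrC. Qed.

Lemma is_derive_affine (k a x : R) : is_derive x (1:R) (fun r : R => k * r + a) k.
Proof.
rewrite (_ : (fun r => _) = (k *: (id : R -> R) + cst a)); last by apply/funext.
by apply: is_derive_eq; rewrite addr0 /GRing.scale/= mulr1.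
Qed.

Lemma is_derive_comp_affine f f1 (k a x : R) :
  (forall z, is_derive z (1:R) f (f1 z)) ->
  is_derive x (1:R) (fun r : R => f (k * r + a)) (k * f1 (k * x + a)).
Proof.
move=> df; rewrite mulrC.
exact: (@is_derive1_comp R f (fun r : R => k * r + a) x _ _ (df _) (is_derive_affine k a x)).
Qed.

(** Two mean value theorems give sd f x t = t (f1 (x + c) - f1 (x - c)) = 2 c t f2 (e). The bound on
    [f2] is asked only within |t| of x, so that its decay away from the origin can be exploited. *)
Lemma sd_taylor f f1 f2 M x t :
  (forall z, is_derive z (1:R) f (f1 z)) -> (forall z, is_derive z (1:R) f1 (f2 z)) ->
  (forall z, `|z - x| <= `|t| -> `|f2 z| <= M) ->
  `|sd f x t| <= 2 * M * `|t| ^+ 2.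
Proof.
move=> df df1; wlog t0 : t / 0 <= t => [H|].
  have [/H//|t0] := leP 0 t.
  by rewrite -sdN -normrN => Hz; apply: H; rewrite ?oppr_ge0 ?ltW.
rewrite (ger0_norm t0) => f2M.
move: (t0); rewrite le_eqVlt => /predU1P[<-|tp].
  by rewrite /sd addr0 subr0 expr0n /= mulr0 mulr_natl mulr2n subrr normr0.
have dphi (r : R) : is_derive r (1:R) (fun r : R => f (x + r) + f (x - r)) (f1 (x + r) - f1 (x - r)).
  have H1 := is_derive_comp_affine 1 x r df.
  have H2 := is_derive_comp_affine (-1) x r df.
  have := @is_deriveD _ _ _ _ _ _ _ _ _ H1 H2.
  rewrite !mul1r !mulN1r ![_ + x]addrC.
  rewrite (_ : _ + _ = (fun r : R => f (x + r) + f (x - r)))//.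
  by apply/funext => q /=; rewrite !fctE mul1r mulN1r ![_ + x]addrC.
have [c c_ E1] := @MVT R _ _ 0 t tp (fun r _ => dphi r)
  (@continuous_subspaceT _ _ _ _ (fun r => is_derive_cont (dphi r))).
move: c_; rewrite in_itv/= => /andP[c0 ct].
have cc : x - c < x + c by rewrite ltrD2l gtrN.
have [e e_ E2] := @MVT R f1 f2 (x - c) (x + c) cc (fun r _ => df1 r)
  (@continuous_subspaceT _ _ _ _ (fun r => is_derive_cont (df1 r))).
have -> : sd f x t = f2 e * (2 * c) * t.
  have -> : sd f x t = f (x + t) + f (x - t) - (f (x + 0) + f (x - 0)).
    by rewrite /sd addr0 subr0 mulr_natl mulr2n.
  rewrite E1 E2; ring.
have fe : `|f2 e| <= M.
  apply: f2M; rewrite ler_norml; move: e_; rewrite in_itv/= => /andP[e1 e2].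
  by apply/andP; split; lra.
rewrite !normrM (gtr0_norm c0) (ger0_norm t0) normr_nat expr2.
have M0 : 0 <= M by exact: le_trans fe.
rewrite [2 * M]mulrC -!mulrA ler_pM// ?mulr_ge0//; first exact: ltW.
by rewrite ler_wpM2l// ler_wpM2r// ltW.
Qed.

(* (-Delta)^s up to its constant, where al = 2 s - 1; symmetrising the integrand
   makes it absolutely convergent. *)
Definition fl al f x : R := 2^-1 * integ (fun t => - sd f x t * `|t| `^ (- (2 + al))).

(** Second differences see only f and its second derivative. With exponent 3 for the latter, the
    integral of r^(-3) |t|^(-al) over |t| <= r is of order r^(-(2 + al)), the same as that of the
    remote part. *)
Definition decays B d f := exists f1 f2,
  [/\ forall z, is_derive z (1:R) f (f1 z), forall z, is_derive z (1:R) f1 (f2 z),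
      forall x, `|f x| <= B * wt (1 + d) x & forall x, `|f2 x| <= B * wt 3 x].

Lemma decays_cont B d f : decays B d f -> continuous f.
Proof. by move=> [f1 [f2 [df _ _ _]]] x; exact: is_derive_cont (df x). Qed.

Lemma wt_ge0 q x : 0 <= wt q x.
Proof. exact/ltW/wt_gt0. Qed.

Lemma wtE q x : wt q x = 2 `^ (- q) * ((1 + `|x|) / 2) `^ (- q).
Proof.
rewrite /wt -powRM ?divr_ge0// ?addr_ge0//.
by rewrite mulrC divfK.
Qed.

Lemma sd_meas f x : measurable_fun setT f -> measurable_fun setT (sd f x).
Proof. by move=> mf; rewrite /sd; mfun. Qed.

(** The integral is cut at |t| = r with r = (1 + |x|) / 2: within r of x the weight of the second
    derivative is still that of a point at distance of order r, and beyond r the kernel is at most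
    r^(-(2 + al)). K is fixed before f, so that the estimate is uniform along the truncations. *)
Lemma Dabs_bound al d : 0 < al < 1 -> 0 < d -> exists2 K, 0 < K &
  forall B f, decays B d f -> forall x,
  itg (fun t => `|sd f x t| * `|t| `^ (- (2 + al))) /\
  integ (fun t => `|sd f x t| * `|t| `^ (- (2 + al))) <= K * B * wt (2 + al) x.
Proof.
move=> /andP[al0 al1] d0.
set Iw := integ (@wt R (1 + d)).
have Iw0 : 0 <= Iw by apply: integ_ge0 => x; exact/ltW/wt_gt0.
have d1 : 1 < 1 + d by rewrite ltrDl.
exists (2 `^ (2 + al) * (4 / (1 - al) + 2 * Iw + 2 / (1 + al))).
  rewrite mulr_gt0 ?powR_gt0// addr_gt0 ?ltr_pwDl// ?divr_gt0 ?subr_gt0 ?mulr_ge0//.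
  by rewrite addr_gt0.
move=> B f fd x; have cf := decays_cont fd.
have mf : measurable_fun setT f by exact: continuous_measurable.
have [f1 [f2 [df df1 fB f2B]]] := fd.
have B0 : 0 <= B.
  by have := le_trans (normr_ge0 _) (fB 0); rewrite pmulr_lge0// wt_gt0.
set r := (1 + `|x|) / 2.
have r0 : 0 < r by rewrite divr_gt0// ltr_pwDl.
(* [g1] bounds the part |t| <= r by Taylor; beyond r, [g2] bounds the two shifted values and [g3]
   the central value. *)
pose g1 t := 2 * (B * r `^ (- 3)) * (ind (`|t| <= r) * `|t| `^ (- al)).
pose g2 t := r `^ (- (2 + al)) * (B * wt (1 + d) (x + t) + B * wt (1 + d) (x - t)).
pose g3 t := 2 * `|f x| * (ind (r <= `|t|) * `|t| `^ (- (2 + al))).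
have al01 : 0 < al < 1 by rewrite al0.
have [I1 E1] := itg_pow0 al01 (ltW r0).
have al2 : 1 < 2 + al by lra.
have [I3 E3] := itg_powy al2 r0.
have Iwt := itg_wt d1.
have Ip : itg (fun t => wt (1 + d) (x + t)).
  by apply: eq_itg (itg_shift x Iwt) => t; rewrite [t + x]addrC.
have Im : itg (fun t => wt (1 + d) (x - t)) by exact: itg_refl.
have Ig1 : itg g1 by exact: itgZ.
have Ig2 : itg g2 by apply: itgZ; apply: itgD; exact: itgZ.
have Ig3 : itg g3 by exact: itgZ.
have bound t : `|sd f x t| * `|t| `^ (- (2 + al)) <= g1 t + g2 t + g3 t.
  have g20 : 0 <= g2 t.
    by rewrite mulr_ge0 ?powR_ge0// addr_ge0 ?mulr_ge0 ?wt_ge0.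
  have g30 : 0 <= g3 t by rewrite mulr_ge0 ?mulr_ge0 ?ind_ge0 ?powR_ge0.
  have g10 : 0 <= g1 t by rewrite !mulr_ge0 ?ind_ge0 ?powR_ge0.
  have [tr|tr] := leP `|t| r.
    apply: (@le_trans _ _ (g1 t)); last by rewrite -addrA lerDl; exact: addr_ge0.
    rewrite /g1 /ind tr mul1r.
    have H : `|sd f x t| <= 2 * (B * r `^ (- 3)) * `|t| ^+ 2.
      apply: sd_taylor df df1 _ => z zx.
      apply: le_trans (f2B z) _; rewrite ler_wpM2l// /wt.
      apply: powR_le_neg => //.
      have : `|x| <= `|z| + `|z - x| by have := ler_normB z (z - x); rewrite opprB addrC subrK.
      by move: tr zx; rewrite /r; clear; lra.
    apply: (le_trans (ler_wpM2r (powR_ge0 _ _) H)).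
    rewrite -[leLHS]mulrA ler_wpM2l ?mulr_ge0 ?powR_ge0//.
    have [->|t0] := eqVneq t 0.
      by rewrite normr0 expr0n /= mul0r powR_ge0.
    rewrite -powR_mulrn// -powRD; last by rewrite normr_eq0 t0 implybT.
    by rewrite (_ : 2 + - (2 + al) = - al)//; ring.
  apply: (@le_trans _ _ (g2 t + g3 t)); last by rewrite -addrA lerDr.
  rewrite /g3 /ind (ltW tr) mul1r.
  have H : `|sd f x t| <= (B * wt (1 + d) (x + t) + B * wt (1 + d) (x - t)) + 2 * `|f x|.
    rewrite /sd; apply: (le_trans (ler_normB _ _)); rewrite normrM normr_nat lerD2r.
    by apply: (le_trans (ler_normD _ _)); exact: lerD.
  apply: (le_trans (ler_wpM2r (powR_ge0 _ _) H)).
  rewrite mulrDl lerD2r /g2 mulrC ler_wpM2r//.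
    by rewrite addr_ge0 ?mulr_ge0 ?wt_ge0.
  by apply: powR_le_neg => //; [exact: ltW (lt_trans _ al2)|exact: ltW].
have Ig : itg (fun t => g1 t + g2 t + g3 t) by apply: itgD => //; exact: itgD.
have If : itg (fun t => `|sd f x t| * `|t| `^ (- (2 + al))).
  have msd := sd_meas x mf.
  apply: itg_le Ig; first by mfun.
  by move=> t; rewrite ger0_norm// mulr_ge0 ?powR_ge0.
split => //; apply: (le_trans (le_integ If Ig bound)).
rewrite integD//; last exact: itgD.
rewrite integD// /g1 /g2 /g3 !integZ//; last by apply: itgD; exact: itgZ.
rewrite integD; [|exact: itgZ|exact: itgZ]; rewrite !integZ// E1.
have -> : integ (fun t => wt (1 + d) (x + t)) = Iw.
  by rewrite /Iw -(integ_shift x Iwt); apply: eq_integ => t; rewrite [t + x]addrC.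
have -> : integ (fun t => wt (1 + d) (x - t)) = Iw by rewrite /Iw -(integ_refl x Iwt).
rewrite wtE -/r.
have -> : 2 `^ (2 + al) * (4 / (1 - al) + 2 * Iw + 2 / (1 + al)) * B * (2 `^ (- (2 + al)) * r `^ (- (2 + al)))
   = (4 / (1 - al) + 2 * Iw + 2 / (1 + al)) * B * r `^ (- (2 + al)).
  rewrite powRN; field; rewrite !gt_eqF ?powR_gt0 ?subr_gt0//; lra.
have rE : r `^ (- 3) * r `^ (1 - al) = r `^ (- (2 + al)).
  rewrite -powRD; last by rewrite (gt_eqF r0) implybT.
  by congr (_ `^ _); ring.
have rE2 : r `^ (1 - (2 + al)) = r * r `^ (- (2 + al)).
  rewrite powRD; last by rewrite (gt_eqF r0) implybT.
  by rewrite powRr1// ltW.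
(* The tail of the kernel is r^(1 - (2 + al)), one power short of the claim; one power of the decay
   of f supplies it. *)
have fx : `|f x| <= B * (2 * r)^-1.
  apply: (le_trans (fB x)); rewrite ler_wpM2l//.
  rewrite -powR_inv1; last by rewrite mulr_ge0// ltW.
  rewrite /wt (_ : 2 * r = 1 + `|x|); last by rewrite /r mulrC divfK.
  by rewrite ler_powR ?lerDl// lerN2 lerDl ltW.
have H3 : 2 * `|f x| * integ (fun x0 : R => ind (r <= `|x0|) * `|x0| `^ (- (2 + al))) <=
   2 * (B * (2 * r)^-1) * (2 * (r * r `^ (- (2 + al)) / (1 + al))).
  rewrite -rE2 (_ : 1 + al = 2 + al - 1); last by ring.
  rewrite ler_pM ?mulr_ge0//; first by apply: integ_ge0 => t; rewrite mulr_ge0 ?ind_ge0 ?powR_ge0.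
  by rewrite ler_wpM2l.
apply: (le_trans (lerD (lexx _) H3)).
rewrite le_eqVlt; apply/orP; left; apply/eqP.
rewrite -rE; field; rewrite !gt_eqF ?subr_gt0//; lra.
Qed.

End second_difference.

(** * Test functions *)

Section smooth_functions.
Context {R : realType}.
Implicit Types (f g phi : R -> R).

Lemma is_derive_littleo f (x d : R) (w : R -> R) : w h @[h --> 0] --> 0 ->
  (forall h, `|f (x + h) - f x - d * h| <= `|h| * w h) -> is_derive x (1:R) f d.
Proof.
move=> w0 fw.
have c : h^-1 *: (f (h *: (1:R) + x) - f x) @[h --> 0^'] --> d.
  apply/cvgrPdist_le => /= e e0; near=> h.
  have h0 : h != 0 by near: h; exact: nbhs_dnbhs_neq.
  have wh : `|w h| <= e.
    near: h; apply: nbhs_dnbhs; move/cvgrPdist_le: w0 => /(_ _ e0).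
    by apply: filterS => h; rewrite sub0r normrN.
  rewrite /GRing.scale /= mulr1 distrC.
  rewrite (_ : _ - d = h^-1 * (f (x + h) - f x - d * h)); last first.
    by rewrite [h + x]addrC; field.
  rewrite normrM normfV ler_pdivrMl ?normr_gt0//.
  by apply: (le_trans (fw h)); rewrite ler_wpM2l// (le_trans (ler_norm _)).
apply: DeriveDef; first by apply/cvg_ex; exists d.
by rewrite /derive; apply: cvg_lim.
Unshelve. all: by end_near. Qed.

(** Existence of successive derivatives as functions. Unlike a statement about iterated total
    derivatives, it passes through sums, products and compositions by plain induction on n. *)
Fixpoint ndiff (n : nat) f : Prop := if n is m.+1 then
  exists2 f1, (forall x, is_derive x (1:R) f (f1 x)) & ndiff m f1 else True.

Lemma smoothP f : smooth f <-> forall n, ndiff n f.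
Proof.
split=> [sf n|nf n].
- elim: n f sf => // n IH f sf /=; exists (derive1 f).
    move=> x; rewrite derive1E; apply: derivableP.
    by have := sf 0%N x.
  by apply: IH => k x; have := sf k.+1 x; rewrite derive1Sn.
- suff : forall n f, ndiff n.+1 f -> forall x, derivable (derive1n n f) x 1 by apply.
  elim => [g [g1 dg _] x|k IH g [g1 dg ng1] x]; first exact: (@ex_derive _ _ _ _ _ _ _ (dg x)).
  rewrite derive1Sn (_ : derive1 g = g1); first exact: IH.
  by apply/funext => y; rewrite derive1E; exact: (@derive_val _ _ _ _ _ _ _ (dg y)).
Qed.

Lemma ndiffW n f : ndiff n.+1 f -> ndiff n f.
Proof. by elim: n f => // n IH f [f1 df nf1]; exists f1 => //; exact: IH. Qed.

Lemma ndiff_eq n f g : f =1 g -> ndiff n f -> ndiff n g.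
Proof. by move=> /funext ->. Qed.

Lemma ndiff_cst n c : ndiff n (fun=> c).
Proof.
elim: n c => //= n IH c; exists (fun=> 0); last exact: IH.
by move=> x; exact: is_derive_cst.
Qed.

Lemma ndiffD n f g : ndiff n f -> ndiff n g -> ndiff n (fun x => f x + g x).
Proof.
elim: n f g => //= n IH f g [f1 df nf1] [g1 dg ng1]; exists (fun x => f1 x + g1 x); last exact: IH.
by move=> x; exact: is_deriveD.
Qed.

Lemma ndiffM n f g : ndiff n f -> ndiff n g -> ndiff n (fun x => f x * g x).
Proof.
elim: n f g => // n IH f g nf ng.
have := ndiffW nf; have := ndiffW ng; move: nf ng.
move=> [f1 df nf1] [g1 dg ng1] nf ng; exists (fun x => f x * g1 x + g x * f1 x).
  by move=> x; exact: is_deriveM.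
by apply: ndiffD; exact: IH.
Qed.

Lemma ndiff_affine n f (k a : R) : ndiff n f -> ndiff n (fun x => f (k * x + a)).
Proof.
elim: n f => //= n IH f [f1 df nf1]; exists (fun x => k * f1 (k * x + a)).
  by move=> x; exact: is_derive_comp_affine.
by apply: (@ndiffM n (fun=> k)); [exact: ndiff_cst|exact: IH].
Qed.

Lemma ndiff_id n : ndiff n (@id R).
Proof.
case: n => //= n; exists (fun=> 1); last exact: ndiff_cst.
by move=> x; exact: is_derive_id.
Qed.

Lemma ndiff_powR n f b : (forall x, 0 < f x) -> ndiff n f -> ndiff n (fun x => f x `^ b).
Proof.
move=> f0; elim: n b => // n IH b nf; have nf' := ndiffW nf.
move: nf => [f1 df nf1]; exists (fun x => b * f x `^ (b - 1) * f1 x).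
  move=> x; exact: (@is_derive1_comp R (fun y => y `^ b) f x _ _ (is_derive1_powR b (f0 x)) (df x)).
by apply: ndiffM => //; apply: (@ndiffM n (fun=> b)); [exact: ndiff_cst|exact: IH].
Qed.

(* The derivative of flat k is flat k.+2 - k flat k.+1, whence smoothness. *)
Definition flat (k : nat) (x : R) : R := if 0 < x then x ^- k * expR (- x^-1) else 0.

(** Write e^y as the power n + 1 of e^(y / (n + 1)) and use e^t >= 1 + t. *)
Lemma expR_ge_exprn (n : nat) (y : R) : 0 <= y -> (y / n.+1%:R) ^+ n.+1 <= expR y.
Proof.
move=> y0; rewrite -[y in expR y](@divfK _ n.+1%:R) ?pnatr_eq0// expRM_natr.
apply: lerXn2r; rewrite ?nnegrE ?expR_ge0 ?divr_ge0//.
by apply: le_trans (expR_ge1Dx _); rewrite lerDr.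
Qed.

(** h^(-k) e^(-1/h) is O(h^2), from the polynomial lower bound on e^(1/h) in degree k + 2. This
    makes the derivative at 0 vanish. *)
Lemma flat_quad k h : `|flat k h| <= `|h| * (k.+2%:R ^+ k.+2 * `|h|).
Proof.
rewrite /flat; case: ltP => h0; last first.
  by rewrite normr0; apply: mulr_ge0 => //; apply: mulr_ge0 => //; exact: exprn_ge0.
rewrite !gtr0_norm ?mulr_gt0 ?invr_gt0 ?exprn_gt0 ?expR_gt0//.
have hi : 0 <= h^-1 by rewrite invr_ge0 ltW.
have := expR_ge_exprn k.+1 hi.
rewrite expRN -[_ <= expR _]lef_pV2 ?posrE ?expR_gt0 ?exprn_gt0 ?divr_gt0 ?invr_gt0//.
move=> H; apply: (le_trans (ler_wpM2l _ H)); first by rewrite invr_ge0 exprn_ge0// ltW.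
rewrite le_eqVlt; apply/orP; left; apply/eqP.
rewrite expr_div_n exprVn; set N := k.+2%:R ^+ k.+2.
have N0 : N != 0 by rewrite /N expf_neq0// pnatr_eq0.
by rewrite !exprS; field; rewrite N0 expf_neq0 ?gt_eqF.
Qed.

Lemma is_derive_exprn k (x : R) : is_derive x (1:R) (fun y => y ^+ k) (k%:R * x ^+ k.-1).
Proof.
elim: k => [|k IH]; first by rewrite mul0r; exact: is_derive_cst.
rewrite (_ : (fun y => _) = (id : R -> R) * (fun y => y ^+ k)); last first.
  by apply/funext => y; rewrite exprS.
have := @is_deriveM _ _ _ _ _ _ _ _ (is_derive_id x 1) IH; rewrite /GRing.scale/=.
move=> H; apply: (is_derive_eq H); rewrite mulr1 -natr1 mulrDl mul1r.
by case: k {IH H} => [|k] /=; rewrite ?mul0r ?mulr0// exprS; ring.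
Qed.

Lemma is_derive_flat k x : is_derive x (1:R) (flat k) (- k%:R * flat k.+1 x + flat k.+2 x).
Proof.
have [x0|x0|->] := ltgtP x 0.
- rewrite /flat ltNge (ltW x0) /= mulr0 addr0.
  have H0 : is_derive x (1:R) (fun=> 0 : R) 0 by exact: is_derive_cst.
  apply: near_eq_is_derive H0.
  near=> y; rewrite ltNge ltW//=; near: y.
  by apply: open_nbhs_nbhs; split => //; exact: open_lt.
- have H1 : is_derive x (1:R) (fun y => (y ^+ k)^-1) (- (x ^+ k) ^- 2 *: (k%:R * x ^+ k.-1)).
    apply: is_deriveV; first by rewrite expf_neq0// gt_eqF.
    exact: is_derive_exprn.
  have H2 : is_derive x (1:R) (fun y => expR (- y^-1)) (expR (- x^-1) * (x ^- 2)).
    apply: (@is_derive1_comp R expR (fun y => - y^-1)).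
    have := @is_deriveN _ _ _ _ _ _ _ (@is_deriveV R id x 1 1 (lt0r_neq0 x0) (is_derive_id _ _)).
    by rewrite /GRing.scale/= mulr1 opprK.
  have H3 : is_derive x (1:R) (fun y => y ^- k * expR (- y^-1))
      (- k%:R * flat k.+1 x + flat k.+2 x).
    have := @is_deriveM _ _ _ _ _ _ _ _ H1 H2; rewrite /GRing.scale/= => H.
    apply: (is_derive_eq H); rewrite /flat x0.
    case: k {H H1} => [|k] /=; first by rewrite !expr0 expr2 invr1; field; exact: lt0r_neq0.
    have xk : x ^+ k != 0 by rewrite expf_neq0// gt_eqF.
    by rewrite !exprS; field; rewrite xk gt_eqF.
  apply: near_eq_is_derive H3.
  near=> y; rewrite /flat (_ : 0 < y)//; near: y.
  by apply: open_nbhs_nbhs; split => //; exact: open_gt.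
- have E j : flat j 0 = 0 by rewrite /flat ltxx.
  rewrite !E mulr0 addr0.
  apply: (@is_derive_littleo _ _ _ (fun h => k.+2%:R ^+ k.+2 * `|h|)).
    have H : k.+2%:R ^+ k.+2 * `|h| @[h --> (0:R)] --> k.+2%:R ^+ k.+2 * `|0 : R|.
      by apply: cvgMr; exact: (@norm_continuous _ R 0).
    by rewrite normr0 mulr0 in H.
  move=> h; rewrite add0r mul0r subr0.
  by rewrite E subr0; exact: flat_quad.
Unshelve. all: by end_near. Qed.

Lemma ndiff_flat n k : ndiff n (flat k).
Proof.
elim: n k => // n IH k; exists (fun x => - k%:R * flat k.+1 x + flat k.+2 x).
  exact: is_derive_flat.
apply: ndiffD => //; apply: (@ndiffM n (fun=> - k%:R)) => //; exact: ndiff_cst.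
Qed.

(** Each factor is e^(-1/((n + 1) t)) in the distance t to an end of ]a, b[; as n grows the product
    tends to the indicator of ]a, b[. *)
Definition bump (a b : R) (n : nat) (x : R) : R :=
  flat 0 (n.+1%:R * (x - a)) * flat 0 (n.+1%:R * (b - x)).

Lemma flat0_ge0 x : 0 <= flat 0 x.
Proof. by rewrite /flat; case: ifP => // _; rewrite expr0 invr1 mul1r expR_ge0. Qed.

Lemma flat0_le1 x : flat 0 x <= 1.
Proof.
rewrite /flat; case: ltP => // x0.
by rewrite expr0 invr1 mul1r -expR0 ler_expR lerNl oppr0 invr_ge0 ltW.
Qed.

Lemma ndiff_bump a b n m : ndiff m (bump a b n).
Proof.
apply: ndiffM.
- apply: (@ndiff_eq _ (fun x => flat 0 (n.+1%:R * x + (- (n.+1%:R * a))))).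
    by move=> x; rewrite mulrBr.
  exact/ndiff_affine/ndiff_flat.
- apply: (@ndiff_eq _ (fun x => flat 0 (- n.+1%:R * x + (n.+1%:R * b)))).
    by move=> x; rewrite mulrBr addrC mulNr.
  exact/ndiff_affine/ndiff_flat.
Qed.

Lemma bump_out a b n x : ~~ (a < x < b) -> bump a b n x = 0.
Proof.
rewrite /bump negb_and -!leNgt => /orP[xa|bx].
- by rewrite {1}/flat pmulr_rgt0// subr_gt0 ltNge xa/= mul0r.
- by rewrite mulrC {1}/flat pmulr_rgt0// subr_gt0 ltNge bx/= mul0r.
Qed.

Lemma bump_gt0 a b n x : a < x < b -> 0 < bump a b n x.
Proof.
move=> /andP[ax xb]; rewrite /bump mulr_gt0// /flat pmulr_rgt0// subr_gt0.
- by rewrite ax expr0 invr1 mul1r expR_gt0.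
- by rewrite xb expr0 invr1 mul1r expR_gt0.
Qed.

Lemma bump_bounds a b n x : 0 <= bump a b n x <= 1.
Proof.
rewrite /bump mulr_ge0 ?flat0_ge0//=; apply: mulr_ile1; by rewrite ?flat0_ge0 ?flat0_le1.
Qed.

Lemma cvg_flat0 y : 0 < y -> flat 0 (n.+1%:R * y) @[n --> \oo] --> (1 : R).
Proof.
move=> y0; rewrite /flat.
under eq_fun do rewrite pmulr_rgt0// y0 expr0 invr1 mul1r invfM.
have H : - (n.+1%:R^-1 / y) @[n --> \oo] --> - (0 / y).
  by apply: cvgN; apply: cvgMl; exact: cvg_harmonic.
have := @cvg_comp _ _ _ _ expR _ _ _ H (@continuous_expR R (- (0 / y))).
by rewrite mul0r oppr0 expR0.
Qed.

Lemma cvg_bump a b x : bump a b n x @[n --> \oo] --> ind (a < x < b).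
Proof.
have [axb|axb] := boolP (a < x < b).
- rewrite /ind -[X in _ --> X](mulr1 (1:R)) /bump; case/andP: axb => ax xb.
  by apply: cvgM; apply: cvg_flat0; rewrite subr_gt0.
- by rewrite /ind; apply: cvg_near_cst; apply: nearW => n; rewrite bump_out.
Qed.

(** Working form of [test_function], with an explicit radius in place of a compact closure. *)
Definition tf f := (forall n, ndiff n f) /\ exists2 S, 0 < S & forall x, S < `|x| -> f x = 0.

Lemma test_functionP phi : test_function phi <-> tf phi.
Proof.
split=> [[/smoothP sphi cphi]|[sphi [S S0 phiS]]]; split; [by []| |exact/smoothP|].
- have /compact_bounded[M [Mr Mb]] := cphi.
  pose S := Num.max 1 (M + 1).
  exists S; first by rewrite lt_max ltr01.
  move=> x Sx; apply/eqP; apply: contraTT Sx => phix0.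
  rewrite -leNgt; apply: (Mb S); first by rewrite lt_max ltrDl ltr01 orbT.
  exact: subset_closure.
- apply: (@subclosed_compact _ _ `[- S, S]); [exact: closed_closure|exact: segment_compact|].
  rewrite (_ : `[- S, S]%classic = closure `[- S, S]%classic); last first.
    by apply/closure_id; exact: interval_closed.
  apply: closure_subset => x /= phix0; rewrite in_itv/= -ler_norml leNgt.
  by apply: contra phix0 => /phiS ->.
Qed.

Lemma tf_derive f : tf f -> exists2 f1, (forall x, is_derive x (1:R) f (f1 x)) & tf f1.
Proof.
move=> [nf [S S0 fS]].
have [f1 df _] := nf 1%N.
exists f1 => //; split.
  move=> n; have [g dg ng] := nf n.+1.
  apply: ndiff_eq ng => x.
  by rewrite -(@derive_val _ _ _ _ _ _ _ (dg x)) (@derive_val _ _ _ _ _ _ _ (df x)).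
exists S => // x Sx; have [df1 <-] := df x.
rewrite (@near_eq_derive _ _ _ f (cst 0)); first exact: derive_cst.
near=> y; rewrite fS//; near: y.
exists (`|x| - S); first by rewrite /= subr_gt0.
move=> y /= xy; have := ler_normD (x - y) y; rewrite subrK.
by move: xy; clear; lra.
Unshelve. all: by end_near. Qed.

Lemma tf_cont f : tf f -> continuous f.
Proof. by move=> /tf_derive[f1 df _] x; exact: is_derive_cont (df x). Qed.

Lemma tf_wt f q : 0 <= q -> tf f -> exists2 B, 0 <= B & forall x, `|f x| <= B * wt q x.
Proof.
move=> q0 fT; have cf := tf_cont fT; have [_ [S S0 fS]] := fT.
have [M M0 fM] := cont_bounded (- S) S cf.
exists (M * (1 + S) `^ q) => [|x]; first by rewrite mulr_ge0 ?powR_ge0.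
have [xS|Sx] := leP `|x| S; last by rewrite fS// normr0 !mulr_ge0 ?powR_ge0 ?wt_ge0.
apply: (@le_trans _ _ M); first by apply: fM; rewrite -ler_norml.
rewrite -mulrA ler_peMr// /wt powRN -ler_pdivrMr ?invr_gt0 ?powR_gt0 ?ltr_pwDl//.
by rewrite mul1r invrK ge0_ler_powR ?nnegrE ?addr_ge0 ?lerD2l// ltW.
Qed.

Lemma tf_decays f : tf f -> exists2 B, 0 <= B & decays B 2 f.
Proof.
move=> fT; have [f1 df f1T] := tf_derive fT; have [f2 df1 f2T] := tf_derive f1T.
have [B1 B10 H1] := @tf_wt f (1 + 2) (ltac:(by [])) fT.
have [B2 B20 H2] := @tf_wt f2 3 (ltac:(by [])) f2T.
exists (B1 + B2); first exact: addr_ge0.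
exists f1, f2; split => // x.
- by apply: (le_trans (H1 x)); rewrite ler_wpM2r ?wt_ge0// lerDl.
- by apply: (le_trans (H2 x)); rewrite ler_wpM2r ?wt_ge0// lerDr.
Qed.

Lemma tf_itg f : tf f -> itg f.
Proof.
move=> fT; have [B B0 fB] := @tf_wt f 2 (ltac:(by [])) fT.
apply: (@itg_le _ _ (fun x => B * wt 2 x)) => //.
  by apply: continuous_measurable; exact: tf_cont.
by apply/itgZ/itg_wt; rewrite ltr1n.
Qed.

Lemma tfD f g : tf f -> tf g -> tf (fun x => f x + g x).
Proof.
move=> [nf [S S0 fS]] [ng [T T0 gT]]; split => [n|]; first exact: ndiffD.
exists (S + T); first exact: addr_gt0.
by move=> x STx; rewrite fS ?gT ?addr0//; apply: le_lt_trans STx; rewrite ?lerDl ?lerDr ltW.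
Qed.

Lemma tfZ c f : tf f -> tf (fun x => c * f x).
Proof.
move=> [nf [S S0 fS]]; split => [n|]; first by apply: (@ndiffM n (fun=> c)) => //; exact: ndiff_cst.
by exists S => // x Sx; rewrite fS// mulr0.
Qed.

Lemma tf_bump a b n : tf (bump a b n).
Proof.
split => [m|]; first exact: ndiff_bump.
exists (1 + `|a| + `|b|); first by rewrite ltr_pwDl// ltr_pwDl.
move=> x abx; apply: bump_out; apply: contraTN abx => /andP[ax xb].
rewrite -leNgt ler_norml; have := ler_norm b; have := ler_norm (- a); rewrite normrN.
by move: ax xb (normr_ge0 a) (normr_ge0 b); clear; lra.
Qed.

End smooth_functions.

(** * The fractional Laplacian *)

Section fractional_laplacian.
Context {R : realType}.
Implicit Types (f g phi psi P : R -> R) (al B K x : R).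
Local Notation mu := (@lebesgue_measure R).

Lemma powR_le (a b q : R) : 0 <= q -> 0 <= a -> a <= b -> a `^ q <= b `^ q.
Proof.
by move=> q0 a0 ab; rewrite ge0_ler_powR// nnegrE// (le_trans a0).
Qed.

Lemma wt_bound_ge0 B q f : (forall z, `|f z| <= B * wt q z) -> 0 <= B.
Proof.
by move=> fB; have := le_trans (normr_ge0 _) (fB 0); rewrite pmulr_lge0// wt_gt0.
Qed.

Lemma decays_ge0 B d f : decays B d f -> 0 <= B.
Proof. by move=> [f1 [f2 [_ _ fB _]]]; exact: wt_bound_ge0 fB. Qed.

Lemma decays_bounded B d f : 0 < d -> decays B d f -> forall x, `|f x| <= B.
Proof.
move=> d0 [f1 [f2 [_ _ fB _]]] x; apply: (le_trans (fB x)).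
have B0 := wt_bound_ge0 fB.
rewrite ler_piMr// /wt; apply: (@le_trans _ _ (1 `^ (- (1 + d)))); last by rewrite powR1.
apply: powR_le_neg => //; last by rewrite lerDl.
by rewrite addr_ge0// ltW.
Qed.

(** Averaging the truncated integral over t and -t turns the first difference into half a second
    difference, which is absolutely integrable against the kernel. Dominated convergence then
    removes the truncation and shows that the principal value exists. *)
Lemma fraclapE (s : R) phi x : 2^-1 < s < 1 -> tf phi ->
  fraclap s phi x = fraclap_cst s * fl (2 * s - 1) phi x.
Proof.
move=> /andP[s0 s1] phiT; set al := 2 * s - 1.
have al01 : 0 < al < 1 by rewrite /al; apply/andP; split; lra.
have cphi := tf_cont phiT.
have mphi : measurable_fun setT phi by exact: continuous_measurable.
have [B B0 dphi] := tf_decays phiT.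
have phiB := @decays_bounded _ _ _ (ltr0Sn R 1) dphi.
have [K K0 /(_ _ _ dphi x)[Iabs _]] := @Dabs_bound R al 2 al01 (ltr0Sn R 1).
have al2 : 1 < 2 + al by move: al01 => /andP[]; lra.
pose F t := - sd phi x t * `|t| `^ (- (2 + al)).
have mF : measurable_fun setT F.
  by rewrite /F /sd; under eq_fun do rewrite opprB; mfun.
have FE t : `|F t| = `|sd phi x t| * `|t| `^ (- (2 + al)).
  by rewrite normrM normrN (ger0_norm (powR_ge0 _ _)).
pose T eps := \int[mu]_(y in [set y | (eps < `|x - y|)%R])
          ((phi x - phi y) / `|x - y| `^ (1 + 2 * s)).
have TE eps : 0 < eps -> T eps = 2^-1 * integ (fun t => ind (eps < `|t|) * F t).
  move=> eps0.
  pose h t := ind (eps < `|t|) * ((phi x - phi (x + t)) * `|t| `^ (- (2 + al))).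
  have mh : measurable_fun setT h by rewrite /h; mfun.
  have Ih : itg h.
    have [I _] := itg_powy al2 eps0.
    apply: itg_le (itgZ (2 * B) I) => // t; rewrite /h.
    rewrite normrM (ger0_norm (ind_ge0 _)) normrM (ger0_norm (powR_ge0 _ _)).
    rewrite mulrCA; apply: ler_pM; rewrite ?mulr_ge0 ?ind_ge0 ?powR_ge0//.
      apply: (le_trans (ler_normB _ _)); rewrite mulr_natl mulr2n; exact: lerD.
    rewrite ler_wpM2r ?powR_ge0// /ind ler_nat.
    by case: ltP => // /ltW ->.
  rewrite /T -(@integ_ind _ _ (fun y => eps < `|x - y|))//.
  rewrite (_ : integ _ = integ (fun y => h (y + - x))); last first.
    apply: eq_integ => y; rewrite /h distrC; congr (_ * (_ * _)).
    - by rewrite [x + _]addrC subrK.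
    - by rewrite -powRN (_ : 1 + 2 * s = 2 + al)// /al; ring.
  rewrite integ_shift// -[LHS]mul1r -[1 in LHS](@mulVf _ 2)// -mulrA -integ_even//.
  congr (_ * _); apply: eq_integ => t; rewrite /h /F /sd normrN.
  by rewrite -mulrDr -mulrDl; congr (_ * (_ * _)); ring.
have cvT : T eps @[eps --> 0^'+] --> fl al phi x.
  apply/cvg_at_rightP => u [u0 u_0].
  rewrite (_ : (fun n => T (u n)) = (fun n => 2^-1 * integ (fun t => ind (u n < `|t|) * F t))); last first.
    by apply/funext => n; rewrite TE.
  rewrite /fl; apply: cvgMr.
  have mu_ n : measurable_fun setT (fun t : R => ind (u n < `|t|) * F t) by mfun.
  have cu t : ind (u n < `|t|) * F t @[n --> \oo] --> F t.
    have [->|t0] := eqVneq t 0.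
      rewrite /F normr0 powR0 ?mulr0; last by rewrite oppr_eq0 gt_eqF// (lt_trans _ al2).
      by apply: cvg_near_cst; apply: nearW => n; rewrite mulr0.
    apply: cvg_near_cst; near=> n.
    rewrite (_ : u n < `|t|) ?/ind ?mul1r//; near: n.
    by apply: (cvgr_lt _ u_0); rewrite normr_gt0.
  have bu n t : `|ind (u n < `|t|) * F t| <= `|sd phi x t| * `|t| `^ (- (2 + al)).
    by rewrite -FE normrM ler_piMl// ger0_norm ?ind_le1 ?ind_ge0.
  by have [] := dct mu_ mF cu bu Iabs.
rewrite /fraclap; congr (_ * _); exact: cvg_lim cvT.
Unshelve. all: by end_near. Qed.

Definition conv P psi x : R := integ (fun y => P y * psi (x - y)).

Definition growth al K P := measurable_fun setT P /\ forall y, `|P y| <= K * (1 + `|y|) `^ al.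

Lemma growth_ge0 al K P : growth al K P -> 0 <= K.
Proof.
move=> [_ /(_ 0)]; rewrite normr0 addr0 powR1 mulr1; exact: le_trans.
Qed.

(** This is 1 + |y| <= (1 + |x|) (1 + |x - y|) raised to the power a. *)
Lemma wt_shift a q x y : 0 <= a ->
  (1 + `|y|) `^ a * wt q (x - y) <= (1 + `|x|) `^ a * wt (q - a) (x - y).
Proof.
move=> a0; rewrite /wt.
have p1 (z : R) : 0 < 1 + `|z| by rewrite ltr_pwDl.
have -> : (1 + `|x - y|) `^ (- (q - a)) = (1 + `|x - y|) `^ a * (1 + `|x - y|) `^ (- q).
  rewrite -powRD; last by rewrite (gt_eqF (p1 _)) implybT.
  by congr (_ `^ _); ring.
rewrite mulrA ler_wpM2r ?powR_ge0// -powRM ?(ltW (p1 _))//.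
apply: powR_le => //.
have : `|y| <= `|x| + `|x - y| by have := ler_normB x (x - y); rewrite subKr.
have : 0 <= `|x| * `|x - y| by rewrite mulr_ge0.
lra.
Qed.

Lemma itg_growth al K P psi B q x : 0 <= al -> 1 + al < q -> growth al K P ->
  measurable_fun setT psi -> (forall z, `|psi z| <= B * wt q z) ->
  itg (fun y => P y * psi (x - y)).
Proof.
move=> al0 alq gP mpsi psiB; have [mP PK] := gP.
have K0 := growth_ge0 gP.
have B0 := wt_bound_ge0 psiB.
have q1 : 1 < q - al by rewrite ltrBrDr.
apply: (itg_le _ _ (itgZ (K * B * (1 + `|x|) `^ al) (itg_refl x (itg_wt q1)))).
  by mfun.
move=> y; rewrite normrM.
apply: (le_trans (ler_pM (normr_ge0 _) (normr_ge0 _) (PK y) (psiB (x - y)))).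
by rewrite mulrACA -[leRHS]mulrA ler_wpM2l ?mulr_ge0//; exact: wt_shift.
Qed.

Lemma sd_conv al K P psi B q x t : 0 <= al -> 1 + al < q -> growth al K P ->
  measurable_fun setT psi -> (forall z, `|psi z| <= B * wt q z) ->
  integ (fun y => P y * sd psi (x - y) t) = sd (conv P psi) x t.
Proof.
move=> al0 alq gP mpsi psiB; rewrite /sd /conv.
have I z : itg (fun y => P y * psi (z - y)) by exact: itg_growth gP mpsi psiB.
rewrite -integZ// -integD// -integB//; last first.
- exact: itgZ.
- exact: itgD.
apply: eq_integ => y.
by rewrite [x + t - y]addrAC [x - t - y]addrAC; ring.
Qed.

(** Fubini in y and t. The t-integral decays with exponent 2 + al, which beats the growth of P by
    the integrable weight of exponent 2. The third conclusion serves later to remove a truncation in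
    t. *)
Lemma fl_conv al K P psi B x : 0 < al < 1 -> growth al K P -> decays B 2 psi ->
  [/\ itg (fun y => P y * fl al psi (x - y)),
      integ (fun y => P y * fl al psi (x - y)) = fl al (conv P psi) x &
      itg (fun t => sd (conv P psi) x t * `|t| `^ (- (2 + al)))].
Proof.
move=> al01 gP dpsi; have [mP PK] := gP.
have K0 := growth_ge0 gP.
have /andP[al0 al1] := al01.
have mpsi : measurable_fun setT psi by apply: continuous_measurable; exact: decays_cont dpsi.
have [C C0 /(_ _ _ dpsi) HC] := @Dabs_bound R al 2 al01 (ltr0Sn R 1).
have B0 := decays_ge0 dpsi.
have psiB z : `|psi z| <= B * wt 3 z.
  have [f1 [f2 [_ _ fB _]]] := dpsi; have := fB z.
  by rewrite (_ : 1 + 2 = 3 :> R)//; ring.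
pose F (p : R * R) := P p.1 * (- sd psi (x - p.1) p.2 * `|p.2| `^ (- (2 + al))).
have mF : measurable_fun setT F.
  by rewrite /F /sd; under eq_fun do rewrite opprB; mfun.
have Iy y : itg (fun t => - sd psi (x - y) t * `|t| `^ (- (2 + al))).
  have [I _] := HC (x - y).
  apply: itg_le I.
    by rewrite /sd; under eq_fun do rewrite opprB; mfun.
  by move=> t; rewrite normrM normrN (ger0_norm (powR_ge0 _ _)).
have IF y : itg (fun t => F (y, t)) by apply: eq_itg (itgZ (P y) (Iy y)).
have bF y : integ (fun t => `|F (y, t)|) <= K * (C * B) * (1 + `|x|) `^ al * wt 2 (x - y).
  have [I IC] := HC (x - y).
  rewrite (_ : integ _ = `|P y| * integ (fun t => `|sd psi (x - y) t| * `|t| `^ (- (2 + al)))); last first.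
    rewrite -integZ//; apply: eq_integ => t.
    by rewrite /F /= !normrM normrN (ger0_norm (powR_ge0 _ _)).
  have I0 : 0 <= integ (fun t => `|sd psi (x - y) t| * `|t| `^ (- (2 + al))).
    by apply: integ_ge0 => t; rewrite mulr_ge0 ?powR_ge0.
  apply: (le_trans (ler_pM (normr_ge0 _) I0 (PK y) IC)).
  rewrite mulrACA -[leRHS]mulrA ler_wpM2l ?mulr_ge0 ?(ltW C0)//.
  by have := @wt_shift al (2 + al) x y (ltW al0); rewrite addrK.
have Ibd : itg (fun y => K * (C * B) * (1 + `|x|) `^ al * wt 2 (x - y)).
  by apply: itgZ; apply: itg_refl; apply: itg_wt; rewrite ltr1n.
have [E I1 I2 _] := fubini mF IF bF Ibd.
have al3 : 1 + al < 3 by move: al1; clear; lra.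
have sdE t : integ (fun y => F (y, t)) = - sd (conv P psi) x t * `|t| `^ (- (2 + al)).
  rewrite -(sd_conv x t (ltW al0) al3 gP mpsi psiB).
  have Isd : itg (fun y => P y * sd psi (x - y) t).
    have I z : itg (fun y => P y * psi (z - y)) by exact: itg_growth (ltW al0) al3 gP mpsi psiB.
    apply: eq_itg (itgB (itgD (I (x + t)) (I (x - t))) (itgZ 2 (I x))) => y.
    by rewrite /sd [x + t - y]addrAC [x - t - y]addrAC; ring.
  transitivity (- `|t| `^ (- (2 + al)) * integ (fun y => P y * sd psi (x - y) t)).
    by rewrite -(integZ _ Isd); apply: eq_integ => y; rewrite /F /=; ring.
  by rewrite !mulNr mulrC.
have flE y : P y * fl al psi (x - y) = 2^-1 * integ (fun t => F (y, t)).
  by rewrite /fl mulrCA; congr (_ * _); rewrite -(integZ _ (Iy y)).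
split.
- by apply: eq_itg (itgZ 2^-1 I1) => y; rewrite flE.
- by rewrite (eq_integ flE) (integZ _ I1) E (eq_integ sdE).
- by apply: eq_itg (itgN I2) => t; rewrite sdE mulNr opprK.
Qed.

End fractional_laplacian.

(** * The fundamental solution *)

Section fundamental_solution.
Context {R : realType} (al : R).
Hypothesis al01 : 0 < al < 1.
Implicit Types (f g psi : R -> R) (x y z t : R).
Local Notation mu := (@lebesgue_measure R).

Let al0 : 0 < al. Proof. by case/andP: al01. Qed.
Let al1 : al < 1. Proof. by case/andP: al01. Qed.

Definition absal (a : R) (y : R) : R := `|y| `^ a.

Lemma absal_continuous : continuous (absal al).
Proof.
move=> x; have [->|x0] := eqVneq x 0.
  apply/cvgrPdist_le => /= e e0; near=> h.
  rewrite /absal normr0 powR0 ?gt_eqF// sub0r normrN ger0_norm ?powR_ge0//.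
  have -> : e = (e `^ al^-1) `^ al by rewrite -powRrM mulVf ?gt_eqF// powRr1// ltW.
  apply: powR_le => //; first exact: ltW.
  near: h; exists (e `^ al^-1); first by rewrite /= powR_gt0.
  by move=> h /=; rewrite sub0r normrN => /ltW.
apply: (@continuous_comp _ _ _ (fun y : R => `|y|) (fun y : R => y `^ al)).
  exact: norm_continuous.
by apply: powR_continuous; rewrite normr_gt0.
Unshelve. all: by end_near. Qed.

(** The odd primitive of (1 + al) |z|^al, homogeneous of degree 1 + al. *)
Definition sig (z : R) : R := z * `|z| `^ al.

Lemma sig_pos z : 0 <= z -> sig z = z `^ (1 + al).
Proof.
rewrite le_eqVlt => /predU1P[<-|z0].
  by rewrite /sig mul0r powR0// gt_eqF// ltr_pwDl// ltW.
rewrite /sig gtr0_norm// powRD; last by rewrite (gt_eqF z0) implybT.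
by rewrite powRr1// ltW.
Qed.

Lemma sigN z : sig (- z) = - sig z.
Proof. by rewrite /sig normrN mulNr. Qed.

Lemma is_derive_sig z : is_derive z (1:R) sig ((1 + al) * absal al z).
Proof.
have pos (w : R) : 0 < w -> is_derive w (1:R) sig ((1 + al) * absal al w).
  move=> w0; have := is_derive1_powR (1 + al) w0.
  rewrite (_ : 1 + al - 1 = al); last by ring.
  rewrite /absal gtr0_norm//; apply: near_eq_is_derive.
  near=> y; rewrite sig_pos// ltW//; near: y.
  by apply: open_nbhs_nbhs; split => //; exact: open_gt.
have [z0|z0|->] := ltgtP z 0; last first.
- rewrite /absal normr0 powR0 ?gt_eqF// mulr0.
  apply: (@is_derive_littleo _ _ _ _ (absal al)).
    have H : absal al h @[h --> (0:R)] --> absal al 0 by exact: absal_continuous.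
    by rewrite {2}/absal normr0 powR0 ?gt_eqF in H.
  by move=> h; rewrite add0r mul0r subr0 /sig mul0r subr0 normrM [ `| _ `^ _ |]ger0_norm ?powR_ge0.
- exact: pos.
- have nz : 0 < (-1) * z + 0 by rewrite mulN1r addr0 oppr_gt0.
  have H := @is_derive1_comp R sig (fun r : R => -1 * r + 0) z _ _ (pos _ nz) (is_derive_affine (-1) 0 z).
  have := is_deriveN H; rewrite mulrN1 opprK mulN1r addr0 {1}/absal normrN.
  by rewrite (_ : - _ = sig)//; apply/funext => y; rewrite !fctE /= mulN1r addr0 sigN opprK.
Unshelve. all: by end_near. Qed.

Lemma sig_homog k z : 0 < k -> sig (k * z) = k `^ (1 + al) * sig z.
Proof.
move=> k0; rewrite -(sig_pos (ltW k0)) /sig normrM (gtr0_norm k0) powRM ?(ltW k0)//.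
by ring.
Qed.

(* Restricted to e < |t| < N, the integral fl |.|^al x is kerP (x / N) / N - kerP (x / e) / e:
   an approximate identity, so that |.|^al is a fundamental solution. *)
Definition kerP (y : R) : R := sd sig y 1 / ((1 + al) * y).

Lemma sd_sig_odd y t : sd sig (- y) t = - sd sig y t.
Proof.
have E1 : - y + t = - (y - t) by ring.
have E2 : - y - t = - (y + t) by ring.
by rewrite /sd E1 E2 !sigN; ring.
Qed.

Lemma kerP_even y : kerP (- y) = kerP y.
Proof. by rewrite /kerP sd_sig_odd mulrN invrN mulrNN. Qed.

Lemma is_derive_sd_sig y t :
  is_derive t (1:R) (sd sig y) ((1 + al) * (absal al (y + t) - absal al (y - t))).
Proof.
have H1 := is_derive_comp_affine 1 y t is_derive_sig.
have H2 := is_derive_comp_affine (-1) y t is_derive_sig.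
have := is_deriveB (is_deriveD H1 H2) (is_derive_cst (2 * sig y) t (1 : R)).
rewrite (_ : _ - _ = sd sig y); last first.
  by apply/funext => r; rewrite /sd !fctE mul1r mulN1r ![_ + y]addrC.
move=> H; apply: (is_derive_eq H).
by rewrite !mul1r !mulN1r ![_ + y]addrC; ring.
Qed.

Lemma kerP_ftc y e N : y != 0 -> 0 < e -> e <= N ->
  itg (fun t => ind (e <= t <= N) * (- sd (absal al) y t * t `^ (- (2 + al)))) /\
  integ (fun t => ind (e <= t <= N) * (- sd (absal al) y t * t `^ (- (2 + al)))) =
  N^-1 * kerP (N^-1 * y) - e^-1 * kerP (e^-1 * y).
Proof.
move=> y0 e0 eN.
have p0 : 1 + al != 0 by rewrite gt_eqF// ltr_pwDl// ltW.
(* An exact primitive: as sig (y + t) = (y + t) |y + t|^al and likewise for y - t, the combination t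
   (|y + t|^al - |y - t|^al) - sd sig y t equals - y sd (absal al) y t. Homogeneity of [sig]
   identifies H with the dilate of [kerP]. *)
pose H t : R := ((1 + al) * y)^-1 * (t `^ (- (1 + al)) * sd sig y t).
have HE t : 0 < t -> t^-1 * kerP (t^-1 * y) = H t.
  move=> t0; rewrite /kerP /H.
  have ti : 0 < t^-1 by rewrite invr_gt0.
  have -> : sd sig (t^-1 * y) 1 = t `^ (- (1 + al)) * sd sig y t.
    rewrite /sd -[X in t^-1 * y + X](mulVf (lt0r_neq0 t0)) -[X in t^-1 * y - X](mulVf (lt0r_neq0 t0)).
    rewrite -mulrDr -mulrBr !sig_homog//.
    have -> : t^-1 `^ (1 + al) = t `^ (- (1 + al)).
      by rewrite -powR_inv1 ?(ltW t0)// -powRrM mulN1r.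
    by ring.
  by field; rewrite p0 y0 (gt_eqF t0).
have N0 : 0 < N by exact: lt_le_trans eN.
rewrite !HE//.
have dH t : 0 < t -> is_derive t (1:R) H (- sd (absal al) y t * t `^ (- (2 + al))).
  move=> t0.
  have H1 := is_derive1_powR (- (1 + al)) t0.
  have H2 := is_deriveM H1 (is_derive_sd_sig y t).
  have H3 := is_deriveM (is_derive_cst (((1 + al) * y)^-1) t (1:R)) H2.
  apply: (is_derive_eq H3); rewrite /GRing.scale/= mulr0 addr0.
  have -> : - (1 + al) - 1 = - (2 + al) by ring.
  have -> : t `^ (- (1 + al)) = t * t `^ (- (2 + al)).
    rewrite -[t in t * _]powRr1 ?(ltW t0)// -powRD; last by rewrite (gt_eqF t0) implybT.
    by congr (_ `^ _); ring.
  rewrite /sd /sig /absal.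
  by field; rewrite y0 p0.
apply: ftc_in => //.
- by move=> t /andP[et _]; apply: dH; exact: lt_trans et.
- apply: within_cont => t; rewrite /= in_itv/= => /andP[et _].
  have t0 : 0 < t by exact: lt_le_trans et.
  apply: cvgM; last exact: powR_continuous.
  apply: cvgN; apply: cvgB; last exact: cvg_cst.
  apply: cvgD.
    apply: (@cvg_comp _ _ _ (fun t => y + t) (absal al) _ (nbhs (y + t))); last exact: absal_continuous.
    by apply: cvgD; [exact: cvg_cst|exact: cvg_id].
  apply: (@cvg_comp _ _ _ (fun t => y - t) (absal al) _ (nbhs (y - t))); last exact: absal_continuous.
  by apply: cvgB; [exact: cvg_cst|exact: cvg_id].
- apply: within_cont => t; rewrite /= in_itv/= => /andP[et _].
  by apply: is_derive_cont (dH _ _); exact: lt_le_trans et.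
Qed.

Lemma sig_cont : continuous sig.
Proof. by move=> z; exact: is_derive_cont (is_derive_sig z). Qed.

(** The second difference is an increment of a first difference; for y >= 1 both points met by the
    first mean value theorem are positive, where |.|^al is itself differentiable and a second one
    applies. *)
Lemma sd_sig_far y : 1 <= y ->
  exists2 d, y - 1 < d < y + 1 & sd sig y 1 = (1 + al) * (al * d `^ (al - 1)).
Proof.
move=> y1.
have dphi (r : R) : is_derive r (1:R) (fun r => sig (y + r) - sig (y - 1 + r))
    ((1 + al) * (absal al (y + r) - absal al (y - 1 + r))).
  have H1 := is_derive_comp_affine 1 y r is_derive_sig.
  have H2 := is_derive_comp_affine 1 (y - 1) r is_derive_sig.
  have := is_deriveB H1 H2.
  rewrite (_ : _ - _ = (fun r => sig (y + r) - sig (y - 1 + r))); last first.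
    by apply/funext => s; rewrite !fctE !mul1r [s + y]addrC [s + (y - 1)]addrC.
  move=> H; apply: (is_derive_eq H).
  by rewrite !mul1r [r + y]addrC [r + (y - 1)]addrC; ring.
have [c c_ E1] := @MVT R _ _ 0 1 ltr01 (fun r _ => dphi r)
  (@continuous_subspaceT _ _ _ _ (fun r => is_derive_cont (dphi r))).
move: c_; rewrite in_itv/= => /andP[c0 c1].
have cc : y - 1 + c < y + c by rewrite ltrD2r gtrBl.
have ge0 : 0 < y - 1 + c by rewrite ltr_wpDl// subr_ge0.
have dpw (r : R) : r \in `]y - 1 + c, y + c[ ->
    is_derive r (1:R) (fun r : R => r `^ al) (al * r `^ (al - 1)).
  by rewrite in_itv/= => /andP[r0 _]; apply: is_derive1_powR; exact: lt_trans r0.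
have cpw : {within `[y - 1 + c, y + c], continuous (fun r : R => r `^ al)}.
  apply: within_cont => r; rewrite /= in_itv/= => /andP[r0 _].
  by apply: powR_continuous; exact: lt_le_trans r0.
have [d d_ E2] := MVT cc dpw cpw.
exists d.
  by move: d_ c0 c1; rewrite in_itv/= => /andP[d1 d2] c0 c1; apply/andP; split; lra.
move: E1; rewrite !addr0 subrK subr0 mulr1 /sd {1 2}/absal.
rewrite (gtr0_norm ge0) gtr0_norm ?(lt_trans ge0 cc)// E2.
have -> : y + c - (y - 1 + c) = 1 by ring.
by rewrite mulr1 => <-; ring.
Qed.

(** For 0 < y < 1 the second difference is (sig (1 + y) - sig (y - 1)) - 2 sig (1 - y) - 2 sig y.
    The bracket is nondecreasing in y, hence at least its value 2 at 0, and sig z <= z on [0, 1]. *)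
Lemma kerP_ge0 y : 0 <= kerP y.
Proof.
wlog y0 : y / 0 <= y => [H|].
  by have [/H//|y0] := leP 0 y; rewrite -kerP_even H// oppr_ge0 ltW.
have p0 : 0 < 1 + al by rewrite ltr_pwDl// ltW.
rewrite /kerP divr_ge0 ?mulr_ge0 ?(ltW p0)//.
have [y1|y1] := leP 1 y.
  have [d d_ ->] := sd_sig_far y1.
  by rewrite !mulr_ge0 ?powR_ge0// ltW.
move: y0; rewrite le_eqVlt => /predU1P[<-|y0].
  by rewrite /sd add0r sub0r sigN subrr sub0r /sig mul0r mulr0 oppr0.
have dphi (r : R) : is_derive r (1:R) (fun r => sig (1 + r) - sig (r - 1))
    ((1 + al) * (absal al (1 + r) - absal al (r - 1))).
  have H1 := is_derive_comp_affine 1 1 r is_derive_sig.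
  have H2 := is_derive_comp_affine 1 (-1) r is_derive_sig.
  have := is_deriveB H1 H2.
  rewrite (_ : _ - _ = (fun r => sig (1 + r) - sig (r - 1))); last first.
    by apply/funext => s; rewrite !fctE !mul1r [s + 1]addrC.
  move=> H; apply: (is_derive_eq H).
  by rewrite !mul1r [r + 1]addrC; ring.
have [c c_ E1] := @MVT R _ _ 0 y y0 (fun r _ => dphi r)
  (@continuous_subspaceT _ _ _ _ (fun r => is_derive_cont (dphi r))).
move: c_; rewrite in_itv/= => /andP[c0 cy].
have le2 : 2 <= sig (1 + y) - sig (y - 1).
  rewrite -subr_ge0.
  have -> : 2 = sig (1 + 0) - sig (0 - 1).
    by rewrite addr0 sub0r sigN /sig normr1 powR1 mulr1; ring.
  rewrite E1 subr0; apply: mulr_ge0; last exact: ltW.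
  apply: mulr_ge0; first exact: ltW.
  rewrite subr_ge0 /absal.
  apply: powR_le; rewrite ?(ltW al0)//.
  have -> : `|1 + c| = 1 + c by rewrite gtr0_norm// ltr_pwDl// ltW.
  rewrite ler_norml.
  by move: c0; clear -al0 al1; move=> ?; apply/andP; split; lra.
have small (z : R) : 0 <= z <= 1 -> sig z <= z.
  move=> /andP[z0 z1]; rewrite /sig ler_piMr// ger0_norm//.
  apply: (@le_trans _ _ (1 `^ al)); last by rewrite powR1.
  by apply: powR_le => //; exact: ltW.
have s1 := small y; have s2 := small (1 - y).
have -> : sd sig y 1 = (sig (1 + y) - sig (y - 1)) - 2 * sig (1 - y) - 2 * sig y.
  by rewrite /sd [y + 1]addrC -[1 - y]opprB sigN; ring.
rewrite (ltW y0) (ltW y1) /= in s1; rewrite subr_ge0 (ltW y1) /= in s2.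
have {}s1 := s1 isT.
have {}s2 : sig (1 - y) <= 1 - y by apply: s2; rewrite lerBlDr lerDl ltW.
by move: s1 s2 le2; clear -al0 al1; lra.
Qed.

Lemma kerP_gt0 y : 1 <= y -> 0 < kerP y.
Proof.
move=> y1; have [d /andP[d1 d2] E] := sd_sig_far y1.
have p0 : 0 < 1 + al by rewrite ltr_pwDl// ltW.
have d0 : 0 < d by apply: le_lt_trans d1; rewrite subr_ge0.
have y0 : 0 < y by exact: lt_le_trans y1.
by rewrite /kerP E divr_gt0 ?mulr_gt0 ?powR_gt0.
Qed.

Lemma kerP_meas : measurable_fun setT kerP.
Proof.
have ms : measurable_fun setT sig by apply: continuous_measurable; exact: sig_cont.
have mi : measurable_fun setT (fun y : R => y^-1).
  (* Inverses are known to be measurable for nonnegative functions, whence 1 / y = y / |y|^2. *)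
  rewrite (_ : (fun y : R => _) = (fun y => y * (`|y| ^-1 * `|y|^-1))).
    have mn : measurable_fun setT (fun y : R => `|y|^-1).
      by apply: measurable_inv_comp => //; mfun.
    by mfun.
  apply/funext => y; rewrite -invfM -normrM ger0_norm; last by rewrite -expr2 sqr_ge0.
  by have [->|y0] := eqVneq y 0; rewrite ?invr0 ?mul0r//; field.
rewrite /kerP /sd; under eq_fun do rewrite invfM.
by mfun.
Qed.

Lemma kerP_bound : exists2 C, 0 < C & forall y, `|kerP y| <= C * wt (2 - al) y.
Proof.
have p0 : 0 < 1 + al by rewrite ltr_pwDl// ltW.
have q0 : 0 <= 2 - al by rewrite subr_ge0 ltW// (lt_trans al1)// ltr1n.
(* The first term covers |y| <= 2, where a mean value theorem in y bounds [kerP] by 4 * 3^al and the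
   weight is at least 3^(-(2 - al)). The second covers |y| > 2, from d >= y / 2 and y >= (1 + y) /
   2. *)
set C := 4 * 3 `^ al * 3 `^ (2 - al) + 2 `^ (1 - al) * 2 `^ (2 - al).
have C0 : 0 < C by rewrite /C ltr_pwDl ?mulr_gt0 ?powR_gt0 ?mulr_ge0 ?powR_ge0.
exists C => // y; wlog y0 : y / 0 < y => [H|].
  have [yn|yp|->] := ltgtP y 0; [|exact: H|].
  - by rewrite -kerP_even; have := H (- y); rewrite /wt normrN; apply; rewrite oppr_gt0.
  - by rewrite /kerP mulr0 invr0 mulr0 normr0 mulr_ge0 ?wt_ge0// ltW.
have y0n := gt_eqF y0.
rewrite /C mulrDl (ger0_norm (kerP_ge0 y)).
have [y2|y2] := leP y 2.
  apply: ler_wpDr; first by rewrite !mulr_ge0 ?powR_ge0 ?wt_ge0.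
  have dphi (r : R) : is_derive r (1:R) (fun r => sd sig r 1)
      ((1 + al) * sd (absal al) r 1).
    have H1 := is_derive_comp_affine 1 1 r is_derive_sig.
    have H2 := is_derive_comp_affine 1 (-1) r is_derive_sig.
    have := is_deriveB (is_deriveD H1 H2) (is_deriveZ 2 (is_derive_sig r)).
    rewrite (_ : _ - _ = (fun r => sd sig r 1)); last first.
      by apply/funext => s; rewrite !fctE !mul1r.
    move=> H; apply: (is_derive_eq H).
    by rewrite !mul1r /sd /GRing.scale/=; ring.
  have [c c_ E1] := @MVT R _ _ 0 y y0 (fun r _ => dphi r)
    (@continuous_subspaceT _ _ _ _ (fun r => is_derive_cont (dphi r))).
  move: c_; rewrite in_itv/= => /andP[c0 cy].
  have s0 : sd sig 0 1 = 0 by rewrite /sd add0r sub0r sigN subrr sub0r /sig mul0r mulr0 oppr0.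
  rewrite s0 !subr0 in E1; rewrite /kerP E1.
  have -> : (1 + al) * sd (absal al) c 1 * y / ((1 + al) * y) = sd (absal al) c 1.
    by field; rewrite y0n gt_eqF.
  have b3 (z : R) : `|z| <= 3 -> absal al z <= 3 `^ al by move=> z3; apply: powR_le => //; exact: ltW.
  have c2 : c <= 2 by rewrite ltW// (lt_le_trans cy).
  have B1 : absal al (c + 1) <= 3 `^ al by apply: b3; rewrite ger0_norm ?addr_ge0 ?(ltW c0)//; lra.
  have B2 : absal al (c - 1) <= 3 `^ al by apply: b3; rewrite ler_norml; apply/andP; split; lra.
  have B3 : 0 <= absal al c by rewrite powR_ge0.
  have B4 : 0 <= 3 `^ al :> R by rewrite powR_ge0.
  apply: (@le_trans _ _ (4 * 3 `^ al)).
    by rewrite /sd; move: B1 B2 B3 B4; clear -al0 al1; lra.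
  rewrite -[leRHS]mulrA ler_peMr ?mulr_ge0//.
  rewrite /wt powRN -ler_pdivrMr ?invr_gt0 ?powR_gt0 ?ltr_pwDl//.
  rewrite mul1r invrK; apply: powR_le => //; rewrite gtr0_norm//.
  by move: y2; clear -al0 al1; lra.
apply: ler_wpDl; first by rewrite !mulr_ge0 ?powR_ge0 ?wt_ge0.
have y1 : 1 <= y by rewrite ltW// (lt_trans _ y2)// ltr1n.
have [d /andP[d1 d2] E] := sd_sig_far y1.
rewrite /kerP E.
have -> : (1 + al) * (al * d `^ (al - 1)) / ((1 + al) * y) = al * d `^ (al - 1) / y.
  by field; rewrite y0n gt_eqF.
have d0 : 0 < d by apply: le_lt_trans d1; rewrite subr_ge0.
have yd : y / 2 <= d by move: d1 y2; clear -al0 al1; lra.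
have y20 : 0 < y / 2 by rewrite divr_gt0.
have Hd : d `^ (al - 1) <= 2 `^ (1 - al) * y `^ (al - 1).
  rewrite -[al - 1]opprB.
  apply: (le_trans (powR_le_neg _ y20 yd)); first by rewrite subr_ge0 ltW.
  rewrite powRM ?(ltW y0)// ?invr_ge0// [leLHS]mulrC ler_wpM2r ?powR_ge0//.
  by rewrite -powR_inv1// -powRrM mulrN mulNr mul1r opprK.
have Hy : y `^ (al - 1) / y <= 2 `^ (2 - al) * wt (2 - al) y.
  have -> : y `^ (al - 1) / y = y `^ (- (2 - al)).
    rewrite -{2}(@powRr1 R y) ?(ltW y0)// -powRN -powRD; last by rewrite y0n implybT.
    by congr (_ `^ _); ring.
  rewrite /wt gtr0_norm//.
  have h : (1 + y) / 2 <= y by move: y1; clear -al0 al1; lra.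
  have h0 : 0 < (1 + y) / 2 by rewrite divr_gt0// ltr_pwDl// ltW.
  apply: (le_trans (powR_le_neg q0 h0 h)).
  rewrite powRM ?invr_ge0 ?addr_ge0 ?(ltW y0)// mulrC ler_wpM2r ?powR_ge0//.
  by rewrite -powR_inv1// -powRrM mulrN mulNr mul1r opprK.
apply: (@le_trans _ _ (1 * (2 `^ (1 - al) * y `^ (al - 1)) / y)).
  rewrite ler_wpM2r ?invr_ge0 ?(ltW y0)// ler_pM ?(ltW al0) ?(ltW al1)//.
  exact: powR_ge0.
by rewrite mul1r -[leLHS]mulrA -[leRHS]mulrA ler_wpM2l// powR_ge0.
Qed.

Lemma kerP_itg : itg kerP.
Proof.
have [C C0 H] := kerP_bound.
apply: (itg_le kerP_meas H); apply: itgZ; apply: itg_wt.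
by rewrite ltrBrDl addrC -ltrBrDl (_ : 2 - 1 = 1 :> R)//; ring.
Qed.

Lemma kerP_integ_gt0 : 0 < integ kerP.
Proof.
rewrite lt_neqAle integ_ge0 ?andbT; last by move=> y; exact: kerP_ge0.
apply/eqP => I0.
have [N [mN N0 subN]] := integ_eq0 kerP_itg kerP_ge0 (esym I0).
have mI : measurable (`[1%R, 2%R]%classic : set (measurableTypeR R)) by exact: measurable_itv.
have : (mu `[1%R, 2%R]%classic <= mu N)%E.
  apply: le_measure; rewrite ?inE//.
  move=> y; rewrite /= in_itv/= => /andP[y1 _]; apply: subN => /= H.
  by have := kerP_gt0 y1; rewrite H ltxx.
rewrite N0 lebesgue_measure_itv/= lte_fin ltr1n/=.
by rewrite -EFinB lee_fin leNgt subr_gt0 ltr1n.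
Qed.

End fundamental_solution.

Section fundamental_identity.
Context {R : realType} (al : R).
Hypothesis al01 : 0 < al < 1.
Implicit Types (f g psi : R -> R) (x y z t : R).

Let al0 : 0 < al. Proof. by case/andP: al01. Qed.
Let al1 : al < 1. Proof. by case/andP: al01. Qed.

Lemma growth_absal : growth al 1 (absal al).
Proof.
split; first by apply: continuous_measurable; exact: absal_continuous.
move=> y; rewrite mul1r ger0_norm ?powR_ge0// /absal; apply: powR_le => //.
  exact: ltW.
by rewrite lerDr.
Qed.

Lemma growth_cst : growth al 1 (fun=> 1).
Proof.
split => // y; rewrite mul1r normr1.
apply: (@le_trans _ _ (1 `^ al)); first by rewrite powR1.
by apply: powR_le => //; [exact: ltW|rewrite lerDl].
Qed.

Lemma integ_dilation k f : 0 < k -> itg f -> integ (fun y => k * f (k * y)) = integ f.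
Proof.
move=> k0 If; have kn := lt0r_neq0 k0.
have I := itg_affine 0 kn If; have E := integ_affine 0 kn If.
rewrite (_ : integ _ = integ (fun y => k * f (k * y + 0))); last first.
  by apply: eq_integ => y; rewrite addr0.
by rewrite integZ// E gtr0_norm// mulrA mulfV// mul1r.
Qed.

Lemma sd_absal_bound y t N : `|t| <= N ->
  `|sd (absal al) y t| <= 4 * (1 + N) `^ al * (1 + `|y|) `^ al.
Proof.
move=> tN; have N0 : 0 <= N by exact: le_trans tN.
have b z : `|z| <= `|y| + N -> absal al z <= (1 + N) `^ al * (1 + `|y|) `^ al.
  move=> zy; rewrite -powRM ?addr_ge0//; apply: powR_le => //; first exact: ltW.
  apply: (le_trans zy); rewrite mulrDl mul1r mulrDr mulr1.
  have h : 0 <= N * `|y| by rewrite mulr_ge0.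
  by move: h (normr_ge0 y); lra.
have b1 := b (y + t) (le_trans (ler_normD _ _) (lerD (lexx _) tN)).
have b2 := b (y - t) (le_trans (ler_normB _ _) (lerD (lexx _) tN)).
have b3 : absal al y <= (1 + N) `^ al * (1 + `|y|) `^ al by apply: b; rewrite lerDl.
rewrite /sd; apply: (le_trans (ler_normB _ _)).
rewrite -mulrA; set M := _ `^ al * _ `^ al in b1 b2 b3 *.
rewrite normrM normr_nat !ger0_norm ?addr_ge0 ?powR_ge0//.
by move: b1 b2 b3; lra.
Qed.

Lemma fl_conv_cst psi x : tf psi -> fl al (conv (fun=> 1) psi) x = 0.
Proof.
move=> psiT; have Ipsi := tf_itg psiT.
have cE z : conv (fun=> 1) psi z = integ psi.
  by rewrite /conv -(integ_refl z Ipsi); apply: eq_integ => y; rewrite mul1r.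
rewrite /fl (_ : integ _ = 0) ?mulr0// -[RHS](integ0 (R := R)); apply: eq_integ => t.
by rewrite /sd !cE -mulr2n mulr_natl subrr oppr0 mul0r.
Qed.

(** [fl] commutes with convolution by the constant 1 and annihilates the constant function this
    produces. *)
Lemma integ_fl0 psi x : tf psi -> itg (fun y => fl al psi (x - y)) /\
  integ (fun y => fl al psi (x - y)) = 0.
Proof.
move=> psiT; have [B B0 dpsi] := tf_decays psiT.
have [I E _] := fl_conv x al01 growth_cst dpsi.
split; first by apply: eq_itg I => y; rewrite mul1r.
by rewrite -(fl_conv_cst x psiT) -E; apply: eq_integ => y; rewrite mul1r.
Qed.

Lemma kerP_ftc2 y e N : y != 0 -> 0 < e -> e <= N ->
  integ (fun t => ind (e <= `|t| <= N) * (- sd (absal al) y t * `|t| `^ (- (2 + al)))) =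
  2 * (N^-1 * kerP al (N^-1 * y) - e^-1 * kerP al (e^-1 * y)).
Proof.
move=> y0 e0 eN; have [I <-] := kerP_ftc al01 y0 e0 eN.
rewrite -(integ_even I); apply: eq_integ => t; rewrite sdN.
have [t0|t0|->] := ltgtP t 0.
- by rewrite [e <= t]leNgt (lt_trans t0 e0)/= /ind mul0r add0r ltr0_norm.
- by rewrite [e <= - t]leNgt (lt_trans _ e0) ?oppr_lt0//= /ind mul0r addr0 gtr0_norm.
- by rewrite oppr0 normr0 [e <= 0]leNgt e0/= /ind !mul0r addr0.
Qed.

(** Fubini moves the second difference from the convolution onto |.|^al, whose truncated t-integral
    is a difference of two dilates of [kerP]; a scaling in y transfers the dilation to psi. *)
Lemma truncated_identity psi x e N : tf psi -> 0 < e -> e <= N ->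
  integ (fun t => ind (e <= `|t| <= N) * (- sd (conv (absal al) psi) x t * `|t| `^ (- (2 + al)))) =
  2 * (integ (fun y => psi (x - N * y) * kerP al y) - integ (fun y => psi (x - e * y) * kerP al y)).
Proof.
move=> psiT e0 eN; have N0 : 0 < N by exact: lt_le_trans eN.
have [B B0 dpsi] := tf_decays psiT.
have psiB := decays_bounded (ltr0Sn R 1) dpsi.
have [B3 B30 psi3] := tf_wt (ler0n R 3) psiT.
have mpsi : measurable_fun setT psi by apply: continuous_measurable; exact: tf_cont.
have cabs := @absal_continuous R al al01.
have mabs : measurable_fun setT (absal al) by exact: continuous_measurable.
have mker := kerP_meas al01.
have al3 : 1 + al < 3 by rewrite -ltrBrDl (lt_trans al1)// -subr_gt0; lra.
have al2 : 1 < 2 + al by rewrite -ltrBlDl (lt_trans _ al0)// subr_lt0 ltr1n.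
pose F (p : R * R) := psi (x - p.1) *
   (ind (e <= `|p.2| <= N) * (- sd (absal al) p.1 p.2 * `|p.2| `^ (- (2 + al)))).
have mF : measurable_fun setT F.
  by rewrite /F /sd; under eq_fun do rewrite opprB; mfun.
have [Ie _] := itg_powy al2 e0.
set Ic := integ (fun t : R => ind (e <= `|t|) * `|t| `^ (- (2 + al))) in Ie *.
set C := 4 * (1 + N) `^ al.
have C0 : 0 <= C by rewrite mulr_ge0 ?powR_ge0.
have kb (y t : R) : `|ind (e <= `|t| <= N) * (- sd (absal al) y t * `|t| `^ (- (2 + al)))| <=
    C * (1 + `|y|) `^ al * (ind (e <= `|t|) * `|t| `^ (- (2 + al))).
  rewrite !normrM [ `|ind _|]ger0_norm ?ind_ge0//.
  rewrite [ `|_ `^ _|]ger0_norm ?powR_ge0// normrN.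
  rewrite [leRHS]mulrA [leLHS]mulrA ler_wpM2r ?powR_ge0//.
  have [/andP[et tN]|_] := boolP (e <= `|t| <= N).
    by rewrite /ind et mul1r mulr1; exact: sd_absal_bound.
  by rewrite {1}/ind mul0r !mulr_ge0 ?ind_ge0 ?powR_ge0.
have bF y t : `|F (y, t)| <= `|psi (x - y)| * (C * (1 + `|y|) `^ al) *
    (ind (e <= `|t|) * `|t| `^ (- (2 + al))).
  by rewrite /F normrM -[leRHS]mulrA ler_wpM2l//; exact: kb.
have IF y : itg (fun t => F (y, t)).
  by apply: (itg_le _ (bF y)); [exact: measurable_pair1|exact: itgZ].
have nF y : integ (fun t => `|F (y, t)|) <= `|psi (x - y)| * (C * (1 + `|y|) `^ al) * Ic.
  by rewrite -(integZ _ Ie); apply: le_integ; [exact: itg_norm|exact: itgZ|exact: bF].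
have Ig : itg (fun y => `|psi (x - y)| * (C * (1 + `|y|) `^ al) * Ic).
  have gP : growth al 1 (fun y : R => (1 + `|y|) `^ al).
    by split => [|y]; [mfun|rewrite mul1r ger0_norm ?powR_ge0].
  have mn : measurable_fun setT (fun y => `|psi y|) by mfun.
  have nn z : `| `|psi z| | <= B3 * wt 3 z by rewrite normr_id.
  have := itg_growth x (ltW al0) al3 gP mn nn.
  by move=> /(itgZ (C * Ic)); apply: eq_itg => y; ring.
have [E I1 I2 _] := fubini mF IF nF Ig.
have I z : itg (fun y => absal al y * psi (z - y)).
  exact: itg_growth (ltW al0) al3 growth_absal mpsi psi3.
have sdE t : integ (fun y => sd (absal al) y t * psi (x - y)) = sd (conv (absal al) psi) x t /\
    itg (fun y => sd (absal al) y t * psi (x - y)).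
  have Ip : itg (fun y => absal al (y + t) * psi (x - y)).
    apply: eq_itg (itg_shift t (I (x + t))) => y; congr (_ * psi _); ring.
  have Im : itg (fun y => absal al (y - t) * psi (x - y)).
    apply: eq_itg (itg_shift (- t) (I (x - t))) => y; congr (_ * psi _); ring.
  have I0 := itgB (itgD Ip Im) (itgZ 2 (I x)).
  split; last by apply: eq_itg I0 => y; rewrite /sd; ring.
  rewrite (_ : sd _ x t = integ (fun y => absal al (y + t) * psi (x - y)) +
     integ (fun y => absal al (y - t) * psi (x - y)) - 2 * integ (fun y => absal al y * psi (x - y))).
    rewrite -(integZ _ (I x)) -(integD Ip Im) -(integB (itgD Ip Im) (itgZ 2 (I x))).
    by apply: eq_integ => y; rewrite /sd; ring.
  rewrite /sd /conv; congr (_ + _ - _).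
  - rewrite -(integ_shift t (I (x + t))); apply: eq_integ => y; congr (_ * psi _); ring.
  - rewrite -(integ_shift (- t) (I (x - t))); apply: eq_integ => y; congr (_ * psi _); ring.
rewrite (_ : integ _ = integ (fun t => integ (fun y => F (y, t)))); last first.
  apply: eq_integ => t; have [<- It] := sdE t.
  transitivity ((- (ind (e <= `|t| <= N) * `|t| `^ (- (2 + al)))) *
     integ (fun y => sd (absal al) y t * psi (x - y))); first by ring.
  by rewrite -(integZ _ It); apply: eq_integ => y; rewrite /F /=; ring.
rewrite -E.
pose G y := psi (x - y) * (2 * (N^-1 * kerP al (N^-1 * y) - e^-1 * kerP al (e^-1 * y))).
have EG : integ (fun y => integ (fun t => F (y, t))) = integ G.
  apply: ae_eq_integ; [exact: itg_meas I1|by rewrite /G; mfun|].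
  (* The primitive behind [kerP_ftc2] divides by y, so the point y = 0 is discarded. *)
  exists [set 0]; split; [exact: measurable_set1|exact: lebesgue_measure_set1|].
  move=> y /= H; apply: contrapT => /eqP y0; apply: H.
  pose k t := ind (e <= `|t| <= N) * (- sd (absal al) y t * `|t| `^ (- (2 + al))).
  have Ik : itg k.
    apply: (itg_le _ _ (itgZ (C * (1 + `|y|) `^ al) Ie)).
      by rewrite /k /sd; under eq_fun do rewrite opprB; mfun.
    by move=> t; exact: kb.
  by rewrite /G -(kerP_ftc2 y0 e0 eN) -(integZ _ Ik).
rewrite EG.
have If k : itg (fun y => psi (x - k * y) * kerP al y).
  apply: (itg_le _ _ (itgZ B (kerP_itg al01))); first by mfun.
  move=> y; rewrite normrM (ger0_norm (kerP_ge0 al01 y)); apply: ler_wpM2r.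
    exact: kerP_ge0.
  exact: psiB.
have sc k : 0 < k -> integ (fun y => psi (x - y) * (k^-1 * kerP al (k^-1 * y))) =
    integ (fun y => psi (x - k * y) * kerP al y) /\
    itg (fun y => psi (x - y) * (k^-1 * kerP al (k^-1 * y))).
  move=> k0; have ki : 0 < k^-1 by rewrite invr_gt0.
  have Ey y : psi (x - y) * (k^-1 * kerP al (k^-1 * y)) =
     k^-1 * (psi (x - k * (k^-1 * y)) * kerP al (k^-1 * y)).
    have kk : k * (k^-1 * y) = y by rewrite mulrA (mulfV (lt0r_neq0 k0)) mul1r.
    by rewrite kk mulrCA.
  split; first by rewrite (eq_integ Ey) (integ_dilation ki (If k)).
  apply: eq_itg (itgZ k^-1 (itg_affine 0 (lt0r_neq0 ki) (If k))) => y.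
  by rewrite Ey addr0.
have [<- IN] := sc N N0; have [<- Ie2] := sc e e0.
rewrite -(integB IN Ie2) -(integZ 2 (itgB IN Ie2)).
by apply: eq_integ => y; rewrite /G; ring.
Qed.

(** In the truncated identity the dilates at the small scale concentrate and produce the mass of
    [kerP] times psi x, while those at the large scale spread out and miss the support of psi. *)
Lemma fl_conv_absal psi x : tf psi ->
  fl al (conv (absal al) psi) x = - integ (kerP al) * psi x.
Proof.
move=> psiT; have [B B0 dpsi] := tf_decays psiT.
have psiB := decays_bounded (ltr0Sn R 1) dpsi.
have cpsi := tf_cont psiT.
have mpsi : measurable_fun setT psi by exact: continuous_measurable.
have mker := kerP_meas al01.
have Iker := kerP_itg al01.
have [_ _ I3] := fl_conv x al01 growth_absal dpsi.
set c := conv (absal al) psi in I3 *.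
pose G t := - sd c x t * `|t| `^ (- (2 + al)).
have IG : itg G by apply: eq_itg (itgN I3) => t; rewrite /G mulNr.
have mG := itg_meas IG.
pose S n := integ (fun t : R => ind (n.+1%:R^-1 <= `|t| <= n.+1%:R) * G t).
have c1 : S n @[n --> \oo] --> integ G.
  have m_ (n : nat) : measurable_fun setT (fun t : R => ind (n.+1%:R^-1 <= `|t| <= n.+1%:R) * G t) by mfun.
  have cv t : ind (n.+1%:R^-1 <= `|t| <= n.+1%:R) * G t @[n --> \oo] --> G t.
    have [->|t0] := eqVneq t 0.
      rewrite /G normr0 powR0 ?mulr0; last by rewrite oppr_eq0 gt_eqF// ltr_pwDl// ltW.
      by apply: cvg_near_cst; apply: nearW => n; rewrite mulr0.
    apply: cvg_near_cst; near=> n.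
    rewrite (_ : _ <= _ <= _) ?/ind ?mul1r//; apply/andP; split; near: n.
      have [k k_] := ltr_add_invr (ltac:(by rewrite normr_gt0) : 0 < `|t|).
      exists k => // n /= kn; rewrite add0r in k_; apply: le_trans (ltW k_).
      by rewrite lef_pV2 ?posrE// ler_nat.
    near=> n; apply: (@le_trans _ _ n%:R); last by rewrite ler_nat.
    by near: n; exact: nbhs_infty_ger.
  have bd (n : nat) t : `|ind (n.+1%:R^-1 <= `|t| <= n.+1%:R) * G t| <= `|G t|.
    by rewrite normrM ler_piMl// ger0_norm ?ind_le1 ?ind_ge0.
  by have [_] := dct m_ mG cv bd (itg_norm IG).
pose A n := integ (fun y => psi (x - n.+1%:R * y) * kerP al y).
pose D n := integ (fun y => psi (x - n.+1%:R^-1 * y) * kerP al y).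
have bdk (k : nat -> R) n y : `|psi (x - k n * y) * kerP al y| <= B * kerP al y.
  by rewrite normrM [ `|kerP al y|]ger0_norm ?kerP_ge0// ler_wpM2r ?kerP_ge0.
have cA : A n @[n --> \oo] --> (0:R).
  rewrite -[X in _ --> X](integ0 (R := R)).
  have m_ (n : nat) : measurable_fun setT (fun y => psi (x - n.+1%:R * y) * kerP al y) by mfun.
  have cv y : psi (x - n.+1%:R * y) * kerP al y @[n --> \oo] --> (0 : R).
    have [->|y0] := eqVneq y 0.
      rewrite /kerP mulr0 invr0 mulr0.
      by apply: cvg_near_cst; apply: nearW => n; rewrite mulr0.
    have [_ [S0 S00 psi0]] := psiT.
    apply: cvg_near_cst; near=> n; rewrite psi0 ?mul0r//.
    have : `|n.+1%:R * y| <= `|x| + `|x - n.+1%:R * y|.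
      by have := ler_normB x (x - n.+1%:R * y); rewrite subKr.
    rewrite normrM normr_nat => H.
    rewrite -(ltrD2l `|x|); apply: lt_le_trans H.
    rewrite -ltr_pdivrMr ?normr_gt0//; apply: (@lt_le_trans _ _ n%:R); last by rewrite ler_nat.
    by near: n; exact: nbhs_infty_gtr.
  by have [_] := dct m_ (measurable_cst _) cv (bdk (fun n => n.+1%:R)) (itgZ B Iker).
have cD : D n @[n --> \oo] --> psi x * integ (kerP al).
  rewrite -(integZ _ Iker).
  have m_ (n : nat) : measurable_fun setT (fun y => psi (x - n.+1%:R^-1 * y) * kerP al y) by mfun.
  have mfk : measurable_fun setT (fun y => psi x * kerP al y) by mfun.
  have cv y : psi (x - n.+1%:R^-1 * y) * kerP al y @[n --> \oo] --> psi x * kerP al y.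
    apply: cvgMl.
    have h : x - n.+1%:R^-1 * y @[n --> \oo] --> x - 0 * y.
      by apply: cvgB; [exact: cvg_cst|apply: cvgMl; exact: cvg_harmonic].
    rewrite mul0r subr0 in h.
    exact: (@cvg_comp _ _ _ _ psi _ _ _ h (cpsi x)).
  by have [_] := dct m_ mfk cv (bdk (fun n => n.+1%:R^-1)) (itgZ B Iker).
have SE n : S n = 2 * (A n - D n).
  rewrite /S /A /D -truncated_identity//.
  have n1 : 1 <= n.+1%:R :> R by rewrite ler1n.
  by apply: le_trans n1; rewrite invf_le1 ?ltr0n// ler1n.
have c2 : S n @[n --> \oo] --> 2 * (0 - psi x * integ (kerP al)).
  rewrite (_ : S = fun n => 2 * (A n - D n)); last by apply/funext => n; rewrite SE.
  by apply: cvgMr; apply: cvgB.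
have EG : integ G = 2 * (0 - psi x * integ (kerP al)).
  by rewrite -(cvg_lim _ c1)// -(cvg_lim _ c2).
by rewrite /fl -/(G _) EG sub0r mulrA mulVf// mul1r mulNr mulrC.
Unshelve. all: by end_near. Qed.

End fundamental_identity.

(** * Convolution and truncation *)

Section convolution_calculus.
Context {R : realType}.
Implicit Types (f g eta K : R -> R) (x y z t M : R).

Lemma lipschitz_bound f f1 M a b : (forall z, is_derive z (1:R) f (f1 z)) ->
  (forall z, `|z - a| <= `|b - a| -> `|f1 z| <= M) -> `|f b - f a| <= M * `|b - a|.
Proof.
move=> df f1M.
have [ba|ab|<-] := ltgtP b a; last by rewrite !subrr normr0 mulr0.
  have [c] := @MVT R f f1 b a ba (fun r _ => df r)
    (@continuous_subspaceT _ _ _ _ (fun r => is_derive_cont (df r))).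
  rewrite in_itv/= => /andP[bc ca] E; rewrite distrC E normrM distrC ler_wpM2r//.
  by apply: f1M; rewrite !ltr0_norm ?subr_lt0// !opprB lerD2l lerN2 ltW.
have [c] := @MVT R f f1 a b ab (fun r _ => df r)
  (@continuous_subspaceT _ _ _ _ (fun r => is_derive_cont (df r))).
rewrite in_itv/= => /andP[ac cb] E; rewrite E normrM ler_wpM2r//.
by apply: f1M; rewrite !gtr0_norm ?subr_gt0// lerD2r ltW.
Qed.

Lemma taylor1 f f1 f2 M z t : (forall z, is_derive z (1:R) f (f1 z)) ->
  (forall z, is_derive z (1:R) f1 (f2 z)) -> (forall z, `|f2 z| <= M) ->
  `|f (z + t) - f z - t * f1 z| <= `|t| * (M * `|t|).
Proof.
move=> df df1 f2M.
have dphi r : is_derive r (1:R) (fun r : R => f (1 * r + z) - f1 z * r) (f1 (1 * r + z) - f1 z).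
  have H1 := is_derive_comp_affine 1 z r df.
  have H2 : is_derive r (1:R) (fun r : R => f1 z * r + 0) (f1 z) by exact: is_derive_affine.
  have := @is_deriveB _ _ _ _ _ _ _ _ _ H1 H2.
  rewrite mul1r; congr is_derive; apply/funext => q /=.
  by rewrite !fctE addr0.
have L : `|(f (1 * t + z) - f1 z * t) - (f (1 * 0 + z) - f1 z * 0)| <= M * `|t| * `|t - 0|.
  apply: (lipschitz_bound dphi) => r; rewrite !subr0 mul1r => rt.
  have := @lipschitz_bound f1 f2 M z (r + z) df1 (fun w _ => f2M w).
  rewrite addrK => /le_trans; apply; rewrite ler_wpM2l//.
  exact: le_trans (f2M z).
rewrite mulrC; move: L; rewrite !mulr0 !subr0 add0r mul1r.
by rewrite [t + z]addrC addrAC [leRHS]mulrC.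
Qed.

Lemma itg_conv K g M x : itg K -> continuous g -> (forall z, `|g z| <= M) ->
  itg (fun y => K y * g (x - y)).
Proof.
move=> IK cg gM; have mK := itg_meas IK.
have mg : measurable_fun setT g by exact: continuous_measurable.
apply: (itg_le _ _ (itgZ M (itg_norm IK))); first by mfun.
by move=> y; rewrite normrM mulrC ler_wpM2r.
Qed.

Lemma is_derive_conv K g g1 g2 M x : itg K ->
  (forall z, is_derive z (1:R) g (g1 z)) -> (forall z, is_derive z (1:R) g1 (g2 z)) ->
  (forall z, `|g z| <= M) -> (forall z, `|g1 z| <= M) -> (forall z, `|g2 z| <= M) ->
  is_derive x (1:R) (conv K g) (conv K g1 x).
Proof.
move=> IK dg dg1 gM g1M g2M.
have cg : continuous g by move=> z; exact: is_derive_cont (dg z).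
have cg1 : continuous g1 by move=> z; exact: is_derive_cont (dg1 z).
have I z := itg_conv z IK cg gM; have I1 z := itg_conv z IK cg1 g1M.
have IN := itg_norm IK.
apply: (@is_derive_littleo R _ _ _ (fun h => integ (fun y => `|K y|) * (M * `|h|))).
  rewrite -[X in _ --> X](mulr0 (integ (fun y => `|K y|))); apply: cvgMl_tmp.
  rewrite -[X in _ --> X](mulr0 M); apply: cvgMl_tmp.
  by rewrite -[X in _ --> X](normr0 R); apply: cvg_norm; exact: cvg_id.
move=> h; rewrite /conv.
have -> : integ (fun y => K y * g (x + h - y)) - integ (fun y => K y * g (x - y)) -
    integ (fun y => K y * g1 (x - y)) * h =
    integ (fun y => K y * (g (x - y + h) - g (x - y) - h * g1 (x - y))).
  rewrite [_ * h]mulrC -(integZ h (I1 x)) -(integB (I (x + h)) (I x)).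
  rewrite -(integB (itgB (I (x + h)) (I x)) (itgZ h (I1 x))).
  by apply: eq_integ => y; rewrite [x - y + h]addrAC; ring.
rewrite mulrCA mulrC -(integZ _ IN).
have mh := itg_meas IK.
have [mg mg1] := (continuous_measurable cg, continuous_measurable cg1).
apply: norm_integ_le; last exact: (itgZ _ IN); first by mfun.
move=> y; rewrite normrM mulrC ler_wpM2r//.
exact: taylor1 dg dg1 g2M.
Qed.

Lemma integ_derive0 f f1 S : 0 < S -> (forall z, is_derive z (1:R) f (f1 z)) -> continuous f1 ->
  (forall x, S < `|x| -> f x = 0) -> itg f1 /\ integ f1 = 0.
Proof.
move=> S0 df cf1 fS.
have f1S x : S < `|x| -> f1 x = 0.
  move=> Sx; have [_ <-] := df x.
  rewrite (@near_eq_derive _ _ _ f (cst 0)); first exact: derive_cst.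
  near=> y; rewrite fS//; near: y.
  exists (`|x| - S); first by rewrite /= subr_gt0.
  move=> y /= xy; have := ler_normD (x - y) y; rewrite subrK.
  by move: xy; clear; lra.
have E x : ind (- (S + 1) <= x <= S + 1) * f1 x = f1 x.
  rewrite -ler_norml; have [_|h] := leP `|x| (S + 1); first by rewrite /ind mul1r.
  by rewrite f1S ?mulr0//; apply: lt_trans h; rewrite ltrDl.
split; first by apply: eq_itg E _; exact: itg_ind_cont.
have S1 : S < `|S + 1| by rewrite gtr0_norm ?addr_gt0// ltrDl.
rewrite -(eq_integ E) (ftc _ df cf1) ?fS ?normrN ?subrr//.
by rewrite -subr_ge0 opprK ltW// addr_gt0// addr_gt0.
Unshelve. all: by end_near. Qed.

Lemma conv_by_parts P P1 eta eta1 x : (forall z, is_derive z (1:R) P (P1 z)) -> continuous P1 ->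
  tf eta -> (forall z, is_derive z (1:R) eta (eta1 z)) -> continuous eta1 ->
  conv P eta1 x = conv P1 eta x.
Proof.
move=> dP cP1 eT de ce1.
have cP : continuous P by move=> z; exact: is_derive_cont (dP z).
have ce := tf_cont eT; have [_ [S S0 eS]] := eT.
have cr (g : R -> R) : continuous g -> continuous (fun y : R => g (x - y)).
  move=> cg y; apply: (@continuous_comp _ _ _ (fun y => x - y) g); last exact: cg.
  by apply: cvgB; [exact: cvg_cst|exact: cvg_id].
have dh y : is_derive y (1:R) (fun y : R => P y * eta (x - y)) (P1 y * eta (x - y) - P y * eta1 (x - y)).
  have H : is_derive y (1:R) (fun y : R => eta (x - y)) (- eta1 (x - y)).
    have := is_derive_comp_affine (-1) x y de.
    rewrite mulN1r mulN1r [_ + x]addrC; congr is_derive.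
    by apply/funext => z; rewrite mulN1r addrC.
  apply: (is_derive_eq (is_deriveM (dP y) H)).
  by rewrite /GRing.scale /=; ring.
have ch : continuous (fun y => P1 y * eta (x - y) - P y * eta1 (x - y)).
  by move=> y; apply: cvgB; apply: cvgM;
    [exact: cP1|exact: (cr eta)|exact: cP|exact: (cr eta1)].
have far T y : T + `|x| < `|y| -> T < `|x - y|.
  by move=> h; have := ler_normB (x - y) x; rewrite addrAC subrr sub0r normrN; move: h; clear; lra.
have hS y : S + `|x| < `|y| -> P y * eta (x - y) = 0.
  by move=> /far /eS ->; rewrite mulr0.
have [I E] := integ_derive0 (ltr_pwDl S0 (normr_ge0 x)) dh ch hS.
have I1 : itg (fun y => P1 y * eta (x - y)).
  apply: eq_itg (itg_ind_cont (- (S + `|x|)) (S + `|x|) (f := fun y => P1 y * eta (x - y)) _).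
    move=> y; rewrite -ler_norml; have [_|h] := leP `|y| (S + `|x|); first by rewrite /ind mul1r.
    by rewrite (eS _ (far _ _ h)) !mulr0.
  by move=> y; apply: cvgM; [exact: cP1|exact: (cr eta)].
apply/eqP; rewrite eq_sym -subr_eq0; apply/eqP; rewrite -[RHS]E /conv -(integB I1)//.
apply: eq_itg (itgB I1 I) => y; ring.
Qed.

End convolution_calculus.

Section smooth_absolute_value.
Context {R : realType} (al : R).
Hypothesis al01 : 0 < al < 1.
Let al0 : 0 < al. Proof. by case/andP: al01. Qed.
Let al1 : al < 1. Proof. by case/andP: al01. Qed.
Implicit Types (P : nat -> R -> R) (x : R).

(** Taking k = 1 and k = -1 treats the two half-lines at once; iterated, it gives all derivatives of
    |x|^al away from the origin. *)
Lemma derive_tail (p p1 : R -> R) (k c b : R) :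
  (forall x, is_derive x (1:R) p (p1 x)) -> (forall x, 1 < k * x -> p x = c * (k * x) `^ b) ->
  forall x, 1 < k * x -> p1 x = c * b * k * (k * x) `^ (b - 1).
Proof.
move=> dp pE x kx; have [_ <-] := dp x.
rewrite (@near_eq_derive _ _ _ p (fun x => c * (k * x) `^ b)); last first.
  near=> y; apply: pE; near: y.
  have : (fun y => k * y) @ x --> k * x by apply: cvgM; [exact: cvg_cst|exact: cvg_id].
  by move=> /cvgr_gt; apply.
have kx0 : 0 < k * x by exact: lt_trans kx.
have H : is_derive x (1:R) (fun y : R => k * y) k.
  have := is_derive_affine k 0 x; congr is_derive.
  by apply/funext => y; rewrite addr0.
have H1 := @is_derive1_comp R (fun y => y `^ b) (fun y : R => k * y) x _ _ (is_derive1_powR b kx0) H.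
have := @is_deriveZ _ _ _ _ c _ _ _ H1 => H2.
rewrite (_ : (fun x => c * _) = c \*: ((fun y => y `^ b) \o (fun y => k * y)))//.
rewrite (derive_val (f := _)) /GRing.scale /=; ring.
Unshelve. all: by end_near. Qed.

(** |x|^al smoothed near 0: x^2 plus a bump is positive everywhere and equals x^2 for |x| >= 1, so
    its power al / 2 is smooth. [P n] is its n-th derivative. *)
Lemma smooth_abs : exists P, [/\ forall n x, is_derive x (1:R) (P n) (P n.+1 x),
    forall x, 1 < `|x| -> P 0%N x = `|x| `^ al &
    forall n, exists2 B, 0 <= B & forall x, `|P n.+1 x| <= B * wt (n.+1%:R - al) x].
Proof.
pose f x : R := (x * x + bump (-1) 1 0 x) `^ (al / 2).
have fpos x : 0 < x * x + bump (-1) 1 0 x.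
  have [x11|x11] := boolP (-1 < x < 1).
    by rewrite ltr_wpDl ?bump_gt0//; rewrite -expr2 sqr_ge0.
  rewrite bump_out// addr0 -expr2 exprn_even_gt0//=.
  by apply/eqP => x0; move: x11; rewrite x0 ltrN10 ltr01.
have sf : smooth f.
  apply/smoothP => n; apply: ndiff_powR => //; apply: ndiffD; last exact: ndiff_bump.
  by apply: ndiffM; exact: ndiff_id.
have dP n x : is_derive x (1:R) (derive1n n f) (derive1n n.+1 f x).
  have := sf n x; rewrite derive1nS derive1E => h; exact: derivableP.
have P0 x : 1 < `|x| -> f x = `|x| `^ al.
  move=> x1; rewrite /f bump_out; last first.
    by rewrite -ltr_norml -leNgt ltW.
  rewrite addr0 -expr2 -real_normK ?num_real// -powR_mulrn// -powRrM.
  by congr (_ `^ _); field.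
exists (fun n => derive1n n f); split => // n.
have T (k : R) m : k != 0 -> `|k| = 1 -> exists c, forall x, 1 < k * x ->
    derive1n m f x = c * (k * x) `^ (al - m%:R).
  move=> k0 k1; elim: m => [|m [c IH]].
    exists 1 => x kx; change (f x = 1 * (k * x) `^ (al - 0)); have nx : `|x| = k * x.
      by rewrite -(gtr0_norm (lt_trans ltr01 kx)) normrM k1 mul1r.
    by rewrite P0 nx ?mul1r ?subr0.
  exists (c * (al - m%:R) * k) => x kx.
  rewrite (derive_tail (dP m) IH kx) -[in RHS]natr1.
  by congr (_ * _ `^ _); ring.
have [c1 H1] := T 1 n.+1 (oner_neq0 _) (normr1 _).
have n1 : -1 != 0 :> R by rewrite oppr_eq0 oner_neq0.
have [c2 H2] := T (-1) n.+1 n1 (normrN1 _).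
have cP : continuous (derive1n n.+1 f) by move=> x; exact: is_derive_cont (dP n.+1 x).
have [M M0 HM] := cont_bounded (-1) 1 cP.
set q := n.+1%:R - al.
have q0 : 0 <= q by rewrite subr_ge0 (le_trans (ltW al1))// ler1n.
exists ((M + `|c1| + `|c2|) * 2 `^ q).
  by rewrite mulr_ge0 ?powR_ge0// !addr_ge0.
have far (c y : R) x : 1 < y -> y = `|x| -> `|c * y `^ (al - n.+1%:R)| <= `|c| * 2 `^ q * wt q x.
  move=> y1 yx; rewrite normrM (ger0_norm (powR_ge0 _ _)) -mulrA ler_wpM2l//.
  rewrite wtE mulrA powRN mulfV ?gt_eqF ?powR_gt0// mul1r -yx -opprB -/q.
  apply: powR_le_neg => //; first by lra.
  by rewrite ler_pdivrMr//; lra.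
have wtpos := mulr_ge0 (powR_ge0 2 q) (wt_ge0 q _).
move=> x; rewrite -mulrA.
have [x1|x1] := ltP 1 (1 * x).
  rewrite H1//; apply: (le_trans (far c1 _ x x1 _)).
    by rewrite gtr0_norm ?mul1r// -[x]mul1r (lt_trans _ x1).
  by rewrite -mulrA ler_wpM2r// -addrA addrCA lerDl addr_ge0.
have [x2|x2] := ltP 1 (-1 * x).
  rewrite H2//; apply: (le_trans (far c2 _ x x2 _)).
    by rewrite ltr0_norm ?mulN1r// -oppr_gt0 -mulN1r (lt_trans _ x2).
  by rewrite -mulrA ler_wpM2r// lerDr addr_ge0.
have x11 : -1 <= x <= 1 by move: x1 x2; rewrite mul1r mulN1r lerNl => -> ->.
apply: (le_trans (HM x x11)).
apply: (@le_trans _ _ ((M + `|c1| + `|c2|) * 1)); first by rewrite mulr1 -addrA lerDl addr_ge0.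
rewrite ler_wpM2l ?addr_ge0//.
rewrite /wt -ler_pdivrMr; last by rewrite powR_gt0// ltr_pwDl.
rewrite mul1r -powRN opprK; apply: powR_le => //.
have xn : `|x| <= 1 by rewrite ler_norml.
by move: xn; clear -al0 al1; lra.
Qed.

End smooth_absolute_value.

(** * Compactly supported approximations of |.|^al * eta'' *)

Section cutoff.
Context {R : realType} (al : R).
Hypothesis al01 : 0 < al < 1.
Let al0 : 0 < al. Proof. by case/andP: al01. Qed.
Let al1 : al < 1. Proof. by case/andP: al01. Qed.
Implicit Types (eta psi g : R -> R) (x k : R).

(** Smoothing at scale k leaves a second derivative of order (k + |x|)^(-(2 - al)), and 2 - al = 1 +
    2 a: one a becomes the rate k^(-a), the other keeps the decay integrable. *)
Let a : R := (1 - al) / 2.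
Let a0 : 0 < a. Proof. by rewrite divr_gt0// subr_gt0. Qed.

(** The left side is (k + |x|)^(-q), and k + |x| is at least both k and 1 + |x|; the exponent q is
    shared between the two. *)
Lemma wt_scale q b k x : 1 <= k -> 0 <= b -> b <= q ->
  k `^ (- q) * wt q (k^-1 * x) <= k `^ (- b) * wt (q - b) x.
Proof.
move=> k1 b0 bq; have k0 : 0 < k by exact: lt_le_trans k1.
have kx : 0 < k + `|x| by rewrite ltr_pwDl.
have -> : k `^ (- q) * wt q (k^-1 * x) = (k + `|x|) `^ (- q).
  rewrite /wt normrM gtr0_norm ?invr_gt0// -powRM ?(ltW k0)//.
    by rewrite mulrDr mulr1 mulrA mulfV ?mul1r// lt0r_neq0.
  by rewrite addr_ge0// mulr_ge0// invr_ge0 ltW.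
have -> : - q = - b + - (q - b) by ring.
rewrite powRD; last by rewrite (gt_eqF kx) implybT.
rewrite ler_pM ?powR_ge0//; apply: powR_le_neg => //.
- by rewrite lerDl.
- by rewrite subr_ge0.
- by rewrite lerD2r.
Qed.

Lemma one_powR (q : R) : 1 `^ q = 1.
Proof. by rewrite powR1. Qed.

Lemma wt_le1 q x : 0 <= q -> wt q x <= 1.
Proof.
by move=> q0; rewrite /wt -[leRHS](one_powR (- q)); apply: powR_le_neg => //; rewrite lerDl.
Qed.

Lemma is_derive_unique (f f1 f2 : R -> R) : (forall x, is_derive x (1:R) f (f1 x)) ->
  (forall x, is_derive x (1:R) f (f2 x)) -> f1 = f2.
Proof.
move=> d1 d2; apply/funext => x.
by rewrite -(@derive_val _ _ _ _ _ _ _ (d1 x)) (@derive_val _ _ _ _ _ _ _ (d2 x)).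
Qed.

(** k^al P (x / k) is |x|^al smoothed inside radius k. The second and fourth derivatives are bounded
    because they become, after convolution, the function and its second derivative in [decays]; B
    does not depend on k. *)
Lemma smooth_abs_scaled : exists2 B, 0 <= B & forall k, 1 <= k -> exists P : nat -> R -> R,
  [/\ forall n x, is_derive x (1:R) (P n) (P n.+1 x),
      forall x, k < `|x| -> P 0%N x = `|x| `^ al,
      forall n, exists2 M, 0 <= M & forall x, `|P n.+1 x| <= M,
      forall x, `|P 2%N x| <= B * k `^ (- a) * wt (1 + a) x &
      forall x, `|P 4%N x| <= B * k `^ (- a) * wt 3 x].
Proof.
have [P [dP P0 PB]] := smooth_abs al01.
have [B2 B20 H2] := PB 1%N; have [B4 B40 H4] := PB 3%N.
exists (B2 + B4); first exact: addr_ge0.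
move=> k k1; have k0 : 0 < k by exact: lt_le_trans k1.
have kn := lt0r_neq0 k0.
have kq (n : nat) : k `^ al * k^-1 ^+ n = k `^ (- (n%:R - al)).
  rewrite opprB powRD; last by rewrite kn implybT.
  by rewrite powRN powR_mulrn ?(ltW k0)// exprVn.
exists (fun n x => k `^ al * k^-1 ^+ n * P n (k^-1 * x)); split.
- move=> n x.
  have := is_derive_comp_affine k^-1 0 x (dP n) => H.
  have := @is_deriveZ _ _ _ _ (k `^ al * k^-1 ^+ n) _ _ _ H => {H}.
  rewrite addr0 (_ : _ *: (_ * _) = k `^ al * k^-1 ^+ n.+1 * P n.+1 (k^-1 * x)).
    by congr is_derive; apply/funext => y; rewrite /GRing.scale /= addr0.
  by rewrite /GRing.scale /= exprS; ring.
- move=> x kx; rewrite expr0 mulr1 P0.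
    rewrite normrM -powRM ?(ltW k0)// gtr0_norm ?invr_gt0// mulrA mulfV ?mul1r//.
  by rewrite normrM gtr0_norm ?invr_gt0// -ltr_pdivrMl ?invr_gt0// invrK mulr1.
- move=> n; have [B B0 H] := PB n.
  exists (k `^ (- (n.+1%:R - al)) * B) => [|x]; first by rewrite mulr_ge0 ?powR_ge0.
  rewrite normrM kq (ger0_norm (powR_ge0 _ _)) ler_wpM2l ?powR_ge0//.
  apply: (le_trans (H _)); rewrite ler_piMr//; apply: wt_le1.
  by rewrite subr_ge0 (le_trans (ltW al1))// ler1n.
- move=> x; rewrite normrM kq (ger0_norm (powR_ge0 _ _)).
  apply: (le_trans (ler_wpM2l (powR_ge0 _ _) (H2 _))).
  rewrite mulrCA -[leRHS]mulrA; apply: ler_pM => //.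
  + by rewrite mulr_ge0 ?powR_ge0 ?wt_ge0.
  + by rewrite lerDl.
  have -> : 1 + a = 2 - al - a by rewrite /a; field.
  have a2 : a <= 2 - al by rewrite /a; move: al0 al1 => ? ?; lra.
  by apply: wt_scale => //; exact: ltW.
- move=> x; rewrite normrM kq (ger0_norm (powR_ge0 _ _)).
  apply: (le_trans (ler_wpM2l (powR_ge0 _ _) (H4 _))).
  rewrite mulrCA -[leRHS]mulrA; apply: ler_pM => //.
  + by rewrite mulr_ge0 ?powR_ge0 ?wt_ge0.
  + by rewrite lerDr.
  apply: (@le_trans _ _ (k `^ (- (1 - al)) * wt (4%:R - al - (1 - al)) x)).
    by apply: wt_scale; rewrite // ?subr_ge0 ?lerD2r ?ler1n// ltW.
  rewrite (_ : 4 - al - (1 - al) = 3); last by ring.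
  rewrite ler_wpM2r ?wt_ge0// ler_powR// lerN2 /a; move: al1 => ?; lra.
Qed.

Lemma ndiff_conv n K psi : itg K -> tf psi -> ndiff n (conv K psi).
Proof.
move=> IK; elim: n psi => //= n IH psi pT.
have [p1 dp p1T] := tf_derive pT; have [p2 dp1 p2T] := tf_derive p1T.
have bd f : tf f -> exists2 M, 0 <= M & forall x, `|f x| <= M.
  move=> fT; have [B B0 dB] := tf_decays fT; exists B => // x.
  exact: decays_bounded dB x.
have [M0 M00 H0] := bd _ pT; have [M1 M10 H1] := bd _ p1T; have [M2 M20 H2] := bd _ p2T.
exists (conv K p1); last exact: IH.
move=> x; apply: (is_derive_conv (M := M0 + M1 + M2) x IK dp dp1) => z.
- by apply: (le_trans (H0 z)); rewrite -addrA lerDl addr_ge0.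
- by apply: (le_trans (H1 z)); rewrite addrAC lerDr addr_ge0.
- by apply: (le_trans (H2 z)); rewrite lerDr addr_ge0.
Qed.

Lemma tf_conv K psi S : itg K -> (forall x, S < `|x| -> K x = 0) -> tf psi -> tf (conv K psi).
Proof.
move=> IK KS pT; split => [n|]; first exact: ndiff_conv.
have [_ [T T0 pS]] := pT.
exists (T + `|S|); first by rewrite ltr_pwDl.
move=> x xTS; rewrite -[RHS](integ0 (R := R)); apply: eq_integ => y.
have [yS|yS] := ltP S `|y|; first by rewrite KS ?mul0r.
rewrite pS ?mulr0//; have := ler_normD (x - y) y; rewrite subrK.
by move: yS xTS (ler_norm S); clear -al0 al1 a0; lra.
Qed.

Lemma conv_sym f psi x : itg (fun y => f y * psi (x - y)) -> conv f psi x = conv psi f x.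
Proof.
move=> I; rewrite /conv -(integ_refl x I); apply: eq_integ => y.
by rewrite subKr mulrC.
Qed.

(** Convolution with a test function keeps the decay: 1 + |x| <= (1 + |y|) (1 + |x - y|) costs q
    powers of 1 + |y|, and psi has two more to stay integrable. *)
Lemma wt_conv q psi : 0 <= q -> tf psi -> exists2 C, 0 <= C &
  forall g B x, measurable_fun setT g -> (forall x, `|g x| <= B * wt q x) ->
   itg (fun y => psi y * g (x - y)) /\ `|conv psi g x| <= C * B * wt q x.
Proof.
move=> q0 pT; have q2 : 0 <= q + 2 by exact: addr_ge0.
have [A A0 pA] := tf_wt q2 pT.
have I2 : itg (wt 2 : R -> R) by apply: itg_wt; rewrite ltr1n.
exists (A * integ (wt 2)); first by rewrite mulr_ge0// integ_ge0// => x; exact: wt_ge0.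
move=> g B x mg gB; have B0 := wt_bound_ge0 gB.
have bnd y : `|psi y * g (x - y)| <= A * B * wt q x * wt 2 y.
  rewrite normrM; apply: (le_trans (ler_pM (normr_ge0 _) (normr_ge0 _) (pA y) (gB _))).
  have -> : A * B * wt q x * wt 2 y = A * B * (wt q x * wt 2 y) by rewrite -mulrA.
  rewrite mulrACA ler_wpM2l ?mulr_ge0//.
  rewrite [leRHS]mulrC /wt opprD powRD; last first.
    by apply/implyP => _; rewrite lt0r_neq0// ltr_pwDl.
  rewrite [X in X * _ <= _]mulrC -mulrA ler_wpM2l ?powR_ge0//.
  rewrite -powRM; [|by rewrite addr_ge0|by rewrite addr_ge0].
  apply: powR_le_neg => //.
  have := ler_normD y (x - y); rewrite addrC subrK.
  by move: (mulr_ge0 (normr_ge0 y) (normr_ge0 (x - y))); clear -al0 al1 a0; lra.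
have mp := itg_meas (tf_itg pT).
have m : measurable_fun setT (fun y => psi y * g (x - y)) by mfun.
split; first by apply: (itg_le m bnd); exact: itgZ.
rewrite (_ : A * _ * B * _ = integ (fun y => A * B * wt q x * wt 2 y)).
  by apply: norm_integ_le => //; exact: itgZ.
by rewrite (integZ _ I2); ring.
Qed.

Lemma fl_le g B K x : (forall x, itg (fun t => `|sd g x t| * `|t| `^ (- (2 + al))) /\
    integ (fun t => `|sd g x t| * `|t| `^ (- (2 + al))) <= K * B * wt (2 + al) x) ->
  continuous g -> `|fl al g x| <= K * B * wt (2 + al) x.
Proof.
move=> H cg; have [I I1] := H x.
rewrite /fl normrM ger0_norm ?invr_ge0// ler_pdivrMl//.
have mg := continuous_measurable cg; have ms := sd_meas x mg.
apply: (@le_trans _ _ (integ (fun t => `|sd g x t| * `|t| `^ (- (2 + al))))).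
  apply: norm_integ_le => //; first by mfun.
  by move=> t; rewrite normrM normrN (ger0_norm (powR_ge0 _ _)).
apply: (le_trans I1); rewrite ler_peMl ?ler1n//.
exact: le_trans (integ_ge0 _) I1.
Qed.

(** |.|^al * eta2 is not compactly supported. Replacing |.|^al by its difference with the smoothing
    at scale k gives a test function, and the error is eta convolved with the second derivative of
    the smoothing. That error is small uniformly, and its [fl] is small relative to the weight
    against which elements of the solution space are integrable. *)
Lemma truncation eta eta1 eta2 : tf eta -> (forall x, is_derive x (1:R) eta (eta1 x)) ->
  (forall x, is_derive x (1:R) eta1 (eta2 x)) -> exists2 C, 0 <= C &
  forall k, 1 <= k -> exists theta, [/\ tf theta,
    forall x, `|theta x - conv (absal al) eta2 x| <= C * k `^ (- a) &
    forall x, `|fl al theta x + integ (kerP al) * eta2 x| <= C * k `^ (- a) * wt (2 + al) x].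
Proof.
move=> eT de de1.
have e1T : tf eta1 by have [f df fT] := tf_derive eT; rewrite (is_derive_unique de df).
have e2T : tf eta2 by have [f df fT] := tf_derive e1T; rewrite (is_derive_unique de1 df).
have [B B0 HB] := smooth_abs_scaled.
have a1 : 0 <= 1 + a by rewrite addr_ge0// ltW.
have [C1 C10 W1] := wt_conv a1 eT.
have [C2 C20 W2] := wt_conv (ler0n R 3) eT.
have [K K0 HK] := Dabs_bound al01 a0.
exists (C1 * B + K * ((C1 + C2) * B)).
  by rewrite addr_ge0 ?mulr_ge0 ?addr_ge0// ltW.
move=> k k1; have [P [dP P0 PM P2 P4]] := HB k k1.
have cP n : continuous (P n) by move=> x; exact: is_derive_cont (dP n x).
have mP n := continuous_measurable (cP n).
have cA := absal_continuous al01.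
pose Phi x := absal al x - P 0%N x.
have cPhi : continuous Phi by move=> x; apply: cvgB; [exact: cA|exact: cP].
have PhiS x : k < `|x| -> Phi x = 0 by move=> kx; rewrite /Phi P0// subrr.
have IPhi : itg Phi.
  apply: eq_itg (itg_ind_cont (- k) k cPhi) => x; rewrite -ler_norml.
  by have [_|/PhiS ->] := leP `|x| k; rewrite /ind ?mul1r ?mulr0.
have [B2 B20 de2] := tf_decays e2T.
have gP0 : exists G, growth al G (P 0%N).
  have [M M0 HM] := cont_bounded (- k) k (cP 0).
  exists (M + 1); split => // x.
  have [xk|kx] := leP `|x| k.
    rewrite ler_norml in xk; apply: (le_trans (HM x xk)).
    rewrite -[leLHS]mulr1 ler_pM// ?lerDl//.
    by rewrite -[leLHS](one_powR al); apply: powR_le => //; [exact: ltW|rewrite lerDl].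
  rewrite P0// ger0_norm ?powR_ge0// -[leLHS]mul1r ler_pM ?powR_ge0// ?lerDr//.
  by apply: powR_le => //; [exact: ltW|rewrite lerDr].
have {gP0} [G gP0] := gP0.
have gA := growth_absal al01.
have ce1 := tf_cont e1T; have ce2 := tf_cont e2T.
(* Two integrations by parts: this is where testing with a second derivative pays, as the growing
   smoothing is replaced by its decaying second derivative. *)
have E0 x : conv (P 0%N) eta2 x = conv eta (P 2%N) x.
  rewrite (conv_by_parts x (dP 0%N) (cP 1%N) e1T de1 ce2).
  rewrite (conv_by_parts x (dP 1%N) (cP 2%N) eT de ce1) conv_sym//.
  have [I _] := W1 _ _ x (mP 2%N) P2.
  by apply: eq_itg (itg_refl x I) => y; rewrite subKr mulrC.
have Etheta x : conv Phi eta2 x = conv (absal al) eta2 x - conv eta (P 2%N) x.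
  have eB := decays_bounded (ltr0Sn R 1) de2.
  have m2 := continuous_measurable ce2.
  have [f1 [f2 [_ _ fB _]]] := de2.
  have q3 : 1 + al < 1 + 2 by rewrite ltrD2l (lt_trans al1)// ltr1n.
  have IA := itg_growth x (ltW al0) q3 gA m2 fB.
  have IP := itg_growth x (ltW al0) q3 gP0 m2 fB.
  rewrite -E0 /conv -(integB IA IP); apply: eq_integ => y; rewrite /Phi; ring.
have kb : 0 <= k `^ (- a) by exact: powR_ge0.
have dg : decays ((C1 + C2) * (B * k `^ (- a))) a (conv eta (P 2%N)).
  have [M2 M20 H2] := PM 1%N; have [M3 M30 H3] := PM 2%N.
  have [M4 M40 H4] := PM 3%N; have [M5 M50 H5] := PM 4%N.
  pose M := M2 + M3 + M4 + M5.
  have Ieta := tf_itg eT.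
  exists (conv eta (P 3%N)), (conv eta (P 4%N)); split => x.
  - apply: (is_derive_conv (M := M) x Ieta (dP 2%N) (dP 3%N)) => z; rewrite /M.
    + by apply: (le_trans (H2 z)); move: M30 M40 M50; clear -al0 al1 a0; lra.
    + by apply: (le_trans (H3 z)); move: M20 M40 M50; clear -al0 al1 a0; lra.
    + by apply: (le_trans (H4 z)); move: M20 M30 M50; clear -al0 al1 a0; lra.
  - apply: (is_derive_conv (M := M) x Ieta (dP 3%N) (dP 4%N)) => z; rewrite /M.
    + by apply: (le_trans (H3 z)); move: M20 M40 M50; clear -al0 al1 a0; lra.
    + by apply: (le_trans (H4 z)); move: M20 M30 M50; clear -al0 al1 a0; lra.
    + by apply: (le_trans (H5 z)); move: M20 M30 M40; clear -al0 al1 a0; lra.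
  - have [_ h] := W1 _ _ x (mP 2%N) P2; apply: (le_trans h).
    by rewrite ler_wpM2r ?wt_ge0// ler_wpM2r ?mulr_ge0// lerDl.
  - have [_ h] := W2 _ _ x (mP 4%N) P4; apply: (le_trans h).
    by rewrite ler_wpM2r ?wt_ge0// ler_wpM2r ?mulr_ge0// lerDr.
exists (conv Phi eta2); split; first exact: tf_conv PhiS e2T.
- move=> x; rewrite Etheta addrAC subrr add0r normrN.
  have [_ h] := W1 _ _ x (mP 2%N) P2; apply: (le_trans h).
  apply: (@le_trans _ _ (C1 * (B * k `^ (- a)) * 1)).
    by rewrite ler_wpM2l ?mulr_ge0//; apply: wt_le1.
  rewrite mulr1 mulrA ler_wpM2r// lerDl !mulr_ge0 ?addr_ge0//; exact: ltW.
- move=> x.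
  have [_ _ IA] := fl_conv x al01 gA de2.
  have [_ _ IP] := fl_conv x al01 gP0 de2.
  have -> : fl al (conv Phi eta2) x + integ (kerP al) * eta2 x = - fl al (conv eta (P 2%N)) x.
    have EA := fl_conv_absal al01 x e2T.
    have -> : integ (kerP al) * eta2 x = - fl al (conv (absal al) eta2) x.
      by rewrite EA mulNr opprK.
    have EP : conv (P 0%N) eta2 = conv eta (P 2%N) by apply/funext.
    have IN g : itg (fun t => sd g x t * `|t| `^ (- (2 + al))) ->
        itg (fun t => - sd g x t * `|t| `^ (- (2 + al))).
      by move=> /itgN; apply: eq_itg => t; rewrite mulNr.
    have [IA' IP'] := (IN _ IA, IN _ IP).
    have key : integ (fun t => - sd (conv Phi eta2) x t * `|t| `^ (- (2 + al))) =
        integ (fun t => - sd (conv (absal al) eta2) x t * `|t| `^ (- (2 + al))) -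
        integ (fun t => - sd (conv (P 0%N) eta2) x t * `|t| `^ (- (2 + al))).
      rewrite -(integB IA' IP'); apply: eq_integ => t; rewrite /sd !Etheta !E0; ring.
    rewrite -EP.
    rewrite /fl key.
    by move: (integ _) (integ _) => b c; rewrite mulrBr addrAC subrr add0r.
  rewrite normrN; apply: (le_trans (fl_le x (HK _ _ dg) (decays_cont dg))).
  rewrite ler_wpM2r ?wt_ge0// mulrA mulrA ler_wpM2r//.
  by rewrite mulrA lerDr mulr_ge0.
Qed.

End cutoff.

(** * Weak solutions of w'' = 0 *)

Section distributions.
Context {R : realType}.
Implicit Types (f g w eta psi : R -> R) (x y z a b : R).
Local Notation mu := (@lebesgue_measure R).

Lemma integ_gt0 f a b : itg f -> (forall x, 0 <= f x) -> a < b ->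
  (forall x, a < x < b -> 0 < f x) -> 0 < integ f.
Proof.
move=> If f0 ab fab; rewrite lt_neqAle integ_ge0 ?andbT//.
apply/eqP => I0.
have [N [mN N0 subN]] := integ_eq0 If f0 (esym I0).
have mI : measurable (`]a, b[%classic : set (measurableTypeR R)) by exact: measurable_itv.
have : (mu `]a, b[%classic <= mu N)%E.
  apply: le_measure; rewrite ?inE//.
  move=> y; rewrite /= in_itv/= => yab; apply: subN => /= H.
  by have := fab _ yab; rewrite H ltxx.
rewrite N0 lebesgue_measure_itv/= lte_fin ab -EFinB lee_fin leNgt subr_gt0 ab//.
Qed.

Lemma tf_antiderivative psi : tf psi -> integ psi = 0 ->
  exists2 eta, tf eta & forall x, is_derive x (1:R) eta (psi x).
Proof.
move=> pT p0; have Ip := tf_itg pT; have cp := tf_cont pT.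
have [np [S S0 pS]] := pT.
pose F x := \int[mu]_(t in [set` `]-oo, x]]) psi t.
have dF x : is_derive x (1:R) F (psi x).
  have IU : mu.-integrable [set` `]-oo, x + 1]] (EFin \o psi).
    by apply: integrableS Ip => //; exact: measurable_itv.
  have xx : x < x + 1 by rewrite ltrDl.
  have [] := @continuous_FTC1 R psi -oo%O x (x + 1) xx IU (ltNyr _) (cp x).
  rewrite derive1E => d1 d2; rewrite -d2; exact: derivableP.
exists F => //; split; first by case=> // n; exists psi.
have E x : F x = integ (fun t => ind (t <= x) * psi t).
  symmetry; apply: (@integ_ind R [set` `]-oo, x]] (fun t => t <= x)) => t.
  by rewrite /= in_itv.
exists S => // x; have [x0|x0] := leP 0 x.
  rewrite ger0_norm// => Sx; rewrite E -p0; apply: eq_integ => t.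
  have [_|xt] := leP t x; first by rewrite /ind mul1r.
  rewrite pS ?mulr0//; apply: lt_trans Sx _.
  by apply: lt_le_trans xt _; exact: ler_norm.
rewrite ltr0_norm// => Sx; rewrite E -[RHS](integ0 (R := R)); apply: eq_integ => t.
have [tx|_] := leP t x; last by rewrite /ind mul0r.
rewrite pS ?mulr0//; apply: (lt_le_trans Sx); rewrite -normrN.
by apply: le_trans _ (ler_norm _); rewrite lerN2.
Qed.

(** Subtracting from psi the multiple of one fixed bump with the same integral leaves a test
    function of mean zero, which is the derivative of a test function. *)
Lemma du_bois_reymond (L : (R -> R) -> R) :
  (forall f g c, tf f -> tf g -> L (fun x => f x + c * g x) = L f + c * L g) ->
  (forall eta eta1, tf eta -> (forall x, is_derive x (1:R) eta (eta1 x)) -> tf eta1 ->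
    L eta1 = 0) ->
  exists k, forall psi, tf psi -> L psi = k * integ psi.
Proof.
move=> lL L0; pose rho := bump (0:R) 1 0.
have rT : tf rho by exact: tf_bump.
have rpos : 0 < integ rho.
  apply: (integ_gt0 (tf_itg rT) _ (@ltr01 R)).
    by move=> x; have /andP[] := bump_bounds 0 1 0 x.
  by move=> x; exact: bump_gt0.
exists (L rho / integ rho) => psi pT.
set c := - (integ psi / integ rho).
have qT : tf (fun x => psi x + c * rho x) by apply: tfD => //; exact: tfZ.
have q0 : integ (fun x => psi x + c * rho x) = 0.
  rewrite (integD (tf_itg pT) (itgZ c (tf_itg rT))) (integZ _ (tf_itg rT)) /c.
  by rewrite mulNr mulfVK ?subrr// gt_eqF.
have [eta eT de] := tf_antiderivative qT q0.
have := L0 _ _ eT de qT; rewrite (lL _ _ _ pT rT) => /eqP.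
rewrite addr_eq0 /c mulNr opprK => /eqP ->; ring.
Qed.

Lemma ae_and (P Q : R -> Prop) : {ae mu, forall x, P x} -> {ae mu, forall x, Q x} ->
  {ae mu, forall x, P x /\ Q x}.
Proof. exact: (@filterI _ _ (ae_filter_ringOfSetsType mu)). Qed.

(** The positive and negative parts of w have equal integrals over intervals, hence against every
    nonnegative function. Against the indicator of {w > 0} one integral is that of the positive part
    and the other is 0. *)
Lemma ae_le0 w : measurable_fun setT w ->
  (forall c d, itg (fun x => ind (c < x <= d) * w x) /\
     integ (fun x => ind (c < x <= d) * w x) = 0) -> {ae mu, forall x, w x <= 0}.
Proof.
move=> mw H; pose p x := Num.max (w x) 0; pose q x := Num.max (- w x) 0.
have mp : measurable_fun setT p by apply: measurable_maxr.
have mq : measurable_fun setT q by apply: measurable_maxr => //; exact: (measurableT_comp (@oppr_measurable _ _) mw).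
have p0 x : 0 <= p x by rewrite le_max lexx orbT.
have q0 x : 0 <= q x by rewrite le_max lexx orbT.
have pqE x : w x = p x - q x.
  rewrite /p /q; have [w0|w0] := leP (w x) 0.
    by rewrite max_l ?oppr_ge0// sub0r opprK.
  by rewrite max_r ?subr0// oppr_le0 ltW.
have mi c d : measurable_fun setT (fun x : R => ind (c < x <= d) : R) by mfun.
have Ipq c d (r : R -> R) : measurable_fun setT r -> (forall x, `|r x| <= `|w x|) ->
    itg (fun x => ind (c < x <= d) * r x).
  move=> mr rw; have [I _] := H c d; apply: (itg_le _ _ (itg_norm I)); first by mfun.
  by move=> x; rewrite !normrM ler_wpM2l.
have Ip c d : itg (fun x => ind (c < x <= d) * p x).
  apply: Ipq => // x; rewrite ger0_norm// /p ge_max normr_ge0 ler_norm//.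
have Iq c d : itg (fun x => ind (c < x <= d) * q x).
  apply: Ipq => // x; rewrite ger0_norm// /q ge_max normr_ge0 -normrN ler_norm//.
have conv_int c d (r : R -> R) : itg (fun x => ind (c < x <= d) * r x) ->
    (\int[mu]_(x in `]c, d]) (r x)%:E)%E = (integ (fun x => ind (c < x <= d) * r x))%:E.
  move=> Ir; rewrite -(EFin_integ Ir) [LHS]integral_mkcond; apply: eq_integral => x _.
  rewrite patchE; case: ifPn => [|]; first by rewrite inE /= in_itv /= => ->; rewrite /ind mul1r.
  by rewrite notin_setE /= in_itv /= => /negP/negbTE ->; rewrite /ind mul0r.
have E : (\int[mu]_x (p x)%:E = 0)%E.
  have wp x : ind (0 < w x) * p x = p x.
    rewrite /p; have [w0|w0] := leP (w x) 0; first by rewrite mulr0.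
    by rewrite /ind mul1r.
  under eq_integral do rewrite -wp.
  have := @change_of_variables R id p q (@measurable_id _ _ _) p0 mp q0 mq _ _ (fun x => ind (0 < w x)).
  move=> ->.
  - rewrite -[RHS](integral0 mu setT); apply: eq_integral => x _; rewrite /q.
    have [w0|w0] := leP (w x) 0; first by rewrite /ind mul0r.
    by rewrite max_r ?mulr0// oppr_le0 ltW.
  - move=> c d cd; rewrite preimage_id !conv_int//; congr EFin.
    have [_ h] := H c d; apply/eqP; rewrite -subr_eq0 -(integB (Ip c d) (Iq c d)) -h.
    by apply/eqP; apply: eq_integ => x; rewrite pqE mulrBr.
  - by move=> c d; rewrite conv_int ?ltry.
  - by apply: measurable_ind; apply: measurable_fun_ltr.
  - by move=> x; exact: ind_ge0.
have Ip0 : itg p by apply/itg_ge0P => //; rewrite E ltry.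
apply: ae_imp (integ_eq0 Ip0 p0 _) => [x|].
  by move=> <-; rewrite /p le_max lexx.
by apply: EFin_inj; rewrite -(EFin_integ Ip0) E.
Qed.

Lemma weak_zero w : measurable_fun setT w -> (forall eta, tf eta -> itg (fun x => w x * eta x)) ->
  (forall a b, itg (fun x => ind (a < x < b) * w x)) ->
  (forall eta, tf eta -> integ (fun x => w x * eta x) = 0) -> {ae mu, forall x, w x = 0}.
Proof.
move=> mw Iw Ib w0.
have i0 a b : integ (fun x => ind (a < x < b) * w x) = 0.
  have mb n : measurable_fun setT (fun x => bump a b n x * w x).
    by apply: measurable_funM => //; apply: continuous_measurable; apply: tf_cont; exact: tf_bump.
  have [] := @dct R (fun n x => bump a b n x * w x) (fun x => ind (a < x < b) * w x)
      (fun x => `|ind (a < x < b) * w x|) mb.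
  - by have := itg_meas (Ib a b).
  - by move=> x; apply: cvgM; [exact: cvg_bump|exact: cvg_cst].
  - move=> n x; rewrite normrM [leRHS]normrM; apply: ler_wpM2r => //.
    have [h|h] := boolP (a < x < b); last by rewrite bump_out// normr0.
    by rewrite /ind normr1; have /andP[h1 h2] := bump_bounds a b n x; rewrite ger0_norm.
  - exact: itg_norm.
  move=> _; rewrite (_ : (fun n => _) = fun=> 0).
    by move=> /(cvg_unique _ (cvg_cst _)) ->.
  apply/funext => n; rewrite -(w0 (bump a b n)); last exact: tf_bump.
  by apply: eq_integ => x; rewrite mulrC.
have i1 c d : integ (fun x => ind (c < x <= d) * w x) = 0.
  rewrite -(i0 c d); apply: ae_eq_integ.
  - by mfun.
  - by have := itg_meas (Ib c d).
  exists [set d]; split; [exact: measurable_set1|exact: lebesgue_measure_set1|].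
  have E (x : R) : x != d -> ind (c < x <= d) * w x = ind (c < x < d) * w x.
    by move=> xd; rewrite [x < d]lt_neqAle xd.
  by move=> x /= H; apply/eqP; apply: contra_notT H; exact: E.
have Ii c d : itg (fun x => ind (c < x <= d) * w x).
  apply: (itg_le _ _ (itg_norm (Ib c (d + 1)))); first by mfun.
  move=> x; rewrite normrM [leRHS]normrM ler_wpM2r// !ger0_norm ?ind_ge0//.
  rewrite /ind ler_nat; case: (boolP (c < x <= d)) => // /andP[-> xd] /=.
  by rewrite (le_lt_trans xd)// ltrDl.
have wN : {ae mu, forall x, - w x <= 0}.
  apply: ae_le0 => [|c d]; first exact: (measurableT_comp (@oppr_measurable _ _) mw).
  have E : (fun x => - (ind (c < x <= d) * w x)) =1 (fun x => ind (c < x <= d) * - w x).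
    by move=> x; rewrite mulrN.
  split; first exact: eq_itg E (itgN (Ii c d)).
  by rewrite -(eq_integ E) (integN (Ii c d)) i1 oppr0.
have wP : {ae mu, forall x, w x <= 0} by apply: ae_le0 => // c d; split.
apply: ae_imp (ae_and wN wP) => x [w1 w2]; apply/eqP; rewrite eq_le w2 /=.
by rewrite -oppr_le0.
Qed.

(** Du Bois-Reymond twice: applied to psi -> int w psi' it gives w' = -k weakly, and applied to w +
    k x it gives a constant b. *)
Lemma weak_affine w : measurable_fun setT w -> (forall n : nat, itg (fun x => ind (`|x| <= n%:R) * w x)) ->
  (forall eta eta1 eta2, tf eta -> (forall x, is_derive x (1:R) eta (eta1 x)) -> tf eta1 ->
    (forall x, is_derive x (1:R) eta1 (eta2 x)) -> tf eta2 -> integ (fun x => w x * eta2 x) = 0) ->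
  exists k b, {ae mu, forall x, w x = k * x + b}.
Proof.
move=> mw Iw w0.
have Itf v eta : measurable_fun setT v -> (forall n : nat, itg (fun x : R => ind (`|x| <= n%:R) * v x)) ->
    tf eta -> itg (fun x => v x * eta x).
  move=> mv Iv eT; have [B B0 dB] := tf_decays eT; have [_ [S S0 eS]] := eT.
  have me := itg_meas (tf_itg eT).
  pose n := (Num.truncn S).+1.
  have Sn : S <= n%:R by apply: ltW; exact: truncnS_gt.
  apply: (itg_le _ _ (itgZ B (itg_norm (Iv n)))); first by mfun.
  move=> x; rewrite normrM mulrC [`|ind _ * _|]normrM mulrA ler_wpM2r//.
  have [xn|nx] := leP `|x| n%:R; last by rewrite eS ?normr0 ?mulr_ge0//; apply: le_lt_trans nx.
  by rewrite /ind normr1 mulr1; exact: (decays_bounded _ dB).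
have Iid (n : nat) : itg (fun x : R => ind (`|x| <= n%:R) * x).
  apply: (itg_le _ _ (itg_ind_bdd n%:R (ler0n R n))); first by mfun.
  move=> x; rewrite normrM ger0_norm ?ind_ge0//.
  by have [xn|nx] := leP `|x| n%:R; rewrite /ind ?mul1r ?mul0r.
have L_lin v : measurable_fun setT v -> (forall n : nat, itg (fun x : R => ind (`|x| <= n%:R) * v x)) ->
    forall f g c, tf f -> tf g -> integ (fun x => v x * (f x + c * g x)) =
    integ (fun x => v x * f x) + c * integ (fun x => v x * g x).
  move=> mv Iv f g c fT gT; have [I1 I2] := (Itf v f mv Iv fT, Itf v g mv Iv gT).
  rewrite -(integZ c I2) -(integD I1 (itgZ c I2)); apply: eq_integ => x; ring.
have dE (f f1 : R -> R) : (forall x, is_derive x (1:R) f (f1 x)) -> derive1 f = f1.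
  by move=> df; apply/funext => x; rewrite derive1E (@derive_val _ _ _ _ _ _ _ (df x)).
have [k Hk] : exists k, forall psi, tf psi ->
    integ (fun x => w x * derive1 psi x) = k * integ psi.
  apply: du_bois_reymond => [f g c fT gT|eta eta1 eT de e1T].
    have [f1 df f1T] := tf_derive fT; have [g1 dg g1T] := tf_derive gT.
    have d x : is_derive x (1:R) (fun x => f x + c * g x) (f1 x + c * g1 x).
      exact: (is_deriveD (df x) (is_deriveZ c (dg x))).
    by rewrite (dE _ _ d) (dE _ _ df) (dE _ _ dg) L_lin.
  have [eta2 de1 e2T] := tf_derive e1T.
  by rewrite (dE _ _ de1); exact: w0 eT de e1T de1 e2T.
have m1 : measurable_fun setT (fun x => w x + k * x) by mfun.
have I1 (n : nat) : itg (fun x : R => ind (`|x| <= n%:R) * (w x + k * x)).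
  apply: eq_itg (itgD (Iw n) (itgZ k (Iid n))) => x; ring.
have [b Hb] : exists b, forall psi, tf psi -> integ (fun x => (w x + k * x) * psi x) = b * integ psi.
  apply: du_bois_reymond => [f g c fT gT|eta eta1 eT de e1T]; first exact: L_lin.
  have Ix := Itf id _ (@measurable_id _ _ _) Iid e1T.
  have Iw1 := Itf w _ mw Iw e1T.
  rewrite (_ : (fun x => _) = (fun x => w x * eta1 x + k * (x * eta1 x))); last first.
    by apply/funext => x; ring.
  rewrite (integD Iw1 (itgZ k Ix)) (integZ k Ix).
  have := Hk _ eT; rewrite (dE _ _ de) => ->; rewrite -mulrDr.
  have [_ [S S0 eS]] := eT.
  have d x : is_derive x (1:R) (fun x => x * eta x) (eta x + x * eta1 x).
    apply: (is_derive_eq (is_deriveM (is_derive_id x 1) (de x))).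
    by rewrite /GRing.scale /= mulr1 addrC.
  have c1 : continuous (fun x => eta x + x * eta1 x).
    by move=> x; apply: cvgD; [exact: tf_cont|apply: cvgM; [exact: cvg_id|exact: tf_cont]].
  have [|_ E] := integ_derive0 S0 d c1 _; first by move=> x /eS ->; rewrite mulr0.
  by rewrite -(integD (tf_itg eT) Ix) E mulr0.
exists (- k), b.
have m2 : measurable_fun setT (fun x => w x + k * x - b) by mfun.
have I2 (n : nat) : itg (fun x : R => ind (`|x| <= n%:R) * (w x + k * x - b)).
  apply: eq_itg (itgB (I1 n) (itg_ind_bdd b (ler0n R n))) => x; ring.
apply: (ae_imp _ (weak_zero m2 _ _ _)).
- move=> x h; apply/eqP; rewrite -subr_eq0 -[X in _ == X]h; apply/eqP; ring.
- by move=> eta; exact: Itf.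
- move=> c d; pose n := (Num.truncn (Num.max `|c| `|d|)).+1.
  apply: (itg_le _ _ (itg_norm (I2 n))); first by mfun.
  move=> x; rewrite normrM [leRHS]normrM ler_wpM2r// !(ger0_norm (ind_ge0 _)).
  have [/andP[cx xd]|_] := boolP (c < x < d); last exact: ind_ge0.
  suff xn : `|x| <= n%:R by rewrite xn.
  have := truncnS_gt (Num.max `|c| `|d|); rewrite -/n gt_max => /andP[cn dn].
  rewrite ler_norml; apply/andP; split.
    by rewrite lerNl; apply: le_trans (ltW cn); rewrite -normrN; apply: le_trans (ler_norm _); rewrite lerN2 ltW.
  by apply: le_trans (ltW dn); apply: le_trans (ler_norm _); exact: ltW.
- move=> eta eT; have Ie := tf_itg eT; have I := Itf _ _ m1 I1 eT.
  rewrite (_ : (fun x => _) = (fun x => (w x + k * x) * eta x - b * eta x)); last first.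
    by apply/funext => x; ring.
  by rewrite (integB I (itgZ b Ie)) (integZ b Ie) Hb// subrr.
Qed.

End distributions.

(** * Positivity of the constant of the fractional Laplacian *)

Section normalisation.
Context {R : realType}.
Implicit Types (z s t : R).

(** A divergent integral would be sent to the default value 0, so integrability comes first;
    positivity then follows from that of the integrand on ]0, 1[. *)
Lemma euler_integral_gt0 z : 0 < z -> z < 2 -> 0 < euler_integral z.
Proof.
move=> z0 z2.
have -> : euler_integral z = integ (fun t => ind (0 < t) * (t `^ (z - 1) * expR (- t))).
  by rewrite (@integ_ind R [set` `]0, +oo[])// => t; rewrite /= in_itv/= andbT.
(* On ]0, 1] the exponent z - 1 is lowered to -(1 - b), which lies in the range of [itg_powR0]. *)
pose b := Num.min (z / 2) (2^-1).
have b01 : 0 < 1 - b < 1.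
  apply/andP; split; last by rewrite ltrBlDr ltrDl lt_min; apply/andP; split; lra.
  by rewrite subr_gt0 gt_min; apply/orP; right; lra.
have me : measurable_fun setT (fun t : R => expR (- t)).
  by apply: (measurableT_comp (@measurable_expR R)); exact: (@oppr_measurable R setT).
have mF : measurable_fun setT (fun t : R => ind (0 < t) * (t `^ (z - 1) * expR (- t))) by mfun.
have [I0 _] := itg_powR0 b01 (@ler01 R).
have [Iy _] := @itg_powRy R 2 1 ltac:(by rewrite ltr1n) ltr01.
have b0 : 0 < b by rewrite /b lt_min; apply/andP; split; lra.
have bz : b <= z by rewrite /b ge_min; apply/orP; left; lra.
have IF : itg (fun t : R => ind (0 < t) * (t `^ (z - 1) * expR (- t))).
  (* For t > 1, t^(z - 1) <= t because z < 2, and e^t >= (t / 3)^3, whence 3^3 and the exponent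
     -2. *)
  apply: (itg_le mF _ (itgD I0 (itgZ (3 ^+ 3) Iy))) => t.
  have h1 : 0 <= ind (0 <= t <= 1) * t `^ (- (1 - b)) by rewrite mulr_ge0 ?ind_ge0 ?powR_ge0.
  have h2 : 0 <= 3 ^+ 3 * (ind (1 <= t) * t `^ (- 2)).
    by rewrite mulr_ge0// mulr_ge0 ?ind_ge0 ?powR_ge0.
  have [t0|t0] := leP t 0; first by rewrite /ind mul0r normr0 addr_ge0.
  rewrite (_ : ind true = 1 :> R)// mul1r ger0_norm ?mulr_ge0 ?powR_ge0 ?expR_ge0//.
  have [t1|t1] := lerP t 1.
    apply: ler_wpDr => //.
    have -> : ind ((0 <= t) && true) = 1 :> R by rewrite (ltW t0).
    rewrite mul1r -[leRHS]mulr1 ler_pM ?powR_ge0 ?expR_ge0//.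
      by rewrite opprB; apply: ger_powR; rewrite ?t0 ?t1 ?lerD2r.
    by rewrite -[leRHS]expR0 ler_expR oppr_le0 ltW.
  apply: ler_wpDl; first by rewrite mulr_ge0 ?ind_ge0 ?powR_ge0.
  rewrite ?(ltW t1) (_ : ind true = 1 :> R)//.
  rewrite mul1r.
  have -> : t `^ (- 2) = t * t `^ (- 3).
    rewrite -{2}(powRr1 (ltW t0)) -powRD; last by rewrite (gt_eqF t0) implybT.
    by congr (_ `^ _); ring.
  rewrite mulrCA; apply: ler_pM; rewrite ?powR_ge0 ?expR_ge0//.
    by rewrite -[leRHS](powRr1 (ltW t0)) ler_powR// ?(ltW t1)//; lra.
  rewrite expRN powRN powR_mulrn ?(ltW t0)//.
  have h := expR_ge_exprn 2 (ltW t0).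
  have p : 0 < (t / 3) ^+ 3 by rewrite exprn_gt0 ?divr_gt0.
  rewrite -lef_pV2 ?posrE ?expR_gt0// in h; apply: (le_trans h).
  by rewrite expr_div_n invf_div.
apply: (integ_gt0 IF _ (@ltr01 R)).
  by move=> t; rewrite mulr_ge0 ?ind_ge0 ?mulr_ge0 ?powR_ge0 ?expR_ge0.
by move=> t /andP[t0 _]; rewrite t0 /ind mul1r mulr_gt0 ?powR_gt0 ?expR_gt0.
Qed.

Lemma fraclap_cst_gt0 s : 2^-1 < s < 1 -> 0 < fraclap_cst s.
Proof.
move=> /andP[s0 s1]; have sp : 0 < s by apply: lt_trans s0; rewrite invr_gt0.
have G1 : 0 < Gamma (2^-1 + s).
  rewrite /Gamma ifT; last by rewrite addr_ge0// ?invr_ge0// ltW.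
  rewrite big_ord0 divr1 addr0; apply: euler_integral_gt0; first by rewrite addr_gt0// invr_gt0.
  by lra.
have G2 : Gamma (- s) != 0.
  rewrite /Gamma ifF; last by rewrite oppr_ge0 leNgt sp.
  (* Hence one step of the functional equation: Gamma (-s) is the Euler integral at 1 - s divided by
     -s. *)
  have -> : Num.floor (- s) = -1.
    by apply/eqP; rewrite floor_eq mulrN1z addNr oppr_lt0 sp lerN2 ltW.
  rewrite big_ord1 addr0; apply: mulf_neq0; last by rewrite invr_eq0 oppr_eq0 gt_eqF.
  by rewrite gt_eqF//; apply: euler_integral_gt0; rewrite /=; lra.
rewrite /fraclap_cst; apply: mulr_gt0; first by rewrite divr_gt0 ?powR_gt0 ?sqrtr_gt0 ?pi_gt0.
by rewrite divr_gt0 ?normr_gt0.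
Qed.

End normalisation.

(** * The integral equation *)

Section potential.
Context {R : realType} (al : R).
Hypothesis al01 : 0 < al < 1.
Let al0 : 0 < al. Proof. by case/andP: al01. Qed.
Let al1 : al < 1. Proof. by case/andP: al01. Qed.
Implicit Types (f g u phi psi eta : R -> R) (x y z t : R).

(** Split (x + y)^al as (x + y) (x + y)^(al - 1) and use z (x + y)^(al - 1) <= z^al for z = x and z
    = y. *)
Lemma powR_subadd x y : 0 <= x -> 0 <= y -> (x + y) `^ al <= x `^ al + y `^ al.
Proof.
move=> x0 y0; have [xy0|xy] := eqVneq (x + y) 0.
  by rewrite xy0 powR0 ?gt_eqF// addr_ge0 ?powR_ge0.
have xyp : 0 < x + y by rewrite lt_neqAle eq_sym xy addr_ge0.
have H z : 0 <= z -> z <= x + y -> z * (x + y) `^ (al - 1) <= z `^ al.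
  move=> z0 zxy; have [->|zn] := eqVneq z 0; first by rewrite mul0r powR_ge0.
  have zp : 0 < z by rewrite lt_neqAle eq_sym zn.
  have -> : z `^ al = z * z `^ (al - 1).
    rewrite -{2}(powRr1 z0) -powRD; last by rewrite zn implybT.
    by congr (_ `^ _); ring.
  rewrite ler_wpM2l// -opprB; apply: powR_le_neg => //.
  by rewrite subr_ge0 ltW.
have -> : (x + y) `^ al = (x + y) * (x + y) `^ (al - 1).
  rewrite -{2}(powRr1 (ltW xyp)) -powRD; last by rewrite xy implybT.
  by congr (_ `^ _); ring.
by rewrite mulrDl lerD// H// ?lerDl ?lerDr.
Qed.

Lemma absalN x : absal al (- x) = absal al x. Proof. by rewrite /absal normrN. Qed.

Lemma absal_ge0 x : 0 <= absal al x. Proof. exact: powR_ge0. Qed.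

Lemma absal_triangle x y : absal al (x + y) <= absal al x + absal al y.
Proof.
apply: le_trans (powR_subadd (normr_ge0 x) (normr_ge0 y)).
by apply: powR_le; [exact: ltW| |exact: ler_normD].
Qed.

Lemma absal_dist x y : `|absal al x - absal al y| <= absal al (x - y).
Proof.
have h1 := absal_triangle (x - y) y; have h2 := absal_triangle (y - x) x.
rewrite subrK in h1; rewrite subrK -(absalN (y - x)) opprB in h2.
by rewrite ler_norml; apply/andP; split; move: h1 h2; move: (absal _ _) (absal _ _) (absal _ _) => *; lra.
Qed.

(** For a merely integrable f the convolution with |.|^al may diverge; the difference with its value
    at 0 converges because | |x - y|^al - |y|^al | <= |x|^al. *)
Definition pot f x : R := integ (fun y => (absal al (x - y) - absal al y) * f y).

Lemma absal_meas : measurable_fun setT (absal al).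
Proof. by apply: continuous_measurable; exact: absal_continuous. Qed.

Lemma pot_itg f x : itg f -> itg (fun y => (absal al (x - y) - absal al y) * f y).
Proof.
move=> If; have mf := itg_meas If; have ma := absal_meas.
apply: (itg_le _ _ (itgZ (absal al x) (itg_norm If))); first by mfun.
move=> y; rewrite normrM ler_wpM2r// -(absalN y); apply: (le_trans (absal_dist _ _)).
by rewrite opprK subrK.
Qed.

Lemma pot_holder f x z : itg f -> `|pot f x - pot f z| <= absal al (x - z) * integ (fun y => `|f y|).
Proof.
move=> If; have mf := itg_meas If; have ma := absal_meas.
rewrite /pot -(integB (pot_itg x If) (pot_itg z If)) -(integZ _ (itg_norm If)).
apply: norm_integ_le; [by mfun| |exact: itgZ (itg_norm If)].
move=> y; rewrite -mulrBl normrM ler_wpM2r// opprB addrA subrK.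
by apply: (le_trans (absal_dist _ _)); rewrite opprB addrA subrK.
Qed.

Lemma pot0 f : pot f 0 = 0.
Proof.
rewrite -[RHS](integ0 (R := R)); apply: eq_integ => y.
by rewrite sub0r absalN subrr mul0r.
Qed.

Lemma pot_le f x : itg f -> `|pot f x| <= absal al x * integ (fun y => `|f y|).
Proof. by move=> If; have := pot_holder x 0 If; rewrite pot0 !subr0. Qed.

Lemma pot_cont f : itg f -> continuous (pot f).
Proof.
move=> If x; apply/cvgrPdist_le => e e0.
have c : (fun z => absal al (x - z) * integ (fun y => `|f y|)) @ x --> (0 : R).
  have c2 : {for x, continuous (fun z : R => absal al (x - z))}.
    apply: (@continuous_comp _ _ _ (fun z : R => x - z) (absal al)); last exact: absal_continuous.
    by apply: cvgB; [exact: cvg_cst|exact: cvg_id].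
  have a0 : absal al (x - x) = 0 by rewrite subrr /absal normr0 powR0// gt_eqF.
  rewrite -[X in _ --> X](mul0r (integ (fun y => `|f y|))) -a0.
  by apply: cvgM; [exact: c2|exact: cvg_cst].
move/cvgrPdist_le : c => /(_ e e0); apply: filterS => z.
rewrite sub0r normrN ger0_norm; last by rewrite mulr_ge0 ?absal_ge0 ?integ_ge0.
exact: le_trans (pot_holder x z If).
Qed.

Lemma fl_bound phi : tf phi -> exists2 B, 0 <= B &
  forall x, `|fl al phi x| <= B * wt (2 + al) x.
Proof.
move=> pT; have [B B0 dB] := tf_decays pT.
have [K K0 HK] := @Dabs_bound R al 2 al01 (ltr0Sn R 1).
exists (K * B) => [|x]; first by rewrite mulr_ge0// ltW.
exact: fl_le (HK _ _ dB) (tf_cont pT).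
Qed.

Lemma fl_meas phi : tf phi -> measurable_fun setT (fl al phi).
Proof.
move=> pT; have [I _] := integ_fl0 al01 0 pT.
have := itg_refl 0 I => /itg_meas; congr measurable_fun.
by apply/funext => x; rewrite !sub0r opprK.
Qed.

Lemma itg_wt_growth g B : measurable_fun setT g -> (forall x, `|g x| <= B * wt (2 + al) x) ->
  itg (fun x => absal al x * `|g x|).
Proof.
move=> mg gB; have ma := absal_meas; have B0 := wt_bound_ge0 gB.
have I2 : itg (wt 2 : R -> R) by apply: itg_wt; rewrite ltr1n.
apply: (itg_le _ _ (itgZ B I2)); first by mfun.
move=> x; rewrite ger0_norm ?mulr_ge0 ?absal_ge0//.
apply: (le_trans (ler_wpM2l (absal_ge0 x) (gB x))); rewrite mulrCA ler_wpM2l//.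
rewrite /wt opprD powRD; last by apply/implyP => _; rewrite gt_eqF// ltr_pwDl.
rewrite mulrCA ler_piMr ?powR_ge0// powRN ler_pdivrMr ?powR_gt0 ?ltr_pwDl// mul1r.
by apply: powR_le; rewrite ?(ltW al0)// lerDr.
Qed.

(* The term |y|^al, subtracted for integrability only, pairs to zero with g. *)
Lemma pot_fubini f g : itg f -> measurable_fun setT g -> itg (fun x => absal al x * `|g x|) ->
  itg g -> integ g = 0 ->
  [/\ itg (fun x => pot f x * g x),
      itg (fun y => f y * integ (fun x => absal al (x - y) * g x)) &
      integ (fun x => pot f x * g x) = integ (fun y => f y * integ (fun x => absal al (x - y) * g x))].
Proof.
move=> If mg Ig2 Ig g0; have mf := itg_meas If; have ma := absal_meas.
pose F (p : R * R) := (absal al (p.1 - p.2) - absal al p.2) * f p.2 * g p.1.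
have mF : measurable_fun setT F.
  by rewrite /F; mfun.
have IF x : itg (fun y => F (x, y)).
  by apply: eq_itg (itgZ (g x) (pot_itg x If)) => y; rewrite /F /= mulrC.
have N0 : 0 <= integ (fun y => `|f y|) by exact: integ_ge0.
have bF x : integ (fun y => `|F (x, y)|) <= integ (fun y => `|f y|) * (absal al x * `|g x|).
  rewrite mulrC -(integZ _ (itg_norm If)).
  apply: le_integ; [exact: itg_norm|exact: itgZ (itg_norm If)|] => y.
  rewrite /F /= normrM [leRHS]mulrAC ler_wpM2r//.
  rewrite normrM ler_wpM2r// -(absalN y); apply: (le_trans (absal_dist _ _)).
  by rewrite opprK subrK.
have [E I1 I2 _] := fubini mF IF bF (itgZ _ Ig2).
have Ey x : integ (fun y => F (x, y)) = pot f x * g x.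
  by rewrite mulrC -(integZ _ (pot_itg x If)); apply: eq_integ => y; rewrite /F /= mulrC.
have Iyx y : itg (fun x => absal al (x - y) * g x).
  apply: (itg_le _ _ (itgD Ig2 (itgZ (absal al y) (itg_norm Ig)))); first by mfun.
  move=> x; rewrite normrM (ger0_norm (absal_ge0 _)) -mulrDl ler_wpM2r//.
  by rewrite -(absalN y); exact: absal_triangle.
have Ex y : integ (fun x => F (x, y)) = f y * integ (fun x => absal al (x - y) * g x).
  rewrite -[X in f y * X]subr0 -[X in _ - X](mulr0 (absal al y)) -g0 -(integZ _ Ig).
  rewrite -(integB (Iyx y) (itgZ _ Ig)) -(integZ (f y) (itgB (Iyx y) (itgZ _ Ig))).
  by apply: eq_integ => x; rewrite /F /=; ring.
split; first exact: eq_itg Ey I1.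
  exact: eq_itg Ex I2.
by rewrite -(eq_integ Ey) E (eq_integ Ex).
Qed.

(** Fubini reduces the pairing to the fundamental identity at each y. *)
Lemma pot_weak f phi : itg f -> tf phi ->
  itg (fun x => pot f x * fl al phi x) /\
  integ (fun x => pot f x * fl al phi x) = - integ (kerP al) * integ (fun x => f x * phi x).
Proof.
move=> If pT; have [B B0 flB] := fl_bound pT; have mfl := fl_meas pT.
have [I0 E0] := integ_fl0 al01 0 pT.
have Ifl : itg (fl al phi) by apply: eq_itg (itg_refl 0 I0) => x; rewrite !sub0r opprK.
have fl0 : integ (fl al phi) = 0.
  by rewrite -E0 -(integ_refl 0 Ifl).
have [I1 I2 ->] := pot_fubini If mfl (itg_wt_growth mfl flB) Ifl fl0.
split=> //; have [B' B'0 dB] := tf_decays pT.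
have Ey y : f y * integ (fun x => absal al (x - y) * fl al phi x) = - integ (kerP al) * (f y * phi y).
  have [I E _] := fl_conv y al01 (growth_absal al01) dB.
  have -> : integ (fun x => absal al (x - y) * fl al phi x) = fl al (conv (absal al) phi) y.
    rewrite -E -(integ_refl y I); apply: eq_integ => x.
    by rewrite subKr -(absalN (y - x)) opprB.
  by rewrite fl_conv_absal//; ring.
rewrite (eq_integ Ey) integZ//.
have [C C0 pC] := @tf_wt R phi 0 (lexx 0) pT.
have mp := itg_meas (tf_itg pT); have mf := itg_meas If.
apply: (itg_le _ _ (itgZ C (itg_norm If))); first by mfun.
move=> x; rewrite normrM mulrC ler_wpM2r//.
by have := pC x; rewrite /wt oppr0 powRr0 mulr1.
Qed.

(** The equation is tested with the truncations at scale k. Their uniform error is paired with the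
    integrable f, the weighted error of their [fl] with u, and both vanish like k^(-a). *)
Lemma weak_pot u f C : measurable_fun setT u -> itg (fun x => u x * wt (2 + al) x) -> itg f ->
  (forall theta, tf theta -> C * integ (fun x => u x * fl al theta x) = integ (fun x => f x * theta x)) ->
  forall eta eta1 eta2, tf eta -> (forall x, is_derive x (1:R) eta (eta1 x)) -> tf eta1 ->
    (forall x, is_derive x (1:R) eta1 (eta2 x)) -> tf eta2 ->
    integ (fun x => (C * integ (kerP al) * u x + pot f x) * eta2 x) = 0.
Proof.
move=> mu_ Iu If H eta eta1 eta2 eT de e1T de1 e2T.
have [D D0 HD] := truncation al01 eT de de1.
pose a : R := (1 - al) / 2; have a0 : 0 < a by rewrite divr_gt0// subr_gt0.
have mf := itg_meas If; have m2 := itg_meas (tf_itg e2T); have ma := absal_meas.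
have bd theta : tf theta -> exists2 B, 0 <= B & forall x, `|theta x| <= B.
  move=> /(tf_wt (lexx 0))[B B0 tB]; exists B => // x.
  by have := tB x; rewrite /wt oppr0 powRr0 mulr1.
have e20 : integ eta2 = 0.
  have [_ [S S0 eS]] := e1T.
  by have [] := integ_derive0 S0 de1 (tf_cont e2T) eS.
have [G G0 eG] := @tf_wt R eta2 (2 + al) (ltac:(by rewrite addr_ge0// ltW)) e2T.
have [I1 I2 Epot] := pot_fubini If m2 (itg_wt_growth m2 eG) (tf_itg e2T) e20.
have cE y : integ (fun x => absal al (x - y) * eta2 x) = conv (absal al) eta2 y.
  have [B B0 dB] := tf_decays e2T; have [f1 [f2 [_ _ fB _]]] := dB.
  have q3 : 1 + al < 1 + 2 by rewrite ltrD2l (lt_trans al1)// ltr1n.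
  have I := itg_growth y (ltW al0) q3 (growth_absal al01) m2 fB.
  rewrite /conv -(integ_refl y I); apply: eq_integ => x.
  by rewrite subKr -(absalN (y - x)) opprB.
have Ifc : itg (fun y => f y * conv (absal al) eta2 y) by apply: eq_itg I2 => y; rewrite cE.
have Iue : itg (fun x => u x * eta2 x).
  apply: (itg_le _ _ (itgZ G (itg_norm Iu))); first by mfun.
  move=> x; rewrite normrM [X in G * X]normrM mulrCA ler_wpM2l//.
  by rewrite (ger0_norm (wt_ge0 _ _)).
set A := integ (fun y => f y * conv (absal al) eta2 y) in Epot *.
have EA : integ (fun x => pot f x * eta2 x) = A.
  by rewrite Epot; apply: eq_integ => y; rewrite cE.
pose N := D * (`|C| * integ (fun x => `|u x * wt (2 + al) x|) + integ (fun x => `|f x|)).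
have key k : 1 <= k -> `|A + C * integ (kerP al) * integ (fun x => u x * eta2 x)| <= N * k `^ (- a).
  move=> k1; have [theta [tT t1 t2]] := HD k k1.
  have [B B0 tB] := bd _ tT; have mt := itg_meas (tf_itg tT).
  have Ift : itg (fun x => f x * theta x).
    apply: (itg_le _ _ (itgZ B (itg_norm If))); first by mfun.
    by move=> x; rewrite normrM mulrC ler_wpM2r.
  have mfl := fl_meas tT; have [F F0 flF] := fl_bound tT.
  have Iuf : itg (fun x => u x * fl al theta x).
    apply: (itg_le _ _ (itgZ F (itg_norm Iu))); first by mfun.
    move=> x; rewrite normrM [X in F * X]normrM mulrCA ler_wpM2l//.
    by rewrite (ger0_norm (wt_ge0 _ _)).
  have -> : A + C * integ (kerP al) * integ (fun x => u x * eta2 x) =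
      C * integ (fun x => u x * fl al theta x + integ (kerP al) * (u x * eta2 x)) -
      integ (fun x => f x * theta x - f x * conv (absal al) eta2 x).
    rewrite (integD Iuf (itgZ _ Iue)) (integZ _ Iue) (integB Ift Ifc) -H// -/A; ring.
  rewrite /N mulrDr mulrDl; apply: (le_trans (ler_normB _ _)); apply: lerD.
    rewrite normrM -mulrA mulrCA -!mulrA ler_wpM2l//.
    have -> : integ (fun x => `|u x * wt (2 + al) x|) * (D * k `^ (- a)) =
       integ (fun x => D * k `^ (- a) * `|u x * wt (2 + al) x|).
      by rewrite (integZ _ (itg_norm Iu)); ring.
    apply: norm_integ_le; [by mfun| |exact: itgZ (itg_norm Iu)].
    move=> x; rewrite [integ _ * (_ * _)]mulrCA -mulrDr normrM [`|u x * wt _ _|]normrM.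
    by rewrite [leRHS]mulrCA ler_wpM2l// (ger0_norm (wt_ge0 _ _)).
  have -> : D * integ (fun x => `|f x|) * k `^ (- a) = integ (fun x => D * k `^ (- a) * `|f x|).
    by rewrite (integZ _ (itg_norm If)); ring.
  apply: norm_integ_le; [|move=> x|exact: itgZ (itg_norm If)].
    by have := itg_meas (itgB Ift Ifc).
  by rewrite -mulrBr normrM mulrC ler_wpM2r.
have Z : A + C * integ (kerP al) * integ (fun x => u x * eta2 x) = 0.
  apply/eqP; rewrite -normr_le0 leNgt; apply/negP => X0.
  have c : N * (n.+1%:R^-1 : R) `^ a @[n --> \oo] --> (0 : R).
    by rewrite -[X in _ --> X](mulr0 N); apply: cvgM; [exact: cvg_cst|exact: cvg_harmonic_powR].
  move/cvgr_lt : c => /(_ _ X0) [n _ /(_ n (leqnn n)) /=].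
  rewrite ltNge; apply/negP; rewrite negbK.
  apply: (le_trans (key n.+1%:R _)); first by rewrite ler1n.
  by rewrite -powR_inv1// -powRrM mulN1r.
rewrite (_ : (fun x => _) = (fun x => C * integ (kerP al) * (u x * eta2 x) + pot f x * eta2 x)); last first.
  by apply/funext => x; ring.
by rewrite (integD (itgZ _ Iue) I1) (integZ _ Iue) EA addrC.
Qed.

End potential.

Section integral_equation.
Context {R : realType} (al : R).
Hypothesis al01 : 0 < al < 1.
Let al0 : 0 < al. Proof. by case/andP: al01. Qed.
Let al1 : al < 1. Proof. by case/andP: al01. Qed.
Implicit Types (f g u : R -> R) (x y c k : R).
Local Notation mu := (@lebesgue_measure R).

Lemma wt_cancel (a q x : R) : (1 + `|x|) `^ a * wt (q + a) x = wt q x.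
Proof.
have p0 : 1 + `|x| != 0 by rewrite gt_eqF// ltr_pwDl.
rewrite /wt -powRD; last by rewrite p0 implybT.
by congr (_ `^ _); ring.
Qed.

(* log f = a - c |.|^al * f, the convolution being normalised at the origin. *)
Definition balanced c f := itg f /\ exists a, forall x, f x = expR (a - c * pot al f x).

Lemma balanced_gt0 c f x : balanced c f -> 0 < f x.
Proof. by move=> [_ [a ->]]; exact: expR_gt0. Qed.

Lemma balanced_mass_gt0 c f : balanced c f -> 0 < integ f.
Proof.
move=> bf; have [If _] := bf.
by apply: (integ_gt0 If _ (@ltr01 R)) => x *; rewrite ?ltW// (balanced_gt0 _ bf).
Qed.

Lemma ae_eq_pot f g x : measurable_fun setT f -> measurable_fun setT g ->
  {ae mu, forall x, f x = g x} -> pot al f x = pot al g x.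
Proof.
move=> mf mg fg; have ma := absal_meas al01; apply: ae_eq_integ; [by mfun|by mfun|].
by apply: ae_imp fg => y ->.
Qed.

Lemma linear_dominates A k b : 0 <= A -> 0 < k ->
  exists2 X, 0 < X & forall t, X <= t -> A * t `^ al <= k * t + b.
Proof.
move=> A0 k0; have a1 : 0 < 1 - al by rewrite subr_gt0.
pose B := 2 * A / k + 1; have B0 : 0 < B.
  by rewrite ltr_wpDl// divr_ge0 ?mulr_ge0// ltW.
exists (B `^ (1 - al)^-1 + 2 * `|b| / k).
  by rewrite ltr_pwDl ?powR_gt0// divr_ge0 ?mulr_ge0// ltW.
move=> t Xt.
have t1 : B `^ (1 - al)^-1 <= t by apply: le_trans Xt; rewrite lerDl divr_ge0 ?mulr_ge0// ltW.
have t2 : 2 * `|b| / k <= t by apply: le_trans Xt; rewrite lerDr powR_ge0.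
have t0 : 0 < t by apply: lt_le_trans t1; rewrite powR_gt0.
have h : 2 * A / k <= t `^ (1 - al).
  apply: (@le_trans _ _ B); first by rewrite lerDl.
  have -> : B = (B `^ (1 - al)^-1) `^ (1 - al).
    by rewrite -powRrM mulVf ?gt_eqF// powRr1// ltW.
  by apply: powR_le => //; [exact: ltW|rewrite powR_ge0].
have tE : t = t `^ (1 - al) * t `^ al.
  rewrite -powRD; last by rewrite (gt_eqF t0) implybT.
  by rewrite subrK powRr1// ltW.
have h1 : A * t `^ al <= k * t / 2.
  rewrite {2}tE mulrA mulrAC ler_wpM2r ?powR_ge0//.
  move: h; rewrite ler_pdivrMr// => h; rewrite ler_pdivlMr//.
  by rewrite [k * _]mulrC [A * _]mulrC.
have h2 : `|b| <= k * t / 2.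
  move: t2; rewrite ler_pdivrMr// => t2; rewrite ler_pdivlMr//.
  by rewrite [k * _]mulrC [`|b| * _]mulrC.
have h3 : - `|b| <= b by rewrite lerNl -normrN ler_norm.
by move: h1 h2 h3; move: al0 => _; lra.
Qed.

(** The potential is O(|x|^al), so a slope k would dominate it and make f >= 1 far out on the side
    where k x > 0; an interval there longer than the total mass gives a contradiction. *)
Lemma no_drift f c a k : 0 <= c -> itg f -> (forall x, 0 <= f x) ->
  {ae mu, forall x, f x = expR (a - c * pot al f x + k * x)} -> k = 0.
Proof.
move=> c0 If f0 fE; apply/eqP/negPn/negP => kn.
have M0 : 0 <= integ (fun y => `|f y|) by exact: integ_ge0.
have k0 : 0 < `|k| by rewrite normr_gt0.
have [X X0 HX] := @linear_dominates (c * integ (fun y => `|f y|)) `|k| a (mulr_ge0 c0 M0) k0.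
pose n := (Num.truncn (integ f)).+1.
pose b x : R := ind (X <= Num.sg k * x <= X + n%:R).
have kn1 : `|Num.sg k| = 1 by rewrite normr_sg kn.
have sg0 : Num.sg k != 0 by rewrite sgr_eq0.
have I0 : itg (fun x => ind (X <= x <= X + n%:R) * 1) by apply: itg_ind_cont => x; exact: cvg_cst.
have Ib : itg (fun x => b x).
  by apply: eq_itg (itg_affine 0 sg0 I0) => x; rewrite addr0 mulr1.
have bE : integ b = n%:R.
  have d1 x : is_derive x (1:R) (@id R) 1 by exact: is_derive_id.
  have XX : X <= X + n%:R by rewrite lerDl.
  have := ftc XX d1 (fun x => cvg_cst _).
  rewrite addrAC subrr add0r => <-.
  have := integ_affine 0 sg0 I0; rewrite kn1 invr1 mul1r => <-.
  by apply: eq_integ => x; rewrite addr0 mulr1.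
have mf := itg_meas If; have mp : measurable_fun setT (pot al f).
  by apply: continuous_measurable; exact: pot_cont.
pose g x := expR (a - c * pot al f x + k * x).
have mg : measurable_fun setT g.
  apply: (measurableT_comp (@measurable_expR R)); mfun.
have Ig : itg g by exact: ae_itg mg fE If.
have : integ b <= integ g.
  apply: le_integ => // x; rewrite /b; have [/andP[Xx _]|_] := boolP (X <= Num.sg k * x <= X + n%:R).
    rewrite -[leLHS]expR0 ler_expR.
    have tx : `|x| = Num.sg k * x by rewrite -(gtr0_norm (lt_le_trans X0 Xx)) normrM kn1 mul1r.
    have kx : k * x = `|k| * `|x| by rewrite tx {1}(numEsg k) mulrA [_ * `|k|]mulrC.
    have := HX _ Xx; rewrite -tx kx -subr_ge0 => h; apply: (le_trans h).
    rewrite [leRHS]addrAC [in leRHS](addrC a) lerD2l lerN2 -mulrA ler_wpM2l// mulrC.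
    by apply: le_trans (pot_le al01 x If); exact: ler_norm.
  by rewrite expR_ge0.
rewrite bE -(ae_eq_integ mf mg fE) leNgt => /negP; apply.
exact: truncnS_gt.
Qed.

End integral_equation.

(** * Equivalence of the weak and the integral equation *)

Section solutions.
Context {R : realType} (s : R).
Hypothesis hs : 2^-1 < s < 1.
Let al : R := 2 * s - 1.
Let al01 : 0 < al < 1. Proof. by move: hs => /andP[? ?]; rewrite /al; apply/andP; split; lra. Qed.
Let al0 : 0 < al. Proof. by case/andP: al01. Qed.
Let al1 : al < 1. Proof. by case/andP: al01. Qed.
Implicit Types (f g u : R -> R) (x y k : R).
Local Notation mu := (@lebesgue_measure R).

(** The fractional Laplacian sends the potential of f to minus the inverse of this constant times f,
    which fixes the coefficient of the potential in log f. *)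
Definition coupling : R := (fraclap_cst s * integ (kerP al))^-1.

Lemma coupling_gt0 : 0 < coupling.
Proof. by rewrite invr_gt0 mulr_gt0 ?fraclap_cst_gt0//; exact: kerP_integ_gt0. Qed.

Let twoal : 1 + 2 * s = 2 + al. Proof. by rewrite /al; ring. Qed.

Lemma locally_integrableP u : locally_integrable setT u <->
  measurable_fun setT u /\ forall n : nat, itg (fun x => ind (`|x| <= n%:R) * u x).
Proof.
have Db (n : nat) (x : R) : `[(- n%:R : R), n%:R]%classic x <-> `|x| <= n%:R.
  by rewrite /= in_itv/= ler_norml.
split=> [[mu_ _ H]|[mu_ H]].
  split=> // n; apply/(itg_ind u _ (Db n)); first exact: measurable_itv.
  apply/integrableP; split.
    by apply/measurable_EFinP; exact: measurable_funS mu_.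
  by apply: H => //; exact: segment_compact.
split=> //; first exact: openT.
move=> K _ cK; have [M [Mr HM]] := compact_bounded cK.
pose n := (Num.truncn (Num.max (M + 1) 0)).+1.
have Kn : K `<=` `[(- n%:R : R), n%:R]%classic.
  move=> x Kx; apply/Db; apply: ltW; apply: le_lt_trans (truncnS_gt (Num.max (M + 1) 0)).
  by rewrite le_max; apply/orP; left; apply: (HM (M + 1) _ x Kx); rewrite ltrDl.
have I : mu.-integrable `[(- n%:R : R), n%:R]%classic (EFin \o u).
  by apply/(itg_ind u _ (Db n)); [exact: measurable_itv|exact: H].
have mK : measurable K by exact: compact_measurable.
suff /integrableP[_] : mu.-integrable K (EFin \o u) by [].
exact: (@integrableS _ _ _ mu _ _ _ (measurable_itv _) mK Kn I).
Qed.

Lemma wt_le_inv q x : 0 <= q -> wt q x <= 2 * (1 + `|x| `^ q)^-1.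
Proof.
move=> q0; rewrite /wt powRN ler_pdivlMr ?ltr_pwDl ?powR_ge0// mulrC ler_pdivrMr ?powR_gt0 ?ltr_pwDl//.
rewrite mulr_natl mulr2n lerD//; last by apply: powR_le => //; rewrite lerDr.
by rewrite -[leLHS](one_powR q); apply: powR_le => //; rewrite lerDl.
Qed.

Lemma inv_le_wt q x : 0 <= q -> (1 + `|x| `^ q)^-1 <= 2 `^ q * wt q x.
Proof.
move=> q0; have p0 : 0 < 1 + `|x| by rewrite ltr_pwDl.
rewrite /wt powRN ler_pdivlMr ?powR_gt0// mulrC ler_pdivrMr ?ltr_pwDl ?powR_ge0//.
have h : 1 + `|x| <= 2 * Num.max 1 `|x| by case: (leP 1 `|x|); lra.
apply: (@le_trans _ _ ((2 * Num.max 1 `|x|) `^ q)); first by apply: powR_le => //; exact: ltW.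
rewrite powRM// ?le_max ?ler01// ler_wpM2l ?powR_ge0//.
by case: (leP 1 `|x|) => _; rewrite ?one_powR ?lerDl ?lerDr ?powR_ge0.
Qed.

Lemma Ls_space_itg u : Ls_space s u -> measurable_fun setT u /\ itg (fun x => u x * wt (2 + al) x).
Proof.
move=> [/locally_integrableP[mu_ _] H]; split => //.
have q0 : 0 <= 2 + al by rewrite addr_ge0// ltW.
have mw := @wt_meas R (2 + al).
have mg : measurable_fun setT (fun x => `|u x| / (1 + `|x| `^ (2 + al))).
  apply: measurable_funM; first exact: measurable_normr_comp.
  by apply: measurable_inv_comp => [|x]; [mfun|rewrite addr_ge0 ?powR_ge0].
have pos x : 0 <= `|u x| / (1 + `|x| `^ (2 + al)) by rewrite divr_ge0// addr_ge0 ?powR_ge0.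
have Ig : itg (fun x => `|u x| / (1 + `|x| `^ (2 + al))).
  by apply/(itg_ge0P mg pos); move: H; rewrite twoal.
apply: (itg_le _ _ (itgZ 2 Ig)); first by mfun.
move=> x; rewrite normrM mulrCA ler_wpM2l// (ger0_norm (wt_ge0 _ _)).
exact: wt_le_inv.
Qed.

Lemma growth_Ls u A : growth al A u -> Ls_space s u.
Proof.
move=> gu; have [mu_ uA] := gu; have A0 := growth_ge0 gu.
have q0 : 0 <= 2 + al by rewrite addr_ge0// ltW.
split.
  apply/locally_integrableP; split=> // n.
  apply: (itg_le _ _ (itg_ind_bdd (A * (1 + n%:R) `^ al) (ler0n R n))); first by mfun.
  move=> x; rewrite normrM (ger0_norm (ind_ge0 _)).
  have [xn|_] := leP `|x| n%:R; last by rewrite /ind !mul0r.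
  rewrite /ind !mul1r; apply: (le_trans (uA x)); rewrite ler_wpM2l//.
  by apply: powR_le; rewrite ?(ltW al0) ?addr_ge0// lerD2l.
have I2 : itg (wt 2 : R -> R) by apply: itg_wt; rewrite ltr1n.
have mg : measurable_fun setT (fun x => `|u x| / (1 + `|x| `^ (2 + al))).
  apply: measurable_funM; first exact: measurable_normr_comp.
  by apply: measurable_inv_comp => [|x]; [mfun|rewrite addr_ge0 ?powR_ge0].
have pos x : 0 <= `|u x| / (1 + `|x| `^ (2 + al)) by rewrite divr_ge0// addr_ge0 ?powR_ge0.
rewrite twoal; apply/(itg_ge0P mg pos).
apply: (itg_le mg _ (itgZ (A * 2 `^ (2 + al)) I2)) => x.
rewrite (ger0_norm (pos x)).
apply: (@le_trans _ _ (A * (1 + `|x|) `^ al * (2 `^ (2 + al) * wt (2 + al) x))).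
  have i0 : 0 <= (1 + `|x| `^ (2 + al))^-1 by rewrite invr_ge0 addr_ge0 ?powR_ge0.
  exact: (ler_pM (normr_ge0 _) i0 (uA x) (inv_le_wt x q0)).
by rewrite mulrACA wt_cancel.
Qed.

(** A multiple of u plus the potential of e^u has zero second derivative weakly, hence is affine,
    and finite mass removes the slope. *)
Lemma solution_balanced u : liouville_solution s u -> finite_mass u ->
  exists2 f, balanced al coupling f & {ae mu, forall x, u x = ln (f x)}.
Proof.
move=> [uL eL uE] uM; have [mu_ Iu] := Ls_space_itg uL.
have /locally_integrableP[me _] := eL.
pose f x := expR (u x); have mf : measurable_fun setT f by exact: me.
have If : itg f by apply/itg_ge0P => // x; exact: expR_ge0.
have C0 := fraclap_cst_gt0 hs; have P0 := kerP_integ_gt0 al01.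
have H theta : tf theta ->
    fraclap_cst s * integ (fun x => u x * fl al theta x) = integ (fun x => f x * theta x).
  move=> tT; have [F F0 flF] := fl_bound al01 tT; have mfl := fl_meas al01 tT.
  have Iuf : itg (fun x => u x * fl al theta x).
    apply: (itg_le _ _ (itgZ F (itg_norm Iu))); first by mfun.
    move=> x; rewrite normrM [X in F * X]normrM mulrCA ler_wpM2l//.
    by rewrite (ger0_norm (wt_ge0 _ _)).
  have tt : test_function theta by exact/test_functionP.
  have <- : integ (fun x => u x * fraclap s theta x) = integ (fun x => f x * theta x).
    by rewrite /integ /Rintegral (uE _ tt).
  rewrite -(integZ _ Iuf); apply: eq_integ => x; rewrite fraclapE// -/al; ring.
have W := weak_pot al01 mu_ Iu If H.
set c1 := fraclap_cst s * integ (kerP al) in W.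
have c10 : 0 < c1 by rewrite mulr_gt0.
have mp : measurable_fun setT (pot al f) by apply: continuous_measurable; exact: pot_cont.
have mw : measurable_fun setT (fun x => c1 * u x + pot al f x) by mfun.
have Iw (n : nat) : itg (fun x : R => ind (`|x| <= n%:R) * (c1 * u x + pot al f x)).
  have Ip : itg (fun x => ind (- n%:R <= x <= n%:R) * pot al f x).
    by apply: itg_ind_cont; exact: pot_cont.
  have [/locally_integrableP[_ Iun] _] := uL.
  apply: eq_itg (itgD (itgZ c1 (Iun n)) Ip) => x; rewrite -ler_norml; ring.
have [k [b kb]] := weak_affine mw Iw W.
have uE2 : {ae mu, forall x, u x = b / c1 - coupling * pot al f x + k / c1 * x}.
  apply: ae_imp kb => x h; rewrite /coupling -/c1.
  have c1n := lt0r_neq0 c10.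
  have -> : u x = c1^-1 * (c1 * u x + pot al f x) - c1^-1 * pot al f x.
    by field.
  by rewrite h; field.
have fE : {ae mu, forall x, f x = expR (b / c1 - coupling * pot al f x + k / c1 * x)}.
  by apply: ae_imp uE2 => x; rewrite /f => ->.
have k0 : k / c1 = 0.
  apply: (no_drift al01 (ltW coupling_gt0) If _ fE) => x; exact: expR_ge0.
(* [balanced] is an identity at every point, so f is replaced by its continuous representative; the
   potential does not notice. *)
pose g x := expR (b / c1 - coupling * pot al f x).
have mg : measurable_fun setT g by apply: (measurableT_comp (@measurable_expR R)); mfun.
have fg : {ae mu, forall x, f x = g x}.
  by apply: ae_imp fE => x; rewrite k0 mul0r addr0.
exists g.
  split; first exact: ae_itg mg fg If.
  by exists (b / c1) => x; rewrite -(ae_eq_pot al01 x mf mg fg).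
by apply: ae_imp uE2 => x; rewrite k0 mul0r addr0 /g expRK.
Qed.

Lemma balanced_solution f : balanced al coupling f ->
  liouville_solution s (fun x => ln (f x)) /\ finite_mass (fun x => ln (f x)).
Proof.
move=> bf; have [If [a fE]] := bf; have f0 x := balanced_gt0 x bf.
have mf := itg_meas If; have cc := coupling_gt0.
have mp : measurable_fun setT (pot al f) by apply: continuous_measurable; exact: pot_cont.
have lnE x : ln (f x) = a - coupling * pot al f x by rewrite fE expRK.
have eE x : expR (ln (f x)) = f x by rewrite lnK// posrE.
have M0 : 0 <= integ (fun y => `|f y|) by exact: integ_ge0.
split; last first.
  rewrite /finite_mass; under eq_integral do rewrite eE.
  by rewrite (EFin_integ If) ltry.
split.
- apply: (@growth_Ls _ (`|a| + coupling * integ (fun y => `|f y|))); split.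
    rewrite (_ : (fun x => _) = (fun x => a - coupling * pot al f x)); last exact/funext.
    by mfun.
  move=> x; rewrite lnE; apply: (le_trans (ler_normB _ _)); rewrite mulrDl lerD//.
    rewrite ler_peMr// -[leLHS](one_powR al); apply: powR_le; rewrite ?(ltW al0)//.
    by rewrite lerDl.
  rewrite normrM (gtr0_norm cc) -mulrA ler_wpM2l ?(ltW cc)// mulrC.
  apply: (le_trans (pot_le al01 x If)); rewrite ler_wpM2r//.
  by apply: powR_le; rewrite ?(ltW al0)// lerDr.
- apply/locally_integrableP; rewrite (_ : expR \o _ = f); last by apply/funext => x; exact: eE.
  split=> // n; apply: (itg_le _ _ (itg_norm If)); first by mfun.
  by move=> x; rewrite normrM ler_piMl// (ger0_norm (ind_ge0 _)) ind_le1.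
move=> phi /test_functionP pT.
have [I1 E1] := pot_weak al01 If pT.
have [C C0 pC] := tf_wt (lexx 0) pT.
have mphi := itg_meas (tf_itg pT).
have I2 : itg (fun x => f x * phi x).
  apply: (itg_le _ _ (itgZ C (itg_norm If))); first by mfun.
  move=> x; rewrite normrM mulrC ler_wpM2r//.
  by have := pC x; rewrite /wt oppr0 powRr0 mulr1.
have [J0 E0] := integ_fl0 al01 0 pT.
have J : itg (fl al phi) by apply: eq_itg (itg_refl 0 J0) => x; rewrite !sub0r opprK.
have EJ : integ (fl al phi) = 0 by rewrite -E0 -(integ_refl 0 J).
have cE x : ln (f x) * fraclap s phi x =
    fraclap_cst s * (a * fl al phi x - coupling * (pot al f x * fl al phi x)).
  by rewrite lnE fraclapE// -/al; ring.
under eq_integral do rewrite cE.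
under [RHS]eq_integral do rewrite eE.
have I3 := itgB (itgZ a J) (itgZ coupling I1).
rewrite (EFin_integ (itgZ _ I3)) (EFin_integ I2); congr EFin.
rewrite (integZ _ I3) (integB (itgZ a J) (itgZ coupling I1)) (integZ _ J) (integZ _ I1) E1 EJ.
rewrite /coupling; have n1 := lt0r_neq0 (fraclap_cst_gt0 hs).
have n2 := lt0r_neq0 (kerP_integ_gt0 al01).
by field; rewrite n1 n2.
Qed.

End solutions.

(** * The crossing energy *)

Section riesz_kernel.
Context {R : realType} (al : R).
Hypothesis al01 : 0 < al < 1.
Let al0 : 0 < al. Proof. by case/andP: al01. Qed.
Let al1 : al < 1. Proof. by case/andP: al01. Qed.
Implicit Types (f g : R -> R) (x y z t a b c k B p : R).
Local Notation mu := (@lebesgue_measure R).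

Lemma ae_neq r : {ae mu, forall x, x != r}.
Proof.
exists [set r]; split; [exact: measurable_set1|exact: lebesgue_measure_set1|].
by move=> x /= Hx; apply/eqP; apply: contra_notT Hx.
Qed.

Lemma itg_itv a b : itg (fun z : R => ind (a < z <= b)).
Proof.
have I : itg (fun z : R => ind (a <= z <= b) * 1) by apply: itg_ind_cont => x; exact: cvg_cst.
apply: (itg_le _ _ I); first by mfun.
move=> z; rewrite mulr1 ger0_norm ?ind_ge0//; have [/andP[az zb]|_] := boolP (a < z <= b).
  by rewrite (ltW az) zb.
exact: ind_ge0.
Qed.

Lemma integ_itv a b : a <= b -> integ (fun z : R => ind (a < z <= b)) = b - a.
Proof.
move=> ab; have d1 x : is_derive x (1:R) (@id R) 1 by exact: is_derive_id.
rewrite -(ftc ab d1 (fun x => cvg_cst _)); apply: ae_eq_integ.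
- by mfun.
- by mfun.
apply: ae_imp (ae_neq a) => z za.
by rewrite mulr1 [a <= z]le_eqVlt eq_sym (negbTE za).
Qed.

Definition rk t : R := `|t| `^ (- (1 - al)).

(** The derivative of |t|^al / al, with value 0 at the singularity. *)
Definition sker t : R := (ind (0 < t) - ind (t < 0)) * rk t.

(** Formally the derivative of the potential of f, divided by al. *)
Definition interaction f z : R := integ (fun y => sker (z - y) * f y).

Lemma rk_ge0 t : 0 <= rk t. Proof. exact: powR_ge0. Qed.

Lemma rk_meas : measurable_fun setT rk.
Proof. by apply: measurable_powR_comp; exact: measurable_normr_comp. Qed.

Lemma sker_meas : measurable_fun setT sker.
Proof. by have m := rk_meas; rewrite /sker; mfun. Qed.

Lemma rkN t : rk (- t) = rk t. Proof. by rewrite /rk normrN. Qed.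

Lemma skerN t : sker (- t) = - sker t.
Proof. by rewrite /sker rkN oppr_gt0 oppr_lt0 -mulNr opprB. Qed.

Lemma sker_le t : `|sker t| <= rk t.
Proof.
rewrite normrM (ger0_norm (rk_ge0 t)) ler_piMl ?rk_ge0// /ind.
by case: (ltgtP 0 t) => _; rewrite ?subr0 ?sub0r ?subrr ?normrN ?normr1 ?normr0.
Qed.

(** Within distance 1 the kernel is integrable and f bounded; beyond it the kernel is at most 1 and
    f integrable. *)
Lemma riesz_bound f B : itg f -> (forall x, `|f x| <= B) -> exists2 D, 0 <= D & forall z,
  itg (fun y => rk (z - y) * f y) /\ integ (fun y => rk (z - y) * `|f y|) <= D.
Proof.
move=> If fB; have mf := itg_meas If; have mr := rk_meas.
have B0 : 0 <= B by exact: le_trans (fB 0).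
have b01 : 0 < 1 - al < 1 by rewrite subr_gt0 al1 ltrBlDr ltrDl.
have [I0 E0] := itg_pow0 b01 (@ler01 R).
set h := fun x : R => _ in I0 E0.
have bnd z y : rk (z - y) * `|f y| <= B * h (z - y) + `|f y|.
  rewrite /h -/(rk _); have [zy|zy] := leP `|z - y| 1.
    rewrite /ind mul1r -[leLHS]addr0 lerD// mulrC ler_wpM2r ?rk_ge0//.
  rewrite /ind mul0r mulr0 add0r ler_piMl// /rk -[leRHS](one_powR (- (1 - al))).
  by apply: powR_le_neg; rewrite ?(ltW zy) ?subr_ge0 ?(ltW al1).
have Ih z : itg (fun y => B * h (z - y) + `|f y|).
  by apply: itgD; [apply: itgZ; exact: itg_refl|exact: itg_norm].
exists (B * integ h + integ (fun y => `|f y|)) => [|z].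
  rewrite addr_ge0 ?mulr_ge0 ?integ_ge0// => x.
  by rewrite mulr_ge0 ?ind_ge0 ?powR_ge0.
have In : itg (fun y => rk (z - y) * `|f y|).
  apply: (itg_le _ _ (Ih z)); first by mfun.
  by move=> y; rewrite ger0_norm ?mulr_ge0 ?rk_ge0.
split.
  apply: (itg_le _ _ In); first by mfun.
  by move=> y; rewrite normrM (ger0_norm (rk_ge0 _)).
rewrite -(integ_refl z I0) -(integZ B (itg_refl z I0)) -(integD (itgZ B (itg_refl z I0)) (itg_norm If)).
exact: le_integ.
Qed.

Lemma interaction_itg f B z : itg f -> (forall x, `|f x| <= B) -> itg (fun y => sker (z - y) * f y).
Proof.
move=> If fB; have [D D0 /(_ z)[I _]] := riesz_bound If fB.
have mf := itg_meas If; have mr := rk_meas; have ms := sker_meas.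
apply: (itg_le _ _ (itg_norm I)); first by mfun.
by move=> y; rewrite normrM [leRHS]normrM (ger0_norm (rk_ge0 _)) ler_wpM2r ?sker_le.
Qed.

Lemma interaction_bound f B : itg f -> (forall x, `|f x| <= B) -> exists2 D, 0 <= D & forall z,
  `|interaction f z| <= D.
Proof.
move=> If fB; have [D D0 HD] := riesz_bound If fB; exists D => // z.
have [I ID] := HD z; apply: le_trans ID.
have mf := itg_meas If; have mr := rk_meas; have ms := sker_meas.
apply: norm_integ_le; [by mfun| |].
  by move=> y; rewrite normrM ler_wpM2r ?sker_le.
by apply: eq_itg (itg_norm I) => y; rewrite normrM (ger0_norm (rk_ge0 _)).
Qed.

Lemma interaction_meas f : measurable_fun setT f -> measurable_fun setT (interaction f).
Proof.
move=> mf; have ms := sker_meas.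
apply: (measurable_param (f := fun p : R * R => sker (p.1 - p.2) * f p.2)); mfun.
Qed.

(** Indicator of the oriented interval from 0 to r: integrating against it gives the primitive that
    vanishes at 0, for either sign of r. *)
Definition sgi (r t : R) : R := ind (0 < t <= r) - ind (r < t <= 0).

Lemma sgiB a b t : a <= b -> ind (a < t <= b) = sgi b t - sgi a t.
Proof.
move=> ab; rewrite /sgi /ind.
case: (ltP 0 t) => t0; case: (leP t b) => tb; case: (leP t a) => ta /=; rewrite ?subrr ?subr0 ?sub0r ?opprK//.
all: by have := le_lt_trans (le_trans ta ab) tb; rewrite ltxx.
Qed.

Lemma sker_primitive r : itg (fun t => sgi r t * sker t) /\
  integ (fun t => sgi r t * sker t) = absal al r / al.
Proof.
have b01 : 0 < 1 - al < 1 by rewrite subr_gt0 al1 ltrBlDr ltrDl.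
have pos q : 0 <= q -> itg (fun t => ind (0 < t <= q) * sker t) /\
    integ (fun t => ind (0 < t <= q) * sker t) = q `^ al / al.
  move=> q0; have [I E] := itg_powR0 b01 q0.
  have H t : t != 0 -> ind (0 <= t <= q) * t `^ (- (1 - al)) = ind (0 < t <= q) * sker t.
    move=> t0; rewrite [0 <= t]le_eqVlt eq_sym (negbTE t0)/=.
    have [tp|_] := ltP 0 t; last by rewrite /ind !mul0r.
    by rewrite /sker tp ltNge (ltW tp) /= /ind subr0 mul1r /rk gtr0_norm.
  have ms := sker_meas.
  have m1 : measurable_fun setT (fun t : R => ind (0 < t <= q) * sker t) by mfun.
  have ae : {ae mu, forall t : R, ind (0 <= t <= q) * t `^ (- (1 - al)) = ind (0 < t <= q) * sker t}.
    exact: ae_imp H (ae_neq 0).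
  split; first exact: ae_itg m1 ae I.
  by rewrite -(ae_eq_integ (itg_meas I) m1 ae) E subKr.
have [r0|r0] := leP 0 r.
  have [I E] := pos r r0.
  have H : (fun t => ind (0 < t <= r) * sker t) =1 (fun t => sgi r t * sker t).
    move=> t; rewrite /sgi; congr (_ * _).
    have [rt|_] := ltP r t; last by rewrite /ind subr0.
    by rewrite /= leNgt (le_lt_trans r0 rt) /= /ind subr0.
  by rewrite -(eq_integ H) E /absal (ger0_norm r0); split=> //; exact: eq_itg H I.
have rp : 0 <= - r by rewrite oppr_ge0 ltW.
have [I E] := pos _ rp.
have ae : {ae mu, forall t : R, ind (0 < 0 - t <= - r) * sker (0 - t) = sgi r t * sker t}.
  have H (t : R) : t != r -> t != 0 -> ind (0 < 0 - t <= - r) * sker (0 - t) = sgi r t * sker t.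
    move=> tr t0; rewrite sub0r skerN oppr_gt0 lerN2 /sgi.
    rewrite [r <= t]le_eqVlt eq_sym (negbTE tr) /= [t <= 0]le_eqVlt (negbTE t0)/=.
    have [tp|_] := ltP 0 t.
      have tN : (t < 0) = false by rewrite ltNge (ltW tp).
      have tR : (t <= r) = false by rewrite leNgt (lt_trans r0 tp).
      by rewrite tN tR !andbF /ind subrr !mul0r.
    by rewrite /= andbC /ind sub0r mulrN mulNr.
  by apply: ae_imp (ae_and (ae_neq r) (ae_neq 0)) => t [? ?]; exact: H.
have ms := sker_meas.
have m1 : measurable_fun setT (fun t : R => sgi r t * sker t) by rewrite /sgi; mfun.
split; first exact: ae_itg m1 ae (itg_refl 0 I).
rewrite -(ae_eq_integ (itg_meas (itg_refl 0 I)) m1 ae) (integ_refl 0 I) E.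
by rewrite /absal ltr0_norm.
Qed.

Lemma sker_integral a b y : a <= b -> itg (fun z => ind (a < z <= b) * sker (z - y)) /\
  integ (fun z => ind (a < z <= b) * sker (z - y)) = (absal al (b - y) - absal al (a - y)) / al.
Proof.
move=> ab; have [Ia Ea] := sker_primitive (a - y); have [Ib Eb] := sker_primitive (b - y).
have I := itgB Ib Ia.
have H z : sgi (b - y) (z - y) * sker (z - y) - sgi (a - y) (z - y) * sker (z - y) =
    ind (a < z <= b) * sker (z - y).
  have aby : a - y <= b - y by rewrite lerD2r.
  by rewrite -mulrBl -(sgiB _ aby) ltrD2r lerD2r.
split; first exact: eq_itg H (itg_shift (- y) I).
by rewrite -(eq_integ H) (integ_shift (- y) I) (integB Ib Ia) Ea Eb mulrBl.
Qed.

(** The derivative of the potential in integrated form: Fubini reduces it to the primitive of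
    [sker]. *)
Lemma pot_interaction f B a b : itg f -> (forall x, `|f x| <= B) -> a <= b ->
  pot al f b - pot al f a = al * integ (fun z => ind (a < z <= b) * interaction f z).
Proof.
move=> If fB ab; have mf := itg_meas If; have ms := sker_meas.
have [D D0 HD] := riesz_bound If fB.
pose F (p : R * R) := ind (a < p.1 <= b) * (sker (p.1 - p.2) * f p.2).
have mF : measurable_fun setT F by rewrite /F; mfun.
have IF z : itg (fun y => F (z, y)) by apply: eq_itg (itgZ (ind (a < z <= b)) (interaction_itg z If fB)) => y.
have Iab : itg (fun z : R => ind (a <= z <= b) * 1) by apply: itg_ind_cont => x; exact: cvg_cst.
have bF z : integ (fun y => `|F (z, y)|) <= D * (ind (a <= z <= b) * 1).
  have [I ID] := HD z; rewrite mulr1 mulrC.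
  have -> : (fun y => `|F (z, y)|) = (fun y => ind (a < z <= b) * `|sker (z - y) * f y|).
    by apply/funext => y; rewrite /F /= normrM (ger0_norm (ind_ge0 _)).
  rewrite (integZ _ (itg_norm (interaction_itg z If fB))).
  apply: ler_pM; [exact: ind_ge0|exact: integ_ge0| |].
    have [/andP[az zb]|_] := boolP (a < z <= b); last exact: ind_ge0.
    by rewrite (ltW az) zb.
  apply: le_trans ID; apply: le_integ => [||y].
  - exact: itg_norm (interaction_itg z If fB).
  - by apply: eq_itg (itg_norm I) => y; rewrite normrM (ger0_norm (rk_ge0 _)).
  - by rewrite normrM ler_wpM2r ?sker_le.
have [E _ _ _] := fubini mF IF bF (itgZ D Iab).
have -> : integ (fun z => ind (a < z <= b) * interaction f z) = integ (fun z => integ (fun y => F (z, y))).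
  by apply: eq_integ => z; rewrite /F /= (integZ _ (interaction_itg z If fB)).
have Ipa := pot_itg al01 a If; have Ipb := pot_itg al01 b If.
rewrite E -(integB Ipb Ipa).
have Iq : itg (fun y => integ (fun z => F (z, y))).
  by have [_ _] := fubini mF IF bF (itgZ D Iab).
rewrite -(integZ al Iq); apply: eq_integ => y; rewrite /F /=.
have [Is Es] := sker_integral y ab.
have -> : integ (fun z => ind (a < z <= b) * (sker (z - y) * f y)) =
    f y * ((absal al (b - y) - absal al (a - y)) / al).
  by rewrite -Es -(integZ _ Is); apply: eq_integ => z; ring.
by field; exact: lt0r_neq0.
Qed.

End riesz_kernel.

Section crossing_energy.
Context {R : realType} (al : R).
Hypothesis al01 : 0 < al < 1.
Let al0 : 0 < al. Proof. by case/andP: al01. Qed.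
Let al1 : al < 1. Proof. by case/andP: al01. Qed.
Implicit Types (f g : R -> R) (x y z t a b c k B p : R).
Local Notation mu := (@lebesgue_measure R).

Lemma eq_opp0 x : x = - x -> x = 0.
Proof. by move/eqP; rewrite -addr_eq0 -mulr2n mulrn_eq0 => /eqP. Qed.

Lemma expR_split c x y : expR (c * x) = expR (c * y) * expR (c * (x - y)).
Proof. by rewrite -expRD; congr expR; ring. Qed.

Lemma le_of_eq x y : x = y -> x <= y. Proof. by move=> ->. Qed.

(* Integrating f' = - c (pot f)' f over ]p, +oo[, the interactions of pairs on the
   same side of p cancel; those of the separated pairs remain. *)
Definition crossing f p : R :=
  integ (fun z => integ (fun y => ind (y < p < z) * rk al (z - y) * f y) * f z).

(** Any kernel dominated by the Riesz kernel may be paired with f twice and have its arguments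
    exchanged; this is what lets an antisymmetric kernel cancel. *)
Lemma pair_fubini (K : R * R -> R) f B : measurable_fun setT K ->
  (forall q, `|K q| <= rk al (q.1 - q.2)) -> itg f -> (forall x, `|f x| <= B) ->
  [/\ forall z, itg (fun y => K (z, y) * f y),
      itg (fun z => integ (fun y => K (z, y) * f y) * f z) &
      integ (fun z => integ (fun y => K (z, y) * f y) * f z) =
      integ (fun z => integ (fun y => K (y, z) * f y) * f z)].
Proof.
move=> mK Kr If fB; have mf := itg_meas If; have mr := @rk_meas R al.
have [D D0 HD] := riesz_bound al01 If fB.
have mKz z : measurable_fun setT (fun y => K (z, y)) by exact: measurable_pair1.
have IK z : itg (fun y => K (z, y) * f y).
  have [I _] := HD z; apply: (itg_le _ _ (itg_norm I)); first by apply: measurable_funM.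
  by move=> y; rewrite normrM [leRHS]normrM (ger0_norm (rk_ge0 _ _)) ler_wpM2r// (Kr (z, y)).
pose F (p : R * R) := K p * f p.2 * f p.1.
have mF : measurable_fun setT F by rewrite /F; mfun.
have IF z : itg (fun y => F (z, y)) by apply: eq_itg (itgZ (f z) (IK z)) => y; rewrite mulrC.
have bF z : integ (fun y => `|F (z, y)|) <= D * `|f z|.
  have [I ID] := HD z.
  apply: (@le_trans _ _ (integ (fun y => `|f z| * (rk al (z - y) * `|f y|)))); last first.
    have I' : itg (fun y => rk al (z - y) * `|f y|).
      by apply: eq_itg (itg_norm I) => y; rewrite normrM (ger0_norm (rk_ge0 _ _)).
    by rewrite (integZ _ I') [leRHS]mulrC ler_wpM2l.
  apply: le_integ => [||y]; first exact: itg_norm (IF z).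
    apply: itgZ.
    by apply: eq_itg (itg_norm I) => y; rewrite normrM (ger0_norm (rk_ge0 _ _)).
  by rewrite /F /= normrM mulrC ler_wpM2l// normrM ler_wpM2r// (Kr (z, y)).
have [E I1 _ IFy] := fubini mF IF bF (itgZ D (itg_norm If)).
have Ez z : integ (fun y => F (z, y)) = integ (fun y => K (z, y) * f y) * f z.
  by rewrite mulrC -(integZ _ (IK z)); apply: eq_integ => y; rewrite /F /= mulrC.
split; [exact: IK|exact: eq_itg Ez I1|].
rewrite -(eq_integ Ez) E.
have : {ae mu, forall y, integ (fun z => F (z, y)) = integ (fun z => K (z, y) * f z) * f y}.
  apply: ae_imp IFy => y Iy.
  (* Integrability of the section of F gives that of K (., y) f only after division by f y; where f
     y = 0 both sides vanish. *)
  have [f0|f0] := eqVneq (f y) 0.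
    rewrite f0 mulr0 -[RHS](integ0 (R := R)); apply: eq_integ => z; rewrite /F /= f0; ring.
  rewrite mulrC -integZ; first by apply: eq_integ => z; rewrite /F /=; ring.
  by apply: eq_itg (itgZ (f y)^-1 Iy) => z; rewrite /F /=; field.
apply: ae_eq_integ.
  exact: (measurable_param (measurable_swap mF)).
apply: measurable_funM => //.
apply: (measurable_param (f := fun p : R * R => K (p.2, p.1) * f p.2)).
apply: measurable_funM; [exact: measurable_swap|exact: (measurableT_comp mf)].
Qed.

Lemma crossing_interaction f B p : itg f -> (forall x, `|f x| <= B) ->
  itg (fun z => ind (p < z) * (interaction al f z * f z)) /\
  crossing f p = integ (fun z => ind (p < z) * (interaction al f z * f z)).
Proof.
move=> If fB; have mf := itg_meas If; have mr := @rk_meas R al; have ms := @sker_meas R al.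
(* [K1] sees the pairs separated by p, [K2] those with both points beyond p. [K2] is antisymmetric
   and integrates to 0, and for y <> p the two add up to the signed kernel restricted to z > p. *)
pose K1 (q : R * R) := ind (q.2 < p < q.1) * rk al (q.1 - q.2).
pose K2 (q : R * R) := ind (p < q.1) * ind (p < q.2) * sker al (q.1 - q.2).
have m1 : measurable_fun setT K1 by rewrite /K1; mfun.
have m2 : measurable_fun setT K2 by rewrite /K2; mfun.
have b1 q : `|K1 q| <= rk al (q.1 - q.2).
  by rewrite normrM !ger0_norm ?ind_ge0 ?rk_ge0// ler_piMl ?rk_ge0 ?ind_le1.
have b2 q : `|K2 q| <= rk al (q.1 - q.2).
  rewrite normrM; apply: le_trans (sker_le _ _); rewrite ler_piMl//.
  by rewrite ger0_norm ?mulr_ge0 ?ind_ge0// mulr_ile1 ?ind_ge0 ?ind_le1.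
have [I1 J1 _] := pair_fubini m1 b1 If fB.
have [I2 J2 E2] := pair_fubini m2 b2 If fB.
have Z2 : integ (fun z => integ (fun y => K2 (z, y) * f y) * f z) = 0.
  have E : integ (fun z => integ (fun y => K2 (y, z) * f y) * f z) =
      - integ (fun z => integ (fun y => K2 (z, y) * f y) * f z).
    rewrite -(integN J2); apply: eq_integ => z; rewrite -mulNr -(integN (I2 z)).
    by congr (_ * _); apply: eq_integ => y; rewrite /K2 /= -(opprB z y) skerN; ring.
  exact: eq_opp0 (etrans E2 E).
have Ez z : ind (p < z) * (interaction al f z * f z) =
    integ (fun y => K1 (z, y) * f y) * f z + integ (fun y => K2 (z, y) * f y) * f z.
  rewrite mulrA -mulrDl -(integD (I1 z) (I2 z)) /interaction.
  have Is := interaction_itg al01 z If fB.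
  rewrite -(integZ _ Is); congr (_ * _).
  apply: ae_eq_integ; [exact: itg_meas (itgZ _ Is)|exact: itg_meas (itgD (I1 z) (I2 z))|].
  apply: ae_imp (ae_neq p) => y yp; rewrite -mulrDl mulrA; congr (_ * _).
  rewrite /K1 /K2 /=; have [pz|zp] := ltP p z; last by rewrite andbF /ind !mul0r addr0.
  have [yp1|py] := ltP y p.
    rewrite /= [p < y]ltNge (ltW yp1) /= /ind mulr0 mul0r addr0 !mul1r.
    by rewrite /sker subr_gt0 subr_lt0 (lt_trans yp1 pz) [z < y]ltNge (ltW (lt_trans yp1 pz)) /ind subr0 mul1r.
  by rewrite /= lt_neqAle eq_sym yp py /= /ind mul0r add0r mulr1.
split; first by apply: eq_itg (itgD J1 J2) => z; rewrite Ez.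
by rewrite (eq_integ Ez) (integD J1 J2) Z2 addr0.
Qed.

Lemma expR_taylor x : `|expR x - 1 - x| <= x ^+ 2 * expR `|x|.
Proof.
have de z : is_derive z (1:R) (@expR R) (expR z) by exact: is_derive_expR.
have h1 t : `|t| <= `|x| -> `|expR t - 1| <= expR `|x| * `|x|.
  move=> tx; have := @lipschitz_bound R expR expR (expR `|x|) 0 t de.
  rewrite expR0 subr0 => /(_ _)/le_trans; apply; last by rewrite ler_wpM2l ?expR_ge0.
  move=> z; rewrite subr0 => zt; rewrite ger0_norm ?expR_ge0// ler_expR.
  by apply: le_trans (ler_norm _) _; exact: le_trans zt tx.
have dF z : is_derive z (1:R) (fun t => expR t - t) (expR z - 1).
  by apply: is_deriveB.
have := @lipschitz_bound R _ _ (expR `|x| * `|x|) 0 x dF.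
rewrite expR0 !subr0 => H; have -> : expR x - 1 - x = expR x - x - 1 by ring.
apply: (le_trans (H _)); first by move=> z; rewrite subr0; exact: h1.
by rewrite -mulrA -expr2 real_normK ?num_real// mulrC.
Qed.

(** Quadratic increments force a zero derivative. The exponential factor is harmless near t = 0; it
    is the form in which the remainder of the exponential comes. *)
Lemma cst_of_quadratic g k :
  (forall x, exists A, forall t, `|g (x + t) - g x| <= A * t ^+ 2 * expR (k * `|t|)) ->
  forall x y, g x = g y.
Proof.
move=> H x y; apply: is_derive_0_is_cst => {x y} z.
have [A HA] := H z.
apply: (@is_derive_littleo R _ _ _ (fun t => A * `|t| * expR (k * `|t|))).
  have e0 : A * `|0 : R| * expR (k * `|0 : R|) = 0 by rewrite normr0 mulr0 mul0r.
  rewrite -[X in _ --> X]e0; apply: cvgM.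
    by apply: cvgM; [exact: cvg_cst|apply: cvg_norm; exact: cvg_id].
  apply: (@continuous_comp _ _ _ (fun t : R => k * `|t|) (@expR R)); last exact: continuous_expR.
  by apply: cvgM; [exact: cvg_cst|apply: cvg_norm; exact: cvg_id].
move=> t; rewrite mul0r subr0; apply: (le_trans (HA t)).
rewrite -real_normK ?num_real// expr2.
by move: `|t| (expR _) => r q; apply: le_of_eq; ring.
Qed.

Lemma expR_taylor_le k x t : 0 <= k -> `|x| <= k * `|t| ->
  `|expR x - 1 - x| <= k ^+ 2 * t ^+ 2 * expR (k * `|t|).
Proof.
move=> k0 xt; apply: (le_trans (expR_taylor _)); apply: ler_pM.
- exact: sqr_ge0.
- exact: expR_ge0.
- rewrite -exprMn -real_normK ?num_real// -[leRHS]real_normK ?num_real//.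
  by rewrite lerXn2r ?nnegrE// (le_trans xt)// normrM (ger0_norm k0).
- by rewrite ler_expR.
Qed.

(* The increments of the tail integral and of f * V agree to first order,
   which replaces differentiating them. *)
Section increments.
Variables (f V tail : R -> R) (B D c : R).
Hypotheses (c0 : 0 <= c) (D0 : 0 <= D) (fB : forall x, `|f x| <= B).
Hypothesis le_V : forall a b, `|V b - V a| <= al * D * `|b - a|.
Hypothesis tail_V : forall L a b, 0 <= L -> (forall x y, `|f x - f y| <= L * `|x - y|) ->
  `|tail a - tail b - f a * ((V b - V a) / al)| <= D * L * (b - a) ^+ 2.
Let B0 : 0 <= B. Proof. exact: le_trans (fB 0). Qed.

(** Formally f' = - c V' f and tail' = - f V' / al, so f - c al tail has derivative 0. The
    exponential form first makes f Lipschitz, as [tail_V] asks. *)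
Lemma tail_of_exp a : (forall x, f x = expR (a - c * V x)) ->
  forall x y, f x - c * al * tail x = f y - c * al * tail y.
Proof.
move=> fE.
have fpos x : 0 < f x by rewrite fE expR_gt0.
have fL x y : `|f x - f y| <= B * (c * (al * D)) * `|x - y|.
  wlog xy : x y / f y <= f x => [H|].
    by have [/H//|/ltW yx] := leP (f y) (f x); rewrite distrC [`|x - y|]distrC; exact: H.
  have -> : f x - f y = f x * (1 - expR (c * (V x - V y))).
    rewrite mulrBr mulr1; congr (_ - _); rewrite [LHS]fE [in RHS]fE -expRD; congr expR.
    by move: (V x) (V y) => *; ring.
  rewrite normrM -mulrA; apply: ler_pM => //.
  have h1 := expR_ge1Dx (c * (V x - V y)).
  have h2 : expR (c * (V x - V y)) <= 1.
    rewrite -(ler_pM2l (fpos x)) mulr1 {1}fE -expRD; apply: le_trans xy.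
    by rewrite [f y]fE ler_expR; apply: le_of_eq; move: (V x) (V y) => *; ring.
  rewrite ger0_norm ?subr_ge0//.
  apply: (@le_trans _ _ (c * `|V x - V y|)).
    rewrite -[X in _ <= X](_ : `|c * (V x - V y)| = _); last by rewrite normrM (ger0_norm c0).
    have := ler_norm (- (c * (V x - V y))); rewrite normrN; apply: le_trans.
    by rewrite lerBlDr -lerBlDl opprK.
  by rewrite -!mulrA ler_wpM2l// mulrA le_V.
have {}fL : exists2 L, 0 <= L & forall x y, `|f x - f y| <= L * `|x - y|.
  by exists (B * (c * (al * D))); rewrite // !mulr_ge0// ltW.
have [L L0 {}fL] := fL.
move=> x y.
have [k kE] : exists k, k = c * (al * D) by exists (c * (al * D)).
apply: (@cst_of_quadratic (fun x => f x - c * al * tail x) k) => {}x.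
exists (B * k ^+ 2 + c * al * (D * L)) => t.
have k0 : 0 <= k by rewrite kE !mulr_ge0// ltW.
have -> : f (x + t) - c * al * tail (x + t) - (f x - c * al * tail x) =
   f x * (expR (- (c * (V (x + t) - V x))) - 1 - (- (c * (V (x + t) - V x)))) +
   c * al * (tail x - tail (x + t) - f x * ((V (x + t) - V x) / al)).
  have -> : f (x + t) = f x * expR (- (c * (V (x + t) - V x))).
    by rewrite [LHS]fE [in RHS]fE -expRD; congr expR; move: (V x) (V (x + t)) => *; ring.
  move: (tail x) (tail (x + t)) (V x) (V (x + t)) (f x) (expR _) => *.
  by field; exact: lt0r_neq0.
apply: (le_trans (ler_normD _ _)); rewrite ![in leRHS]mulrDl.
have xt : x + t - x = t by rewrite addrAC subrr add0r.
have dV : `|- (c * (V (x + t) - V x))| <= k * `|t|.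
  rewrite normrN normrM (ger0_norm c0) kE -!mulrA ler_wpM2l// mulrA.
  by have := le_V x (x + t); rewrite xt.
apply: lerD.
  rewrite normrM.
  apply: (le_trans (ler_pM (normr_ge0 _) (normr_ge0 _) (fB x) (expR_taylor_le k0 dV))).
  by rewrite !mulrA.
have ca : 0 <= c * al by rewrite mulr_ge0// ltW.
have H := tail_V x (x + t) L0 fL; rewrite xt in H.
rewrite normrM (ger0_norm ca); apply: (le_trans (ler_wpM2l ca H)).
rewrite [leLHS]mulrA ler_peMr// ?(mulr_ge0 (mulr_ge0 ca (mulr_ge0 D0 L0)) (sqr_ge0 t))//.
by rewrite -(@expR0 R) ler_expR mulr_ge0.
Qed.

(** The converse: formally f' = - c V' f, so f e^(c V) has derivative 0. Here the Lipschitz bound on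
    f comes from that on the tail. *)
Lemma exp_of_tail : (forall a b, `|tail b - tail a| <= D * B * `|b - a|) -> (forall p, f p = c * al * tail p) ->
  forall x y, f x * expR (c * V x) = f y * expR (c * V y).
Proof.
move=> le_tail fT.
have ca : 0 <= c * al by rewrite mulr_ge0// ltW.
have fL x y : `|f x - f y| <= c * al * (D * B) * `|x - y|.
  rewrite !fT -mulrBr normrM (ger0_norm ca) -[leRHS]mulrA ler_wpM2l//.
have {}fL : exists2 L, 0 <= L & forall x y, `|f x - f y| <= L * `|x - y|.
  by exists (c * al * (D * B)); rewrite // !mulr_ge0// ltW.
have [L L0 {}fL] := fL.
have [k kE] : exists k, k = c * (al * D) by exists (c * (al * D)).
have k0 : 0 <= k by rewrite kE !mulr_ge0// ltW.
move=> x y.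
apply: (@cst_of_quadratic (fun x => f x * expR (c * V x)) k) => {}x.
exists (expR (c * V x) * (B * k ^+ 2 + L * k + c * al * (D * L))) => t.
have xt : x + t - x = t by rewrite addrAC subrr add0r.
have -> : f (x + t) * expR (c * V (x + t)) - f x * expR (c * V x) =
  expR (c * V x) * (f (x + t) * (expR (c * (V (x + t) - V x)) - 1 - c * (V (x + t) - V x)) +
   (f (x + t) - f x) * (c * (V (x + t) - V x)) -
   c * al * (tail x - tail (x + t) - f x * ((V (x + t) - V x) / al))).
  rewrite (expR_split c (V (x + t)) (V x)).
  have -> : c * al * (tail x - tail (x + t) - f x * ((V (x + t) - V x) / al)) =
    f x - f (x + t) - f x * (c * (V (x + t) - V x)).
    rewrite (fT (x + t)) [X in _ = X - _ - _](fT x).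
    move: (tail x) (tail (x + t)) (V x) (V (x + t)) (f x) => *.
    by field; exact: lt0r_neq0.
  by move: (V x) (V (x + t)) (f x) (f (x + t)) (expR _) (expR _) => *; ring.
rewrite normrM (ger0_norm (expR_ge0 _)) -[leRHS]mulrA -[leRHS]mulrA ler_wpM2l ?expR_ge0// [leRHS]mulrA.
have dV : `|c * (V (x + t) - V x)| <= k * `|t|.
  rewrite normrM (ger0_norm c0) kE -!mulrA ler_wpM2l// mulrA.
  by have := le_V x (x + t); rewrite xt.
have e1 : 1 <= expR (k * `|t|) by rewrite -[leLHS]expR0 ler_expR mulr_ge0.
apply: (le_trans (ler_normB _ _)); rewrite ![in leRHS]mulrDl; apply: lerD.
  apply: (le_trans (ler_normD _ _)); apply: lerD.
    rewrite normrM.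
    apply: (le_trans (ler_pM (normr_ge0 _) (normr_ge0 _) (fB _) (expR_taylor_le k0 dV))).
    by rewrite !mulrA.
  rewrite normrM; have := fL (x + t) x; rewrite xt => h1.
  apply: (le_trans (ler_pM _ _ h1 dV)) => //.
  have -> : L * `|t| * (k * `|t|) = L * k * t ^+ 2.
    by rewrite -[t ^+ 2]real_normK ?num_real//; ring.
  by rewrite ler_peMr// (mulr_ge0 (mulr_ge0 L0 k0) (sqr_ge0 t)).
have H := tail_V x (x + t) L0 fL; rewrite xt in H.
rewrite normrM (ger0_norm ca); apply: (le_trans (ler_wpM2l ca H)).
by rewrite [leLHS]mulrA ler_peMr// ?(mulr_ge0 (mulr_ge0 ca (mulr_ge0 D0 L0)) (sqr_ge0 t)).
Qed.

End increments.

Section flow.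
Variables (f : R -> R) (B D : R).
Hypothesis If : itg f.
Hypothesis fB : forall x, `|f x| <= B.
Hypothesis WD : forall z, `|interaction al f z| <= D.
Let W := interaction al f.
Let V := pot al f.
Let mf : measurable_fun setT f. Proof. exact: itg_meas. Qed.
Let mW : measurable_fun setT W. Proof. exact: interaction_meas. Qed.
Let B0 : 0 <= B. Proof. exact: le_trans (fB 0). Qed.
Let D0 : 0 <= D. Proof. exact: le_trans (WD 0). Qed.

Let tail p : R := integ (fun z => ind (p < z) * (W z * f z)).

Let IWf : itg (fun z => W z * f z).
Proof.
apply: (itg_le _ _ (itgZ D (itg_norm If))); first by mfun.
by move=> z; rewrite normrM ler_wpM2r.
Qed.

Let Itail p : itg (fun z => ind (p < z) * (W z * f z)).
Proof. by have [] := crossing_interaction p If fB. Qed.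

Let Iloc (g : R -> R) C a b : measurable_fun setT g -> (forall z, `|g z| <= C) ->
  itg (fun z => ind (a < z <= b) * g z).
Proof.
move=> mg gC; apply: (itg_le _ _ (itgZ C (itg_itv a b))); first by mfun.
by move=> z; rewrite normrM (ger0_norm (ind_ge0 _)) mulrC ler_wpM2r ?ind_ge0.
Qed.

Let tailB a b : a <= b -> tail a - tail b = integ (fun z => ind (a < z <= b) * (W z * f z)).
Proof.
move=> ab; rewrite -(integB (Itail a) (Itail b)); apply: eq_integ => z.
rewrite -mulrBl; congr (_ * _); rewrite /ind.
have [az|za] := ltP a z; have [bz|zb] := ltP b z => /=; rewrite ?subrr ?subr0//.
by have := lt_le_trans bz (le_trans za ab); rewrite ltxx.
Qed.

Let le_tail a b : `|tail b - tail a| <= D * B * `|b - a|.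
Proof.
wlog ab : a b / a <= b => [H|].
  by have [/H//|/ltW ba] := leP a b; rewrite distrC [`|b - a|]distrC; exact: H.
rewrite distrC (tailB ab) (ger0_norm (_ : 0 <= b - a)) ?subr_ge0//.
rewrite -(integ_itv ab) -(integZ _ (itg_itv a b)).
apply: norm_integ_le; [by mfun| |exact: itgZ (itg_itv a b)].
move=> z; rewrite normrM (ger0_norm (ind_ge0 _)) mulrC ler_wpM2r ?ind_ge0//.
by rewrite normrM ler_pM.
Qed.

Let le_V a b : `|V b - V a| <= al * D * `|b - a|.
Proof.
wlog ab : a b / a <= b => [H|].
  by have [/H//|/ltW ba] := leP a b; rewrite distrC [`|b - a|]distrC; exact: H.
rewrite (pot_interaction al01 If fB ab) (ger0_norm (_ : 0 <= b - a)) ?subr_ge0//.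
rewrite normrM (gtr0_norm al0) -mulrA ler_wpM2l ?(ltW al0)//.
rewrite -(integ_itv ab) -(integZ _ (itg_itv a b)).
apply: norm_integ_le; [by mfun| |exact: itgZ (itg_itv a b)].
by move=> z; rewrite normrM (ger0_norm (ind_ge0 _)) mulrC ler_wpM2r ?ind_ge0.
Qed.

Let tail_V L a b : 0 <= L -> (forall x y, `|f x - f y| <= L * `|x - y|) ->
  `|tail a - tail b - f a * ((V b - V a) / al)| <= D * L * (b - a) ^+ 2.
Proof.
move=> L0 fL.
(* Letting f be frozen at any point of the interval covers both orders of a and b. Freezing changes
   f by at most L (hi - lo) under an integral of length hi - lo, whence the square. *)
suff H lo hi x : lo <= hi -> lo <= x <= hi ->
    `|tail lo - tail hi - f x * ((V hi - V lo) / al)| <= D * L * (hi - lo) ^+ 2.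
  have [ab|/ltW ba] := leP a b; first by apply: H; rewrite ?lexx.
  have := H b a a ba; rewrite ba lexx => /(_ isT).
  have -> : (b - a) ^+ 2 = (a - b) ^+ 2 by ring.
  have -> : tail a - tail b - f a * ((V b - V a) / al) = - (tail b - tail a - f a * ((V a - V b) / al)).
    by move: (tail a) (tail b) (V a) (V b) => *; ring.
  by rewrite normrN.
move=> lohi /andP[lx xh].
have IW := Iloc lo hi mW WD; have IWf' := Iloc lo hi (measurable_funM mW mf) (C := D * B).
have {}IWf' : itg (fun z => ind (lo < z <= hi) * (W z * f z)).
  by apply: IWf' => z; rewrite normrM ler_pM.
rewrite (tailB lohi) (pot_interaction al01 If fB lohi) [al * _]mulrC mulfK ?lt0r_neq0//.
rewrite -(integZ _ IW) -(integB IWf' (itgZ _ IW)).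
rewrite expr2 mulrA -{2}(integ_itv lohi) -(integZ _ (itg_itv lo hi)).
apply: norm_integ_le; [by mfun| |exact: itgZ (itg_itv lo hi)].
move=> z; rewrite [f x * (_ * _)]mulrCA -mulrBr normrM (ger0_norm (ind_ge0 _)) mulrC.
have [/andP[lz zh]|_] := boolP (lo < z <= hi); last by rewrite /ind !mulr0.
rewrite ler_wpM2r ?ind_ge0// [f x * _]mulrC -mulrBr normrM -mulrA ler_pM//.
apply: (le_trans (fL _ _)); rewrite ler_wpM2l// ler_norml; apply/andP; split; lra.
Qed.

(** The constant f - c al tail is computed along the integers, where both terms tend to 0. *)
Lemma balanced_flow c : 0 <= c -> (exists a, forall x, f x = expR (a - c * V x)) ->
  (f n%:R @[n --> \oo] --> (0:R)) -> forall p, f p = c * al * crossing f p.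
Proof.
move=> c0 [a fE] f0 p.
have fpos x : 0 < f x by rewrite fE expR_gt0.
have cst := tail_of_exp c0 D0 fB le_V tail_V fE.
have [_ ->] := crossing_interaction p If fB.
have t0 : tail n%:R @[n --> \oo] --> (0 : R).
  have [|||||_] := @dct R (fun n z => ind (n%:R < z) * (W z * f z)) (fun=> 0) (fun z => `|W z * f z|).
  - by move=> n; mfun.
  - exact: measurable_cst.
  - move=> z; apply: cvg_near_cst; near=> n.
    have zn : z <= n%:R by near: n; exact: nbhs_infty_ger.
    by rewrite ltNge zn /ind mul0r.
  - by move=> n z; rewrite normrM (ger0_norm (ind_ge0 _)) ler_piMl// ind_le1.
  - exact: itg_norm.
  by rewrite integ0.
have : (fun n => f n%:R - c * al * tail n%:R) @ \oo --> (0 : R).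
  rewrite -[X in _ --> X](subrr 0) -{2}(mulr0 (c * al)).
  by apply: cvgB => //; apply: cvgM => //; exact: cvg_cst.
rewrite (_ : (fun n => _) = fun=> f p - c * al * tail p); last by apply/funext => n.
move=> H; apply/eqP; rewrite -subr_eq0; apply/eqP.
exact: (cvg_unique (@Rhausdorff R) (cvg_cst _) H).
Unshelve. all: by end_near. Qed.

Lemma flow_balanced c : 0 <= c -> (forall x, 0 < f x) ->
  (forall p, f p = c * al * crossing f p) -> balanced al c f.
Proof.
move=> c0 fpos fN; split=> //.
have fT p : f p = c * al * tail p.
  by rewrite [LHS]fN; have [_ ->] := crossing_interaction p If fB.
have cst := exp_of_tail c0 D0 fB le_V tail_V le_tail fT.
exists (ln (f 0 * expR (c * V 0))) => x.
rewrite expRD lnK; last by rewrite posrE mulr_gt0 ?expR_gt0.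
by rewrite -(cst x) -mulrA -expRD subrr expR0 mulr1.
Qed.

End flow.

End crossing_energy.

(** * Two-sided estimates of the crossing energy *)

Section crossing_bounds.
Context {R : realType} (al : R).
Hypothesis al01 : 0 < al < 1.
Let al0 : 0 < al. Proof. by case/andP: al01. Qed.
Let al1 : al < 1. Proof. by case/andP: al01. Qed.
Implicit Types (f g : R -> R) (x y z t a b c k B p : R).

Definition cdf f p : R := integ (fun y => ind (y < p) * f y).
Definition tail f p : R := integ (fun z => ind (p < z) * f z).

Lemma itg_indl f (b : R -> bool) : measurable_fun setT b -> itg f -> itg (fun x => ind (b x) * f x).
Proof.
move=> mb If; have mf := itg_meas If; have mi := measurable_ind mb.
apply: (itg_le _ _ (itg_norm If)); first by mfun.
by move=> x; rewrite normrM (ger0_norm (ind_ge0 _)) ler_piMl// ind_le1.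
Qed.

Lemma itg_cdf f p : itg f -> itg (fun y => ind (y < p) * f y).
Proof. by move=> If; apply: itg_indl => //; apply: measurable_fun_ltr. Qed.

Lemma itg_tail f p : itg f -> itg (fun y => ind (p < y) * f y).
Proof. by move=> If; apply: itg_indl => //; apply: measurable_fun_ltr. Qed.

Lemma tail_reflect f p : itg f -> tail (fun x => f (- x)) (- p) = cdf f p.
Proof.
move=> If; rewrite /cdf -(integ_refl 0 (itg_cdf p If)); apply: eq_integ => z.
by rewrite sub0r ltrNl.
Qed.

Lemma tail_ge0 f p : (forall x, 0 <= f x) -> 0 <= tail f p.
Proof. by move=> f0; apply: integ_ge0 => z; rewrite mulr_ge0 ?ind_ge0. Qed.

(** Reflection exchanges the two members of each separated pair; it lets every estimate be proved
    for the right tail only. *)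
Lemma crossing_reflect f B p : itg f -> (forall x, `|f x| <= B) ->
  crossing al (fun x => f (- x)) (- p) = crossing al f p.
Proof.
move=> If fB; have mr := @rk_meas R al.
pose K (q : R * R) := ind (q.1 < p < q.2) * rk al (q.1 - q.2).
have mK : measurable_fun setT K by rewrite /K; mfun.
have bK q : `|K q| <= rk al (q.1 - q.2).
  by rewrite normrM !ger0_norm ?ind_ge0 ?rk_ge0// ler_piMl ?rk_ge0 ?ind_le1.
have [I J E] := pair_fubini al01 mK bK If fB.
have E1 z : integ (fun y => ind (y < p < z) * rk al (z - y) * f y) = integ (fun y => K (y, z) * f y).
  by apply: eq_integ => y; rewrite /K /= -(opprB z y) rkN.
have E2 z : integ (fun y => ind (y < - p < z) * rk al (z - y) * f (- y)) =
    integ (fun y => K (- z, y) * f y).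
  rewrite -(integ_refl 0 (I (- z))); apply: eq_integ => y.
  by rewrite sub0r /K /= [- z < p]ltrNl [p < - y]ltrNr andbC -opprD rkN.
rewrite /crossing (eq_integ (fun z => congr1 (fun r => r * f z) (E1 z))) -E -(integ_refl 0 J).
by apply: eq_integ => z; rewrite E2 sub0r.
Qed.

(** Cut at distance r = (1 + |p|) / 2 from p: nearer, f is O(r^(-2)) against a kernel of integral
    O(r^al); farther, the kernel is at most r^(-(1 - al)). As r >= 1/2, the spare power of the first
    part is absorbed. *)
Lemma riesz_decay f B : itg f -> (forall x, `|f x| <= B * wt 2 x) ->
  exists2 C, 0 < C & forall p, integ (fun y => rk al (p - y) * `|f y|) <= C * wt (1 - al) p.
Proof.
move=> If fB; have mf := itg_meas If; have mr := @rk_meas R al.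
have B0 := wt_bound_ge0 fB.
have fB1 x : `|f x| <= B.
  by apply: (le_trans (fB x)); rewrite ler_piMr//; apply: wt_le1.
have b01 : 0 < 1 - al < 1 by rewrite subr_gt0 al1 ltrBlDr ltrDl.
have e2 : 0 <= 1 - al by rewrite subr_ge0 ltW.
pose M := integ (fun y => `|f y|); have M0 : 0 <= M by exact: integ_ge0.
pose C := 4 * B / al + M.
exists (2 `^ (1 - al) * (C + 1)) => [|p].
  by rewrite mulr_gt0 ?powR_gt0// ltr_pwDr// addr_ge0// divr_ge0 ?mulr_ge0// ltW.
pose r := (1 + `|p|) / 2.
have r2 : 2^-1 <= r by rewrite /r -[leLHS]mul1r ler_wpM2r ?invr_ge0// lerDl.
have r0 : 0 < r by apply: lt_le_trans r2; rewrite invr_gt0.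
have [I0 E0] := itg_pow0 b01 (ltW r0).
set h := fun x : R => _ in I0 E0.
have I1 := itgZ (B * r `^ (- 2)) (itg_refl p I0).
have I2 := itgZ (r `^ (- (1 - al))) (itg_norm If).
have bnd y : rk al (p - y) * `|f y| <= B * r `^ (- 2) * h (p - y) + r `^ (- (1 - al)) * `|f y|.
  rewrite /h -/(rk al _); have [py|py] := leP `|p - y| r.
    rewrite /ind mul1r mulrC; apply: ler_wpDr; first by rewrite mulr_ge0 ?powR_ge0.
    rewrite ler_wpM2r ?rk_ge0//; apply: (le_trans (fB y)); rewrite ler_wpM2l//.
    apply: powR_le_neg => //.
    have := ler_normD y (p - y); rewrite addrC subrK => h1.
    by move: py h1; rewrite /r; move: al0 => _; lra.
  rewrite /ind mul0r mulr0 add0r ler_wpM2r//; apply: powR_le_neg => //; exact: ltW.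
have [D D0 HD] := riesz_bound al01 If fB1.
have [I _] := HD p.
have I' : itg (fun y => rk al (p - y) * `|f y|).
  by apply: eq_itg (itg_norm I) => y; rewrite normrM (ger0_norm (rk_ge0 _ _)).
apply: (@le_trans _ _ (C * r `^ (- (1 - al)))).
  apply: (le_trans (le_integ I' (itgD I1 I2) bnd)).
  rewrite (integD I1 I2) (integZ _ (itg_refl p I0)) (integZ _ (itg_norm If)) (integ_refl p I0) E0.
  rewrite /C [leRHS]mulrDl; apply: lerD; last by rewrite mulrC.
  rewrite subKr.
  have -> : r `^ (- 2) = r^-1 * r `^ (-1) by rewrite powR_inv1 ?(ltW r0)// powRN powR_mulrn ?(ltW r0)// expr2 invfM.
  have -> : r `^ (- (1 - al)) = r `^ al * r `^ (-1).
    rewrite -powRD; last by rewrite (gt_eqF r0) implybT.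
    by congr (_ `^ _); ring.
  have -> : B * (r^-1 * r `^ (-1)) * (2 * (r `^ al / al)) = r^-1 * (2 * B / al * (r `^ al * r `^ (-1))).
    by ring.
  have -> : 4 * B / al * (r `^ al * r `^ (-1)) = 2 * (2 * B / al * (r `^ al * r `^ (-1))) by ring.
  rewrite ler_wpM2r ?mulr_ge0 ?powR_ge0 ?invr_ge0 ?(ltW al0)//.
  by rewrite -[leRHS]invrK lef_pV2 ?posrE ?invr_gt0.
rewrite [wt _ _]wtE -/r mulrACA -powRD; last by rewrite pnatr_eq0 implybT.
rewrite subrr powRr0 mul1r ler_wpM2r ?powR_ge0// lerDl//.
Qed.

(** For y < p < z the kernel at z - y is at most that at p - y, so the double integral is bounded by
    the Riesz potential at p times the right tail; reflection gives the left one. *)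
Lemma crossing_le f B : itg f -> (forall x, 0 <= f x) -> (forall x, `|f x| <= B * wt 2 x) ->
  exists2 C, 0 < C & forall p, crossing al f p <= C * wt (1 - al) p * Num.min (cdf f p) (tail f p).
Proof.
move=> If f0 fB; have mf := itg_meas If; have mr := @rk_meas R al.
have [C C0 HC] := riesz_decay If fB; exists C => // p.
have fB1 x : `|f x| <= B.
  apply: (le_trans (fB x)); rewrite ler_piMr//; last exact: wt_le1.
  exact: wt_bound_ge0 fB.
have half g : itg g -> (forall x, 0 <= g x) -> (forall x, `|g x| <= B) -> forall q,
    integ (fun y => rk al (q - y) * `|g y|) <= C * wt (1 - al) q ->
    crossing al g q <= C * wt (1 - al) q * tail g q.
  move=> Ig g0 gB q Hq; have mg := itg_meas Ig.
  pose K (r : R * R) := ind (r.2 < q < r.1) * rk al (r.1 - r.2).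
  have mK : measurable_fun setT K by rewrite /K; mfun.
  have bK r : `|K r| <= rk al (r.1 - r.2).
    by rewrite normrM !ger0_norm ?ind_ge0 ?rk_ge0// ler_piMl ?rk_ge0 ?ind_le1.
  have [I J _] := pair_fubini al01 mK bK Ig gB.
  have [D D0 HD] := riesz_bound al01 Ig gB; have [I1 _] := HD q.
  have I' : itg (fun y => rk al (q - y) * `|g y|).
    by apply: eq_itg (itg_norm I1) => y; rewrite normrM (ger0_norm (rk_ge0 _ _)).
  rewrite /tail -(integZ _ (itg_tail q Ig)); apply: le_integ; [exact: J|exact: itgZ (itg_tail q Ig)|].
  move=> z; have [qz|zq] := ltP q z; last first.
    rewrite /ind mul0r mulr0 mulr_le0_ge0// (_ : integ _ = 0)//.
    by rewrite -[RHS](integ0 (R := R)); apply: eq_integ => y; rewrite andbF /ind !mul0r.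
  rewrite /ind mul1r ler_wpM2r//; apply: le_trans Hq.
  apply: le_integ; [by apply: eq_itg (I z) => y; rewrite /K /= qz|exact: I'|] => y.
  rewrite (ger0_norm (g0 y)) ler_wpM2r//.
  have [yq|_] := ltP y q; last by rewrite /= mul0r rk_ge0.
  rewrite mul1r; apply: powR_le_neg; first by rewrite subr_ge0 ltW.
    by rewrite normr_gt0 subr_eq0 gt_eqF.
  by rewrite !gtr0_norm ?subr_gt0 ?(lt_trans yq qz)// lerD2r ltW.
rewrite /Num.min; case: ifP => _; last exact: half.
rewrite -(crossing_reflect p If fB1) -(tail_reflect p If).
have -> : wt (1 - al) p = wt (1 - al) (- p) by rewrite /wt normrN.
apply: half => [||x|].
- by apply: eq_itg (itg_refl 0 If) => x; rewrite sub0r.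
- by move=> x.
- exact: fB1.
have := HC p; rewrite -(integ_refl 0 (_ : itg (fun y => rk al (p - y) * `|f y|))).
  rewrite (_ : wt _ p = wt (1 - al) (- p)); last by rewrite /wt normrN.
  congr (_ <= _); apply: eq_integ => y; rewrite sub0r opprK; congr (_ * _).
  by rewrite -(rkN al (p + y)) opprD.
have [D D0 HD] := riesz_bound al01 If fB1; have [I1 _] := HD p.
by apply: eq_itg (itg_norm I1) => y; rewrite normrM (ger0_norm (rk_ge0 _ _)).
Qed.

Lemma stretched_exp k : 0 < k -> exists2 C, 0 < C & forall x, expR (- (k * absal al x)) <= C * wt 2 x.
Proof.
(* The exponential beats its n-th power, and (1 + |x|)^(al n) is at least (1 + |x|)^2 for this n. *)
move=> k0; pose n := (Num.truncn (2 / al)).+1; have nal : 2 <= al * n%:R.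
  by rewrite mulrC -ler_pdivrMr//; apply: ltW; exact: truncnS_gt.
have n0 : 0 < n%:R :> R by rewrite ltr0n.
exists (expR k * (n%:R / k) ^+ n) => [|x].
  by rewrite mulr_gt0 ?expR_gt0// exprn_gt0// divr_gt0.
have s1 : 1 <= 1 + `|x| by rewrite lerDl.
have s0 : 0 < 1 + `|x| by apply: lt_le_trans s1.
have h1 : (1 + `|x|) `^ al <= 1 + absal al x.
  by have := powR_subadd al01 ler01 (normr_ge0 x); rewrite one_powR.
have h2 : expR (- (k * absal al x)) <= expR k * expR (- (k * (1 + `|x|) `^ al)).
  have h : k * (1 + `|x|) `^ al <= k + k * absal al x.
    by apply: (le_trans (ler_wpM2l (ltW k0) h1)); rewrite mulrDr mulr1.
  by rewrite -expRD ler_expR -subr_ge0 opprK addrAC subr_ge0.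
apply: (le_trans h2); rewrite -mulrA ler_wpM2l ?expR_ge0//.
have h3 := @expR_ge_exprn R n.-1 (k * (1 + `|x|) `^ al) (mulr_ge0 (ltW k0) (powR_ge0 _ _)).
rewrite expRN /wt powRN -lef_pV2 ?posrE ?invr_gt0 ?expR_gt0 ?mulr_gt0 ?exprn_gt0 ?invr_gt0 ?powR_gt0 ?divr_gt0//.
rewrite invrK invfM invrK -exprVn invf_div; apply: le_trans h3.
change (n.-1.+1) with n; rewrite [in leRHS]mulrAC [in leRHS]exprMn ler_wpM2l ?exprn_ge0 ?divr_ge0 ?(ltW k0)//.
rewrite -powR_mulrn ?powR_ge0// -powRrM; exact: ler_powR.
Qed.

(* The mass beyond L (1 + p) is at most half of the tail, so a fixed fraction of
   the pairs counted by the crossing energy are at distance O(1 + p). *)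
Lemma crossing_ge f k k' K K' : 0 < k -> 0 < k' -> itg f ->
  (forall x, expR (- (k * absal al x) - K) <= f x) ->
  (forall x, f x <= expR (- (k' * absal al x) + K')) ->
  (forall x, `|f x| <= expR K') ->
  exists2 C, 0 < C & forall p, C * wt (1 - al) p * Num.min (cdf f p) (tail f p) <= crossing al f p.
Proof.
move=> k0 k'0 If fl fu fB.
suff [C C0 HC] : exists2 C, 0 < C & forall g, itg g ->
    (forall x, expR (- (k * absal al x) - K) <= g x) ->
    (forall x, g x <= expR (- (k' * absal al x) + K')) -> (forall x, `|g x| <= expR K') ->
    forall p, 0 <= p -> C * wt (1 - al) p * tail g p <= crossing al g p.
  exists C => // p; have [p0|p0] := leP 0 p.
    apply: le_trans (HC f If fl fu fB p p0).
    by rewrite ler_wpM2l ?mulr_ge0 ?(ltW C0) ?wt_ge0// ge_min lexx orbT.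
  rewrite -(crossing_reflect p If fB).
  apply: le_trans (HC (fun x => f (- x)) _ _ _ _ (- p) _).
  - rewrite (tail_reflect p If) /wt normrN.
    by rewrite ler_wpM2l ?mulr_ge0 ?(ltW C0) ?powR_ge0// ge_min lexx.
  - by apply: eq_itg (itg_refl 0 If) => x; rewrite sub0r.
  - by move=> x; rewrite -absalN; exact: fl.
  - by move=> x; rewrite -absalN; exact: fu.
  - by [].
  - by rewrite oppr_ge0 ltW.
have k2 : 0 < k' / 2 by rewrite divr_gt0.
(* Half of the exponent keeps [E] integrable; the other half supplies the factor e^(-(k' / 2) q^al)
   beyond q. *)
pose E x := expR (- (k' / 2 * absal al x) + K').
have mE : measurable_fun setT E.
  apply: (measurableT_comp (@measurable_expR R)); have ma := absal_meas al01; by mfun.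
have IE : itg E.
  have [C C0 HC] := stretched_exp k2.
  have I2 : itg (wt 2 : R -> R) by apply: itg_wt; rewrite ltr1n.
  apply: (itg_le mE _ (itgZ (expR K' * C) I2)) => x.
  by rewrite ger0_norm ?expR_ge0// /E expRD [leLHS]mulrC -[leRHS]mulrA ler_wpM2l ?expR_ge0.
pose C' := integ E; have C'0 : 0 <= C' by apply: integ_ge0 => x; exact: expR_ge0.
(* From e^L >= L: this L makes e^(-L) C' at most half of e^(-K). *)
pose L := 2 * C' * expR K; have L0 : 0 <= L by rewrite !mulr_ge0 ?expR_ge0.
have HL : expR (- L) * C' <= expR (- K) / 2.
  have := expR_ge1Dx L => h; have h' : L <= expR L by apply: le_trans h; rewrite lerDr.
  rewrite !expRN mulrC ler_pdivrMr ?expR_gt0// mulrAC ler_pdivlMr// mulrC ler_pdivlMl ?expR_gt0//.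
  by rewrite [leLHS]mulrC; exact: h'.
(* Chosen so that (k' / 2) (Lam (1 + p))^al >= k (1 + p)^al + L; the summand 1 ensures Lam >= 1. *)
pose Lam := ((k + L) / (k' / 2) + 1) `^ al^-1.
have lam1 : 1 <= (k + L) / (k' / 2) + 1.
  by rewrite lerDr divr_ge0// ?addr_ge0// ltW.
have Lam_al : Lam `^ al = (k + L) / (k' / 2) + 1.
  by rewrite /Lam -powRrM mulVf ?lt0r_neq0// powRr1// (le_trans ler01).
have Lam1 : 1 <= Lam.
  by rewrite /Lam -[leLHS](one_powR al^-1); apply: powR_le; rewrite // invr_ge0 ltW.
have Lam0 : 0 < Lam by apply: lt_le_trans Lam1.
have p2 : 0 < 3 * Lam by rewrite mulr_gt0.
(* Partners y in ]-2, -1] carry mass at least e^(-2 k - K) and lie within 3 Lam (1 + p) of every z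
   in ]p, q]; the factor 1/2 is the share of the tail located before q. *)
exists ((3 * Lam) `^ (- (1 - al)) * expR (- (k * 2) - K) / 2).
  by rewrite divr_gt0// mulr_gt0 ?powR_gt0 ?expR_gt0.
move=> g Ig gl gu gB p p0; have mg := itg_meas Ig.
have g0 x : 0 <= g x by apply: le_trans (gl x); exact: expR_ge0.
pose q := Lam * (1 + p); have p1 : 0 < 1 + p by rewrite ltr_pwDl.
have pq : p + 1 <= q by rewrite /q addrC ler_peMl// ltW.
have pq' : p <= q by apply: le_trans pq; rewrite lerDl.
have q0 : 0 < q by rewrite mulr_gt0.
have Sq : tail g q <= expR (- (k * (1 + p) `^ al) - K) / 2.
  apply: (@le_trans _ _ (integ (fun x => expR (- (k' / 2 * q `^ al)) * E x))).
    apply: le_integ; [exact: itg_tail|exact: itgZ|] => z.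
    have [qz|_] := ltP q z; last by rewrite /ind mul0r mulr_ge0 ?expR_ge0.
    rewrite /ind mul1r; apply: (le_trans (gu z)); rewrite /E -expRD ler_expR addrA lerD2r.
    rewrite -opprD lerN2 [leRHS](_ : _ = k' / 2 * absal al z + k' / 2 * absal al z); last by field.
    rewrite lerD2r ler_wpM2l ?(ltW k2)// /absal; apply: powR_le; rewrite ?(ltW al0) ?(ltW q0)//.
    by apply: le_trans (ltW qz) _; exact: ler_norm.
  rewrite (integZ _ IE) -/C'.
  apply: (@le_trans _ _ (expR (- (k * (1 + p) `^ al)) * (expR (- L) * C'))); last first.
    by rewrite expRD -mulrA ler_wpM2l ?expR_ge0.
  rewrite mulrA ler_wpM2r// -expRD ler_expR -opprD lerN2.
  rewrite /q powRM ?(ltW Lam0) ?(ltW p1)// Lam_al mulrA mulrDr mulr1 [k' / 2 * (_ / _)]mulrC.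
  rewrite mulfVK ?lt0r_neq0// -addrA mulrDl lerD2l mulrDl.
  apply: ler_wpDr; first by rewrite mulr_ge0 ?powR_ge0// ltW.
  rewrite ler_peMr// -[leLHS](one_powR al); apply: powR_le => //; first exact: ltW.
  by rewrite lerDl.
have Sp : expR (- (k * (1 + p) `^ al) - K) <= tail g p.
  rewrite -[leLHS]mulr1 -[X in _ * X](_ : integ (fun z : R => ind (p < z <= p + 1)) = 1); last first.
    by rewrite integ_itv ?lerDl// addrAC subrr add0r.
  rewrite -(integZ _ (itg_itv p (p + 1))); apply: le_integ; [exact: itgZ (itg_itv _ _)|exact: itg_tail|].
  move=> z; have [pz|_] := ltP p z; last by rewrite /ind mulr0 mul0r.
  have [zp|_] := leP z (p + 1); last by rewrite /ind mulr0 mul1r.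
  rewrite /ind mulr1 mul1r; apply: le_trans (gl z); rewrite ler_expR lerD2r lerN2 ler_wpM2l ?(ltW k0)//.
  rewrite /absal gtr0_norm ?(le_lt_trans p0 pz)//; apply: powR_le; rewrite ?(ltW al0)//.
    by apply: ltW; exact: le_lt_trans p0 pz.
  by rewrite addrC.
have half : tail g p / 2 <= integ (fun z => ind (p < z <= q) * g z).
  have -> : integ (fun z => ind (p < z <= q) * g z) = tail g p - tail g q.
    rewrite /tail -(integB (itg_tail p Ig) (itg_tail q Ig)); apply: eq_integ => z.
    rewrite -mulrBl; congr (_ * _); rewrite /ind.
    have [az|za] := ltP p z; have [bz|zb] := ltP q z => /=; rewrite ?subrr ?subr0//.
    by have := lt_le_trans bz (le_trans za pq'); rewrite ltxx.
  by move: Sq Sp; clear; lra.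
pose c := (3 * Lam) `^ (- (1 - al)) * wt (1 - al) p * expR (- (k * 2) - K).
have c0 : 0 <= c by rewrite !mulr_ge0 ?powR_ge0 ?expR_ge0.
apply: (@le_trans _ _ (c * integ (fun z => ind (p < z <= q) * g z))).
  apply: (@le_trans _ _ (c * (tail g p / 2))); last by rewrite ler_wpM2l.
  by apply: le_of_eq; rewrite /c; ring.
have Iq : itg (fun z => ind (p < z <= q) * g z).
  apply: itg_indl => //; apply: measurable_and; [exact: measurable_fun_ltr|exact: measurable_fun_ler].
pose K1 (r : R * R) := ind (r.2 < p < r.1) * rk al (r.1 - r.2).
have mr := @rk_meas R al.
have mK : measurable_fun setT K1 by rewrite /K1; mfun.
have bK r : `|K1 r| <= rk al (r.1 - r.2).
  by rewrite normrM !ger0_norm ?ind_ge0 ?rk_ge0// ler_piMl ?rk_ge0 ?ind_le1.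
have [I J _] := pair_fubini al01 mK bK Ig gB.
rewrite -(integZ _ Iq); apply: le_integ; [exact: itgZ|exact: J|] => z; rewrite mulrA.
have inner0 : 0 <= integ (fun y => ind (y < p < z) * rk al (z - y) * g y).
  by apply: integ_ge0 => y; rewrite !mulr_ge0 ?ind_ge0 ?rk_ge0.
rewrite ler_wpM2r//; have [/andP[pz zq]|_] := boolP (p < z <= q); last by rewrite /ind mulr0.
rewrite mulr1 -[leLHS]mulr1 -[X in _ * X](_ : integ (fun z : R => ind (-2 < z <= -1)) = 1); last first.
  by rewrite integ_itv; [ring|rewrite lerN2 ler1n].
rewrite -(integZ _ (itg_itv _ _)); apply: le_integ; [exact: itgZ (itg_itv _ _)|exact: (I z)|] => y.
have [/andP[y2 y1]|_] := boolP (-2 < y <= -1); last first.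
  by rewrite mulr0 !mulr_ge0 ?ind_ge0 ?rk_ge0.
have yp : y < p by apply: le_lt_trans y1 _; rewrite (lt_le_trans _ p0)// oppr_lt0.
rewrite yp pz /ind !mulr1 mul1r; apply: ler_pM; rewrite ?mulr_ge0 ?powR_ge0 ?expR_ge0//.
  rewrite /wt -powRM ?(ltW p2) ?addr_ge0//; apply: powR_le_neg.
  - by rewrite subr_ge0 ltW.
  - by rewrite normr_gt0 subr_eq0 gt_eqF// (lt_trans yp).
  rewrite (ger0_norm p0) gtr0_norm ?subr_gt0 ?(lt_trans yp)//.
  have h1 : 1 <= q by apply: le_trans pq; rewrite lerDr.
  have -> : 3 * Lam * (1 + p) = 3 * q by rewrite /q; ring.
  by move: zq y2 h1; clear; lra.
apply: le_trans (gl y); rewrite ler_expR lerD2r lerN2 ler_wpM2l ?(ltW k0)//.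
apply: (@le_trans _ _ (2 `^ al)).
  apply: powR_le; rewrite ?(ltW al0)// ler_norml (ltW y2) (le_trans y1)//.
  by rewrite (le_trans (lerN10 _))// ler0n.
by rewrite -[leRHS]powRr1// ler_powR ?ler1n// ltW.
Qed.

End crossing_bounds.

(** * A priori bounds and the reference density *)

Section balanced_bounds.
Context {R : realType} (al : R).
Hypothesis al01 : 0 < al < 1.
Let al0 : 0 < al. Proof. by case/andP: al01. Qed.
Let al1 : al < 1. Proof. by case/andP: al01. Qed.
Implicit Types (f g w : R -> R) (x y z t a b c k B p : R).

(** Let [-A, A] carry three quarters of the mass. There the kernel is at least |x|^al - 2 A^al,
    elsewhere at least -|x|^al, and 3/4 - 1/4 leaves half of the mass. *)
Lemma pot_ge f : itg f -> (forall x, 0 <= f x) -> 0 < integ f ->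
  exists K, forall x, integ f / 2 * absal al x - K <= pot al f x.
Proof.
move=> If f0 M0; have mf := itg_meas If.
have [A A0 HA] : exists2 A, 0 <= A & 3 / 4 * integ f <= integ (fun y => ind (- A <= y <= A) * f y).
  have lt1 : 3 / 4 * integ f < integ f by move: M0; clear -al01 al0 al1; lra.
  have := integ_lim_sym If => /cvgr_gt /(_ _ lt1) [n _ /(_ n (leqnn n)) /= /ltW H].
  by exists n%:R.
set MA := integ (fun y => ind (- A <= y <= A) * f y) in HA.
have IA : itg (fun y => ind (- A <= y <= A) * f y).
  by apply: itg_indl => //; apply: measurable_and; apply: measurable_fun_ler.
exists (2 * A `^ al * integ f) => x.
pose h y := absal al x * (2 * (ind (- A <= y <= A) * f y) - f y) - 2 * A `^ al * (ind (- A <= y <= A) * f y).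
have Ih1 := itgB (itgZ 2 IA) If.
have Ih : itg h by apply: itgB; apply: itgZ.
have MAM : MA <= integ f.
  by apply: le_integ => // y; rewrite ler_piMl// ind_le1.
apply: (@le_trans _ _ (integ h)).
  rewrite /h (integB (itgZ _ Ih1) (itgZ _ IA)) (integZ _ Ih1) (integZ _ IA) (integB (itgZ 2 IA) If) (integZ _ IA) -/MA.
  apply: lerB; last by rewrite ler_wpM2l// mulr_ge0// powR_ge0.
  rewrite mulrC ler_wpM2l ?absal_ge0//.
  by move: HA; clear -al01 al0 al1; lra.
apply: le_integ; [exact: Ih|exact: pot_itg|] => y; rewrite /h.
have [yA|_] := boolP (- A <= y <= A); last first.
  rewrite /ind mul0r !mulr0 subr0 sub0r mulrN -mulNr ler_wpM2r//.
  have := absal_dist al01 (x - y) (- y); rewrite opprK subrK absalN ler_norml => /andP[h1 _].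
  exact: h1.
rewrite /ind mul1r.
have -> : absal al x * (2 * f y - f y) - 2 * A `^ al * f y = (absal al x - 2 * A `^ al) * f y by ring.
rewrite ler_wpM2r//.
have h1 : absal al y <= A `^ al by apply: powR_le => //; [exact: ltW|rewrite ler_norml].
have := absal_triangle al01 (x - y) y; rewrite subrK => h2.
by move: h1 h2; move: (absal al x) (absal al y) (absal al (x - y)) (A `^ al); clear -al01 al0 al1; move=> *; lra.
Qed.

Lemma balanced_bounds c f : 0 < c -> balanced al c f -> exists k k' K K',
  [/\ 0 < k, 0 < k', forall x, expR (- (k * absal al x) - K) <= f x,
     forall x, f x <= expR (- (k' * absal al x) + K') & forall x, `|f x| <= expR K'].
Proof.
move=> c0 bf; have [If [a fE]] := bf.
have M0 := balanced_mass_gt0 bf.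
have f0 x : 0 <= f x by rewrite ltW// (balanced_gt0 x bf).
have [K HK] := pot_ge If f0 M0.
have up x : f x <= expR (- (c * (integ f / 2) * absal al x) + (a + c * K)).
  rewrite fE ler_expR addrCA lerD2l.
  have -> : - (c * (integ f / 2) * absal al x) + c * K = - (c * (integ f / 2 * absal al x - K)) by ring.
  by rewrite lerN2 ler_wpM2l// ltW.
exists (c * integ f), (c * (integ f / 2)), (- a), (a + c * K); split => //.
- by rewrite mulr_gt0.
- by rewrite mulr_gt0// divr_gt0.
- move=> x; rewrite fE ler_expR opprK addrC lerD2l lerN2 -mulrA ler_wpM2l ?(ltW c0)//.
  have := pot_le al01 x If; rewrite (eq_integ (fun y => ger0_norm (f0 y))) mulrC.
  by apply: le_trans; exact: ler_norm.
- move=> x; rewrite ger0_norm//; apply: (le_trans (up x)); rewrite ler_expR gerDr oppr_le0.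
  by rewrite !mulr_ge0 ?absal_ge0// ltW// divr_gt0.
Qed.

Lemma exp_decay f k' K' : 0 < k' -> (forall x, 0 <= f x) ->
  (forall x, f x <= expR (- (k' * absal al x) + K')) -> exists B, forall x, `|f x| <= B * wt 2 x.
Proof.
move=> k0 f0 fu; have [C C0 HC] := stretched_exp al01 k0.
exists (expR K' * C) => x; rewrite ger0_norm//; apply: (le_trans (fu x)).
by rewrite expRD [leLHS]mulrC -[leRHS]mulrA ler_wpM2l ?expR_ge0.
Qed.

End balanced_bounds.

Section frame.
Context {R : realType} (al : R).
Hypothesis al01 : 0 < al < 1.
Let al0 : 0 < al. Proof. by case/andP: al01. Qed.
Let al1 : al < 1. Proof. by case/andP: al01. Qed.
Implicit Types (f g w : R -> R) (x y z t a b c k B p : R).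

(* frame is the even probability density with tail ftail on the half-line; it
   has the decay of a balanced density. *)
Definition ftail t : R := expR (1 - (1 + t) `^ al) / 2.
Definition frame x : R := al * wt (1 - al) x * ftail `|x|.

Lemma ftail_gt0 t : 0 < ftail t. Proof. by rewrite divr_gt0// expR_gt0. Qed.

Lemma frame_gt0 x : 0 < frame x.
Proof. by rewrite /frame !mulr_gt0 ?ftail_gt0 ?wt_gt0. Qed.

Lemma frameN x : frame (- x) = frame x. Proof. by rewrite /frame /wt normrN. Qed.

Lemma frame_continuous : continuous frame.
Proof.
move=> x; have x0 : 0 < 1 + `|x| by rewrite ltr_pwDl.
have c1 : {for x, continuous (fun x : R => 1 + `|x|)}.
  by apply: cvgD; [exact: cvg_cst|apply: cvg_norm; exact: cvg_id].
have cp b : {for x, continuous (fun x : R => (1 + `|x|) `^ b)}.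
  by apply: (@continuous_comp _ _ _ (fun x : R => 1 + `|x|) (fun y => y `^ b)); [exact: c1|exact: powR_continuous].
apply: cvgM; first by apply: cvgM; [exact: cvg_cst|exact: cp].
apply: cvgM; last exact: cvg_cst.
apply: (@continuous_comp _ _ _ (fun x : R => 1 - (1 + `|x|) `^ al) (@expR R)); last exact: continuous_expR.
by apply: cvgB; [exact: cvg_cst|exact: cp].
Qed.

Lemma frame_upper x : frame x <= expR (- (1 * absal al x) + 1).
Proof.
rewrite /frame /ftail mul1r.
have h1 : al * wt (1 - al) x <= 1.
  rewrite mulr_ile1 ?wt_ge0 ?(ltW al0) ?(ltW al1)//; apply: wt_le1.
  by rewrite subr_ge0 ltW.
apply: (@le_trans _ _ (1 * expR (1 - (1 + `|x|) `^ al))).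
  apply: ler_pM => //; rewrite ?mulr_ge0 ?wt_ge0 ?invr_ge0 ?expR_ge0 ?(ltW al0)//.
  by rewrite ler_piMr ?expR_ge0// invf_le1// ler1n.
rewrite mul1r ler_expR addrC lerD2r lerN2; apply: powR_le; rewrite ?(ltW al0)//.
by rewrite lerDr.
Qed.

(** Of the two factors e^(-|x|^al) one bounds the tail and the other pays for the power weight. *)
Lemma frame_lower : exists K, forall x, expR (- (2 * absal al x) - K) <= frame x.
Proof.
have [C C0 HC] := stretched_exp al01 (@ltr01 R).
have r0 : 0 < al / (2 * C) by rewrite divr_gt0// mulr_gt0.
exists (- ln (al / (2 * C))) => x; rewrite opprK expRD lnK ?posrE//.
have h1 : expR (- (2 * absal al x)) = expR (- (1 * absal al x)) * expR (- absal al x).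
  by rewrite -expRD; congr expR; ring.
have h2 : expR (- absal al x) <= expR (1 - (1 + `|x|) `^ al).
  rewrite ler_expR; have := powR_subadd al01 ler01 (normr_ge0 x); rewrite one_powR.
  by rewrite -/(absal al x); move: (absal _ _) (_ `^ _); clear -al01 al0 al1; move=> *; lra.
have h3 : wt 2 x <= wt (1 - al) x.
  rewrite /wt ler_powR ?lerDl// lerN2; move: al0 => ?; lra.
rewrite h1 /frame /ftail.
have -> : expR (- (1 * absal al x)) * expR (- absal al x) * (al / (2 * C)) =
   al * (C^-1 * expR (- (1 * absal al x))) * (expR (- absal al x) / 2) by field; exact: lt0r_neq0.
apply: ler_pM; rewrite ?mulr_ge0 ?invr_ge0 ?expR_ge0 ?(ltW al0) ?(ltW C0)//.
  rewrite ler_wpM2l ?(ltW al0)//; apply: le_trans h3.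
  by rewrite ler_pdivrMl.
by rewrite ler_wpM2r ?invr_ge0.
Qed.

Lemma frame_decay : exists B, forall x, `|frame x| <= B * wt 2 x.
Proof.
apply: (exp_decay al01 ltr01 _ frame_upper) => x; exact/ltW/frame_gt0.
Qed.

Lemma itg_frame : itg frame.
Proof.
have [B HB] := frame_decay; apply: (itg_le _ HB).
  by apply: continuous_measurable; exact: frame_continuous.
by apply: itgZ; apply: itg_wt; rewrite ltr1n.
Qed.

Lemma frame_le x : `|frame x| <= expR 1.
Proof.
rewrite ger0_norm ?(ltW (frame_gt0 x))//; apply: (le_trans (frame_upper x)).
by rewrite ler_expR gerDr oppr_le0 mul1r absal_ge0.
Qed.

Lemma is_derive_ftail t : -1 < t -> is_derive t (1:R) ftail (- (al * (1 + t) `^ (al - 1) * ftail t)).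
Proof.
move=> t1; have t0 : 0 < 1 * t + 1 by rewrite mul1r -ltrBlDr sub0r.
have d1 := @is_derive1_comp R (fun y => y `^ al) (fun r : R => 1 * r + 1) t _ _
  (is_derive1_powR al t0) (is_derive_affine 1 1 t).
have d2 : is_derive t (1:R) (fun r : R => 1 - (1 * r + 1) `^ al) (- (al * (1 * t + 1) `^ (al - 1) * 1)).
  have := @is_deriveB _ _ _ _ _ _ _ _ _ (is_derive_cst (1:R) t 1) d1.
  by rewrite sub0r.
have d3 := @is_derive1_comp R (@expR R) _ t _ _ (is_derive_expR _) d2.
have := @is_deriveZ _ _ _ _ 2^-1 _ _ _ d3.
rewrite (_ : _ \*: _ = ftail); last first.
  by apply/funext => r; rewrite /ftail /= /GRing.scale /= mul1r [r + 1]addrC mulrC.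
move=> H; apply: (is_derive_eq H); rewrite /GRing.scale /= /ftail !mul1r [t + 1]addrC; ring.
Qed.

Lemma ftail_cvg0 : ftail n%:R @[n --> \oo] --> (0 : R).
Proof.
have [C C0 HC] := stretched_exp al01 (@ltr01 R).
apply: (@squeeze_cvgr _ _ _ _ (fun=> 0) (fun n : nat => expR 1 * C * (n.+1%:R^-1 : R) `^ 1)).
- near=> n; rewrite (ltW (ftail_gt0 _)) /=.
  rewrite /ftail; apply: (@le_trans _ _ (expR (1 - (1 + n%:R) `^ al))).
    by rewrite ler_piMr ?expR_ge0// invf_le1// ler1n.
  rewrite expRD -mulrA ler_wpM2l ?expR_ge0//.
  have := HC n.+1%:R; rewrite mul1r /absal ger0_norm// nat1r => /le_trans; apply.
  rewrite ler_wpM2l ?(ltW C0)// /wt ger0_norm//.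
  apply: (@le_trans _ _ (n.+1%:R `^ (- 2))); first by apply: powR_le_neg; rewrite // lerDr.
  by rewrite -powR_inv1// -powRrM mulN1r ler_powR ?ler1n// lerN2 ler1n.
- exact: cvg_cst.
- rewrite -[X in _ --> X](mulr0 (expR 1 * C)); apply: cvgM; first exact: cvg_cst.
  exact: cvg_harmonic_powR.
Unshelve. all: by end_near. Qed.

Lemma tail_frame p : 0 <= p -> tail frame p = ftail p.
Proof.
move=> p0; have If := itg_frame; have mf := itg_meas If.
have E (n : nat) : p <= n%:R -> integ (fun z => ind (p <= z <= n%:R) * frame z) = ftail p - ftail n%:R.
  move=> pn; have [|||_ ->] := @ftc_in R (fun t => - ftail t) frame p n%:R pn.
  - move=> x /andP[px _]; have x0 : 0 < x by exact: le_lt_trans px.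
    have := is_derive_ftail (lt_trans (ltrN10 _) x0) => H.
    have := @is_deriveN _ _ _ _ _ _ _ H; rewrite opprK => H2; apply: (is_derive_eq H2).
    by rewrite /frame /wt gtr0_norm// opprB.
  - by apply: continuous_subspaceT; exact: frame_continuous.
  - apply: within_cont => x; rewrite /= in_itv/= => /andP[px _].
    have x1 : -1 < x by apply: lt_le_trans px; rewrite (lt_le_trans (ltrN10 _)).
    by apply: cvgN; exact: is_derive_cont (is_derive_ftail x1).
  - by rewrite opprK addrC.
have [|||||_ H] := @dct R (fun n z => ind (p <= z <= n%:R) * frame z) (fun z => ind (p <= z) * frame z) frame.
- by move=> n; mfun.
- by mfun.
- move=> z; apply: cvg_near_cst; near=> n.
  have zn : z <= n%:R by near: n; exact: nbhs_infty_ger.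
  by rewrite zn andbT.
- move=> n z; rewrite normrM !ger0_norm ?ind_ge0 ?(ltW (frame_gt0 _))//.
  by rewrite ler_piMl ?ind_le1 ?(ltW (frame_gt0 _)).
- exact: If.
have -> : tail frame p = integ (fun z => ind (p <= z) * frame z).
  apply: ae_eq_integ; [by mfun|by mfun|].
  by apply: ae_imp (ae_neq p) => z zp; rewrite [p <= z]le_eqVlt eq_sym (negbTE zp).
suff L : integ (fun z => ind (p <= z <= n%:R) * frame z) @[n --> \oo] --> ftail p.
  exact: (cvg_unique (@Rhausdorff R) H L).
rewrite -[X in _ --> X](subr0 (ftail p)).
apply: (@cvg_trans _ ((fun n : nat => ftail p - ftail n%:R) @ \oo)); last first.
  by apply: cvgB; [exact: cvg_cst|exact: ftail_cvg0].
apply: near_eq_cvg; near=> n; rewrite E//; near: n; exact: nbhs_infty_ger.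
Unshelve. all: by end_near. Qed.

Lemma frame_mass p : cdf frame p + tail frame p = 1.
Proof.
have If := itg_frame; have mf := itg_meas If.
have S q : cdf frame q + tail frame q = integ frame.
  rewrite -(integD (itg_cdf q If) (itg_tail q If)); apply: ae_eq_integ; [by mfun|exact: mf|].
  apply: ae_imp (ae_neq q) => z zq; rewrite -mulrDl /ind.
  by case: (ltgtP z q) zq => //= _ _; rewrite ?addr0 ?add0r mul1r.
rewrite S -(S 0) -{1}oppr0 -tail_reflect// (_ : (fun x => _) = frame); last first.
  by apply/funext => x; exact: frameN.
rewrite oppr0 oppr0 !tail_frame// /ftail addr0 one_powR subrr expR0.
by field.
Qed.

(** Thus [frame] is al (1 + |p|)^(al - 1) times its own smaller tail, the quantity comparable to its
    crossing energy. This is why it was chosen. *)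
Lemma frame_min p : Num.min (cdf frame p) (tail frame p) = ftail `|p|.
Proof.
have If := itg_frame.
have half t : 0 <= t -> ftail t <= 2^-1.
  move=> t0; rewrite /ftail -[leRHS]mul1r ler_wpM2r ?invr_ge0// -[leRHS](@expR0 R) ler_expR subr_le0.
  by rewrite -[leLHS](one_powR al); apply: powR_le; rewrite ?(ltW al0)// lerDl.
have fE : (fun x => frame (- x)) = frame by apply/funext => x; exact: frameN.
have := frame_mass p; have [p0|p0] := leP 0 p.
  rewrite (tail_frame p0) (ger0_norm p0).
  move: (cdf frame p) (ftail p) (half p p0) => q r hr h; rewrite min_r//.
  by move: h hr; clear -al01 al0 al1; lra.
have np0 : 0 <= - p by rewrite oppr_ge0 ltW.
have tN : cdf frame p = ftail `|p|.
  by rewrite -(tail_reflect p If) fE (tail_frame np0) (ltr0_norm p0).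
rewrite tN; move: (tail frame p) (ftail `|p|) (half _ (normr_ge0 p)) => q r hr h; rewrite min_l//.
by move: h hr; clear -al01 al0 al1; lra.
Qed.

Lemma frame_crossing : exists th1 th2, [/\ 0 < th1, 0 < th2,
  forall x, th1 * crossing al frame x <= frame x & forall x, frame x <= th2 * crossing al frame x].
Proof.
have If := itg_frame; have f0 x := ltW (frame_gt0 x).
have [B HB] := frame_decay; have [K HK] := frame_lower.
have [C1 C10 H1] := crossing_le al01 If f0 HB.
have [C2 C20 H2] := crossing_ge al01 (ltr0Sn R 1) ltr01 If HK frame_upper frame_le.
have fE x : frame x = al * (wt (1 - al) x * Num.min (cdf frame x) (tail frame x)).
  by rewrite frame_min /frame mulrA.
exists (al / C1), (al / C2); split; rewrite ?divr_gt0// => x.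
  by rewrite [leRHS]fE -mulrA ler_wpM2l ?(ltW al0)// ler_pdivrMl// mulrA.
by rewrite [leLHS]fE -[leRHS]mulrA ler_wpM2l ?(ltW al0)// ler_pdivlMl// mulrA.
Qed.

End frame.

(** * Transport maps *)

Section transport_energy.
Context {R : realType} (al : R).
Hypothesis al01 : 0 < al < 1.
Let al0 : 0 < al. Proof. by case/andP: al01. Qed.
Let al1 : al < 1. Proof. by case/andP: al01. Qed.
Implicit Types (f w : R -> R) (x y z t a b c k B p e K lam : R).

Definition between e K w := [/\ 0 < e, measurable_fun setT w, forall x, e <= w x & forall x, w x <= K].

(** The increasing map with derivative w that fixes 0. *)
Definition prim w x : R := integ (fun t => sgi x t * w t).

Lemma itg_prim e K w a b : between e K w -> itg (fun t => ind (a < t <= b) * w t).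
Proof.
move=> [e0 mw we wK]; have K0 : 0 <= K by apply: le_trans (wK 0); apply: le_trans (we 0); exact: ltW.
apply: (itg_le _ _ (itgZ K (itg_itv a b))); first by mfun.
move=> t; rewrite normrM (ger0_norm (ind_ge0 _)) mulrC ler_wpM2r ?ind_ge0//.
by rewrite ger0_norm// (le_trans (ltW e0)).
Qed.

Lemma prim_sub e K w a b : between e K w -> a <= b ->
  prim w b - prim w a = integ (fun t => ind (a < t <= b) * w t).
Proof.
move=> bw ab; have Is r : itg (fun t => sgi r t * w t).
  by apply: eq_itg (itgB (itg_prim 0 r bw) (itg_prim r 0 bw)) => t; rewrite /sgi mulrBl.
rewrite /prim -(integB (Is b) (Is a)); apply: eq_integ => t.
by rewrite -mulrBl (sgiB _ ab).
Qed.

Lemma prim_bounds e K w a b : between e K w -> a <= b ->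
  e * (b - a) <= prim w b - prim w a <= K * (b - a).
Proof.
move=> bw ab; have [e0 mw we wK] := bw; rewrite (prim_sub bw ab).
rewrite -(integ_itv ab) -(integZ e (itg_itv a b)) -(integZ K (itg_itv a b)).
apply/andP; split; (apply: le_integ;
  [by [exact: itgZ (itg_itv _ _)|exact: itg_prim bw]|by [exact: itgZ (itg_itv _ _)|exact: itg_prim bw]|]) => t.
  by rewrite mulrC ler_wpM2l ?ind_ge0.
by rewrite [leRHS]mulrC ler_wpM2l ?ind_ge0.
Qed.

Lemma prim0 w : prim w 0 = 0.
Proof.
rewrite /prim -[RHS](integ0 (R := R)); apply: eq_integ => t; rewrite /sgi.
by case: (ltgtP 0 t) => _; rewrite ?andbF /ind subr0 mul0r.
Qed.

Lemma prim_mono e K w a b : between e K w -> a < b -> prim w a < prim w b.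
Proof.
move=> bw ab; have /andP[h _] := prim_bounds bw (ltW ab); have [e0 _ _ _] := bw.
by rewrite -subr_gt0; apply: lt_le_trans h; rewrite mulr_gt0// subr_gt0.
Qed.

Lemma prim_meas w : measurable_fun setT w -> measurable_fun setT (prim w).
Proof.
move=> mw; apply: (measurable_param (f := fun p : R * R => sgi p.1 p.2 * w p.2)).
by rewrite /sgi; mfun.
Qed.

Lemma prim_le e K w v a b : between e K w -> between e K v -> (forall x, w x <= v x) -> a <= b ->
  prim w b - prim w a <= prim v b - prim v a.
Proof.
move=> bw bv wv ab; rewrite (prim_sub bw ab) (prim_sub bv ab).
apply: le_integ; [exact: itg_prim bw|exact: itg_prim bv|] => t.
by rewrite ler_wpM2l ?ind_ge0.
Qed.

Lemma primZ e K w lam x : between e K w -> prim (fun x => lam * w x) x = lam * prim w x.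
Proof.
move=> bw; have Is r : itg (fun t => sgi r t * w t).
  by apply: eq_itg (itgB (itg_prim 0 r bw) (itg_prim r 0 bw)) => t; rewrite /sgi mulrBl.
by rewrite /prim -(integZ _ (Is x)); apply: eq_integ => t; rewrite mulrCA.
Qed.

Variables (g : R -> R) (B : R).
Hypotheses (Ig : itg g) (g0 : forall x, 0 < g x) (gB : forall x, `|g x| <= B).

Definition tker w x b a : R := ind (a < x < b) * rk al (prim w b - prim w a).

Definition energy w x : R := integ (fun b => integ (fun a => tker w x b a * g a) * g b).

Lemma tker_ge0 w x b a : 0 <= tker w x b a.
Proof. by rewrite mulr_ge0 ?ind_ge0 ?rk_ge0. Qed.

Lemma tker_le e K w x b a : between e K w -> e `^ (1 - al) * tker w x b a <= ind (a < x < b) * rk al (b - a).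
Proof.
move=> bw; have [e0 _ _ _] := bw; rewrite /tker.
have [/andP[ax xb]|_] := boolP (a < x < b); last by rewrite /ind !mul0r mulr0.
rewrite /ind !mul1r; have ab : a < b by exact: lt_trans xb.
have /andP[h _] := prim_bounds bw (ltW ab).
have ba0 : 0 < b - a by rewrite subr_gt0.
have -> : rk al (b - a) = e `^ (1 - al) * rk al (e * (b - a)).
  rewrite /rk normrM (gtr0_norm e0) powRM// ?(ltW e0)// mulrA -powRD; last first.
    by rewrite (gt_eqF e0) implybT.
  by rewrite subrr powRr0 mul1r.
rewrite ler_wpM2l ?powR_ge0//; apply: powR_le_neg.
- by rewrite subr_ge0 ltW.
- by rewrite normr_gt0 mulf_neq0// ?lt0r_neq0.
have eb : 0 < e * (b - a) by rewrite mulr_gt0.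
by rewrite !gtr0_norm// (lt_le_trans eb).
Qed.

Lemma tker_itg e K w x : between e K w ->
  (forall b, itg (fun a => tker w x b a * g a)) /\
  itg (fun b => integ (fun a => tker w x b a * g a) * g b).
Proof.
move=> bw; have [e0 mw _ _] := bw; have mp := prim_meas mw; have mr := @rk_meas R al.
have ee : 0 < e `^ (1 - al) by rewrite powR_gt0.
(* Gaps under [prim w] are at least e times the original ones, so this factor brings the kernel
   below the Riesz kernel, as [pair_fubini] asks. *)
pose k (q : R * R) := e `^ (1 - al) * tker w x q.1 q.2.
have mk : measurable_fun setT k by rewrite /k /tker; mfun.
have bk q : `|k q| <= rk al (q.1 - q.2).
  rewrite ger0_norm; last by rewrite mulr_ge0 ?tker_ge0// ltW.
  by apply: (le_trans (tker_le x q.1 q.2 bw)); rewrite ler_piMl ?rk_ge0 ?ind_le1.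
have [I J _] := pair_fubini al01 mk bk Ig gB.
have en := lt0r_neq0 ee.
have Ib b : itg (fun a => tker w x b a * g a).
  by apply: eq_itg (itgZ (e `^ (1 - al))^-1 (I b)) => a; rewrite /k /= -!mulrA mulKf.
split=> //; apply: eq_itg (itgZ (e `^ (1 - al))^-1 J) => b.
rewrite mulrA; congr (_ * _); rewrite -(integZ _ (I b)); apply: eq_integ => a.
by rewrite /k /= -!mulrA mulKf.
Qed.

(** A larger derivative moves points farther apart, and the kernel decreases with distance. *)
Lemma energy_le_energy e K w v x : between e K w -> between e K v -> (forall x, w x <= v x) ->
  energy v x <= energy w x.
Proof.
move=> bw bv wv; have [Iw Jw] := tker_itg x bw; have [Iv Jv] := tker_itg x bv.
apply: (le_integ Jv Jw) => b; apply: ler_wpM2r; first exact: ltW (g0 b).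
apply: (le_integ (Iv b) (Iw b)) => a; apply: ler_wpM2r; first exact: ltW (g0 a).
rewrite /tker.
have [/andP[ax xb]|_] := boolP (a < x < b); last by rewrite /ind !mul0r.
rewrite ler_wpM2l ?ind_ge0//; have ab : a < b by exact: lt_trans xb.
have w1 : 0 < prim w b - prim w a by rewrite subr_gt0 (prim_mono bw).
have v1 : 0 < prim v b - prim v a by rewrite subr_gt0 (prim_mono bv).
apply: powR_le_neg; rewrite ?normr_gt0 ?gt_eqF ?subr_ge0 ?(ltW al1)// !gtr0_norm//.
exact: prim_le bw bv wv (ltW ab).
Qed.

Lemma energyZ e K w lam x : between e K w -> 0 < lam ->
  energy (fun x => lam * w x) x = lam `^ (- (1 - al)) * energy w x.
Proof.
move=> bw l0; have [I J] := tker_itg x bw; rewrite /energy -(integZ _ J).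
have E b : integ (fun a => tker (fun x => lam * w x) x b a * g a) =
    lam `^ (- (1 - al)) * integ (fun a => tker w x b a * g a).
  rewrite -(integZ _ (I b)); apply: eq_integ => a; rewrite /tker !(primZ lam _ bw) -mulrBr.
  by rewrite /rk normrM (gtr0_norm l0) powRM ?(ltW l0)//; ring.
by apply: eq_integ => b; exact: (etrans (congr1 (fun r => r * g b) (E b)) (esym (mulrA _ _ _))).
Qed.

Lemma energy_cst c x : 0 < c -> energy (fun=> c) x = c `^ (- (1 - al)) * crossing al g x.
Proof.
move=> c0; have b1 : between 1 1 (fun=> 1 : R) by split=> //; exact: measurable_cst.
have E a b : a < b -> prim (fun=> 1) b - prim (fun=> 1) a = b - a.
  by move=> ab; have := prim_bounds b1 (ltW ab); rewrite !mul1r => /andP[h1 h2]; apply/le_anti/andP.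
have E1 b : integ (fun a => tker (fun=> 1) x b a * g a) = integ (fun a => ind (a < x < b) * rk al (b - a) * g a).
  apply: eq_integ => a; congr (_ * _); rewrite /tker.
  have [/andP[ax xb]|_] := boolP (a < x < b); last by rewrite /ind !mul0r.
  by rewrite (E _ _ (lt_trans ax xb)).
have E2 : energy (fun=> 1) x = crossing al g x by apply: eq_integ => b; rewrite E1.
have := energyZ x b1 c0; rewrite E2.
have -> : (fun _ : R => c * 1) = (fun=> c) by apply/funext => y; rewrite mulr1.
by [].
Qed.

Lemma energy_meas w : measurable_fun setT w -> measurable_fun setT (energy w).
Proof.
move=> mw; have mp := prim_meas mw; have mr := @rk_meas R al; have mg := itg_meas Ig.
apply: (measurable_param (f := fun q : R * R => integ (fun a => tker w q.1 q.2 a * g a) * g q.2)).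
apply: measurable_funM; last by mfun.
apply: (measurable_param (f := fun q : (R * R) * R => tker w q.1.1 q.1.2 q.2 * g q.2)).
have m1 : measurable_fun setT (fun q : (R * R) * R => q.1.1).
  by apply: (measurableT_comp measurable_fst); exact: measurable_fst.
have m2 : measurable_fun setT (fun q : (R * R) * R => q.1.2).
  by apply: (measurableT_comp measurable_snd); exact: measurable_fst.
have m3 : measurable_fun setT (fun q : (R * R) * R => q.2) by exact: measurable_snd.
have mp2 := measurableT_comp mp m2; have mp3 := measurableT_comp mp m3.
apply: measurable_funM; last exact: (measurableT_comp mg m3).
apply: measurable_funM.
  by apply: measurable_ind; apply: measurable_and; apply: measurable_fun_ltr.
by apply: (measurableT_comp mr); exact: measurable_funB.
Qed.

Lemma energy_between e K w x : between e K w ->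
  K `^ (- (1 - al)) * crossing al g x <= energy w x <= e `^ (- (1 - al)) * crossing al g x.
Proof.
move=> bw; have [e0 mw we wK]:= bw.
have K0 : 0 < K by apply: lt_le_trans (le_trans (we 0) (wK 0)).
have eK : e <= K by exact: le_trans (we 0) (wK 0).
have bK : between e K (fun=> K) by split=> //; exact: measurable_cst.
have be : between e K (fun=> e) by split=> //; exact: measurable_cst.
rewrite -(energy_cst x K0) -(energy_cst x e0); apply/andP; split.
  exact: energy_le_energy bw bK wK.
exact: energy_le_energy be bw we.
Qed.

Variables (kappa th1 th2 : R).
Hypotheses (kappa0 : 0 < kappa) (th10 : 0 < th1) (th20 : 0 < th2).
Hypothesis gth1 : forall x, th1 * crossing al g x <= g x.
Hypothesis gth2 : forall x, g x <= th2 * crossing al g x.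

Lemma crossing_gt0 x : 0 < crossing al g x.
Proof. by rewrite -(pmulr_rgt0 _ th20); exact: lt_le_trans (g0 x) (gth2 x). Qed.

Lemma energy_gt0 e K w x : between e K w -> 0 < energy w x.
Proof.
move=> bw; have /andP[h _] := energy_between x bw; have [e0 _ we wK] := bw.
apply: lt_le_trans h; rewrite mulr_gt0 ?powR_gt0 ?crossing_gt0//.
exact: lt_le_trans (le_trans (we 0) (wK 0)).
Qed.

(* If X = prim w transports g to f, then energy w x = crossing f (X x) and
   f (X x) = g x / w x, so f = kappa crossing f exactly when w is a fixed point. *)
Definition transport w x : R := g x / (kappa * energy w x).

Lemma transport_le e K w v x : between e K w -> between e K v -> (forall x, w x <= v x) ->
  transport w x <= transport v x.
Proof.
move=> bw bv wv; move: (energy_gt0 x bw) (energy_gt0 x bv) (energy_le_energy x bw bv wv).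
rewrite /transport; move: (energy w x) (energy v x) => E F E0 F0 FE.
rewrite ler_wpM2l ?(ltW (g0 x))// lef_pV2 ?posrE ?mulr_gt0// ler_wpM2l ?(ltW kappa0)//.
Qed.

Lemma transportZ e K w lam x : between e K w -> 0 < lam ->
  transport (fun x => lam * w x) x = lam `^ (1 - al) * transport w x.
Proof.
move=> bw l0; rewrite /transport (energyZ x bw l0) powRN.
have E1 := lt0r_neq0 (energy_gt0 x bw); have k1 := lt0r_neq0 kappa0.
have p1 : lam `^ (1 - al) != 0 by rewrite gt_eqF// powR_gt0.
by move: (energy w x) (lam `^ _) E1 p1 => E p E1 p1; field; rewrite k1 E1 p1.
Qed.

Lemma transport_between e K w x : between e K w ->
  e `^ (1 - al) * (th1 / kappa) <= transport w x <= K `^ (1 - al) * (th2 / kappa).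
Proof.
move=> bw; move: (energy_between x bw) (energy_gt0 x bw) (gth1 x) (gth2 x).
have [e0 _ we wK] := bw; have K0 : 0 < K by apply: lt_le_trans (le_trans (we 0) (wK 0)).
rewrite /transport; move: (energy w x) (crossing al g x) => E c /andP[h1 h2] E0 H1 H2.
rewrite powRN ler_pdivlMl ?powR_gt0// mulrC in h2.
rewrite powRN ler_pdivrMl ?powR_gt0// mulrC in h1.
have kE : 0 < kappa * E by rewrite mulr_gt0.
have k1 := lt0r_neq0 kappa0; have e1 := lt0r_neq0 E0.
have pe : 0 <= e `^ (1 - al) by exact: powR_ge0.
have pK : 0 <= K `^ (1 - al) by exact: powR_ge0.
apply/andP; split.
  rewrite ler_pdivlMr//.
  have -> : e `^ (1 - al) * (th1 / kappa) * (kappa * E) = th1 * (E * e `^ (1 - al)) by field.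
  by apply: le_trans H1; rewrite ler_wpM2l// ltW.
rewrite ler_pdivrMr//.
have -> : K `^ (1 - al) * (th2 / kappa) * (kappa * E) = th2 * (E * K `^ (1 - al)) by field.
by apply: (le_trans H2); rewrite ler_wpM2l// ltW.
Qed.

Lemma transport_meas e K w : between e K w -> measurable_fun setT (transport w).
Proof.
move=> bw; have [_ mw _ _] := bw; have mE := energy_meas mw; have mg := itg_meas Ig.
apply: measurable_funM; first exact: mg.
apply: measurable_inv_comp; first by apply: measurable_funM; [exact: measurable_cst|exact: mE].
by move=> x; exact: mulr_ge0 (ltW kappa0) (ltW (energy_gt0 x bw)).
Qed.

Lemma cvg_powR_geometric c : 0 < c -> c `^ ((1 - al) ^+ n) @[n --> \oo] --> (1 : R).
Proof.
move=> c0; have c1 : (1 - al) ^+ n @[n --> \oo] --> (0 : R).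
  by apply: cvg_expr; rewrite ger0_norm ?subr_ge0 ?(ltW al1)// ltrBlDr ltrDl.
rewrite -[X in _ --> X](@expR0 R) -[X in _ --> expR X](mul0r (ln c)).
rewrite (_ : (fun n => _) = (fun n => expR ((1 - al) ^+ n * ln c))); last first.
  by apply/funext => n; rewrite /powR gt_eqF.
apply: (@cvg_comp _ _ _ (fun n => (1 - al) ^+ n * ln c) (@expR R) \oo (nbhs (0 * ln c))).
  by apply: cvgM => //; exact: cvg_cst.
exact: continuous_expR.
Qed.

Lemma le_cvg (u : nat -> R) a b : u n @[n --> \oo] --> b -> (forall n, a <= u n) -> a <= b.
Proof. by move=> ub H; apply: (cvgr_to_ge ub); exact: nearW. Qed.

(* By homogeneity, a bound r on the ratio of two fixed points improves to r^(1 - al). *)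
Lemma transport_unique e K w v : between e K w -> between e K v ->
  (forall x, transport w x = w x) -> (forall x, transport v x = v x) -> forall x, w x = v x.
Proof.
suff le e' K' w' v' : between e' K' w' -> between e' K' v' -> (forall x, transport w' x = w' x) ->
    (forall x, transport v' x = v' x) -> forall x, w' x <= v' x.
  move=> bw bv fw fv x; apply/le_anti/andP; split.
    exact: (le _ _ _ _ bw bv fw fv x).
  exact: (le _ _ _ _ bv bw fv fw x).
move=> bw bv fw fv x; have [e0 mw we wK] := bw; have [_ mv ve vK] := bv.
have eK : e' <= K' by exact: le_trans (we 0) (wK 0).
have K0 : 0 < K' by exact: lt_le_trans eK.
pose r (n : nat) := (K' / e') `^ ((1 - al) ^+ n).
have r0 n : 0 < r n by rewrite powR_gt0// divr_gt0.
have r1 n : 1 <= r n.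
  rewrite -[leLHS](one_powR ((1 - al) ^+ n)); apply: powR_le => //.
    by rewrite exprn_ge0// subr_ge0 ltW.
  by rewrite ler_pdivlMr// mul1r.
have step n y : w' y <= r n * v' y.
  elim: n y => [|n IH] y.
    rewrite /r expr0 powRr1 ?divr_ge0 ?(ltW e0) ?(ltW K0)//.
    rewrite mulrAC ler_pdivlMr//; exact: (ler_pM (le_trans (ltW e0) (we y)) (ltW e0) (wK y) (ve y)).
  have bwr : between e' (r n * K') w'.
    by split=> // z; apply: (le_trans (wK z)); rewrite ler_peMl// ltW.
  have bvr : between e' (r n * K') (fun x => r n * v' x).
    split=> [||z|z]; [exact: e0|by apply: measurable_funM| |by rewrite ler_wpM2l ?(ltW (r0 n))].
    by apply: (le_trans (ve z)); rewrite ler_peMl// (le_trans (ltW e0)).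
  rewrite -(fw y); apply: (le_trans (transport_le y bwr bvr IH)).
  rewrite (transportZ y bv (r0 n)) (fv y) /r -powRrM exprSr.
  by [].
have rc : r n * v' x @[n --> \oo] --> v' x.
  rewrite -[X in _ --> X]mul1r; apply: cvgM; last exact: cvg_cst.
  by apply: cvg_powR_geometric; rewrite divr_gt0.
by apply: (le_cvg rc) => n; exact: step.
Qed.

Lemma transport_fixed : exists e K w, between e K w /\ forall x, transport w x = w x.
Proof.
have a1 : 0 < th1 / kappa by rewrite divr_gt0.
have a2 : 0 < th2 / kappa by rewrite divr_gt0.
(* The constants with e^(1 - al) th1 / kappa = e and K^(1 - al) th2 / kappa = K, so that [transport]
   maps the order interval [e, K] into itself. *)
pose e := (th1 / kappa) `^ al^-1; pose K := (th2 / kappa) `^ al^-1.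
have e0 : 0 < e by rewrite powR_gt0.
have th12 : th1 <= th2.
  by move: (crossing_gt0 0) (le_trans (gth1 0) (gth2 0)); move: (crossing al g 0) => c c0; rewrite ler_pM2r.
have eK : e <= K.
  by apply: powR_le; rewrite ?invr_ge0 ?(ltW al0) ?(ltW a1)// ler_wpM2r// invr_ge0 ltW.
have K0 : 0 < K by exact: lt_le_trans eK.
have fixc c : 0 < c -> (c `^ al^-1) `^ (1 - al) * c = c `^ al^-1.
  move=> c0; rewrite -powRrM -{2}(powRr1 (ltW c0)) -powRD; last by rewrite (gt_eqF c0) implybT.
  by congr (_ `^ _); field; exact: lt0r_neq0.
have bT w : between e K w -> between e K (transport w).
  move=> bw; split => [||x|x]; [exact: e0|exact: transport_meas bw| |].
    have /andP[h _] := transport_between x bw; apply: le_trans h.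
    by rewrite /e fixc.
  have /andP[_ h] := transport_between x bw; apply: (le_trans h).
  by rewrite /K fixc.
have be : between e K (fun=> e) by split=> //; exact: measurable_cst.
have bK : between e K (fun=> K) by split=> //; exact: measurable_cst.
(* [u] increases, [U] decreases, and their ratio is at most (K / e)^((1 - al)^n), which tends to
   1. *)
pose u n := iter n transport (fun=> e); pose U n := iter n transport (fun=> K).
have bu n : between e K (u n) by elim: n => //= n; exact: bT.
have bU n : between e K (U n) by elim: n => //= n; exact: bT.
have uS n x : u n x <= u n.+1 x.
  elim: n x => [x|n IH x]; first by have [_ _ h _] := bu 1%N.
  exact: transport_le (bu n) (bu n.+1) IH.
have US n x : U n.+1 x <= U n x.
  elim: n x => [x|n IH x]; first by have [_ _ _ h] := bU 1%N.
  exact: transport_le (bU n.+1) (bU n) IH.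
have uU n x : u n x <= U n x.
  elim: n x => [x|n IH x]; first exact: eK.
  exact: transport_le (bu n) (bU n) IH.
pose r (n : nat) := (K / e) `^ ((1 - al) ^+ n).
have r0 n : 0 < r n by rewrite powR_gt0// divr_gt0.
have r1 n : 1 <= r n.
  rewrite -[leLHS](one_powR ((1 - al) ^+ n)); apply: powR_le => //.
    by rewrite exprn_ge0// subr_ge0 ltW.
  by rewrite ler_pdivlMr// mul1r.
have Ur n x : U n x <= r n * u n x.
  elim: n x => [x|n IH x].
    by rewrite /r expr0 powRr1 ?divr_ge0 ?(ltW e0) ?(ltW K0)//= divfK ?lt0r_neq0.
  have [_ mu_ ue uK] := bu n; have [_ mU Ue UK] := bU n.
  have bUr : between e (r n * K) (U n).
    by split=> // z; apply: (le_trans (UK z)); rewrite ler_peMl// ltW.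
  have bur : between e (r n * K) (fun x => r n * u n x).
    split=> [||z|z]; [exact: e0|by apply: measurable_funM| |by rewrite ler_wpM2l ?(ltW (r0 n))].
    by apply: (le_trans (ue z)); rewrite ler_peMl// (le_trans (ltW e0)).
  apply: (le_trans (transport_le x bUr bur IH)).
  by rewrite (transportZ x (bu n) (r0 n)) /r -powRrM exprSr.
have ndu x : nondecreasing_seq (u ^~ x) by apply/nondecreasing_seqP => n; exact: uS.
have niU x : nonincreasing_seq (U ^~ x) by apply/nonincreasing_seqP => n; exact: US.
have ubu x : has_ubound (range (u ^~ x)).
  by exists K => _ [n _ <-]; have [_ _ _ h] := bu n; exact: h.
have cu x : cvgn (u ^~ x) by apply: nondecreasing_is_cvgn.
pose w x := limn (u ^~ x).
have uw n x : u n x <= w x by exact: nondecreasing_cvgn_le.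
have wU n x : w x <= U n x.
  apply: limr_le; first exact: cu.
  apply: nearW => m; apply: (@le_trans _ _ (u (maxn m n) x)); first by apply: ndu; rewrite leq_maxl.
  by apply: (le_trans (uU _ x)); apply: niU; rewrite leq_maxr.
have bw : between e K w.
  split=> [||x|x]; [exact: e0| | |exact: wU 0%N x].
    apply: (@measurable_fun_cvg _ _ _ setT u) => [n|x _]; [by have [] := bu n|exact: cu].
  exact: uw 0%N x.
(* The image of w is at most [U n.+1], hence at most r n.+1 * u n.+1 <= r n.+1 * w, and r tends to
   1: no limit is taken under the energy integrals. *)
exists e, K, w; split=> // x; apply/le_anti/andP; split.
  have rc : r n.+1 * w x @[n --> \oo] --> w x.
    rewrite -[X in _ --> X]mul1r; apply: cvgM; last exact: cvg_cst.
    have := @cvg_powR_geometric (K / e) (divr_gt0 K0 e0).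
    rewrite -(cvg_shiftn 1) (_ : [sequence _]_n = (fun n => r n.+1))//.
    by apply/funext => n; rewrite /r /= addn1.
  apply: (le_cvg rc) => n.
  apply: (le_trans (transport_le x bw (bU n) (wU n))); apply: (le_trans (Ur n.+1 x)).
  by rewrite ler_wpM2l ?(ltW (r0 _)).
apply: limr_le; first exact: cu.
apply: nearW => n; apply: (le_trans (uS n x)); exact: transport_le (bu n) bw (uw n).
Qed.

End transport_energy.

(** * Distribution functions and images of densities *)

Section distribution_functions.
Context {R : realType}.
Implicit Types (f g w X : R -> R) (x y z t a b c k B p e K : R).

Lemma cdf_tail f p : itg f -> cdf f p + tail f p = integ f.
Proof.
move=> If; have mf := itg_meas If; rewrite -(integD (itg_cdf p If) (itg_tail p If)).
apply: ae_eq_integ; [by mfun|exact: mf|].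
apply: ae_imp (ae_neq p) => z zp; rewrite -mulrDl /ind.
by case: (ltgtP z p) zp => //= _ _; rewrite ?addr0 ?add0r mul1r.
Qed.

Lemma tail_sub f a b : itg f -> a <= b -> tail f a - tail f b = integ (fun z => ind (a < z <= b) * f z).
Proof.
move=> If ab; rewrite /tail -(integB (itg_tail a If) (itg_tail b If)); apply: eq_integ => z.
rewrite -mulrBl; congr (_ * _); rewrite /ind.
have [az|za] := ltP a z; have [bz|zb] := ltP b z => /=; rewrite ?subrr ?subr0//.
by have := lt_le_trans bz (le_trans za ab); rewrite ltxx.
Qed.

Lemma cdf_sub f a b : itg f -> a <= b -> cdf f b - cdf f a = integ (fun z => ind (a < z <= b) * f z).
Proof.
move=> If ab; rewrite -(tail_sub If ab); have := cdf_tail a If; have := cdf_tail b If.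
by move: (cdf f a) (cdf f b) (tail f a) (tail f b) => ca cb ta tb <-; lra.
Qed.

Lemma itg_segment f a b : itg f -> itg (fun z => ind (a < z <= b) * f z).
Proof.
move=> If; apply: itg_indl => //; apply: measurable_and; [exact: measurable_fun_ltr|exact: measurable_fun_ler].
Qed.

Lemma cdf_lt f a b : itg f -> (forall x, 0 < f x) -> a < b -> cdf f a < cdf f b.
Proof.
move=> If f0 ab; rewrite -subr_gt0 (cdf_sub If (ltW ab)).
apply: (integ_gt0 (itg_segment a b If) _ ab) => x.
  by rewrite mulr_ge0 ?ind_ge0 ?(ltW (f0 x)).
by move=> /andP[ax xb]; rewrite ax (ltW xb) /ind mul1r.
Qed.

Lemma lipschitz_cont (F : R -> R) L : (forall a b, `|F b - F a| <= L * `|b - a|) -> continuous F.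
Proof.
move=> FL x; apply/cvgrPdist_le => e e0.
have c : (fun z => L * `|x - z|) @ x --> (0 : R).
  have E : L * `|x - x| = 0 by rewrite subrr normr0 mulr0.
  rewrite -[X in _ --> X]E; apply: cvgM; first exact: cvg_cst.
  by apply: cvg_norm; apply: cvgB; [exact: cvg_cst|exact: cvg_id].
move/cvgrPdist_le : c => /(_ e e0); apply: filterS => z.
rewrite sub0r normrN => h; apply: (le_trans (FL z x)); exact: le_trans (ler_norm _) h.
Qed.

Lemma cdf_continuous f B : itg f -> (forall x, `|f x| <= B) -> continuous (cdf f).
Proof.
move=> If fB x; have mf := itg_meas If; have B0 : 0 <= B by exact: le_trans (fB 0).
move: x; apply: (@lipschitz_cont _ B) => a b.
wlog ab : a b / a <= b => [H|].
  by have [/H//|/ltW ba] := leP a b; rewrite distrC [`|b - a|]distrC; exact: H.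
rewrite (cdf_sub If ab) (ger0_norm (_ : 0 <= b - a)) ?subr_ge0//.
rewrite -(integ_itv ab) -(integZ _ (itg_itv a b)).
apply: norm_integ_le; [by mfun| |exact: itgZ (itg_itv a b)].
by move=> z; rewrite normrM (ger0_norm (ind_ge0 _)) mulrC ler_wpM2r ?ind_ge0.
Qed.

Lemma tail_cvg0 f : itg f -> tail f n%:R @[n --> \oo] --> (0 : R).
Proof.
move=> If; have mf := itg_meas If.
have [|||||_] := @dct R (fun n z => ind (n%:R < z) * f z) (fun=> 0) (fun z => `|f z|).
- by move=> n; mfun.
- exact: measurable_cst.
- move=> z; apply: cvg_near_cst; near=> n.
  have zn : z <= n%:R by near: n; exact: nbhs_infty_ger.
  by rewrite ltNge zn /ind mul0r.
- by move=> n z; rewrite normrM (ger0_norm (ind_ge0 _)) ler_piMl// ind_le1.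
- exact: itg_norm.
by rewrite integ0.
Unshelve. all: by end_near. Qed.

Lemma cdf_surj f B v : itg f -> (forall x, `|f x| <= B) -> 0 < v < integ f -> exists z, cdf f z = v.
Proof.
move=> If fB /andP[v0 vM]; have cf := cdf_continuous If fB.
have IfN : itg (fun x => f (- x)) by apply: eq_itg (itg_refl 0 If) => x; rewrite sub0r.
have [b vb] : exists2 b, 0 <= b & v <= cdf f b.
  have d0 : 0 < integ f - v by rewrite subr_gt0.
  have := tail_cvg0 If => /cvgr_lt /(_ _ d0) [n _ /(_ n (leqnn n)) /= H].
  exists n%:R => //; have := cdf_tail n%:R If; move: H.
  by move: (cdf f _) (tail f _) => c t; lra.
have [a va] : exists2 a, a <= 0 & cdf f a <= v.
  have := tail_cvg0 IfN => /cvgr_lt /(_ _ v0) [n _ /(_ n (leqnn n)) /= H].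
  exists (- n%:R); first by rewrite oppr_le0.
  by rewrite -(tail_reflect (- n%:R) If) opprK; exact: ltW H.
move=> av bv; have ab : a <= b by exact: le_trans va vb.
have [||c _ cE] := @IVT R (cdf f) a b v ab.
- exact: continuous_subspaceT.
- by rewrite ge_min av le_max bv orbT.
by exists c.
Qed.

Lemma homo_measurable X : {homo X : x y / x < y} -> measurable_fun setT X.
Proof.
move=> X_; have Xle : {homo X : x y / x <= y}.
  by move=> x y; rewrite le_eqVlt => /predU1P[->//|/X_/ltW].
by apply: nondecreasing_measurable.
Qed.

End distribution_functions.

Section transport_of_densities.
Context {R : realType} (al : R).
Hypothesis al01 : 0 < al < 1.
Let al0 : 0 < al. Proof. by case/andP: al01. Qed.
Let al1 : al < 1. Proof. by case/andP: al01. Qed.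
Implicit Types (f F G w X : R -> R) (x y z t a b c k B p e K : R).
Local Notation mu := (@lebesgue_measure R).

Lemma homo_lt X a b : {homo X : x y / x < y} -> (X a < X b) = (a < b).
Proof.
move=> hX; have [ab|ba] := ltP a b; first exact: hX.
move: ba; rewrite le_eqVlt => /predU1P[->|/hX ba]; first exact: ltxx.
by apply/negbTE; rewrite -leNgt ltW.
Qed.

(** Two changes of variables, one in each point of the pair; as X is increasing, being separated by
    X x pulls back to being separated by x. *)
Lemma crossing_transport X F G B x : {homo X : x y / x < y} ->
  itg F -> (forall x, 0 <= F x) -> (forall x, `|F x| <= B) ->
  (forall h : R -> R, measurable_fun setT h -> (forall z, 0 <= h z) ->
     integ (fun x => h (X x) * G x) = integ (fun z => h z * F z)) ->
  crossing al F (X x) =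
  integ (fun b => integ (fun a => ind (a < x < b) * rk al (X b - X a) * G a) * G b).
Proof.
move=> hX IF F0 FB cov; have mF := itg_meas IF; have mr := @rk_meas R al.
pose H z := integ (fun y => ind (y < X x < z) * rk al (z - y) * F y).
have mH : measurable_fun setT H.
  apply: (measurable_param (f := fun q : R * R => ind (q.2 < X x < q.1) * rk al (q.1 - q.2) * F q.2)).
  by mfun.
have H0 z : 0 <= H z by apply: integ_ge0 => y; rewrite !mulr_ge0 ?ind_ge0 ?rk_ge0.
rewrite /crossing -/H -(cov H mH H0).
have E b : H (X b) = integ (fun a => ind (a < x < b) * rk al (X b - X a) * G a).
  have m1 : measurable_fun setT (fun y => ind (y < X x < X b) * rk al (X b - y)) by mfun.
  rewrite /H -(cov _ m1).
    by apply: eq_integ => a; rewrite !(homo_lt _ _ hX).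
  by move=> z; rewrite mulr_ge0 ?ind_ge0 ?rk_ge0.
by apply: eq_integ => b; rewrite E.
Qed.

Lemma prim_homo e K w : between e K w -> {homo prim w : x y / x < y}.
Proof. by move=> bw x y; exact: prim_mono bw. Qed.

Lemma prim_surj e K w z : between e K w -> exists x, prim w x = z.
Proof.
move=> bw; have [e0 mw we wK] := bw.
have lip a b : `|prim w b - prim w a| <= K * `|b - a|.
  wlog ab : a b / a <= b => [H|].
    by have [/H//|/ltW ba] := leP a b; rewrite distrC [`|b - a|]distrC; exact: H.
  have /andP[h1 h2] := prim_bounds bw ab; rewrite (ger0_norm (_ : 0 <= b - a)) ?subr_ge0//.
  by rewrite ger0_norm// (le_trans _ h1)// mulr_ge0 ?subr_ge0 ?(ltW e0).
have cp := lipschitz_cont lip.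
have p0 := prim0 w.
(* As the slope is at least e, the map passes z between -r and r. *)
pose r := `|z| / e; have r0 : 0 <= r by rewrite divr_ge0// ltW.
have er : e * r = `|z| by rewrite /r mulrC divfK// lt0r_neq0.
have /andP[h1 _] := prim_bounds bw r0; rewrite p0 !subr0 er in h1.
have nr : - r <= 0 by rewrite oppr_le0.
have /andP[h2 _] := prim_bounds bw nr; rewrite p0 !sub0r opprK er in h2.
have [||c _ cE] := @IVT R (prim w) (- r) r z (le_trans nr r0).
- exact: continuous_subspaceT.
- rewrite ge_min le_max; apply/andP; split; apply/orP; [left|right].
    by rewrite lerNr in h2; apply: (le_trans h2); rewrite lerNl -normrN ler_norm.
  by apply: le_trans h1; exact: ler_norm.
by exists c.
Qed.

Lemma integral_segment f a b : itg (fun t => ind (a < t <= b) * f t) ->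
  (\int[mu]_(x in `]a, b]) (f x)%:E = (integ (fun t => ind (a < t <= b) * f t))%:E)%E.
Proof.
move=> If; rewrite -(EFin_integ If) [LHS]integral_mkcond; apply: eq_integral => x _.
rewrite patchE; case: ifPn => [|]; first by rewrite inE /= in_itv /= => ->; rewrite /ind mul1r.
by rewrite notin_setE /= in_itv /= => /negP/negbTE ->; rewrite /ind mul0r.
Qed.

Lemma homo_preimage X a b : {homo X : x y / x < y} -> X @^-1` `]X a, X b] = `]a, b]%classic.
Proof.
move=> hX; apply/seteqP; split => x /=; rewrite !in_itv/= (homo_lt _ _ hX) => /andP[-> /=];
  by rewrite !leNgt (homo_lt _ _ hX).
Qed.

Lemma homo_onto_meas X (Y : R -> R) : {homo X : x y / x < y} -> cancel Y X -> measurable_fun setT Y.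
Proof.
move=> hX XY; apply: homo_measurable => x y xy; rewrite ltNge; apply/negP.
rewrite le_eqVlt => /predU1P[yx|/hX]; last by rewrite !XY ltNge (ltW xy).
by move: xy; rewrite -(XY x) -(XY y) yx ltxx.
Qed.

(** Since X is onto, every interval has endpoints of the form X a and X b, so it suffices to compare
    masses on these. *)
Lemma measure_transport X (p q : R -> R) : {homo X : x y / x < y} -> (forall z, exists x, X x = z) ->
  (forall x, 0 <= p x) -> measurable_fun setT p -> (forall x, 0 <= q x) -> measurable_fun setT q ->
  (forall a b, itg (fun t => ind (a < t <= b) * p t)) ->
  (forall a b, itg (fun t => ind (a < t <= b) * q t)) ->
  (forall a b, a < b -> integ (fun t => ind (a < t <= b) * p t) = integ (fun z => ind (X a < z <= X b) * q z)) ->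
  forall h : R -> R, measurable_fun setT h -> (forall z, 0 <= h z) ->
    (\int[mu]_x (h (X x) * p x)%:E = \int[mu]_x (h x * q x)%:E)%E.
Proof.
move=> hX sX p0 mp q0 mq Ip Iq H h mh h0.
apply: (change_of_variables (homo_measurable hX) p0 mp q0 mq _ _ mh h0).
  move=> c d; have [a <-] := sX c; have [b <-] := sX d; rewrite (homo_lt _ _ hX) => ab.
  by rewrite (homo_preimage _ _ hX) !integral_segment// H.
by move=> c d; rewrite integral_segment// ltry.
Qed.

Lemma integ_transport X (p q : R -> R) :
  (forall h : R -> R, measurable_fun setT h -> (forall z, 0 <= h z) ->
    (\int[mu]_x (h (X x) * p x)%:E = \int[mu]_x (h x * q x)%:E)%E) ->
  forall h : R -> R, measurable_fun setT h -> (forall z, 0 <= h z) ->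
    integ (fun x => h (X x) * p x) = integ (fun x => h x * q x).
Proof. by move=> H h mh h0; rewrite /integ /Rintegral H. Qed.

Variables (g : R -> R) (B : R).
Hypotheses (Ig : itg g) (g0 : forall x, 0 < g x) (gB : forall x, `|g x| <= B).

(** f is the density of the image of g dx under the map with derivative w, so f (X x) = g x / w x,
    and the fixed-point equation becomes f = kappa times its crossing energy. *)
Lemma density_of_transport e K w kappa : 0 < kappa -> between e K w ->
  (forall x, transport al g kappa w x = w x) -> (forall x, 0 < energy al g w x) ->
  exists f, [/\ itg f, forall x, 0 < f x, forall x, `|f x| <= B / e &
      forall p, f p = kappa * crossing al f p].
Proof.
move=> k0 bw fw E0; have [e0 mw we wK] := bw.
have w0 x : 0 < w x by exact: lt_le_trans (we x).
have hX := prim_homo bw; have mg := itg_meas Ig; have sX z := prim_surj z bw.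
have [Y YX] : exists Y, forall z, prim w (Y z) = z by have [Y ?] := boolp.choice sX; exists Y.
have mY := homo_onto_meas hX YX.
have XY x : Y (prim w x) = x.
  apply/eqP; case: (ltgtP (Y (prim w x)) x) => // /hX; rewrite YX ltxx//.
pose f z := g (Y z) / w (Y z).
have fX x : f (prim w x) = g x / w x by rewrite /f XY.
have f0 x : 0 < f x by rewrite /f divr_gt0.
have mf : measurable_fun setT f.
  apply: measurable_funM; first exact: (measurableT_comp mg mY).
  by apply: measurable_inv_comp => [|x]; [exact: (measurableT_comp mw mY)|exact: ltW].
(* The map sends w dx to Lebesgue measure, hence g dx = (g / w) w dx to f dx. *)
have cov1 : forall h : R -> R, measurable_fun setT h -> (forall z, 0 <= h z) ->
    (\int[mu]_x (h (prim w x) * w x)%:E = \int[mu]_x (h x * 1)%:E)%E.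
  apply: (measure_transport hX sX _ mw _ (@measurable_cst _ _ _ _ _ _)) => //.
  - by move=> x; exact: ltW.
  - by move=> a b; exact: itg_prim bw.
  - by move=> a b; apply: eq_itg (itg_itv a b) => t; rewrite mulr1.
  - move=> a b ab; rewrite -(prim_sub bw (ltW ab)) -(integ_itv (ltW (hX _ _ ab))).
    by apply: eq_integ => t; rewrite mulr1.
have cov2 : forall h : R -> R, measurable_fun setT h -> (forall z, 0 <= h z) ->
    (\int[mu]_x (h (prim w x) * g x)%:E = \int[mu]_x (h x * f x)%:E)%E.
  move=> h mh h0; transitivity (\int[mu]_x (h x * f x * 1)%:E)%E; last first.
    by apply: eq_integral => x _; rewrite mulr1.
  rewrite -cov1; last 2 first.
  - exact: measurable_funM.
  - by move=> z; rewrite mulr_ge0// ltW.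
  by apply: eq_integral => x _; rewrite fX -mulrA divfK// lt0r_neq0.
have If : itg f.
  apply/itg_ge0P => //; first by move=> x; exact: ltW.
  have -> : (\int[mu]_x (f x)%:E = \int[mu]_x (1 * f x)%:E)%E by apply: eq_integral => x _; rewrite mul1r.
  rewrite -(cov2 (fun=> 1) (@measurable_cst _ _ _ _ _ _))//.
  by under eq_integral do rewrite mul1r; rewrite (EFin_integ Ig) ltry.
have fB x : `|f x| <= B / e.
  rewrite /f normrM (gtr0_norm (_ : 0 < (w (Y x))^-1)) ?invr_gt0//.
  by apply: ler_pM => //; rewrite ?invr_ge0 ?(ltW (w0 _))// lef_pV2// posrE.
exists f; split=> // p; have [x <-] := sX p.
rewrite (crossing_transport x hX If (fun x => ltW (f0 x)) fB (integ_transport cov2)) fX.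
have E1 := lt0r_neq0 (E0 x); have k1 := lt0r_neq0 k0; have w1 := lt0r_neq0 (w0 x).
apply: (canLR (mulfK w1)); move: (fw x) E1.
rewrite /transport -/(energy al g w x); move: (energy al g w x) => E <- E1.
by field; rewrite k1 E1.
Qed.

End transport_of_densities.

(** * Existence and uniqueness *)

Section existence.
Context {R : realType} (al : R).
Hypothesis al01 : 0 < al < 1.
Let al0 : 0 < al. Proof. by case/andP: al01. Qed.
Let al1 : al < 1. Proof. by case/andP: al01. Qed.

Lemma balanced_exists c : 0 < c -> exists f : R -> R, balanced al c f.
Proof.
move=> c0; have [th1 [th2 [t1 t2 g1 g2]]] := frame_crossing al01.
have Ig := itg_frame al01; have g0 := frame_gt0 al01; have gB := frame_le al01.
have ca : 0 < c * al by rewrite mulr_gt0.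
have [e [K [w [bw fw]]]] := transport_fixed al01 Ig g0 gB ca t1 t2 g1 g2.
have E0 x := energy_gt0 al01 Ig g0 gB t2 g2 x bw.
have [f [If f0 fB fN]] := density_of_transport Ig g0 gB ca bw fw E0.
have [D _ WD] := interaction_bound al01 If fB.
by exists f; apply: (flow_balanced al01 If fB WD (ltW c0) f0 fN).
Qed.

End existence.

Section uniqueness.
Context {R : realType} (al c : R).
Hypothesis al01 : 0 < al < 1.
Hypothesis c0 : 0 < c.
Let al0 : 0 < al. Proof. by case/andP: al01. Qed.
Let al1 : al < 1. Proof. by case/andP: al01. Qed.
Implicit Types (f g w v X : R -> R) (x y z t a b k B p e K L : R).
Local Notation g := (frame al).

(** Logarithms of tails control (1 + |.|)^al; raising to the power (1 - al) / al turns this into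
    control of the weight. *)
Lemma le_wt_of_powR x z L : 0 < L -> (1 + `|x|) `^ al <= L * (1 + `|z|) `^ al ->
  wt (1 - al) z <= L `^ ((1 - al) / al) * wt (1 - al) x.
Proof.
move=> L0 H; have x0 : 0 < 1 + `|x| by rewrite ltr_pwDl.
have z0 : 0 < 1 + `|z| by rewrite ltr_pwDl.
have b0 : 0 <= (1 - al) / al by rewrite divr_ge0 ?subr_ge0 ?ltW.
have := powR_le b0 (powR_ge0 _ _) H; rewrite powRM ?(ltW L0) ?powR_ge0// -!powRrM.
have -> : al * ((1 - al) / al) = 1 - al by field; exact: lt0r_neq0.
move=> h; rewrite /wt !powRN ler_pdivlMr ?powR_gt0// mulrC ler_pdivrMr ?powR_gt0//.
Qed.

Lemma balanced_crossing f : balanced al c f -> forall p, f p = c * al * crossing al f p.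
Proof.
move=> bf; have [If fE] := bf; have f0 x := balanced_gt0 x bf.
have [k [k' [K [K' [k0 k'0 fl fu fB]]]]] := balanced_bounds al01 c0 bf.
have [D _ WD] := interaction_bound al01 If fB.
apply: (balanced_flow al01 If fB WD (ltW c0) fE).
have [B HB] := exp_decay al01 k'0 (fun x => ltW (f0 x)) fu.
have B0 := wt_bound_ge0 HB.
apply/cvgrPdist_le => e e0; near=> n.
rewrite sub0r normrN; apply: (le_trans (HB _)).
have n0 : 0 < 1 + n%:R :> R by rewrite ltr_pwDl.
have : wt 2 n%:R <= (1 + n%:R : R)^-1.
  rewrite /wt (ger0_norm (ler0n _ _)) -[leRHS]powR_inv1 ?(ltW n0)//.
  by apply: ler_powR; rewrite ?lerDl ?ler0n// lerN2 ler1n.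
move=> h; apply: (le_trans (ler_wpM2l B0 h)); rewrite ler_pdivrMr//.
rewrite mulrC -ler_pdivrMr//; have : B / e <= n%:R by near: n; exact: nbhs_infty_ger.
by move/le_trans; apply; rewrite lerDr.
Unshelve. all: by end_near. Qed.

(** f is a multiple of its crossing energy, so the estimates of the latter compare f with its own
    smaller tail. The exponential bounds on f then pass to that tail; dividing by the weight costs
    half of the upper exponent. *)
Lemma balanced_min f : balanced al c f -> exists C1 C2 k k' K K', [/\ 0 < C1 /\ 0 < C2, 0 < k /\ 0 < k',
  forall z, C1 * wt (1 - al) z * Num.min (cdf f z) (tail f z) <= f z,
  forall z, f z <= C2 * wt (1 - al) z * Num.min (cdf f z) (tail f z) &
  forall z, expR (- (k * absal al z) - K) <= Num.min (cdf f z) (tail f z) <= expR (- (k' * absal al z) + K')].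
Proof.
move=> bf; have [If fE] := bf; have f0 x := balanced_gt0 x bf.
have [k [k' [K [K' [k0 k'0 fl fu fB]]]]] := balanced_bounds al01 c0 bf.
have [B HB] := exp_decay al01 k'0 (fun x => ltW (f0 x)) fu.
have [C1 C10 H1] := crossing_ge al01 k0 k'0 If fl fu fB.
have [C2 C20 H2] := crossing_le al01 If (fun x => ltW (f0 x)) HB.
have ca : 0 < c * al by rewrite mulr_gt0.
have fN := balanced_crossing bf.
have a0 : 0 <= 1 - al by rewrite subr_ge0 ltW.
have {}H1 z : c * al * C1 * wt (1 - al) z * Num.min (cdf f z) (tail f z) <= f z.
  by rewrite [leRHS]fN -!mulrA !ler_pM2l// mulrA.
have {}H2 z : f z <= c * al * C2 * wt (1 - al) z * Num.min (cdf f z) (tail f z).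
  by rewrite [leLHS]fN -!mulrA !ler_pM2l// mulrA.
have kh : 0 < k' / 2 by rewrite divr_gt0.
have [S S0 HS] := stretched_exp al01 kh.
exists (c * al * C1), (c * al * C2), k, (k' / 2), (K + ln (c * al * C2)), (K' + ln S - ln (c * al * C1)).
have p1 : 0 < c * al * C1 by rewrite mulr_gt0.
have p2 : 0 < c * al * C2 by rewrite mulr_gt0.
split=> // z; move: (H1 z) (H2 z); set m := Num.min _ _ => h1 h2.
have m0 : 0 <= m.
  rewrite /m le_min tail_ge0 ?andbT; last by move=> y; exact: ltW.
  by apply: integ_ge0 => y; rewrite mulr_ge0 ?ind_ge0// ltW.
apply/andP; split.
  rewrite opprD addrA [expR (_ - ln _)]expRD [expR (- ln _)]expRN lnK ?posrE// ler_pdivrMr//.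
  apply: (le_trans (fl z)); apply: (le_trans h2); rewrite mulrC ler_wpM2l//.
  by rewrite ler_piMr ?(ltW p2)// wt_le1.
have -> : - (k' / 2 * absal al z) + (K' + ln S - ln (c * al * C1)) =
   (- (k' * absal al z) + K') + (ln S + k' / 2 * absal al z) - ln (c * al * C1) by field.
rewrite expRD [expR (- ln _)]expRN lnK ?posrE// ler_pdivlMr// expRD.
apply: (@le_trans _ _ (f z * (wt (1 - al) z)^-1)).
  by rewrite ler_pdivlMr ?wt_gt0//; move: h1; rewrite -mulrA [wt _ _ * m]mulrC mulrA [c * al * C1 * m]mulrC.
apply: ler_pM; rewrite ?invr_ge0 ?wt_ge0 ?(ltW (f0 z)) ?fu//.
rewrite expRD lnK ?posrE// -[expR (_ * _)]invrK -expRN.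
have S1 : expR (- (k' / 2 * absal al z)) <= S * wt (1 - al) z.
  apply: (le_trans (HS z)); rewrite ler_wpM2l ?(ltW S0)//.
  apply: ler_powR; first by rewrite lerDl.
  by rewrite lerN2; move: al0 al1; clear -al01 al0 al1 c0; lra.
rewrite -ler_pdivrMr ?invr_gt0 ?expR_gt0// invrK mulrC ler_pdivrMr ?wt_gt0//.
Qed.

(** Monotone rearrangement: X matches the distribution function of f with that of the reference
    density times the mass of f. The right tails then match because the total masses do. *)
Lemma balanced_map f : balanced al c f -> exists X, [/\ {homo X : x y / x < y},
  forall z, exists x, X x = z, forall x, cdf f (X x) = integ f * cdf g x &
  forall x, tail f (X x) = integ f * tail g x].
Proof.
move=> bf; have [If fE] := bf; have f0 x := balanced_gt0 x bf.
have [k [k' [K [K' [k0 k'0 fl fu fB]]]]] := balanced_bounds al01 c0 bf.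
have M0 := balanced_mass_gt0 bf; have Mn := lt0r_neq0 M0.
have Ig := itg_frame al01; have g0 := frame_gt0 al01.
have gM : integ g = 1 by rewrite -(cdf_tail 0 Ig) frame_mass.
have cdf0 (h : R -> R) : itg h -> (forall x, 0 < h x) -> forall x, 0 < cdf h x < integ h.
  move=> Ih h0 x; have x1 : x - 1 < x by rewrite ltrBlDr ltrDl.
  have x2 : x < x + 1 by rewrite ltrDl.
  apply/andP; split.
    apply: le_lt_trans (cdf_lt Ih h0 x1); apply: integ_ge0 => y.
    by rewrite mulr_ge0 ?ind_ge0// ltW.
  apply: (lt_le_trans (cdf_lt Ih h0 x2)); rewrite -(cdf_tail (x + 1) Ih) lerDl.
  by apply: tail_ge0 => y; exact: ltW.
have cdf_mono (h : R -> R) a b : itg h -> (forall x, 0 < h x) -> cdf h a < cdf h b -> a < b.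
  move=> Ih h0 hab; rewrite ltNge; apply/negP; rewrite le_eqVlt => /predU1P[ba|/(cdf_lt Ih h0)].
    by move: hab; rewrite ba ltxx.
  by rewrite ltNge (ltW hab).
have ex x : exists z, cdf f z = integ f * cdf g x.
  apply: (cdf_surj If fB); have /andP[h1 h2] := cdf0 _ Ig g0 x.
  by rewrite mulr_gt0//= -[ltRHS]mulr1 ltr_pM2l// -gM.
have [X XE] : exists X : R -> R, forall x, cdf f (X x) = integ f * cdf g x.
  by have [X ?] := boolp.choice ex; exists X.
exists X; split=> //.
- move=> a b ab; apply: (cdf_mono f _ _ If f0); rewrite !XE ltr_pM2l//.
  exact: (cdf_lt Ig g0 ab).
- move=> z; have [x xE] : exists x, cdf g x = cdf f z / integ f.
    apply: (cdf_surj Ig (frame_le al01)); have /andP[h1 h2] := cdf0 _ If f0 z.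
    by rewrite divr_gt0//= ltr_pdivrMr// gM mul1r.
  exists x; have E : cdf f (X x) = cdf f z by rewrite XE xE mulrC divfK.
  by apply/eqP; case: ltgtP => // /(cdf_lt If f0); rewrite E ltxx.
move=> x; have h1 := cdf_tail (X x) If; have h2 := frame_mass al01 x.
rewrite XE in h1; have -> : tail g x = 1 - cdf g x by rewrite -h2 addrC addKr.
by rewrite mulrBr mulr1 -[X in X - _]h1 addrC addKr.
Qed.

(** Both f (X x) and the reference density are a weight times a smaller tail, and these tails agree
    up to the mass. Minus the logarithm of the common tail is comparable to (1 + |x|)^al on one side
    and, up to constants, to |X x|^al on the other, so the weights at x and X x are comparable as
    well. *)
Lemma map_distortion f X : balanced al c f ->
  (forall x, cdf f (X x) = integ f * cdf g x) -> (forall x, tail f (X x) = integ f * tail g x) ->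
  exists e K, 0 < e /\ forall x, e * f (X x) <= integ f * g x <= K * f (X x).
Proof.
move=> bf Xc Xt; have M0 := balanced_mass_gt0 bf.
have [C1 [C2 [k [k' [K [K' [[C10 C20] [k0 k'0] H1 H2 H3]]]]]]] := balanced_min bf.
have mE x : Num.min (cdf f (X x)) (tail f (X x)) = integ f * ftail al `|x|.
  by rewrite Xc Xt -(minr_pMr _ _ (ltW M0)) frame_min.
have lnm x : ln (integ f * ftail al `|x|) = ln (integ f / 2) + 1 - (1 + `|x|) `^ al.
  rewrite /ftail mulrCA.
  have M2 : 0 < integ f / 2 by rewrite divr_gt0.
  rewrite (lnM (expR_gt0 _) M2) expRK.
  by move: (ln _) (_ `^ _) => *; ring.
have m0 x : 0 < integ f * ftail al `|x| by rewrite mulr_gt0// divr_gt0// expR_gt0.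
pose l := ln (integ f / 2) + 1.
pose L1 := k + `|K + l|; pose L2 := 1 + (1 + `|K' - l|) / k'.
have L10 : 0 < L1 by rewrite ltr_pwDl.
have L20 : 0 < L2 by rewrite ltr_pwDl// divr_ge0 ?(ltW k'0)// addr_ge0.
have p1 z : 1 <= (1 + `|z|) `^ al.
  by rewrite -[leLHS](one_powR al); apply: powR_le; rewrite ?(ltW al0)// lerDl.
have p2 z : absal al z <= (1 + `|z|) `^ al.
  by apply: powR_le; rewrite ?(ltW al0)// lerDr.
have p3 z : (1 + `|z|) `^ al <= 1 + absal al z.
  have := powR_subadd al01 (@ler01 R) (normr_ge0 z); by rewrite one_powR.
have d1 x : (1 + `|x|) `^ al <= L1 * (1 + `|X x|) `^ al.
  have /andP[h _] := H3 (X x); rewrite mE -ler_ln ?posrE ?expR_gt0// expRK lnm in h.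
  move: h (p2 (X x)) (p1 (X x)) (ler_norm (K + l)) (normr_ge0 (K + l)); rewrite -/l /L1.
  move: (absal al _) ((1 + `|X x|) `^ al) ((1 + `|x|) `^ al) `|K + l| => A P Q N h h2 h3 h4 h5.
  have h6 : k * A <= k * P by rewrite ler_wpM2l// ltW.
  have h7 : N <= N * P by rewrite ler_peMr.
  by rewrite mulrDl; move: h h4 h6 h7; clear -al01 c0 al0 al1; lra.
have d2 x : (1 + `|X x|) `^ al <= L2 * (1 + `|x|) `^ al.
  have /andP[_ h] := H3 (X x); rewrite mE -ler_ln ?posrE ?expR_gt0// expRK lnm in h.
  move: h (p3 (X x)) (p1 x) (ler_norm (K' - l)) (normr_ge0 (K' - l)); rewrite -/l /L2.
  move: (absal al _) ((1 + `|X x|) `^ al) ((1 + `|x|) `^ al) `|K' - l| => A P Q N h h2 h3 h4 h5.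
  have h6 : A <= (1 + N) * Q / k'.
    rewrite ler_pdivlMr// mulrC mulrDl mul1r; have h7 : N <= N * Q by rewrite ler_peMr.
    by move: h h4 h7; clear -al01 c0 al0 al1; lra.
  by rewrite mulrDl mul1r mulrAC; apply: (le_trans h2); exact: lerD.
pose A1 := L1 `^ ((1 - al) / al); pose A2 := L2 `^ ((1 - al) / al).
have A10 : 0 < A1 by rewrite powR_gt0.
have A20 : 0 < A2 by rewrite powR_gt0.
have w1 x : wt (1 - al) (X x) <= A1 * wt (1 - al) x by exact: (le_wt_of_powR L10).
have w2 x : wt (1 - al) x <= A2 * wt (1 - al) (X x) by exact: (le_wt_of_powR L20).
have c2n := lt0r_neq0 C20; have c1n := lt0r_neq0 C10; have a1n := lt0r_neq0 A10.
exists (al / (C2 * A1)), (al * A2 / C1); split=> [|x]; first by rewrite divr_gt0// mulr_gt0.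
move: (H1 (X x)) (H2 (X x)) (m0 x) (w1 x) (w2 x); rewrite mE.
have -> : integ f * g x = al * (integ f * ftail al `|x|) * wt (1 - al) x by rewrite /frame; ring.
move: (integ f * _) (f _) (wt _ (X x)) (wt _ x) => m F u v h1 h2 mp h3 h4.
apply/andP; split.
  apply: (@le_trans _ _ (al / (C2 * A1) * (C2 * (A1 * v) * m))).
    rewrite ler_wpM2l ?divr_ge0 ?mulr_ge0 ?(ltW al0) ?(ltW C20) ?(ltW A10)//; apply: (le_trans h2).
    by rewrite ler_wpM2r ?(ltW mp)// ler_wpM2l// ltW.
  by apply: le_of_eq; field; rewrite c2n a1n.
apply: (@le_trans _ _ (al * A2 / C1 * (C1 * u * m))); last first.
  by rewrite ler_wpM2l// divr_ge0 ?mulr_ge0 ?(ltW al0) ?(ltW C10) ?(ltW A20).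
have -> : al * A2 / C1 * (C1 * u * m) = al * m * (A2 * u) by field.
by rewrite ler_wpM2l// mulr_ge0 ?(ltW al0) ?(ltW mp).
Qed.

(** Every solution is read off a fixed point w, up to the base point a of its transport map and a
    scale lam. *)
Lemma balanced_shape f : balanced al c f -> exists lam a e K w, [/\ 0 < lam, between e K w,
  forall x, transport al g (c * al) w x = w x &
  forall x, f (a + prim w x / lam) = lam `^ (1 + al) * (g x / w x)].
Proof.
move=> bf; have [If fE] := bf; have f0 x := balanced_gt0 x bf.
have [k [k' [K0 [K' [k0 k'0 _ _ fB]]]]] := balanced_bounds al01 c0 bf.
have [X [hX sX Xc Xt]] := balanced_map bf.
have [e [K [e0 H]]] := map_distortion bf Xc Xt.
have M0 := balanced_mass_gt0 bf; have fN := balanced_crossing bf.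
set M := integ f in M0 H Xc Xt; have Mn := lt0r_neq0 M0.
have Ig := itg_frame al01; have g0 := frame_gt0 al01; have gB := frame_le al01.
have mg := itg_meas Ig; have mf := itg_meas If; have mX := homo_measurable hX.
pose w x := M * g x / f (X x).
have w0 x : 0 < w x by rewrite divr_gt0// mulr_gt0.
have bw : between e K w.
  split=> // [|x|x]; last 2 first.
  - by rewrite ler_pdivlMr//; have /andP[] := H x.
  - by rewrite ler_pdivrMr//; have /andP[] := H x.
  apply: measurable_funM; first by apply: measurable_funM; [exact: measurable_cst|exact: mg].
  by apply: measurable_inv_comp => [|x]; [exact: (measurableT_comp mf mX)|exact: ltW].
have IMg := itgZ M Ig.
have cov : forall h : R -> R, measurable_fun setT h -> (forall z, 0 <= h z) ->
    integ (fun x => h (X x) * (M * g x)) = integ (fun z => h z * f z).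
  apply: integ_transport; apply: (measure_transport hX sX _ (itg_meas IMg) _ mf).
  - by move=> x; rewrite mulr_ge0 ?(ltW M0) ?(ltW (g0 x)).
  - by move=> x; exact: ltW.
  - by move=> a b; exact: itg_segment.
  - by move=> a b; exact: itg_segment.
  move=> a b ab; rewrite -(cdf_sub If (ltW (hX _ _ ab))) !Xc -mulrBr (cdf_sub Ig (ltW ab)).
  by rewrite -(integZ _ (itg_segment a b Ig)); apply: eq_integ => t; rewrite mulrCA.
(* Integrating 1 / f over ]X a, X b] against f dz gives the length of that interval; pulled back,
   the integrand is M g / f (X) = w. So w is the derivative of X in integrated form. *)
have XB a b : a <= b -> X b - X a = prim w b - prim w a.
  move=> ab; have Xab : X a <= X b by move: ab; rewrite le_eqVlt => /predU1P[->//|/hX/ltW].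
  have mif : measurable_fun setT (fun z => (f z)^-1) by apply: measurable_inv_comp => // z; exact: ltW.
  have := cov (fun z => ind (X a < z <= X b) * (f z)^-1) _ _.
  rewrite (prim_sub bw ab) -(integ_itv Xab).
  rewrite (_ : (fun z => _ * _ * f z) = (fun z => ind (X a < z <= X b))); last first.
    by apply/funext => z; rewrite -mulrA mulVf ?mulr1// lt0r_neq0.
  move=> <-.
  - apply: eq_integ => t; rewrite (homo_lt _ _ hX) !leNgt (homo_lt _ _ hX) /w.
    by rewrite -mulrA; congr (_ * _); rewrite mulrC.
  - apply: measurable_funM; last exact: mif.
    by apply: measurable_ind; apply: measurable_and; [exact: measurable_fun_ltr|exact: measurable_fun_ler].
  - by move=> z; rewrite mulr_ge0 ?ind_ge0// invr_ge0 ltW.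
have [th1 [th2 [t10 t20 g1 g2]]] := frame_crossing al01.
have ca : 0 < c * al by rewrite mulr_gt0.
(* Each point of a pair contributes one factor M. *)
have EN x : crossing al f (X x) = M ^+ 2 * energy al g w x.
  rewrite (crossing_transport al x hX If (fun x => ltW (f0 x)) fB cov).
  have [I J] := tker_itg al01 Ig gB x bw.
  rewrite /energy -(integZ _ J); apply: eq_integ => b.
  have -> : integ (fun a => ind (a < x < b) * rk al (X b - X a) * (M * g a)) =
      M * integ (fun a => tker al w x b a * g a).
    rewrite -(integZ _ (I b)); apply: eq_integ => a; rewrite /tker.
    have [/andP[ax xb]|_] := boolP (a < x < b); last by rewrite /ind !mul0r mulr0.
    by rewrite (XB _ _ (ltW (lt_trans ax xb))) mulrCA.
  by move: (integ _) => E; ring.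
(* As f (X x) = c al M^2 energy, dividing g by c al energy gives M^2 g / f (X x) = M w. *)
have fw x : transport al g (c * al) w x = M * w x.
  have := energy_gt0 al01 Ig g0 gB t20 g2 x bw; have := fN (X x); rewrite EN.
  rewrite /transport /w => ->; move: (energy al g w x) => E E0.
  have E1 := lt0r_neq0 E0; have k1 := lt0r_neq0 ca; move: k1; rewrite mulf_eq0 negb_or => /andP[k1 k2].
  by field; rewrite k1 k2 E1 Mn.
(* By homogeneity the image of lam w is lam^(1 - al) M w, which equals lam w precisely because
   lam^al = M. *)
pose lam := M `^ al^-1; have l0 : 0 < lam by rewrite powR_gt0.
have lE : lam `^ al = M by rewrite -powRrM mulVf ?lt0r_neq0// powRr1// ltW.
have ln0 := lt0r_neq0 l0.
exists lam, (X 0), (lam * e), (lam * K), (fun x => lam * w x).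
have blw : between (lam * e) (lam * K) (fun x => lam * w x).
  have [_ mw we wK] := bw; split; first by rewrite mulr_gt0.
  - by apply: measurable_funM.
  - by move=> x; rewrite ler_wpM2l// ltW.
  - by move=> x; rewrite ler_wpM2l// ltW.
split=> //.
- move=> x; rewrite (transportZ al01 Ig g0 gB ca t20 g2 x bw l0) fw -lE mulrA; congr (_ * _).
  rewrite -powRD; last by rewrite ln0 implybT.
  by rewrite subrK powRr1// ltW.
move=> x; rewrite (primZ _ _ bw) mulrAC divff// mul1r.
have p0 := prim0 w.
have -> : X 0 + prim w x = X x.
  have [/XB|/ltW/XB] := leP 0 x; rewrite p0 ?subr0 ?sub0r => h; first by rewrite -h addrC subrK.
  by rewrite -[prim w x]opprK -h opprB addrC subrK.
rewrite powRD; last by rewrite ln0 implybT.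
rewrite lE powRr1 ?(ltW l0)// /w; have fn := lt0r_neq0 (f0 (X x)); have gn := lt0r_neq0 (g0 x).
by field; rewrite ln0 Mn fn gn.
Qed.

Lemma balanced_unique f1 f2 : balanced al c f1 -> balanced al c f2 ->
  exists k y, 0 < k /\ forall z, f1 z = k `^ (1 + al) * f2 (k * (z + y)).
Proof.
move=> b1 b2.
have [l1 [a1 [e1 [K1 [w1 [l10 bw1 T1 S1]]]]]] := balanced_shape b1.
have [l2 [a2 [e2 [K2 [w2 [l20 bw2 T2 S2]]]]]] := balanced_shape b2.
have Ig := itg_frame al01; have g0 := frame_gt0 al01; have gB := frame_le al01.
have [th1 [th2 [t10 t20 g1 g2]]] := frame_crossing al01.
have ca : 0 < c * al by rewrite mulr_gt0.
have wE : w1 = w2.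
  (* The uniqueness lemma compares fixed points lying in one order interval, so the two ranges are
     merged. *)
  apply/funext; apply: (transport_unique al01 Ig g0 gB ca t20 g2 (e := Num.min e1 e2) (K := Num.max K1 K2)) => //.
    have [e0 m we wK] := bw1; have [e0' _ _ _] := bw2.
    by split=> [||x|x]; rewrite ?lt_min ?e0 ?ge_min ?le_max ?we ?wK.
  have [e0 m we wK] := bw2; have [e0' _ _ _] := bw1.
  by split=> [||x|x]; rewrite ?lt_min ?e0 ?e0' ?ge_min ?le_max ?we ?wK ?orbT.
subst w2; have n1 := lt0r_neq0 l10; have n2 := lt0r_neq0 l20.
exists (l1 / l2), (a2 * l2 / l1 - a1); split=> [|z]; first by rewrite divr_gt0.
(* The parameter x at which the map of f1 reaches z; the map of f2 at the same x is the affine image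
   of z, and both densities are multiples of g x / w1 x there. *)
have [x xE] := prim_surj (l1 * (z - a1)) bw1.
have := S1 x; have := S2 x; rewrite xE.
have -> : a1 + l1 * (z - a1) / l1 = z by field.
have -> : a2 + l1 * (z - a1) / l2 = l1 / l2 * (z + (a2 * l2 / l1 - a1)) by field; rewrite n1 n2.
move=> -> ->; move: (g x / w1 x) => q; rewrite mulrA; congr (_ * q).
by rewrite -(powRM _ (divr_ge0 (ltW l10) (ltW l20)) (ltW l20)) divfK.
Qed.

End uniqueness.

(** Nondegenerate affine maps pull null sets back to null sets: the indicator still integrates to 0
    after the substitution. *)
Lemma ae_affine (R : realType) (k a : R) (P : R -> Prop) : k != 0 ->
  {ae (@lebesgue_measure R), forall x, P x} -> {ae (@lebesgue_measure R), forall x, P (k * x + a)}.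
Proof.
move=> k0 [N [mN N0 PN]]; pose f : R -> R := \1_N.
have mf : measurable_fun setT f by exact: measurable_indic.
have f0 x : 0 <= f x by rewrite /f indicE ler0n.
have I0 : (\int[@lebesgue_measure R]_x (f x)%:E = 0)%E.
  by rewrite /f integral_indic// setIT.
have If : itg f by apply/itg_ge0P => //; rewrite I0 ltry.
have i0 : integ f = 0 by apply: EFin_inj; rewrite -(EFin_integ If) I0.
have := integ_eq0 (itg_affine a k0 If) (fun x => f0 _); rewrite (integ_affine a k0 If) i0 mulr0.
move=> /(_ erefl); apply: ae_imp => x; apply: contraPP => nP.
by rewrite /f indicE mem_set ?oner_eq0//; [move/eqP; rewrite oner_eq0|exact: PN].
Qed.

Lemma rescaling_of_balanced (R : realType) (s : R) (hs : 2^-1 < s < 1) (f1 f2 : R -> R) :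
  balanced (2 * s - 1) (coupling s) f1 -> balanced (2 * s - 1) (coupling s) f2 ->
  exists y k, 0 < k /\ forall x, ln (f1 x) = rescale s k y (fun x => ln (f2 x)) x.
Proof.
move=> b1 b2; have al01 : 0 < 2 * s - 1 < 1 by lra.
have [k [y [k0 H]]] := balanced_unique al01 (coupling_gt0 hs) b1 b2.
exists y, k; split=> // x; rewrite H lnM ?posrE ?powR_gt0 ?(balanced_gt0 _ b2)//.
(* The exponent 1 + al is 2 s. *)
by rewrite ln_powR /rescale addrC; congr (_ + _ * _); ring.
Qed.

Theorem theorem1p3 (R : realType) (s : R) (hs : 2^-1 < s < 1) :
  exists Q : R -> R,
    represents_solutions s Q /\
    (forall Q' : R -> R, represents_solutions s Q' -> rescaling_of s Q' Q).
Proof.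
have al01 : 0 < 2 * s - 1 < 1 by lra.
have [f bf] := balanced_exists al01 (coupling_gt0 hs).
have [sf mf] := balanced_solution hs bf.
exists (fun x => ln (f x)); split.
  split=> [|u su mu_]; first by have [] := sf.
  have [f' bf' uE] := solution_balanced hs su mu_.
  have [y [k [k0 H]]] := rescaling_of_balanced hs bf' bf.
  by exists y, k; split=> //; apply: ae_imp uE => x ->; exact: H.
(* Since ln f is a solution, Q' represents it; the rescaling with dilation k and translation y is
   then inverted, its inverse having dilation 1 / k and translation - k y. *)
move=> Q' [_ HQ]; have [y [k [k0 H]]] := HQ _ sf mf; have kn := lt0r_neq0 k0.
exists (- (k * y)), k^-1; split; first by rewrite invr_gt0.
have kn' : k^-1 != 0 by rewrite invr_eq0.
apply: ae_imp (ae_affine (- y) kn' H) => x; rewrite /rescale subrK mulrA divff// mul1r.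
rewrite mulrDr mulrN mulrA mulVf// mul1r => ->.
by rewrite lnV ?posrE// mulrN addrK.
Qed.
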